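(* For every $i=1,\ldots,40$ the mapping $\mathrm{Exp}:N_i'\to M_i'$ is a diffeomorphism.
   Context: Let $M=\mathrm{SH}(2)\cong\mathbb{R}^3$ with coordinates $q=(x,y,z)$. Let $C=(\mathbb{R}/4\pi\mathbb{Z})\times\mathbb{R}\ni\lambda=(\gamma,c)$, $\mathbb{R}_+=(0,+\infty)$, $N=C\times\mathbb{R}_+$. For $\lambda\in C$ let $\lambda_t=(\gamma_t,c_t)$ be the solution of $\dot\gamma=c$, $\dot c=-\sin\gamma$ with $\lambda_0=\lambda$. The exponential mapping $\mathrm{Exp}:N\to M$ is $\mathrm{Exp}(\lambda,t)=(x_t,y_t,z_t)$, where $\dot x=\cos\frac{\gamma_t}{2}\cosh z$, $\dot y=\cos\frac{\gamma_t}{2}\sinh z$, $\dot z=\sin\frac{\gamma_t}{2}$, $(x_0,y_0,z_0)=(0,0,0)$. Subsets of $C$. Let $h(\lambda)=\frac{c^2}{2}-\cos\gamma$. $C_1=\{h\in(-1,1)\}$, $C_2=\{h>1\}$, $C_3=\{h=1,c\ne0\}$, $C_4=\{h=-1\}$. $C_1^0=C_1\cap\{\cos\frac{\gamma}{2}>0\}$, $C_2^+=C_2\cap\{c>0\}$, $C_3^{0+}=C_3\cap\{\cos\frac\gamma2>0,\ c>0\}$, $C_4^0=\{(\gamma,c)=(0,0)\}$. Elliptic coordinates $(\varphi,k)$. $K(k)$, $E(k)$ are the complete elliptic integrals of the first and second kind; $\mathrm{sn},\mathrm{cn},\mathrm{dn}$ are Jacobi functions of modulus $k$. On $C_1^0$: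 $k=\sqrt{(h+1)/2}\in(0,1)$, $\sin\frac\gamma2=k\,\mathrm{sn}\,\varphi$, $\cos\frac\gamma2=\mathrm{dn}\,\varphi$, $\frac c2=k\,\mathrm{cn}\,\varphi$ ($\varphi$ modulo $4K$). On $C_2^+$: $k=\sqrt{2/(h+1)}\in(0,1)$, $\sin\frac\gamma2=\mathrm{sn}(\varphi/k)$, $\cos\frac\gamma2=\mathrm{cn}(\varphi/k)$, $\frac c2=\frac1k\mathrm{dn}(\varphi/k)$ ($\varphi/k$ modulo $4K$). On $C_3^{0+}$: $k=1$, $\sin\frac\gamma2=\tanh\varphi$, $\cos\frac\gamma2=\frac c2=1/\cosh\varphi$. For $(\lambda,t)\in N$ put $p=\frac t2$, $\tau=\varphi+\frac t2$ if $\lambda\in C_1^0\cup C_3^{0+}$, and $p=\frac t{2k}$, $\tau=(\varphi+\frac t2)/k$ if $\lambda\in C_2^+$ (in the periodic cases $\tau$ is taken modulo $4K$). Sets $N_j'\subset N$ (with $k$ ranging over $(0,1)$, $K=K(k)$): $N_1'$: $\lambda\in C_1^0$, $p=2K$, $\tau\in(0,K)$; $N_9'$: $\lambda\in C_2^+$, $p=2K$, $\tau\in(0,K)$; $N_{17}'$: $\lambda\in C_1^0$, $p=2K$, $\tau=K$; $N_{21}'$: $\lambda\in C_1^0$, $p=2K$, $\tau=0$; $N_{25}'$: $\lambda\in C_2^+$, $p=2K$, $\tau=0$; $N_{29}'$: $\lambda\in C_2^+$, $p=2K$, $\tau=K$; $N_{33}'$: $\lambda\in C_4^0$, $t=2\pi$;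 $N_{39}'$: $\lambda\in C_4^0$, $t\in(0,2\pi)$; $N_{35}'$: the union of the three sets ($\lambda\in C_1^0$, $p\in(0,2K)$, $\tau=0$), ($\lambda\in C_2^+$, $p\in(0,2K)$, $\tau=0$), ($\lambda\in C_3^{0+}$, $p\in(0,+\infty)$, $\tau=0$). Sets $M_j'\subset M$. Put $a(k)=E(k)-(1-k^2)K(k)$. For $y<0$ let $x_2(y)=\frac{4k\,a(k)}{1-k^2}$ where $k\in(0,1)$ is the unique solution of $y=-\frac{4a(k)}{1-k^2}$, and let $x_3(y)=\frac{4E(k)}{1-k^2}$ where $k\in(0,1)$ is the unique solution of $y=-\frac{4kE(k)}{1-k^2}$. All sets below lie in $\{z=0\}$: $M_1'$: $y<0$, $x>x_3(y)$; $M_9'$: $y<0$, $0<x<x_2(y)$; $M_{17}'$: $y=0$, $x>2\pi$; $M_{21}'$: $y<0$, $x=x_3(y)$; $M_{25}'$: $y<0$, $x=x_2(y)$; $M_{29}'$: $y<0$, $x=0$; $M_{33}'$: $y=0$, $x=2\pi$; $M_{35}'$: $y<0$, $x_2(y)<x<x_3(y)$; $M_{39}'$: $y=0$, $0<x<2\pi$. Reflections. On $C$: $\varepsilon^1(\gamma,c)=(\gamma,-c)$, $\varepsilon^2(\gamma,c)=(-\gamma,c)$, $\varepsilon^3(\gamma,c)=(-\gamma,-c)$, $\varepsilon^4(\gamma,c)=(\gamma+2\pi,c)$, $\varepsilon^5(\gamma,c)=(\gamma+2\pi,-c)$, $\varepsilon^6(\gamma,c)=(-\gamma+2\pi,c)$,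 $\varepsilon^7(\gamma,c)=(-\gamma+2\pi,-c)$. On $N$: $\varepsilon^j(\lambda,t)=(\varepsilon^j(\lambda_t),t)$ for $j=1,2,5,6$ and $\varepsilon^j(\lambda,t)=(\varepsilon^j(\lambda),t)$ for $j=3,4,7$. On the plane $\{z=0\}\subset M$: $\varepsilon^1,\varepsilon^3$ act by $(x,y)\mapsto(x,-y)$; $\varepsilon^2$ by $(x,y)\mapsto(x,y)$; $\varepsilon^4,\varepsilon^6$ by $(x,y)\mapsto(-x,y)$; $\varepsilon^5,\varepsilon^7$ by $(x,y)\mapsto(-x,-y)$. The remaining sets, for both $S=N'$ and $S=M'$ (i.e. $S_j=N_j'$ or $M_j'$), are: $S_{j+i}=\varepsilon^i(S_j)$ for $i=1,\ldots,7$, $j=1,9$; $S_{17+i}=\varepsilon^{2i}(S_{17})$ for $i=1,2,3$; $S_{j+i}=\varepsilon^{2+i}(S_j)$ for $i=1,2,3$, $j=21,25,29,35$; $S_{j+1}=\varepsilon^4(S_j)$ for $j=33,39$. *)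

(* Defs.v *)
From Stdlib Require Import Reals ZArith ClassicalEpsilon.
From Coquelicot Require Import Coquelicot.
Open Scope R_scope.

(** R/4piZ, literally as the type of cosets. *)
Definition is_coset (A : R -> Prop) : Prop :=
  exists g : R, forall g' : R, A g' <-> exists n : Z, g' = g + 4 * PI * IZR n.

Definition circle : Type := { A : R -> Prop | is_coset A }.

Lemma coset_ok (g : R) :
  is_coset (fun g' => exists n : Z, g' = g + 4 * PI * IZR n).
Proof. exists g; intros g'; apply iff_refl. Qed.

Definition ang (g : R) : circle :=
  exist is_coset (fun g' => exists n : Z, g' = g + 4 * PI * IZR n) (coset_ok g).

(** An arbitrary representative of a coset. Changing it by 4piZ shifts the lifted
    trajectory [pendulum] by the same constant and changes nothing in [flow],
    [Exp], the subsets of [N] and the reflections. *)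
Definition rep (a : circle) : R := epsilon (inhabits 0) (proj1_sig a).

Definition Cyl : Type := (circle * R)%type.

(** [N] carries all real times; positivity of the time is part of the definition
    of the subsets of [N] below. *)
Definition N : Type := (Cyl * R)%type.
Definition R3 : Type := (R * R * R)%type.

Definition gam (l : Cyl) : R := rep (fst l).
Definition mom (l : Cyl) : R := snd l.

(** The universal covering R^3 -> C x R, a local diffeomorphism: it defines the
    smooth structure of [N]. *)
Definition cov (v : R3) : N :=
  match v with (g, c, t) => ((ang g, c), t) end.

Definition has_partials (U : R3 -> Prop) (f f1 f2 f3 : R3 -> R) : Prop :=
  forall x y z : R, U (x, y, z) ->
    is_derive (fun s => f (s, y, z)) x (f1 (x, y, z)) /\
    is_derive (fun s => f (x, s, z)) y (f2 (x, y, z)) /\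
    is_derive (fun s => f (x, y, s)) z (f3 (x, y, z)).

Fixpoint class_C (n : nat) (U : R3 -> Prop) (f : R3 -> R) : Prop :=
  match n with
  | O => forall v : R3, U v -> continuous f v
  | S m => exists f1 f2 f3 : R3 -> R, has_partials U f f1 f2 f3 /\
             class_C m U f1 /\ class_C m U f2 /\ class_C m U f3
  end.

(** C^infinity on an open set [U]. *)
Definition smooth_on (U : R3 -> Prop) (F : R3 -> R3) : Prop :=
  forall n : nat,
    class_C n U (fun v => fst (fst (F v))) /\
    class_C n U (fun v => snd (fst (F v))) /\
    class_C n U (fun v => snd (F v)).

(** A map defined on an arbitrary subset of a manifold is smooth when it extends
    locally to a smooth map on an open set. The extensions are read in the
    covering [cov]: on the source side by composing with [cov], on the target
    side by lifting through it. *)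
Definition smooth_from_N (A : N -> Prop) (f : N -> R3) : Prop :=
  forall v : R3, A (cov v) ->
    exists (U : R3 -> Prop) (F : R3 -> R3),
      open U /\ U v /\ smooth_on U F /\
      forall w : R3, U w -> A (cov w) -> F w = f (cov w).

Definition smooth_to_N (B : R3 -> Prop) (g : R3 -> N) : Prop :=
  forall q : R3, B q ->
    exists (U : R3 -> Prop) (G : R3 -> R3),
      open U /\ U q /\ smooth_on U G /\
      forall w : R3, U w -> B w -> cov (G w) = g w.

Definition diffeomorphism (A : N -> Prop) (B : R3 -> Prop) (f : N -> R3) : Prop :=
  (forall nu : N, A nu -> B (f nu)) /\
  smooth_from_N A f /\
  exists g : R3 -> N,
    (forall q : R3, B q -> A (g q)) /\
    (forall nu : N, A nu -> g (f nu) = nu) /\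
    (forall q : R3, B q -> f (g q) = q) /\
    smooth_to_N B g.

Definition pendulum_solution (g0 c0 : R) (s : R -> R * R) : Prop :=
  s 0 = (g0, c0) /\
  forall t : R,
    is_derive (fun u => fst (s u)) t (snd (s t)) /\
    is_derive (fun u => snd (s u)) t (- sin (fst (s t))).

Definition pendulum (l : Cyl) : R -> R * R :=
  epsilon (inhabits (fun _ => (0, 0))) (pendulum_solution (gam l) (mom l)).

Definition flow (l : Cyl) (t : R) : Cyl :=
  (ang (fst (pendulum l t)), snd (pendulum l t)).

Definition horizontal_solution (g : R -> R) (q : R -> R3) : Prop :=
  q 0 = (0, 0, 0) /\
  forall t : R,
    is_derive (fun u => fst (fst (q u))) t (cos (g t / 2) * cosh (snd (q t))) /\
    is_derive (fun u => snd (fst (q u))) t (cos (g t / 2) * sinh (snd (q t))) /\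
    is_derive (fun u => snd (q u)) t (sin (g t / 2)).

Definition geodesic (l : Cyl) : R -> R3 :=
  epsilon (inhabits (fun _ => (0, 0, 0)))
    (horizontal_solution (fun t => fst (pendulum l t))).

Definition Exp (nu : N) : R3 := geodesic (fst nu) (snd nu).

Definition ellF (phi k : R) : R :=
  RInt (fun th => / sqrt (1 - k ^ 2 * sin th ^ 2)) 0 phi.
Definition ellK (k : R) : R := ellF (PI / 2) k.
Definition ellE (k : R) : R :=
  RInt (fun th => sqrt (1 - k ^ 2 * sin th ^ 2)) 0 (PI / 2).

(** For 0 < k < 1, [fun phi => ellF phi k] is a bijection of R; the amplitude is
    its inverse. *)
Definition am (u k : R) : R := epsilon (inhabits 0) (fun phi => ellF phi k = u).
Definition sn (u k : R) : R := sin (am u k).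
Definition cn (u k : R) : R := cos (am u k).
Definition dn (u k : R) : R := sqrt (1 - k ^ 2 * sn u k ^ 2).

Definition energy (l : Cyl) : R := mom l ^ 2 / 2 - cos (gam l).

Definition C1 (l : Cyl) : Prop := -1 < energy l < 1.
Definition C2 (l : Cyl) : Prop := 1 < energy l.
Definition C3 (l : Cyl) : Prop := energy l = 1 /\ mom l <> 0.

Definition C1_0 (l : Cyl) : Prop := C1 l /\ 0 < cos (gam l / 2).
Definition C2_plus (l : Cyl) : Prop := C2 l /\ 0 < mom l.
Definition C3_0plus (l : Cyl) : Prop :=
  C3 l /\ 0 < cos (gam l / 2) /\ 0 < mom l.
Definition C4_0 (l : Cyl) : Prop := l = (ang 0, 0).

Definition coords_C1_0 (l : Cyl) (phi k : R) : Prop :=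
  k = sqrt ((energy l + 1) / 2) /\
  sin (gam l / 2) = k * sn phi k /\
  cos (gam l / 2) = dn phi k /\
  mom l / 2 = k * cn phi k.

Definition coords_C2_plus (l : Cyl) (phi k : R) : Prop :=
  k = sqrt (2 / (energy l + 1)) /\
  sin (gam l / 2) = sn (phi / k) k /\
  cos (gam l / 2) = cn (phi / k) k /\
  mom l / 2 = / k * dn (phi / k) k.

Definition coords_C3_0plus (l : Cyl) (phi : R) : Prop :=
  sin (gam l / 2) = tanh phi /\
  cos (gam l / 2) = / cosh phi /\
  mom l / 2 = / cosh phi.

(** Points of N with lambda in C_1^0 (resp. C_2^+, C_3^{0+}) and a condition [P]
    on (k, p, tau). Quantifying existentially over phi is what renders
    "tau modulo 4K": phi (resp. phi / k) is determined modulo 4K only, so the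
    condition holds for tau modulo 4K iff it holds for some choice of phi. *)
Definition on_C1_0 (P : R -> R -> R -> Prop) (nu : N) : Prop :=
  let (l, t) := nu in
  0 < t /\ C1_0 l /\
  exists phi k : R, coords_C1_0 l phi k /\ P k (t / 2) (phi + t / 2).

Definition on_C2_plus (P : R -> R -> R -> Prop) (nu : N) : Prop :=
  let (l, t) := nu in
  0 < t /\ C2_plus l /\
  exists phi k : R,
    coords_C2_plus l phi k /\ P k (t / (2 * k)) ((phi + t / 2) / k).

Definition on_C3_0plus (P : R -> R -> Prop) (nu : N) : Prop :=
  let (l, t) := nu in
  0 < t /\ C3_0plus l /\
  exists phi : R, coords_C3_0plus l phi /\ P (t / 2) (phi + t / 2).

Definition N1 : N -> Prop :=
  on_C1_0 (fun k p tau => p = 2 * ellK k /\ 0 < tau < ellK k).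
Definition N9 : N -> Prop :=
  on_C2_plus (fun k p tau => p = 2 * ellK k /\ 0 < tau < ellK k).
Definition N17 : N -> Prop :=
  on_C1_0 (fun k p tau => p = 2 * ellK k /\ tau = ellK k).
Definition N21 : N -> Prop :=
  on_C1_0 (fun k p tau => p = 2 * ellK k /\ tau = 0).
Definition N25 : N -> Prop :=
  on_C2_plus (fun k p tau => p = 2 * ellK k /\ tau = 0).
Definition N29 : N -> Prop :=
  on_C2_plus (fun k p tau => p = 2 * ellK k /\ tau = ellK k).
Definition N33 (nu : N) : Prop := C4_0 (fst nu) /\ snd nu = 2 * PI.
Definition N35 (nu : N) : Prop :=
  on_C1_0 (fun k p tau => 0 < p < 2 * ellK k /\ tau = 0) nu \/
  on_C2_plus (fun k p tau => 0 < p < 2 * ellK k /\ tau = 0) nu \/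
  on_C3_0plus (fun p tau => 0 < p /\ tau = 0) nu.
Definition N39 (nu : N) : Prop := C4_0 (fst nu) /\ 0 < snd nu < 2 * PI.

Definition ella (k : R) : R := ellE k - (1 - k ^ 2) * ellK k.

Definition k2 (y : R) : R :=
  epsilon (inhabits 0) (fun k => 0 < k < 1 /\ y = - (4 * ella k / (1 - k ^ 2))).
Definition x2 (y : R) : R := 4 * k2 y * ella (k2 y) / (1 - k2 y ^ 2).

Definition k3 (y : R) : R :=
  epsilon (inhabits 0)
    (fun k => 0 < k < 1 /\ y = - (4 * k * ellE k / (1 - k ^ 2))).
Definition x3 (y : R) : R := 4 * ellE (k3 y) / (1 - k3 y ^ 2).

Definition in_plane (P : R -> R -> Prop) (q : R3) : Prop :=
  match q with (x, y, z) => z = 0 /\ P x y end.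

Definition M1 : R3 -> Prop := in_plane (fun x y => y < 0 /\ x3 y < x).
Definition M9 : R3 -> Prop := in_plane (fun x y => y < 0 /\ 0 < x < x2 y).
Definition M17 : R3 -> Prop := in_plane (fun x y => y = 0 /\ 2 * PI < x).
Definition M21 : R3 -> Prop := in_plane (fun x y => y < 0 /\ x = x3 y).
Definition M25 : R3 -> Prop := in_plane (fun x y => y < 0 /\ x = x2 y).
Definition M29 : R3 -> Prop := in_plane (fun x y => y < 0 /\ x = 0).
Definition M33 : R3 -> Prop := in_plane (fun x y => y = 0 /\ x = 2 * PI).
Definition M35 : R3 -> Prop := in_plane (fun x y => y < 0 /\ x2 y < x < x3 y).
Definition M39 : R3 -> Prop := in_plane (fun x y => y = 0 /\ 0 < x < 2 * PI).

Definition epsC (j : nat) (l : Cyl) : Cyl :=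
  match j with
  | 1%nat => (ang (gam l), - mom l)
  | 2%nat => (ang (- gam l), mom l)
  | 3%nat => (ang (- gam l), - mom l)
  | 4%nat => (ang (gam l + 2 * PI), mom l)
  | 5%nat => (ang (gam l + 2 * PI), - mom l)
  | 6%nat => (ang (- gam l + 2 * PI), mom l)
  | 7%nat => (ang (- gam l + 2 * PI), - mom l)
  | _ => l
  end.

Definition epsN (j : nat) (nu : N) : N :=
  let (l, t) := nu in
  match j with
  | 1%nat | 2%nat | 5%nat | 6%nat => (epsC j (flow l t), t)
  | _ => (epsC j l, t)
  end.

(** Only used on the plane z = 0. *)
Definition epsM (j : nat) (q : R3) : R3 :=
  match q with (x, y, z) =>
    match j with
    | 1%nat | 3%nat => (x, - y, z)
    | 4%nat | 6%nat => (- x, y, z)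
    | 5%nat | 7%nat => (- x, - y, z)
    | _ => (x, y, z)
    end
  end.

Definition image {T : Type} (f : T -> T) (A : T -> Prop) (b : T) : Prop :=
  exists a : T, A a /\ b = f a.

Definition forty {T : Type} (eps : nat -> T -> T)
    (S1 S9 S17 S21 S25 S29 S33 S35 S39 : T -> Prop) (i : nat) : T -> Prop :=
  (match i with
  | 1 => S1
  | 2 => image (eps 1) S1
  | 3 => image (eps 2) S1
  | 4 => image (eps 3) S1
  | 5 => image (eps 4) S1
  | 6 => image (eps 5) S1
  | 7 => image (eps 6) S1
  | 8 => image (eps 7) S1
  | 9 => S9
  | 10 => image (eps 1) S9
  | 11 => image (eps 2) S9
  | 12 => image (eps 3) S9
  | 13 => image (eps 4) S9
  | 14 => image (eps 5) S9
  | 15 => image (eps 6) S9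
  | 16 => image (eps 7) S9
  | 17 => S17
  | 18 => image (eps 2) S17
  | 19 => image (eps 4) S17
  | 20 => image (eps 6) S17
  | 21 => S21
  | 22 => image (eps 3) S21
  | 23 => image (eps 4) S21
  | 24 => image (eps 5) S21
  | 25 => S25
  | 26 => image (eps 3) S25
  | 27 => image (eps 4) S25
  | 28 => image (eps 5) S25
  | 29 => S29
  | 30 => image (eps 3) S29
  | 31 => image (eps 4) S29
  | 32 => image (eps 5) S29
  | 33 => S33
  | 34 => image (eps 4) S33
  | 35 => S35
  | 36 => image (eps 3) S35
  | 37 => image (eps 4) S35
  | 38 => image (eps 5) S35
  | 39 => S39
  | 40 => image (eps 4) S39
  | _ => fun _ => False
  end)%nat.

Definition N' : nat -> N -> Prop :=
  forty epsN N1 N9 N17 N21 N25 N29 N33 N35 N39.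
Definition M' : nat -> R3 -> Prop :=
  forty epsM M1 M9 M17 M21 M25 M29 M33 M35 M39.

(* Main.v *)
From Stdlib Require Import Reals ZArith ClassicalEpsilon Lra Lia Ranalysis5
  ProofIrrelevance FunctionalExtensionality PropExtensionality.
From Coquelicot Require Import Coquelicot.
Require Import Defs.
Open Scope R_scope.

(** The reflections reduce the statement to nine of the forty sets. On an arc that
    ends in the plane [z = 0] the exponential mapping commutes with them
    ([Exp_reflect]), and they act on the covering by affine maps as soon as the
    final state of the arc is known: it is the initial state for a full period, and
    its mirror image for the symmetric arcs of [N35]. Diffeomorphisms are
    transported by such maps ([diffeo_reflected]).

    For the nine base sets the elliptic coordinates are replaced by the momenta
    [C = cos (gamma / 2)] and [b = c / 2]. With [u = C + b], the product [u e^z] is a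
    first integral, so that [z] vanishes at the end of an arc exactly when [u] has
    returned to its initial value, and [x + y], [x - y] are quadratures
    ([geo_quadrature]). Legendre's integrals evaluate them for oscillations,
    rotations and the separatrix ([reach_C1], [reach_C2], [reach_C3]).

    Over a full period the end point is a multiple of the momentum vector [(C, b)],
    and the multiple depends on [C ^ 2 - b ^ 2] only, through the complete integrals
    [Et] and [At]. These increase with [n = k ^ 2 / (1 - k ^ 2)], because their
    integrands do. So [x ^ 2 - y ^ 2] determines [n], and then [C] and [b]; the
    curves [x = x3 y] and [x = x2 y] correspond to the lines [C = 1] and [C = -1].

    On [N35] the inverse has no closed form. If [2 r] is the time of the arc
    and [2 I] the integral of [cos (gamma / 2) ^ 2] along it, the end point is
    [x = 2 (C I - b s) / (C ^ 2 - b ^ 2)], [y = 2 (b I - s C) / (C ^ 2 - b ^ 2)], with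
    [s = sqrt (1 - C ^ 2)]. The heart of the proof is that the derivative of [y] in
    [b] and the Jacobian of [(C, b) -> (x, y)] are positive ([Jac_pos]). The
    derivatives of [I] are again combinations of [I] and [r], so that both
    quantities are explicit ([jacobian_formulas]); up to positive factors they are
    the functions [ellS] and [ellN] of the modulus and the amplitude, whose
    positivity is seen by differentiating suitable quotients in the amplitude
    ([ellS_quotient_derive], [ellN_quotient_derive]). On the separatrix [C = b],
    where the formulas read 0 / 0, the end point is still a smooth function of the
    momenta, being given by quadratures that are regular there, and strict
    positivity follows from lower estimates that are uniform near the separatrix
    ([below_separatrix]).

    Then, for fixed [C], the height [y] increases with [b] from minus infinity to 0
    ([yO_surj]), so that [(C, y)] are coordinates; and for fixed [y] the abscissa [x]
    increases with [C], from the limit [x2 y] at [C = -1] to the limit [x3 y] at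
    [C = 1] ([x_at_height_limit_left], [x_at_height_limit_right]). The smoothness
    of both inversions is the implicit function theorem for one unknown
    ([cinf_param_inverse]). *)

(** * Differential calculus on R^3 *)

Definition px (v : R3) : R := fst (fst v).
Definition py (v : R3) : R := snd (fst v).
Definition pz (v : R3) : R := snd v.

Definition box (d : R) (v w : R3) : Prop :=
  Rabs (px w - px v) < d /\ Rabs (py w - py v) < d /\ Rabs (pz w - pz v) < d.

Lemma R3_eta (v : R3) : v = (px v, py v, pz v).
Proof. now destruct v as [[x y] z]. Qed.

Lemma box_mono (d e : R) (v w : R3) : d <= e -> box d v w -> box e v w.
Proof. unfold box; intros; lra. Qed.

Lemma locally_box (v : R3) (P : R3 -> Prop) :
  locally v P <-> exists d, 0 < d /\ forall w, box d v w -> P w.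
Proof.
  split.
  - intros [d Hd]; exists d; split; [apply cond_pos|].
    intros w (H1 & H2 & H3); apply Hd; destruct v as [[? ?] ?], w as [[? ?] ?].
    repeat split; assumption.
  - intros (d & Hd & H); exists (mkposreal d Hd); intros w Hw; apply H.
    destruct v as [[? ?] ?], w as [[? ?] ?]; destruct Hw as [[? ?] ?].
    repeat split; assumption.
Qed.

Lemma cont_box (f : R3 -> R) (v : R3) :
  continuous f v <-> forall e, 0 < e ->
    exists d, 0 < d /\ forall w, box d v w -> Rabs (f w - f v) < e.
Proof.
  split.
  - intros H e He.
    apply (locally_box v (fun w => Rabs (f w - f v) < e)).
    apply (H (fun y => Rabs (y - f v) < e)).
    exists (mkposreal e He); intros y Hy; exact Hy.
  - intros H P [e He].
    destruct (H e (cond_pos e)) as (d & Hd & Hw).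
    apply (locally_box v (fun w => P (f w))).
    exists d; split; auto; intros w Hb; apply He, Hw, Hb.
Qed.

Lemma cont_R_eps (f : R -> R) (x : R) :
  continuous f x <-> forall e, 0 < e ->
    exists d, 0 < d /\ forall y, Rabs (y - x) < d -> Rabs (f y - f x) < e.
Proof.
  split.
  - intros H e He.
    destruct (H (fun y => Rabs (y - f x) < e)) as [d Hd].
    { exists (mkposreal e He); intros y Hy; exact Hy. }
    exists d; split; [apply cond_pos | intros y Hy; apply (Hd y Hy)].
  - intros H P [e He].
    destruct (H e (cond_pos e)) as (d & Hd & Hw).
    exists (mkposreal d Hd); intros w Hb; apply He, Hw, Hb.
Qed.

Lemma locally_R_eps (x : R) (P : R -> Prop) :
  locally x P <-> exists d, 0 < d /\ forall y, Rabs (y - x) < d -> P y.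
Proof.
  split.
  - intros [d Hd]; exists d; split; [apply cond_pos | intros y Hy; apply (Hd y Hy)].
  - intros (d & Hd & H); exists (mkposreal d Hd); intros w Hb; apply H, Hb.
Qed.

Lemma continuous_px (v : R3) : continuous px v.
Proof.
  apply cont_box; intros e He; exists e; split; auto; intros w Hw; apply Hw.
Qed.
Lemma continuous_py (v : R3) : continuous py v.
Proof.
  apply cont_box; intros e He; exists e; split; auto; intros w Hw; apply Hw.
Qed.
Lemma continuous_pz (v : R3) : continuous pz v.
Proof.
  apply cont_box; intros e He; exists e; split; auto; intros w Hw; apply Hw.
Qed.

Lemma continuous_triple {T : UniformSpace} (g1 g2 g3 : T -> R) (t : T) :
  continuous g1 t -> continuous g2 t -> continuous g3 t ->
  continuous (fun s => ((g1 s, g2 s, g3 s) : R3)) t.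
Proof.
  intros H1 H2 H3 P [e He].
  assert (L : forall g : T -> R, continuous g t ->
              locally t (fun s => ball (g t) e (g s))).
  { intros g Hg; apply Hg; exists e; auto. }
  change (locally t (fun s => P (g1 s, g2 s, g3 s))).
  generalize (filter_and _ _ (L g1 H1) (filter_and _ _ (L g2 H2) (L g3 H3))).
  apply filter_imp; intros s (A & B & D); apply He; repeat split; assumption.
Qed.

(** Caratheodory's form of differentiability: a slope function that is continuous
    at the base point turns every chain-rule argument below into a composition
    of continuous functions. *)
Lemma slope_of_derive (f : R -> R) (x l : R) : is_derive f x l ->
  exists s : R -> R, continuous s x /\ s x = l /\
    forall y, f y - f x = s y * (y - x).
Proof.
  intros H; apply is_derive_Reals in H.
  exists (fun y => if Req_EM_T y x then l else (f y - f x) / (y - x)).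
  repeat split.
  - apply cont_R_eps; intros e He; destruct (H e He) as [d Hd].
    exists d; split; [apply cond_pos|]; intros y Hy.
    destruct (Req_EM_T x x) as [_|n]; [|now elim n].
    destruct (Req_EM_T y x) as [->|n].
    + now rewrite Rminus_diag, Rabs_R0.
    + specialize (Hd (y - x)); replace (x + (y - x)) with y in Hd by ring.
      apply Hd; [lra | exact Hy].
  - destruct (Req_EM_T x x) as [_|n]; [easy|now elim n].
  - intros y; destruct (Req_EM_T y x) as [->|n]; [ring | field; lra].
Qed.

Lemma derive_of_slope (f s : R -> R) (x l : R) : continuous s x -> s x = l ->
  locally x (fun y => f y - f x = s y * (y - x)) -> is_derive f x l.
Proof.
  intros Hs <- Hf; apply is_derive_Reals; intros e He.
  destruct (proj1 (cont_R_eps _ _) Hs e He) as (d & Hd & Hsd).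
  destruct (proj1 (locally_R_eps _ _) Hf) as (d' & Hd' & Hfd).
  exists (mkposreal (Rmin d d') (Rmin_glb_lt _ _ _ Hd Hd')).
  intros h Hh Hhd; simpl in Hhd.
  assert (h = x + h - x) as E by ring.
  rewrite Hfd; replace (x + h - x) with h by ring.
  - replace (s (x + h) * h / h) with (s (x + h)) by (field; auto).
    apply Hsd; rewrite <- E; eapply Rlt_le_trans; [exact Hhd | apply Rmin_l].
  - eapply Rlt_le_trans; [exact Hhd | apply Rmin_r].
Qed.

(** The continuous slopes of a function of three variables with continuous
    partial derivatives, one coordinate being moved at a time. *)
Lemma slopes3 (U : R3 -> Prop) (f f1 f2 f3 : R3 -> R) (v : R3) :
  open U -> U v -> has_partials U f f1 f2 f3 ->
  continuous f1 v -> continuous f2 v -> continuous f3 v ->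
  exists A1 A2 A3 : R3 -> R,
    continuous A1 v /\ continuous A2 v /\ continuous A3 v /\
    A1 v = f1 v /\ A2 v = f2 v /\ A3 v = f3 v /\
    locally v (fun w => f w - f v = A1 w * (px w - px v) +
      A2 w * (py w - py v) + A3 w * (pz w - pz v)).
Proof.
  intros HU Uv Hp C1' C2' C3'.
  destruct (proj1 (locally_box _ _) (HU v Uv)) as (r & Hr & Hbox).
  destruct v as [[x y] z].
  assert (key : forall (g dg : R -> R) (a : R) (b : R),
    (forall s, Rmin a b <= s <= Rmax a b -> is_derive g s (dg s)) -> a <> b ->
    exists c, Rmin a b <= c <= Rmax a b /\ (g b - g a) / (b - a) = dg c).
  { intros g dg a b Hg Hab.
    destruct (MVT_gen g a b dg) as (c & Hc & E).
    - intros s Hs; apply Hg; lra.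
    - intros s Hs; apply continuity_pt_filterlim, (ex_derive_continuous g).
      exists (dg s); apply Hg; lra.
    - exists c; split; [exact Hc | rewrite E; field; lra]. }
  assert (btw : forall a b c d, Rmin a b <= c <= Rmax a b ->
    Rabs (b - a) < d -> Rabs (c - a) < d).
  { intros a b c d; unfold Rmin, Rmax; destruct (Rle_dec a b); intros H1 H2;
      apply Rabs_def2 in H2; apply Rabs_def1; lra. }
  assert (Rdiag : forall a d, 0 < d -> Rabs (a - a) < d).
  { intros a d Hd; now rewrite Rminus_diag, Rabs_R0. }
  exists (fun w => if Req_EM_T (px w) x then f1 w
             else (f w - f (x, py w, pz w)) / (px w - x)),
         (fun w => if Req_EM_T (py w) y then f2 (x, py w, pz w)
             else (f (x, py w, pz w) - f (x, y, pz w)) / (py w - y)),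
         (fun w => if Req_EM_T (pz w) z then f3 (x, y, pz w)
             else (f (x, y, pz w) - f (x, y, z)) / (pz w - z)).
  repeat split.
  - apply cont_box; intros e He.
    destruct (proj1 (cont_box _ _) C1' e He) as (d & Hd & Hf).
    exists (Rmin d r); split; [now apply Rmin_glb_lt|]; intros [[x' y'] z'] Hw.
    assert (box d (x,y,z) (x',y',z') /\ box r (x,y,z) (x',y',z')) as [B1 B2].
    { split; eapply box_mono; try exact Hw; [apply Rmin_l | apply Rmin_r]. }
    cbn [px py pz fst snd] in *.
    destruct (Req_EM_T x x) as [_|n]; [|now elim n].
    destruct (Req_EM_T x' x) as [E|n].
    + apply Hf; exact B1.
    + destruct (key (fun s => f (s, y', z')) (fun s => f1 (s, y', z')) x x')
        as (c & Hc & E); auto.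
      * intros s Hs; apply Hp, Hbox; repeat split; cbn; try apply B2.
        eapply btw; [exact Hs | apply B2].
      * rewrite E; apply Hf; repeat split; cbn; try apply B1.
        eapply btw; [exact Hc | apply B1].
  - apply cont_box; intros e He.
    destruct (proj1 (cont_box _ _) C2' e He) as (d & Hd & Hf).
    exists (Rmin d r); split; [now apply Rmin_glb_lt|]; intros [[x' y'] z'] Hw.
    assert (box d (x,y,z) (x',y',z') /\ box r (x,y,z) (x',y',z')) as [B1 B2].
    { split; eapply box_mono; try exact Hw; [apply Rmin_l | apply Rmin_r]. }
    cbn [px py pz fst snd] in *.
    destruct (Req_EM_T y y) as [_|n]; [|now elim n].
    destruct (Req_EM_T y' y) as [E|n].
    + apply Hf; repeat split; cbn; try apply B1; auto.
    + destruct (key (fun s => f (x, s, z')) (fun s => f2 (x, s, z')) y y')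
        as (c & Hc & E); auto.
      * intros s Hs; apply Hp, Hbox; repeat split; cbn; try apply B2; auto.
        eapply btw; [exact Hs | apply B2].
      * rewrite E; apply Hf; repeat split; cbn; try apply B1; auto.
        eapply btw; [exact Hc | apply B1].
  - apply cont_box; intros e He.
    destruct (proj1 (cont_box _ _) C3' e He) as (d & Hd & Hf).
    exists (Rmin d r); split; [now apply Rmin_glb_lt|]; intros [[x' y'] z'] Hw.
    assert (box d (x,y,z) (x',y',z') /\ box r (x,y,z) (x',y',z')) as [B1 B2].
    { split; eapply box_mono; try exact Hw; [apply Rmin_l | apply Rmin_r]. }
    cbn [px py pz fst snd] in *.
    destruct (Req_EM_T z z) as [_|n]; [|now elim n].
    destruct (Req_EM_T z' z) as [E|n].
    + apply Hf; repeat split; cbn; try apply B1; auto.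
    + destruct (key (fun s => f (x, y, s)) (fun s => f3 (x, y, s)) z z')
        as (c & Hc & E); auto.
      * intros s Hs; apply Hp, Hbox; repeat split; cbn; try apply B2; auto.
        eapply btw; [exact Hs | apply B2].
      * rewrite E; apply Hf; repeat split; cbn; try apply B1; auto.
        eapply btw; [exact Hc | apply B1].
  - cbn; destruct (Req_EM_T x x) as [_|n]; [easy|now elim n].
  - cbn; destruct (Req_EM_T y y) as [_|n]; [easy|now elim n].
  - cbn; destruct (Req_EM_T z z) as [_|n]; [easy|now elim n].
  - apply filter_forall; intros [[x' y'] z']; cbn.
    destruct (Req_EM_T x' x) as [->|n1], (Req_EM_T y' y) as [->|n2],
      (Req_EM_T z' z) as [->|n3]; field; lra.
Qed.

(** Along a curve the increment is a sum of products of continuous slopes, and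
    each slope composed with the curve is continuous at the base point. *)
Lemma chain3 (U : R3 -> Prop) (f f1 f2 f3 : R3 -> R) (g1 g2 g3 : R -> R)
    (t l1 l2 l3 : R) :
  open U -> U (g1 t, g2 t, g3 t) -> has_partials U f f1 f2 f3 ->
  (forall v, U v -> continuous f1 v /\ continuous f2 v /\ continuous f3 v) ->
  is_derive g1 t l1 -> is_derive g2 t l2 -> is_derive g3 t l3 ->
  is_derive (fun s => f (g1 s, g2 s, g3 s)) t
    (f1 (g1 t, g2 t, g3 t) * l1 + f2 (g1 t, g2 t, g3 t) * l2 +
     f3 (g1 t, g2 t, g3 t) * l3).
Proof.
  intros HU Hv Hp Hc D1 D2 D3.
  destruct (Hc _ Hv) as (c1 & c2 & c3).
  destruct (slopes3 U f f1 f2 f3 _ HU Hv Hp c1 c2 c3)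
    as (A1 & A2 & A3 & a1 & a2 & a3 & e1 & e2 & e3 & HA).
  assert (k1 := ex_derive_continuous g1 t (ex_intro _ l1 D1)).
  assert (k2 := ex_derive_continuous g2 t (ex_intro _ l2 D2)).
  assert (k3 := ex_derive_continuous g3 t (ex_intro _ l3 D3)).
  destruct (slope_of_derive _ _ _ D1) as (s1 & sc1 & se1 & sf1).
  destruct (slope_of_derive _ _ _ D2) as (s2 & sc2 & se2 & sf2).
  destruct (slope_of_derive _ _ _ D3) as (s3 & sc3 & se3 & sf3).
  assert (ct := continuous_triple g1 g2 g3 t k1 k2 k3).
  assert (cc : forall (A : R3 -> R) (s : R -> R), continuous A ((g1 t, g2 t, g3 t) : R3) ->
     continuous s t ->
     continuous (fun u : R => A ((g1 u, g2 u, g3 u) : R3) * s u) t).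
  { intros A s HA1 Hs.
    apply (continuous_mult (K := R_AbsRing) (fun u => A ((g1 u, g2 u, g3 u) : R3)) s);
      [|exact Hs].
    exact (continuous_comp (fun u => ((g1 u, g2 u, g3 u) : R3)) A t ct HA1). }
  apply derive_of_slope with (s := fun u =>
    A1 (g1 u, g2 u, g3 u) * s1 u + A2 (g1 u, g2 u, g3 u) * s2 u
    + A3 (g1 u, g2 u, g3 u) * s3 u).
  - apply (continuous_plus (V := R_NormedModule)); [|now apply cc].
    apply (continuous_plus (V := R_NormedModule)); now apply cc.
  - rewrite e1, e2, e3, se1, se2, se3; ring.
  - refine (filter_imp (F := locally t) _ _ _ (ct _ HA)); intros u Hu.
    unfold px, py, pz in Hu; cbn in Hu.
    rewrite Hu, sf1, sf2, sf3; ring.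
Qed.

(** * Functions of class C^n on an open subset of R^3 *)

(** Requiring continuity at every order makes the classes decreasing in [n] by
    mere unfolding, which the closure proofs by induction on [n] need. *)
Fixpoint sc (n : nat) (U : R3 -> Prop) (f : R3 -> R) : Prop :=
  (forall v, U v -> continuous f v) /\
  match n with
  | O => True
  | S m => exists f1 f2 f3, has_partials U f f1 f2 f3 /\
             sc m U f1 /\ sc m U f2 /\ sc m U f3
  end.

Definition cinf (U : R3 -> Prop) (f : R3 -> R) : Prop := forall n, sc n U f.

Lemma sc_cont n U f : sc n U f -> forall v, U v -> continuous f v.
Proof. destruct n; intros H; apply H. Qed.

Lemma sc_class n U f : sc n U f -> class_C n U f.
Proof.
  revert f; induction n as [|n IH]; intros f H; [exact (proj1 H)|].
  destruct H as (_ & f1 & f2 & f3 & Hp & H1 & H2 & H3).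
  exists f1, f2, f3; auto.
Qed.

Lemma sc_S n U f : sc (S n) U f -> sc n U f.
Proof.
  revert f; induction n as [|n IH]; intros f H.
  - exact (conj (proj1 H) I).
  - destruct H as (Hc & f1 & f2 & f3 & Hp & H1 & H2 & H3).
    split; [exact Hc|]; exists f1, f2, f3; auto.
Qed.

Lemma sc_mono n (U V : R3 -> Prop) f :
  (forall v, V v -> U v) -> sc n U f -> sc n V f.
Proof.
  intros HV; revert f; induction n as [|n IH]; intros f H.
  - split; [|easy]; intros v Hv; apply H, HV, Hv.
  - destruct H as (Hc & f1 & f2 & f3 & Hp & H1 & H2 & H3).
    split; [intros v Hv; apply Hc, HV, Hv|].
    exists f1, f2, f3; split; [intros x y z Hv; apply Hp, HV, Hv | auto].
Qed.

Lemma open_lines (U : R3 -> Prop) x y z : open U -> U (x, y, z) ->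
  locally x (fun s => U (s, y, z)) /\ locally y (fun s => U (x, s, z)) /\
  locally z (fun s => U (x, y, s)).
Proof.
  intros HU Hv; destruct (proj1 (locally_box _ _) (HU _ Hv)) as (d & Hd & H).
  assert (Rdiag : forall a, Rabs (a - a) < d).
  { intros a; now rewrite Rminus_diag, Rabs_R0. }
  repeat split; apply locally_R_eps; exists d; split; auto; intros s Hs;
    apply H; repeat split; cbn; auto.
Qed.

Lemma continuous_ext_open (U : R3 -> Prop) (f g : R3 -> R) v :
  open U -> U v -> (forall w, U w -> f w = g w) ->
  continuous f v -> continuous g v.
Proof.
  intros HU Hv E; apply continuous_ext_loc.
  generalize (HU v Hv); apply filter_imp; intros w Hw; apply E, Hw.
Qed.

Lemma Derive_eq (f : R -> R) (x l : R) :
  is_derive f x l -> Derive (fun u => f u) x = l.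
Proof. apply is_derive_unique. Qed.

Lemma derive_ext_loc (f g : R -> R) (x l : R) :
  locally x (fun t => f t = g t) -> is_derive f x l -> is_derive g x l.
Proof. exact (is_derive_ext_loc (K := R_AbsRing) (V := R_NormedModule) f g x l). Qed.

Lemma partials_ext (U : R3 -> Prop) (f g f1 f2 f3 : R3 -> R) : open U ->
  (forall w, U w -> f w = g w) ->
  has_partials U f f1 f2 f3 -> has_partials U g f1 f2 f3.
Proof.
  intros HU E Hp x y z Hv; destruct (Hp x y z Hv) as (d1 & d2 & d3).
  destruct (open_lines U x y z HU Hv) as (l1 & l2 & l3).
  split; [|split].
  - refine (derive_ext_loc _ _ _ _ _ d1).
    generalize l1; apply filter_imp; intros; now apply E.
  - refine (derive_ext_loc _ _ _ _ _ d2).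
    generalize l2; apply filter_imp; intros; now apply E.
  - refine (derive_ext_loc _ _ _ _ _ d3).
    generalize l3; apply filter_imp; intros; now apply E.
Qed.

Lemma sc_ext n (U : R3 -> Prop) (f g : R3 -> R) : open U ->
  (forall w, U w -> f w = g w) -> sc n U f -> sc n U g.
Proof.
  intros HU E H; destruct n as [|n].
  - split; [|easy]; intros v Hv.
    apply (continuous_ext_open U f g v HU Hv E), H, Hv.
  - destruct H as (Hc & f1 & f2 & f3 & Hp & H1).
    split; [intros v Hv; apply (continuous_ext_open U f g v HU Hv E), Hc, Hv|].
    exists f1, f2, f3; split; auto; now apply (partials_ext U f g).
Qed.

Definition D1 (f : R3 -> R) (v : R3) := Derive (fun s => f (s, py v, pz v)) (px v).
Definition D2 (f : R3 -> R) (v : R3) := Derive (fun s => f (px v, s, pz v)) (py v).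
Definition D3 (f : R3 -> R) (v : R3) := Derive (fun s => f (px v, py v, s)) (pz v).

(** Partial derivatives are determined by the function, so that the existential
    ones of a class C^n may be replaced by [D1], [D2], [D3], which no longer
    depend on [n]; hence a C^infinity function has C^infinity partials. *)
Lemma partials_unique U f f1 f2 f3 : has_partials U f f1 f2 f3 ->
  forall v, U v -> f1 v = D1 f v /\ f2 v = D2 f v /\ f3 v = D3 f v.
Proof.
  intros Hp [[x y] z] Hv; destruct (Hp x y z Hv) as (d1 & d2 & d3).
  repeat split; symmetry; apply is_derive_unique; assumption.
Qed.

Lemma sc_D n U f : open U -> sc (S n) U f ->
  has_partials U f (D1 f) (D2 f) (D3 f) /\
  sc n U (D1 f) /\ sc n U (D2 f) /\ sc n U (D3 f).
Proof.
  intros HU (_ & f1 & f2 & f3 & Hp & H1 & H2 & H3).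
  assert (E := partials_unique U f f1 f2 f3 Hp).
  split; [|split; [|split]].
  - intros x y z H; destruct (E _ H) as (<- & <- & <-); apply Hp, H.
  - apply sc_ext with (3 := H1); auto; intros w Hw; apply E, Hw.
  - apply sc_ext with (3 := H2); auto; intros w Hw; apply E, Hw.
  - apply sc_ext with (3 := H3); auto; intros w Hw; apply E, Hw.
Qed.

Lemma cinf_partials U f : open U -> cinf U f ->
  has_partials U f (D1 f) (D2 f) (D3 f) /\
  cinf U (D1 f) /\ cinf U (D2 f) /\ cinf U (D3 f).
Proof.
  intros HU H; split; [apply (sc_D 0 U f HU (H 1%nat))|].
  split; [|split]; intros n; apply (sc_D n U f HU (H (S n))).
Qed.

(** The locally given partial derivatives all coincide with [D1], [D2], [D3],
    which therefore patch together. *)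
Lemma sc_local n (U : R3 -> Prop) f :
  (forall v, U v -> exists V, open V /\ V v /\ sc n V f) -> sc n U f.
Proof.
  revert f; induction n as [|n IH]; intros f H.
  - split; [|easy]; intros v Hv; destruct (H v Hv) as (V & _ & Vv & Hc).
    now apply Hc.
  - split.
    + intros v Hv; destruct (H v Hv) as (V & _ & Vv & Hc); now apply Hc.
    + exists (D1 f), (D2 f), (D3 f); split.
      * intros x y z Hv; destruct (H _ Hv) as (V & OV & Vv & Hc).
        now apply (sc_D n V f OV Hc).
      * repeat split; apply IH; intros v Hv; destruct (H _ Hv) as (V & OV & Vv & Hc);
          exists V; repeat split; auto; now apply (sc_D n V f OV Hc).
Qed.

Lemma cinf_local (U : R3 -> Prop) f :
  (forall v, U v -> exists V, open V /\ V v /\ cinf V f) -> cinf U f.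
Proof.
  intros H n; apply sc_local; intros v Hv; destruct (H v Hv) as (V & OV & Vv & Hc).
  exists V; auto.
Qed.

Lemma sc_const n U c : sc n U (fun _ => c).
Proof.
  revert c; induction n as [|n IH]; intros c.
  - split; [|easy]; intros v _; apply continuous_const.
  - split; [intros v _; apply continuous_const|].
    exists (fun _ => 0), (fun _ => 0), (fun _ => 0); split; [|auto].
    intros x y z _; split; [|split]; apply (@is_derive_const R_AbsRing R_NormedModule).
Qed.

Lemma sc_px n U : sc n U px.
Proof.
  destruct n; (split; [intros v _; apply continuous_px|]); [easy|].
  exists (fun _ => 1), (fun _ => 0), (fun _ => 0).
  split; [|repeat split; apply sc_const].
  intros x y z _; unfold px; cbn; split; [|split].
  apply (@is_derive_id R_AbsRing).
  all: apply (@is_derive_const R_AbsRing R_NormedModule).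
Qed.

Lemma sc_py n U : sc n U py.
Proof.
  destruct n; (split; [intros v _; apply continuous_py|]); [easy|].
  exists (fun _ => 0), (fun _ => 1), (fun _ => 0).
  split; [|repeat split; apply sc_const].
  intros x y z _; unfold py; cbn; split; [|split].
  2: apply (@is_derive_id R_AbsRing).
  all: apply (@is_derive_const R_AbsRing R_NormedModule).
Qed.

Lemma sc_pz n U : sc n U pz.
Proof.
  destruct n; (split; [intros v _; apply continuous_pz|]); [easy|].
  exists (fun _ => 0), (fun _ => 0), (fun _ => 1).
  split; [|repeat split; apply sc_const].
  intros x y z _; unfold pz; cbn; split; [|split].
  3: apply (@is_derive_id R_AbsRing).
  all: apply (@is_derive_const R_AbsRing R_NormedModule).
Qed.

Lemma sc_plus n U f g : sc n U f -> sc n U g -> sc n U (fun v => f v + g v).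
Proof.
  revert f g; induction n as [|n IH]; intros f g Hf Hg;
    (split; [intros v Hv; apply (continuous_plus (V := R_NormedModule));
       [apply Hf | apply Hg]; exact Hv|]); [easy|].
  destruct Hf as (_ & f1 & f2 & f3 & Hp & H1 & H2 & H3).
  destruct Hg as (_ & g1 & g2 & g3 & Hq & K1 & K2 & K3).
  exists (fun v => f1 v + g1 v), (fun v => f2 v + g2 v), (fun v => f3 v + g3 v).
  split; [|auto].
  intros x y z Hv; split; [|split];
    apply (@is_derive_plus R_AbsRing R_NormedModule); try apply (Hp x y z Hv);
    apply (Hq x y z Hv).
Qed.

Lemma sc_mult n U f g : sc n U f -> sc n U g -> sc n U (fun v => f v * g v).
Proof.
  revert f g; induction n as [|n IH]; intros f g Hf Hg;
    (split; [intros v Hv; apply (continuous_mult (K := R_AbsRing));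
       [apply Hf | apply Hg]; exact Hv|]); [easy|].
  assert (Hf' := sc_S _ _ _ Hf); assert (Hg' := sc_S _ _ _ Hg).
  destruct Hf as (_ & f1 & f2 & f3 & Hp & H1 & H2 & H3).
  destruct Hg as (_ & g1 & g2 & g3 & Hq & K1 & K2 & K3).
  exists (fun v => f1 v * g v + f v * g1 v), (fun v => f2 v * g v + f v * g2 v),
    (fun v => f3 v * g v + f v * g3 v).
  split; [|repeat split; apply sc_plus; now apply IH].
  intros x y z Hv; destruct (Hp x y z Hv) as (a1 & a2 & a3),
    (Hq x y z Hv) as (b1 & b2 & b3).
  split; [|split];
    (apply (@is_derive_mult R_AbsRing); [assumption..|]; intros; apply Rmult_comm).
Qed.

Lemma sc_opp n U f : sc n U f -> sc n U (fun v => - f v).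
Proof.
  intros H; assert (K := sc_mult n U _ _ (sc_const n U (-1)) H).
  revert K; clear.
  assert (E : forall v, -1 * f v = - f v) by (intros; ring).
  destruct n.
  - intros [K _]; split; [|easy]; intros v Hv.
    apply (continuous_ext (fun v => -1 * f v)); [intros; apply E | now apply K].
  - intros (K & f1 & f2 & f3 & Hp & H).
    split; [intros v Hv; apply (continuous_ext (fun v => -1 * f v)); [intros; apply E | now apply K]|].
    exists f1, f2, f3; split; [|exact H].
    intros x y z Hv; destruct (Hp x y z Hv) as (a & b & c); split; [|split].
    + refine (derive_ext_loc _ _ _ _ _ a); apply filter_forall; intros; apply E.
    + refine (derive_ext_loc _ _ _ _ _ b); apply filter_forall; intros; apply E.
    + refine (derive_ext_loc _ _ _ _ _ c); apply filter_forall; intros; apply E.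
Qed.

Lemma sc_minus n U f g : sc n U f -> sc n U g -> sc n U (fun v => f v - g v).
Proof. intros Hf Hg; apply sc_plus; [exact Hf | now apply sc_opp]. Qed.

(** Composition with a function of one real variable whose derivative is, after
    composition, again of class C^n; the common core of [sc_inv], [sc_sqrt],
    [sc_acos] and [sc_trig]. *)
Lemma sc_comp1 n U (phi dphi : R -> R) f :
  (forall v, U v -> is_derive phi (f v) (dphi (f v))) ->
  sc (S n) U f -> sc n U (fun v => dphi (f v)) ->
  sc (S n) U (fun v => phi (f v)).
Proof.
  intros Hphi Hf Hd.
  assert (Hc := proj1 Hf).
  destruct Hf as (_ & f1 & f2 & f3 & Hp & H1 & H2 & H3).
  split.
  - intros v Hv; apply (continuous_comp f phi); [now apply Hc|].
    apply (ex_derive_continuous phi); exists (dphi (f v)); now apply Hphi.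
  - exists (fun v => f1 v * dphi (f v)), (fun v => f2 v * dphi (f v)),
      (fun v => f3 v * dphi (f v)).
    split; [|repeat split; now apply sc_mult].
    intros x y z Hv; destruct (Hp x y z Hv) as (a1 & a2 & a3); split; [|split];
      apply (@is_derive_comp R_AbsRing R_NormedModule phi); auto; now apply Hphi.
Qed.

Lemma sc_inv n U f : (forall v, U v -> f v <> 0) -> sc n U f ->
  sc n U (fun v => / f v).
Proof.
  intros H0; induction n as [|n IH]; intros Hf.
  - split; [|easy]; intros v Hv; apply (continuous_comp f Rinv);
      [now apply Hf | now apply continuous_Rinv, H0].
  - apply (sc_comp1 n U Rinv (fun x => - (/ x * / x))); auto.
    + intros v Hv; auto_derive; auto; field; auto.
    + apply sc_opp, sc_mult; now apply IH, sc_S.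
Qed.

Lemma sc_div n U f g : (forall v, U v -> g v <> 0) -> sc n U f -> sc n U g ->
  sc n U (fun v => f v / g v).
Proof. intros H0 Hf Hg; apply sc_mult; auto; now apply sc_inv. Qed.

Lemma sc_sqrt n U f : (forall v, U v -> 0 < f v) -> sc n U f ->
  sc n U (fun v => sqrt (f v)).
Proof.
  intros H0; induction n as [|n IH]; intros Hf.
  - split; [|easy]; intros v Hv; apply (continuous_comp f sqrt);
      [now apply Hf | apply continuous_sqrt].
  - apply (sc_comp1 n U sqrt (fun x => / 2 * / sqrt x)); auto.
    + intros v Hv; auto_derive; auto; field.
      apply Rgt_not_eq, sqrt_lt_R0; auto.
    + apply sc_mult; [apply sc_const|]; apply sc_inv.
      * intros v Hv; apply Rgt_not_eq, sqrt_lt_R0; auto.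
      * now apply IH, sc_S.
Qed.

Lemma is_derive_acos x : -1 < x < 1 -> is_derive acos x (- / sqrt (1 - x * x)).
Proof.
  intros Hx; apply is_derive_Reals.
  replace (- / sqrt (1 - x * x)) with (-1 / sqrt (1 - x²)).
  - rewrite <- (derive_pt_acos x Hx); apply derive_pt_eq_1 with (derivable_pt_acos x Hx).
    reflexivity.
  - unfold Rsqr; field; apply Rgt_not_eq, sqrt_lt_R0; nra.
Qed.

Lemma sc_acos n U f : (forall v, U v -> -1 < f v < 1) -> sc n U f ->
  sc n U (fun v => acos (f v)).
Proof.
  intros H0; destruct n as [|n]; intros Hf.
  - split; [|easy]; intros v Hv; apply (continuous_comp f acos); [now apply Hf|].
    apply (ex_derive_continuous acos); eexists; apply is_derive_acos; auto.
  - apply (sc_comp1 n U acos (fun x => - / sqrt (1 - x * x))); auto.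
    + intros v Hv; apply is_derive_acos; auto.
    + apply sc_opp, sc_inv.
      * intros v Hv; apply Rgt_not_eq, sqrt_lt_R0; specialize (H0 v Hv); nra.
      * apply sc_sqrt; [intros v Hv; specialize (H0 v Hv); nra|].
        apply sc_minus; [apply sc_const|]; now apply sc_mult; apply sc_S.
Qed.

Lemma sc_trig n U f : sc n U f ->
  sc n U (fun v => sin (f v)) /\ sc n U (fun v => cos (f v)).
Proof.
  induction n as [|n IH]; intros Hf.
  - split; (split; [|easy]); intros v Hv.
    + apply (continuous_comp f sin); [now apply Hf | apply continuous_sin].
    + apply (continuous_comp f cos); [now apply Hf | apply continuous_cos].
  - destruct (IH (sc_S _ _ _ Hf)) as [Hs Hc]; split.
    + apply (sc_comp1 n U sin cos); auto; intros v _; apply is_derive_sin.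
    + apply (sc_comp1 n U cos (fun x => - sin x)); auto.
      * intros v _; apply is_derive_cos.
      * now apply sc_opp.
Qed.

Lemma sc_comp n (U V : R3 -> Prop) f g1 g2 g3 :
  open V -> (forall v, U v -> V (g1 v, g2 v, g3 v)) ->
  sc n V f -> sc n U g1 -> sc n U g2 -> sc n U g3 ->
  sc n U (fun v => f (g1 v, g2 v, g3 v)).
Proof.
  intros OV HUV; revert f; induction n as [|n IH]; intros f Hf H1 H2 H3;
    (split; [intros v Hv;
       apply (continuous_comp (fun v => ((g1 v, g2 v, g3 v) : R3)) f);
       [apply continuous_triple;
         [apply (sc_cont _ _ _ H1)|apply (sc_cont _ _ _ H2)|apply (sc_cont _ _ _ H3)];
         exact Hv
       | apply (sc_cont _ _ _ Hf), HUV, Hv]|]); [easy|].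
  assert (S1 := sc_S _ _ _ H1); assert (S2 := sc_S _ _ _ H2);
    assert (S3 := sc_S _ _ _ H3).
  destruct Hf as (_ & f1 & f2 & f3 & Hp & F1 & F2 & F3).
  destruct H1 as (_ & a1 & a2 & a3 & Ha & A1 & A2 & A3).
  destruct H2 as (_ & b1 & b2 & b3 & Hb & B1 & B2 & B3).
  destruct H3 as (_ & c1 & c2 & c3 & Hc & E1 & E2 & E3).
  assert (K : forall v, V v -> continuous f1 v /\ continuous f2 v /\ continuous f3 v).
  { intros v Hv; split; [|split];
      [apply (sc_cont _ _ _ F1)|apply (sc_cont _ _ _ F2)|apply (sc_cont _ _ _ F3)];
      exact Hv. }
  pose (h := fun (f : R3 -> R) v => f (g1 v, g2 v, g3 v)).
  exists (fun v => h f1 v * a1 v + h f2 v * b1 v + h f3 v * c1 v),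
    (fun v => h f1 v * a2 v + h f2 v * b2 v + h f3 v * c2 v),
    (fun v => h f1 v * a3 v + h f2 v * b3 v + h f3 v * c3 v).
  split.
  - intros x y z Hv; destruct (Ha x y z Hv) as (p1 & p2 & p3),
      (Hb x y z Hv) as (q1 & q2 & q3), (Hc x y z Hv) as (r1 & r2 & r3).
    split; [|split].
    + apply (chain3 V f f1 f2 f3 (fun s => g1 (s, y, z)) (fun s => g2 (s, y, z))
        (fun s => g3 (s, y, z))); auto.
    + apply (chain3 V f f1 f2 f3 (fun s => g1 (x, s, z)) (fun s => g2 (x, s, z))
        (fun s => g3 (x, s, z))); auto.
    + apply (chain3 V f f1 f2 f3 (fun s => g1 (x, y, s)) (fun s => g2 (x, y, s))
        (fun s => g3 (x, y, s))); auto.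
  - repeat split; (apply sc_plus; [apply sc_plus|]); apply sc_mult; auto;
      unfold h; now apply IH.
Qed.

(** * Integrals and inverse functions depending on parameters *)

Lemma cont_2d (g : R3 -> R) (x t z : R) : continuous g (x, t, z) ->
  continuity_2d_pt (fun a b => g (a, b, z)) x t.
Proof.
  intros H e; destruct (proj1 (cont_box _ _) H e (cond_pos e)) as (d & Hd & Hb).
  exists (mkposreal d Hd); intros a b Ha Hb'; apply Hb; repeat split; cbn; auto.
  rewrite Rminus_diag, Rabs_R0; exact Hd.
Qed.

Lemma open_plane (U : R3 -> Prop) x y z : open U -> U (x, y, z) ->
  locally_2d (fun a b => U (a, b, z)) x y.
Proof.
  intros HU Hv; destruct (proj1 (locally_box _ _) (HU _ Hv)) as (d & Hd & H).
  exists (mkposreal d Hd); intros a b Ha Hb; apply H; repeat split; cbn; auto.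
  rewrite Rminus_diag, Rabs_R0; exact Hd.
Qed.

(** The primitive in the second variable of a function depending on one parameter,
    the first variable; the third one is frozen so that the calculus on R^3 applies
    to functions of two variables. *)
Definition cut_int (f : R3 -> R) (v : R3) : R :=
  RInt (fun t => f (px v, t, 0)) 0 (py v).

(** The path of integration stays in the domain of the integrand. *)
Definition segments (U V : R3 -> Prop) : Prop :=
  forall x y z, U (x, y, z) -> forall t, Rmin 0 y <= t <= Rmax 0 y -> V (x, t, 0).

Lemma cont_second (f : R3 -> R) x t z :
  continuous f (x, t, z) -> continuous (fun s => f (x, s, z)) t.
Proof.
  intros H; apply (continuous_comp (fun s : R => ((x, s, z) : R3)) f); [|exact H].
  apply continuous_triple;
    [apply continuous_const | apply continuous_id | apply continuous_const].
Qed.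

Lemma ex_cut_int (V : R3 -> Prop) (f : R3 -> R) x a b :
  (forall v, V v -> continuous f v) ->
  (forall t, Rmin a b <= t <= Rmax a b -> V (x, t, 0)) ->
  ex_RInt (fun t => f (x, t, 0)) a b.
Proof.
  intros Hf HV; apply (ex_RInt_continuous (V := R_CompleteNormedModule)).
  intros t Ht; apply cont_second, Hf, HV, Ht.
Qed.

Lemma derive_cut_int_x (U V : R3 -> Prop) (f f1 f2 f3 : R3 -> R) x y z :
  open U -> open V -> segments U V -> U (x, y, z) ->
  (forall v, V v -> continuous f v) -> (forall v, V v -> continuous f1 v) ->
  has_partials V f f1 f2 f3 ->
  is_derive (fun s => cut_int f (s, y, z)) x (cut_int f1 (x, y, z)).
Proof.
  intros OU OV Hseg Hv Cf C1' Hp.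
  destruct (open_lines U x y z OU Hv) as (l1 & _ & _).
  unfold cut_int, px, py; cbn [fst snd].
  assert (E : forall a t, V (a, t, 0) -> Derive (fun u => f (u, t, 0)) a = f1 (a, t, 0)).
  { intros a t Ha; apply is_derive_unique, Hp, Ha. }
  replace (RInt (fun t => f1 (x, t, 0)) 0 y)
    with (RInt (fun t => Derive (fun u => f (u, t, 0)) x) 0 y).
  2:{ apply (RInt_ext (V := R_CompleteNormedModule)); intros t Ht.
      apply E, (Hseg x y z Hv); lra. }
  apply (is_derive_RInt_param (fun u t => f (u, t, 0)) 0 y x).
  - revert l1; apply filter_imp; intros s Hs t Ht.
    exists (f1 (s, t, 0)); exact (proj1 (Hp s t 0 (Hseg s y z Hs t Ht))).
  - intros t Ht.
    assert (Vt := Hseg x y z Hv t Ht).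
    apply continuity_2d_pt_ext_loc with (f := fun a b => f1 (a, b, 0)).
    + destruct (open_plane V x t 0 OV Vt) as [d Hd].
      exists d; intros a b Ha Hb; symmetry; apply E; auto.
    + apply cont_2d; auto.
  - revert l1; apply filter_imp; intros s Hs.
    apply (ex_cut_int V); auto; intros t Ht; apply (Hseg s y z Hs t Ht).
Qed.

Lemma derive_cut_int_y (U V : R3 -> Prop) (f : R3 -> R) x y z :
  open U -> segments U V -> U (x, y, z) ->
  (forall v, V v -> continuous f v) ->
  is_derive (fun s => cut_int f (x, s, z)) y (f (x, y, 0)).
Proof.
  intros OU Hseg Hv Cf.
  destruct (open_lines U x y z OU Hv) as (_ & l2 & _).
  unfold cut_int, px, py; cbn [fst snd].
  apply (is_derive_RInt (V := R_NormedModule) (fun t => f (x, t, 0)) _ 0 y).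
  - revert l2; apply filter_imp; intros s Hs.
    apply (RInt_correct (V := R_CompleteNormedModule)).
    apply (ex_cut_int V); auto; intros t Ht; apply (Hseg x s z Hs t Ht).
  - apply cont_second, Cf, (Hseg x y z Hv).
    split; [apply Rmin_r | apply Rmax_r].
Qed.

Lemma cont_cut_int (U V : R3 -> Prop) (f f1 f2 f3 : R3 -> R) v :
  open U -> open V -> segments U V -> U v ->
  (forall v, V v -> continuous f v) -> (forall v, V v -> continuous f1 v) ->
  has_partials V f f1 f2 f3 ->
  continuous (cut_int f) v.
Proof.
  intros OU OV Hseg Hv Cf C1' Hp; destruct v as [[x y] z].
  assert (Dx := derive_cut_int_x U V f f1 f2 f3 x y z OU OV Hseg Hv Cf C1' Hp).
  assert (Cx := ex_derive_continuous _ _ (ex_intro _ _ Dx)).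
  assert (Vy : V (x, y, 0)).
  { apply (Hseg x y z Hv); split; [apply Rmin_r | apply Rmax_r]. }
  apply cont_box; intros e He.
  destruct (proj1 (cont_R_eps _ _) Cx (e / 2)) as (d1 & Hd1 & H1); [lra|].
  destruct (proj1 (cont_box _ _) (Cf _ Vy) 1) as (d2 & Hd2 & H2); [lra|].
  destruct (proj1 (locally_box _ _) (OV _ Vy)) as (d3 & Hd3 & H3).
  destruct (proj1 (locally_box _ _) (OU _ Hv)) as (d4 & Hd4 & H4).
  set (M := Rabs (f (x, y, 0)) + 1).
  assert (HM : 0 < M) by (unfold M; assert (h := Rabs_pos (f (x, y, 0))); lra).
  set (d5 := e / (2 * M)).
  assert (Hd5 : 0 < d5) by (apply Rdiv_lt_0_compat; lra).
  set (d := Rmin (Rmin d1 d2) (Rmin (Rmin d3 d4) d5)).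
  assert (Hd : 0 < d) by (repeat apply Rmin_glb_lt; auto).
  assert (B : d <= d1 /\ d <= d2 /\ d <= d3 /\ d <= d4 /\ d <= d5).
  { unfold d; assert (m := Rmin_l); assert (m' := Rmin_r).
    assert (a := m (Rmin d1 d2) (Rmin (Rmin d3 d4) d5)).
    assert (a' := m' (Rmin d1 d2) (Rmin (Rmin d3 d4) d5)).
    assert (b := m d1 d2). assert (b' := m' d1 d2).
    assert (c := m (Rmin d3 d4) d5). assert (c' := m' (Rmin d3 d4) d5).
    assert (g := m d3 d4). assert (g' := m' d3 d4). lra. }
  exists d; split; [exact Hd|]; intros [[x' y'] z'] (Bx & By & Bz);
    cbn [px py pz fst snd] in Bx, By, Bz.
  assert (Z : forall a r, 0 < r -> Rabs (a - a) < r).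
  { intros; now rewrite Rminus_diag, Rabs_R0. }
  assert (seg : forall t, Rmin y y' <= t <= Rmax y y' -> Rabs (t - y) < d).
  { intros t; unfold Rmin, Rmax; destruct (Rle_dec y y'); intros Ht;
    apply Rabs_def2 in By; apply Rabs_def1; lra. }
  assert (U' : U (x', y, z)).
  { apply H4; repeat split; cbn; auto; lra. }
  assert (E : cut_int f (x', y', z') - cut_int f (x', y, z) =
     RInt (fun t => f (x', t, 0)) y y').
  { unfold cut_int, px, py; cbn [fst snd].
    assert (e1 : ex_RInt (fun t => f (x', t, 0)) 0 y).
    { apply (ex_cut_int V); auto; intros t Ht; apply (Hseg x' y z U' t Ht). }
    assert (e2 : ex_RInt (fun t => f (x', t, 0)) y y').
    { apply (ex_cut_int V); auto; intros t Ht; apply H3; repeat split; cbn; auto.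
      - lra.
      - apply Rlt_le_trans with d; [now apply seg | lra]. }
    assert (C := RInt_Chasles (V := R_CompleteNormedModule) _ 0 y y' e1 e2).
    rewrite <- C; unfold plus; cbn; ring. }
  assert (F : Rabs (RInt (fun t => f (x', t, 0)) y y') <= Rabs (y' - y) * M).
  { apply (norm_RInt_le_const_abs (V := R_NormedModule) (fun t => f (x', t, 0)) y y').
    - intros t Ht; change (Rabs (f (x', t, 0)) <= M).
      assert (Q : Rabs (f (x', t, 0) - f (x, y, 0)) < 1).
      { apply H2; repeat split; cbn; auto.
        - lra.
        - apply Rlt_le_trans with d; [now apply seg | lra]. }
      unfold M; assert (T := Rabs_triang (f (x', t, 0) - f (x, y, 0)) (f (x, y, 0))).
      replace (f (x', t, 0) - f (x, y, 0) + f (x, y, 0)) with (f (x', t, 0)) in T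
        by ring; lra.
    - apply (RInt_correct (V := R_CompleteNormedModule)).
      apply (ex_cut_int V); auto; intros t Ht; apply H3; repeat split; cbn; auto.
      + lra.
      + apply Rlt_le_trans with d; [now apply seg | lra]. }
  specialize (H1 x'); specialize (H1 (Rlt_le_trans _ _ _ Bx (proj1 B))).
  replace (cut_int f (x', y', z') - cut_int f (x, y, z)) with
    ((cut_int f (x', y', z') - cut_int f (x', y, z)) +
     (cut_int f (x', y, z) - cut_int f (x, y, z))) by ring.
  eapply Rle_lt_trans; [apply Rabs_triang|].
  rewrite E.
  assert (Rabs (y' - y) * M < e / 2).
  { apply Rlt_le_trans with (d5 * M).
    - apply Rmult_lt_compat_r; lra.
    - unfold d5; right; field; lra. }
  replace e with (e / 2 + e / 2) by field.
  apply Rplus_lt_compat; [exact (Rle_lt_trans _ _ _ F H) | exact H1].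
Qed.

(** Both partial derivatives of the integral are again of the same kind: the
    integral of [D1 f], by differentiation under the integral sign, and the
    integrand itself; hence an induction on the order. *)
Lemma sc_cut_int (U V : R3 -> Prop) f : open U -> open V -> segments U V ->
  cinf V f -> cinf U (cut_int f).
Proof.
  intros OU OV Hseg Hf n; revert f Hf; induction n as [|n IH]; intros f Hf;
    destruct (cinf_partials V f OV Hf) as (Hp & F1 & F2 & F3);
    (split; [intros v Hv;
      apply (cont_cut_int U V f (D1 f) (D2 f) (D3 f)); auto; intros w Hw;
      [apply (sc_cont _ _ _ (Hf 0%nat) w Hw) | apply (sc_cont _ _ _ (F1 0%nat) w Hw)]|]); [easy|].
  exists (cut_int (D1 f)), (fun v => f (px v, py v, 0)), (fun _ => 0).
  split; [|split; [now apply IH|split; [|apply sc_const]]].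
  - intros x y z Hv; split; [|split].
    + apply (derive_cut_int_x U V f (D1 f) (D2 f) (D3 f)); auto; intros w Hw;
      [apply (sc_cont _ _ _ (Hf 0%nat) w Hw) | apply (sc_cont _ _ _ (F1 0%nat) w Hw)].
    + apply (derive_cut_int_y U V f x y z); auto; intros w Hw; apply (sc_cont _ _ _ (Hf 0%nat) w Hw).
    + exact (@is_derive_const R_AbsRing R_NormedModule (cut_int f (x, y, 0)) z).
  - apply (sc_comp n U V f px py (fun _ => 0)); auto.
    + intros [[x y] z] Hv; apply (Hseg x y z Hv); split; [apply Rmin_r | apply Rmax_r].
    + apply sc_px.
    + apply sc_py.
    + apply sc_const.
Qed.

(** A function that is strictly monotone in its first variable is inverted in
    that variable, the two others being parameters; [g] need only be some
    inverse, its smoothness and the openness of its domain follow. *)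
Section ParamInverse.
Variables (U V : R3 -> Prop) (f f1 f2 f3 g : R3 -> R).
Hypothesis OU : open U.
Hypothesis convex : forall x x' t y z, U (x, y, z) -> U (x', y, z) ->
  x <= t <= x' -> U (t, y, z).
Hypothesis Hp : has_partials U f f1 f2 f3.
Hypothesis C0 : forall v, U v -> continuous f v.
Hypothesis C1 : forall v, U v -> continuous f1 v.
Hypothesis C2 : forall v, U v -> continuous f2 v.
Hypothesis C3 : forall v, U v -> continuous f3 v.
Hypothesis pos : forall v, U v -> 0 < f1 v.
Hypothesis VH : forall x y z, U (x, y, z) -> V (f (x, y, z), y, z).
Hypothesis Hg : forall t y z, V (t, y, z) ->
  U (g (t, y, z), y, z) /\ f (g (t, y, z), y, z) = t.

Lemma param_increasing x x' y z : U (x, y, z) -> U (x', y, z) -> x < x' ->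
  f (x, y, z) < f (x', y, z).
Proof.
  intros H H' Hx.
  destruct (MVT_gen (fun s => f (s, y, z)) x x' (fun s => f1 (s, y, z)))
    as (c & Hc & E).
  - rewrite Rmin_left, Rmax_right by lra; intros s Hs; apply Hp.
    apply (convex x x'); auto; lra.
  - rewrite Rmin_left, Rmax_right by lra; intros s Hs.
    apply continuity_pt_filterlim, (ex_derive_continuous (fun s => f (s, y, z))).
    exists (f1 (s, y, z)); exact (proj1 (Hp s y z (convex x x' s y z H H' Hs))).
  - rewrite Rmin_left, Rmax_right in Hc by lra.
    assert (0 < f1 (c, y, z)) by (apply pos, (convex x x'); auto).
    nra.
Qed.

Lemma param_inverse_unique x y z : U (x, y, z) -> g (f (x, y, z), y, z) = x.
Proof.
  intros H; destruct (Hg _ _ _ (VH _ _ _ H)) as [K E].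
  destruct (Rtotal_order (g (f (x, y, z), y, z)) x) as [L|[L|L]]; auto; exfalso.
  - assert (M := param_increasing _ _ y z K H L); lra.
  - assert (M := param_increasing _ _ y z H K L); lra.
Qed.

(** The intermediate value theorem on a short segment around [x]: at its two ends
    the values of [f] lie on either side of [t], and they still do for nearby
    parameters and a nearby target. *)
Lemma param_inverse_near t y z : V (t, y, z) -> forall e, 0 < e ->
  exists d, 0 < d /\ forall w, box d (t, y, z) w -> V w /\
    Rabs (g w - g (t, y, z)) < e.
Proof.
  intros Hv e He.
  destruct (Hg _ _ _ Hv) as [K E].
  set (x := g (t, y, z)) in *.
  destruct (proj1 (locally_box _ _) (OU _ K)) as (r & Hr & Hbox).
  set (h := Rmin (r / 2) (e / 2)).
  assert (Hh : 0 < h /\ h < r /\ h < e).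
  { unfold h; split; [apply Rmin_glb_lt; lra|].
    assert (a := Rmin_l (r / 2) (e / 2)); assert (b := Rmin_r (r / 2) (e / 2)); lra. }
  assert (Z : forall a r, 0 < r -> Rabs (a - a) < r).
  { intros; now rewrite Rminus_diag, Rabs_R0. }
  assert (inb : forall s y' z', Rabs (s - x) <= h -> Rabs (y' - y) < r ->
     Rabs (z' - z) < r -> U (s, y', z')).
  { intros s y' z' h1 h2 h3; apply Hbox; repeat split; cbn; auto; lra. }
  assert (Um : U (x - h, y, z)).
  { apply inb; auto; replace (x - h - x) with (- h) by ring.
    rewrite Rabs_Ropp, Rabs_right; lra. }
  assert (Up : U (x + h, y, z)).
  { apply inb; auto; replace (x + h - x) with h by ring.
    rewrite Rabs_right; lra. }
  assert (Lm := param_increasing (x - h) x y z Um K ltac:(lra)).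
  assert (Lp := param_increasing x (x + h) y z K Up ltac:(lra)).
  rewrite E in Lm, Lp.
  set (q := Rmin (t - f (x - h, y, z)) (f (x + h, y, z) - t) / 2).
  assert (Hq : 0 < q /\ f (x - h, y, z) + 2 * q <= t <= f (x + h, y, z) - 2 * q).
  { unfold q; assert (a := Rmin_l (t - f (x - h, y, z)) (f (x + h, y, z) - t)).
    assert (b := Rmin_r (t - f (x - h, y, z)) (f (x + h, y, z) - t)).
    assert (c := Rmin_glb_lt (t - f (x - h, y, z)) (f (x + h, y, z) - t) 0).
    lra. }
  destruct (proj1 (cont_box _ _) (C0 _ Um) q) as (d1 & Hd1 & H1); [lra|].
  destruct (proj1 (cont_box _ _) (C0 _ Up) q) as (d2 & Hd2 & H2); [lra|].
  set (d := Rmin (Rmin d1 d2) (Rmin q r)).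
  assert (Hd : 0 < d) by (repeat apply Rmin_glb_lt; lra).
  assert (B : d <= d1 /\ d <= d2 /\ d <= q /\ d <= r).
  { unfold d; assert (m := Rmin_l); assert (m' := Rmin_r).
    assert (a := m (Rmin d1 d2) (Rmin q r)). assert (a' := m' (Rmin d1 d2) (Rmin q r)).
    assert (b := m d1 d2). assert (b' := m' d1 d2).
    assert (c := m q r). assert (c' := m' q r). lra. }
  exists d; split; [exact Hd|]; intros [[t' y'] z'] (Bt & By & Bz);
    cbn [px py pz fst snd] in Bt, By, Bz.
  assert (F1 : Rabs (f (x - h, y', z') - f (x - h, y, z)) < q).
  { apply H1; repeat split; cbn; auto; lra. }
  assert (F2 : Rabs (f (x + h, y', z') - f (x + h, y, z)) < q).
  { apply H2; repeat split; cbn; auto; lra. }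
  apply Rabs_def2 in F1; apply Rabs_def2 in F2; apply Rabs_def2 in Bt.
  assert (Seg : forall s, x - h <= s <= x + h -> U (s, y', z')).
  { intros s Hs; apply inb; try lra; apply Rabs_le; lra. }
  destruct (IVT_interv (fun s => f (s, y', z') - t') (x - h) (x + h)) as (x' & Hx' & E').
  - intros s Hs; apply continuity_pt_minus.
    + apply continuity_pt_filterlim, (ex_derive_continuous (fun s => f (s, y', z'))).
      exists (f1 (s, y', z')); exact (proj1 (Hp s y' z' (Seg s Hs))).
    + apply continuity_pt_const; intros ? ?; reflexivity.
  - lra.
  - lra.
  - lra.
  - assert (U' := Seg _ Hx').
    assert (E2 : f (x', y', z') = t') by lra.
    assert (G := param_inverse_unique _ _ _ U').
    rewrite E2 in G; split.
    + rewrite <- E2; now apply VH.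
    + rewrite G; apply Rabs_def1; lra.
Qed.

Lemma param_inverse_open : open V.
Proof.
  intros [[t y] z] Hv; apply locally_box.
  destruct (param_inverse_near t y z Hv 1 Rlt_0_1) as (d & Hd & H).
  exists d; split; auto; intros w Hw; now apply H.
Qed.

Lemma param_inverse_cont v : V v -> continuous g v.
Proof.
  intros Hv; destruct v as [[t y] z]; apply cont_box; intros e He.
  destruct (param_inverse_near t y z Hv e He) as (d & Hd & H).
  exists d; split; auto; intros w Hw; now apply H.
Qed.

Definition lift (v : R3) : R3 := (g v, py v, pz v).

Lemma cont_lift v : V v -> continuous lift v.
Proof.
  intros Hv; apply (continuous_triple g py pz).
  - now apply param_inverse_cont.
  - apply continuous_py.
  - apply continuous_pz.
Qed.

(** The slopes of [f] at [lift v], composed with the continuous map [lift], give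
    an exact linear relation between the increments of [g] and of its arguments;
    it is solved for the increment of [g]. *)
Lemma param_inverse_slopes v : V v -> exists B1 B2 B3 : R3 -> R,
  continuous B1 v /\ continuous B2 v /\ continuous B3 v /\
  B1 v = / f1 (lift v) /\ B2 v = - (f2 (lift v) / f1 (lift v)) /\
  B3 v = - (f3 (lift v) / f1 (lift v)) /\
  locally v (fun w => g w - g v = B1 w * (px w - px v) + B2 w * (py w - py v)
     + B3 w * (pz w - pz v)).
Proof.
  intros Hv.
  assert (K : U (lift v) /\ f (lift v) = px v).
  { destruct v as [[t y] z]; exact (Hg t y z Hv). }
  destruct K as [K E].
  destruct (slopes3 U f f1 f2 f3 _ OU K Hp (C1 _ K) (C2 _ K) (C3 _ K))
    as (A1 & A2 & A3 & a1 & a2 & a3 & e1 & e2 & e3 & HA).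
  assert (cA : forall A : R3 -> R, continuous A (lift v) ->
      continuous (fun w => A (lift w)) v).
  { intros A HA'; exact (continuous_comp lift A v (cont_lift v Hv) HA'). }
  assert (p1 := pos _ K).
  assert (ci : continuous (fun w => / A1 (lift w)) v).
  { apply (continuous_comp (fun w => A1 (lift w)) Rinv); [now apply cA|].
    apply continuous_Rinv; rewrite e1; lra. }
  assert (near : locally v (fun w => V w /\ 0 < A1 (lift w))).
  { apply filter_and.
    - exact (param_inverse_open v Hv).
    - assert (c1 := cA _ a1).
      destruct (proj1 (cont_box _ _) c1 (f1 (lift v)) p1) as (d & Hd & H).
      apply locally_box; exists d; split; auto; intros w Hw.
      specialize (H w Hw); rewrite e1 in H; apply Rabs_def2 in H; lra. }
  exists (fun w => / A1 (lift w)), (fun w => - (A2 (lift w) * / A1 (lift w))),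
    (fun w => - (A3 (lift w) * / A1 (lift w))).
  repeat split.
  - exact ci.
  - apply (continuous_opp (V := R_NormedModule) (fun w => A2 (lift w) * / A1 (lift w))).
    apply (continuous_mult (K := R_AbsRing)); auto.
  - apply (continuous_opp (V := R_NormedModule) (fun w => A3 (lift w) * / A1 (lift w))).
    apply (continuous_mult (K := R_AbsRing)); auto.
  - now rewrite e1.
  - now rewrite e1, e2.
  - now rewrite e1, e3.
  - assert (L := filter_and _ _ near (cont_lift v Hv _ HA)).
    revert L; apply filter_imp; intros w [[Vw Aw] L].
    assert (Ew : f (lift w) = px w).
    { destruct w as [[t y] z]; exact (proj2 (Hg t y z Vw)). }
    change (f (lift w) - f (lift v) = A1 (lift w) * (g w - g v) +
      A2 (lift w) * (py w - py v) + A3 (lift w) * (pz w - pz v)) in L.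
    rewrite Ew, E in L.
    apply Rmult_eq_reg_l with (A1 (lift w)); [|lra].
    replace (px w - px v) with (A1 (lift w) * (g w - g v) + A2 (lift w) * (py w - py v)
      + A3 (lift w) * (pz w - pz v)) by (symmetry; exact L).
    field; lra.
Qed.

Lemma param_inverse_partials : has_partials V g (fun v => / f1 (lift v))
  (fun v => - (f2 (lift v) / f1 (lift v))) (fun v => - (f3 (lift v) / f1 (lift v))).
Proof.
  intros x y z Hv.
  destruct (param_inverse_slopes _ Hv) as (B1 & B2 & B3 & b1 & b2 & b3 & e1 & e2 & e3 & H).
  apply locally_box in H; destruct H as (d & Hd & H).
  assert (Z : forall a, Rabs (a - a) < d).
  { intros; now rewrite Rminus_diag, Rabs_R0. }
  split; [|split].
  - apply derive_of_slope with (s := fun s => B1 (s, y, z)); auto.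
    + apply (continuous_comp (fun s : R => ((s, y, z) : R3)) B1); [|exact b1].
      apply continuous_triple; [apply continuous_id|apply continuous_const..].
    + apply locally_R_eps; exists d; split; auto; intros s Hs; rewrite H.
      * unfold px, py, pz; cbn; ring.
      * repeat split; cbn; auto.
  - apply derive_of_slope with (s := fun s => B2 (x, s, z)); auto.
    + apply (continuous_comp (fun s : R => ((x, s, z) : R3)) B2); [|exact b2].
      apply continuous_triple;
        [apply continuous_const|apply continuous_id|apply continuous_const].
    + apply locally_R_eps; exists d; split; auto; intros s Hs; rewrite H.
      * unfold px, py, pz; cbn; ring.
      * repeat split; cbn; auto.
  - apply derive_of_slope with (s := fun s => B3 (x, y, s)); auto.
    + apply (continuous_comp (fun s : R => ((x, y, s) : R3)) B3); [|exact b3].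
      apply continuous_triple;
        [apply continuous_const|apply continuous_const|apply continuous_id].
    + apply locally_R_eps; exists d; split; auto; intros s Hs; rewrite H.
      * unfold px, py, pz; cbn; ring.
      * repeat split; cbn; auto.
Qed.
End ParamInverse.

(** The partial derivatives of [g] are rational functions of those of [f] at
    [lift v], hence are as smooth as [g]: the order grows by one at each step. *)
Lemma cinf_param_inverse (U V : R3 -> Prop) (f g : R3 -> R) :
  open U ->
  (forall x x' t y z, U (x, y, z) -> U (x', y, z) -> x <= t <= x' -> U (t, y, z)) ->
  cinf U f -> (forall v, U v -> 0 < D1 f v) ->
  (forall x y z, U (x, y, z) -> V (f (x, y, z), y, z)) ->
  (forall t y z, V (t, y, z) -> U (g (t, y, z), y, z) /\ f (g (t, y, z), y, z) = t) ->
  open V /\ cinf V g.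
Proof.
  intros OU convex Hf pos VH Hg.
  destruct (cinf_partials U f OU Hf) as (Hp & F1 & F2 & F3).
  assert (OV : open V).
  { apply (param_inverse_open U V f (D1 f) (D2 f) (D3 f) g); auto.
    intros v Hv; apply (sc_cont _ _ _ (Hf 0%nat) v Hv). }
  split; [exact OV|].
  assert (Cg : forall v, V v -> continuous g v).
  { apply (param_inverse_cont U V f (D1 f) (D2 f) (D3 f) g); auto.
    intros v Hv; apply (sc_cont _ _ _ (Hf 0%nat) v Hv). }
  intros n; induction n as [|n IH].
  - split; [exact Cg | easy].
  - split; [exact Cg|].
    eexists _, _, _; split.
    + apply (param_inverse_partials U V f (D1 f) (D2 f) (D3 f) g); auto; intros v Hv.
      * apply (sc_cont _ _ _ (Hf 0%nat) v Hv).
      * apply (sc_cont _ _ _ (F1 0%nat) v Hv).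
      * apply (sc_cont _ _ _ (F2 0%nat) v Hv).
      * apply (sc_cont _ _ _ (F3 0%nat) v Hv).
    + assert (L : forall h, cinf U h -> sc n V (fun v => h (lift g v))).
      { intros h Hh; apply (sc_comp n V U h g py pz); auto.
        - intros [[t y] z] Hv; apply (Hg t y z Hv).
        - apply sc_py.
        - apply sc_pz. }
      assert (nz : forall v, V v -> D1 f (lift g v) <> 0).
      { intros [[t y] z] Hv; apply Rgt_not_eq, pos, (Hg t y z Hv). }
      repeat split; [apply sc_inv; auto | apply sc_opp, sc_div; auto..].
Qed.

(** * Trajectories are determined by their initial point *)

Lemma constant_of_derive_0 (f : R -> R) :
  (forall t, is_derive f t 0) -> forall t, f t = f 0.
Proof.
  intros H t; destruct (MVT_gen f 0 t (fun _ => 0)) as (c & _ & E).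
  - intros; apply H.
  - intros x _; apply continuity_pt_filterlim, (ex_derive_continuous f).
    exists 0; apply H.
  - lra.
Qed.

Lemma eq_of_derive (f g df : R -> R) :
  (forall t, is_derive f t (df t)) -> (forall t, is_derive g t (df t)) ->
  f 0 = g 0 -> forall t, f t = g t.
Proof.
  intros Hf Hg E t.
  assert (H : forall t, is_derive (fun u => f u - g u) t 0).
  { intros s; replace 0 with (df s - df s) by ring.
    apply (@is_derive_minus R_AbsRing R_NormedModule); auto. }
  assert (K := constant_of_derive_0 _ H t); simpl in K; lra.
Qed.

Lemma sin_lipschitz a b : Rabs (sin a - sin b) <= Rabs (a - b).
Proof.
  destruct (MVT_gen sin b a cos) as (c & _ & E).
  - intros; apply is_derive_sin.
  - intros; apply continuity_pt_filterlim, continuous_sin.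
  - rewrite E, Rabs_mult.
    assert (Rabs (cos c) <= 1) by (apply Rabs_le; destruct (COS_bound c); lra).
    assert (0 <= Rabs (a - b)) by apply Rabs_pos; nra.
Qed.

(** The squared distance [d] of two solutions satisfies [|d'| <= 2 d], so that
    [d exp (- 2 t)] does not increase for [t >= 0] and [d exp (2 t)] does not
    decrease for [t <= 0]. *)
Lemma pendulum_unique (g c g' c' : R -> R) :
  (forall t, is_derive g t (c t)) -> (forall t, is_derive c t (- sin (g t))) ->
  (forall t, is_derive g' t (c' t)) -> (forall t, is_derive c' t (- sin (g' t))) ->
  g 0 = g' 0 -> c 0 = c' 0 -> forall t, g t = g' t /\ c t = c' t.
Proof.
  intros Dg Dc Dg' Dc' Eg Ec t.
  set (d := fun t => (g t - g' t) ^ 2 + (c t - c' t) ^ 2).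
  set (dd := fun t => 2 * (g t - g' t) * (c t - c' t)
     - 2 * (c t - c' t) * (sin (g t) - sin (g' t))).
  assert (Bd : forall s, Rabs (dd s) <= 2 * d s).
  { intros s; unfold dd, d.
    assert (L := sin_lipschitz (g s) (g' s)).
    set (p := g s - g' s) in *; set (q := c s - c' s) in *.
    set (r := sin (g s) - sin (g' s)) in *.
    clearbody p q r.
    assert (I1 : Rabs (p * q) <= (p ^ 2 + q ^ 2) / 2) by
      (apply Rabs_le; assert (h1 := pow2_ge_0 (p - q)); assert (h2 := pow2_ge_0 (p + q)); split; nra).
    assert (I2 : Rabs (q * r) <= (p ^ 2 + q ^ 2) / 2).
    { rewrite Rabs_mult.
      assert (q ^ 2 = Rabs q ^ 2) by (now rewrite pow2_abs).
      assert (p ^ 2 = Rabs p ^ 2) by (now rewrite pow2_abs).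
      assert (0 <= Rabs q) by apply Rabs_pos.
      assert (Rabs q * Rabs r <= Rabs q * Rabs p) by now apply Rmult_le_compat_l.
      assert (h1 := pow2_ge_0 (Rabs p - Rabs q)); nra. }
    replace (2 * p * q - 2 * q * r) with (2 * (p * q) - 2 * (q * r)) by ring.
    apply Rabs_le_between in I1; apply Rabs_le_between in I2; apply Rabs_le; lra. }
  assert (D : forall k s, is_derive (fun u => d u * exp (k * u)) s
     ((dd s + k * d s) * exp (k * s))).
  { intros k s; unfold d, dd.
    assert (E1 := Dg s); assert (E2 := Dg' s); assert (E3 := Dc s); assert (E4 := Dc' s).
    auto_derive.
    - repeat split; eexists; eassumption.
    - rewrite (Derive_eq g _ _ E1),
        (Derive_eq g' _ _ E2), (Derive_eq c _ _ E3), (Derive_eq c' _ _ E4).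
      ring. }
  assert (d0 : d 0 = 0) by (unfold d; rewrite Eg, Ec; ring).
  assert (dz : d t <= 0).
  { assert (main : forall k, (0 <= t -> k = -2) -> (t < 0 -> k = 2) ->
       d t * exp (k * t) <= 0).
    { intros k k1 k2.
      destruct (MVT_gen (fun u => d u * exp (k * u)) 0 t
        (fun s => (dd s + k * d s) * exp (k * s))) as (x & Hx & E).
      - intros; apply D.
      - intros x _; apply continuity_pt_filterlim,
          (ex_derive_continuous (fun u => d u * exp (k * u))).
        eexists; apply D.
      - rewrite d0 in E.
        assert (0 < exp (k * x)) by apply exp_pos.
        assert (B := Bd x). assert (B1 := Rle_abs (dd x)).
        assert (B2 := Rle_abs (- dd x)); rewrite Rabs_Ropp in B2.
        assert (0 <= d x).
        { unfold d; assert (q1 := pow2_ge_0 (g x - g' x)); assert (q2 := pow2_ge_0 (c x - c' x)); lra. }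
        destruct (Rle_or_lt 0 t) as [h|h].
        + rewrite (k1 h) in *.
          assert (h1 : dd x + -2 * d x <= 0) by lra.
          assert (h2 : (dd x + -2 * d x) * exp (-2 * x) <= 0).
          { generalize (Rmult_le_compat_r _ _ _ (Rlt_le _ _ H) h1); rewrite Rmult_0_l; auto. }
          generalize (Rmult_le_compat_r _ _ _ h h2); lra.
        + rewrite (k2 h) in *.
          assert (h1 : 0 <= dd x + 2 * d x) by lra.
          assert (h2 := Rmult_le_pos _ _ h1 (Rlt_le _ _ H)).
          generalize (Rmult_le_compat_l _ _ _ h2 (Rlt_le _ _ h)); lra. }
    destruct (Rle_or_lt 0 t) as [h|h].
    - specialize (main (-2) ltac:(auto) ltac:(intros; lra)).
      assert (0 < exp (-2 * t)) by apply exp_pos; nra.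
    - specialize (main 2 ltac:(intros; lra) ltac:(auto)).
      assert (0 < exp (2 * t)) by apply exp_pos; nra. }
  unfold d in dz.
  assert (q1 := pow2_ge_0 (g t - g' t)); assert (q2 := pow2_ge_0 (c t - c' t)).
  split; apply Rminus_diag_uniq, Rsqr_0_uniq; unfold Rsqr; nra.
Qed.

Lemma ang_eq g n : ang (g + 4 * PI * IZR n) = ang g.
Proof.
  apply eq_sig_hprop; [intros; apply proof_irrelevance|]; cbn.
  apply functional_extensionality; intros g'; apply propositional_extensionality.
  split; intros [m ->].
  - exists (n + m)%Z; rewrite plus_IZR; ring.
  - exists (m - n)%Z; rewrite minus_IZR; ring.
Qed.

Lemma ang_inj g g' : ang g = ang g' -> exists n, g' = g + 4 * PI * IZR n.
Proof.
  intros E; assert (H := f_equal (fun a => proj1_sig a g') E); cbn in H.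
  rewrite H; exists 0%Z; simpl; ring.
Qed.

Lemma ang_rep (a : circle) : ang (rep a) = a.
Proof.
  destruct a as [A [g Hg]].
  assert (H : A (rep (exist is_coset A (ex_intro _ g Hg)))).
  { apply (epsilon_spec (inhabits 0) A); exists g; apply Hg; exists 0%Z; simpl; ring. }
  set (r := rep _) in *; apply Hg in H; destruct H as [n ->].
  rewrite ang_eq; apply eq_sig_hprop; [intros; apply proof_irrelevance|]; cbn.
  apply functional_extensionality; intros g'; apply propositional_extensionality.
  symmetry; apply Hg.
Qed.

Lemma rep_ang g : exists n, rep (ang g) = g + 4 * PI * IZR n.
Proof. apply ang_inj; symmetry; apply ang_rep. Qed.

Lemma gam_ang g c : exists n, gam (ang g, c) = g + 4 * PI * IZR n.
Proof. apply rep_ang. Qed.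

Lemma cos_period_Z x n : cos (x + 2 * PI * IZR n) = cos x.
Proof.
  rewrite cos_plus, (Rmult_comm (2 * PI)).
  assert (E : forall m, sin (IZR m * (2 * PI)) = 0).
  { intros m; apply sin_eq_0_1; exists (2 * m)%Z; rewrite mult_IZR; ring. }
  assert (F : cos (IZR n * (2 * PI)) = 1).
  { replace (IZR n * (2 * PI)) with (2 * (IZR n * PI)) by ring.
    rewrite cos_2a_sin; replace (sin (IZR n * PI)) with 0; [ring|].
    symmetry; apply sin_eq_0_1; now exists n. }
  rewrite E, F; ring.
Qed.

Lemma sin_period_Z x n : sin (x + 2 * PI * IZR n) = sin x.
Proof.
  rewrite <- !cos_shift.
  replace (PI / 2 - (x + 2 * PI * IZR n)) with (PI / 2 - x + 2 * PI * IZR (- n)).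
  - apply cos_period_Z.
  - rewrite opp_IZR; ring.
Qed.

(** [geo l g c x y z] says that the lifted pendulum [(g, c)] starts at [l] and
    that [(x, y, z)] is the horizontal curve it steers; such a family exhibits
    the trajectories chosen in the definition of the exponential mapping. *)
Definition geo (l : Cyl) (g c x y z : R -> R) : Prop :=
  l = (ang (g 0), c 0) /\
  (forall t, is_derive g t (c t)) /\ (forall t, is_derive c t (- sin (g t))) /\
  (x 0 = 0 /\ y 0 = 0 /\ z 0 = 0) /\
  (forall t, is_derive x t (cos (g t / 2) * cosh (z t))) /\
  (forall t, is_derive y t (cos (g t / 2) * sinh (z t))) /\
  (forall t, is_derive z t (sin (g t / 2))).

(** Once the angle is known, [z] is a primitive, and so are then [x] and [y]; only
    for the pendulum is the uniqueness of solutions more than that of primitives. *)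
Lemma geo_spec l g c x y z : geo l g c x y z -> forall t,
  Exp (l, t) = (x t, y t, z t) /\ flow l t = (ang (g t), c t).
Proof.
  intros (El & Dg & Dc & (x0 & y0 & z0) & Dx & Dy & Dz).
  destruct (gam_ang (g 0) (c 0)) as [n En]; rewrite <- El in En.
  assert (Em : mom l = c 0) by (now rewrite El).
  assert (HP : pendulum_solution (gam l) (mom l) (pendulum l)).
  { unfold pendulum; apply epsilon_spec; exists (fun t => (g t + 4 * PI * IZR n, c t)).
    split; [cbn; now rewrite En, Em|]; intros t; cbn; split.
    - auto_derive; [eexists; apply Dg|].
      rewrite (Derive_eq g _ _ (Dg t)); ring.
    - replace (g t + 4 * PI * IZR n) with (g t + 2 * PI * IZR (2 * n)).
      + rewrite sin_period_Z; apply Dc.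
      + rewrite mult_IZR; ring. }
  destruct HP as [HP0 HP].
  assert (HU : forall t, g t + 4 * PI * IZR n = fst (pendulum l t) /\
     c t = snd (pendulum l t)).
  { apply (pendulum_unique (fun t => g t + 4 * PI * IZR n) c
      (fun t => fst (pendulum l t)) (fun t => snd (pendulum l t))).
    - intros t; auto_derive; [eexists; apply Dg|].
      rewrite (Derive_eq g _ _ (Dg t)); ring.
    - intros t; replace (g t + 4 * PI * IZR n) with (g t + 2 * PI * IZR (2 * n)).
      + rewrite sin_period_Z; apply Dc.
      + rewrite mult_IZR; ring.
    - intros t; apply HP.
    - intros t; apply HP.
    - rewrite HP0; cbn; now rewrite En.
    - rewrite HP0; now cbn. }
  assert (Hc : forall t, cos (fst (pendulum l t) / 2) = cos (g t / 2) /\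
     sin (fst (pendulum l t) / 2) = sin (g t / 2)).
  { intros t; rewrite <- (proj1 (HU t)).
    replace ((g t + 4 * PI * IZR n) / 2) with (g t / 2 + 2 * PI * IZR n) by field.
    now rewrite cos_period_Z, sin_period_Z. }
  assert (HG : horizontal_solution (fun t => fst (pendulum l t)) (geodesic l)).
  { unfold geodesic; apply epsilon_spec; exists (fun t => (x t, y t, z t)).
    split; [now rewrite x0, y0, z0|]; intros t; cbn.
    destruct (Hc t) as [-> ->]; split; [apply Dx | split; [apply Dy | apply Dz]]. }
  destruct HG as [HG0 HG].
  assert (Ez : forall t, z t = snd (geodesic l t)).
  { apply (eq_of_derive _ _ (fun t => sin (g t / 2))); auto.
    - intros t; rewrite <- (proj2 (Hc t)); apply HG.
    - now rewrite HG0. }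
  assert (Ex : forall t, x t = fst (fst (geodesic l t))).
  { apply (eq_of_derive _ _ (fun t => cos (g t / 2) * cosh (z t))); auto.
    - intros t; rewrite <- (proj1 (Hc t)), Ez; apply HG.
    - now rewrite HG0. }
  assert (Ey : forall t, y t = snd (fst (geodesic l t))).
  { apply (eq_of_derive _ _ (fun t => cos (g t / 2) * sinh (z t))); auto.
    - intros t; rewrite <- (proj1 (Hc t)), Ez; apply HG.
    - now rewrite HG0. }
  intros t; split.
  - unfold Exp; cbn; rewrite Ex, Ey, Ez; now destruct (geodesic l t) as [[? ?] ?].
  - unfold flow; rewrite <- (proj1 (HU t)), <- (proj2 (HU t)), ang_eq; reflexivity.
Qed.

(** * Symmetries of the trajectories *)

Lemma ang_neg g c : ang (- gam (ang g, c)) = ang (- g).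
Proof.
  destruct (gam_ang g c) as [n ->].
  rewrite <- (ang_eq (- g) (- n)); f_equal; rewrite opp_IZR; ring.
Qed.

Lemma ang_shift g c k : ang (gam (ang g, c) + k) = ang (g + k).
Proof.
  destruct (gam_ang g c) as [n ->].
  rewrite <- (ang_eq (g + k) n); f_equal; ring.
Qed.

Lemma geo_neg l g c x y z : geo l g c x y z ->
  geo (ang (- gam l), - mom l) (fun t => - g t) (fun t => - c t) x
    (fun t => - y t) (fun t => - z t).
Proof.
  intros (El & Dg & Dc & (x0 & y0 & z0) & Dx & Dy & Dz).
  split; [rewrite El; cbn [mom snd]; now rewrite ang_neg|].
  split; [|split; [|split; [|split; [|split]]]].
  - intros t; now apply (@is_derive_opp R_AbsRing R_NormedModule).
  - intros t; rewrite sin_neg; now apply (@is_derive_opp R_AbsRing R_NormedModule).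
  - lra.
  - intros t; replace (- g t / 2) with (- (g t / 2)) by field.
    rewrite cos_neg; replace (cosh (- z t)) with (cosh (z t)); auto.
    unfold cosh; rewrite Ropp_involutive; field.
  - intros t; replace (- g t / 2) with (- (g t / 2)) by field.
    rewrite cos_neg; replace (cos (g t / 2) * sinh (- z t)) with
      (- (cos (g t / 2) * sinh (z t))).
    + now apply (@is_derive_opp R_AbsRing R_NormedModule).
    + unfold sinh; rewrite Ropp_involutive; field.
  - intros t; replace (- g t / 2) with (- (g t / 2)) by field.
    rewrite sin_neg; now apply (@is_derive_opp R_AbsRing R_NormedModule).
Qed.

Lemma geo_shift l g c x y z : geo l g c x y z ->
  geo (ang (gam l + 2 * PI), mom l) (fun t => g t + 2 * PI) c (fun t => - x t)
    y (fun t => - z t).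
Proof.
  intros (El & Dg & Dc & (x0 & y0 & z0) & Dx & Dy & Dz).
  assert (H2 : forall t, (g t + 2 * PI) / 2 = g t / 2 + PI) by (intros; field).
  split; [rewrite El; cbn [mom snd]; now rewrite ang_shift|].
  split; [|split; [|split; [|split; [|split]]]].
  - intros t; auto_derive; [eexists; apply Dg|].
    rewrite (Derive_eq g _ _ (Dg t)); ring.
  - intros t; rewrite sin_plus, cos_2PI, sin_2PI.
    replace (- (sin (g t) * 1 + cos (g t) * 0)) with (- sin (g t)) by ring; auto.
  - lra.
  - intros t; rewrite H2, neg_cos.
    replace (- cos (g t / 2) * cosh (- z t)) with (- (cos (g t / 2) * cosh (z t))).
    + now apply (@is_derive_opp R_AbsRing R_NormedModule).
    + unfold cosh; rewrite Ropp_involutive; field.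
  - intros t; rewrite H2, neg_cos.
    replace (- cos (g t / 2) * sinh (- z t)) with (cos (g t / 2) * sinh (z t)); auto.
    unfold sinh; rewrite Ropp_involutive; field.
  - intros t; rewrite H2, neg_sin.
    now apply (@is_derive_opp R_AbsRing R_NormedModule).
Qed.

Lemma derive_reverse (f : R -> R) T t l : is_derive f (T - t) l ->
  is_derive (fun s => f (T - s)) t (- l).
Proof.
  intros H; auto_derive; [eexists; exact H|].
  replace (T + - t) with (T - t) by ring.
  rewrite (Derive_eq f _ _ H); ring.
Qed.

(** Running the pendulum backwards traverses the curve backwards from its end
    point; since [z T = 0], the left translation that brings this end point to
    the origin is a mere translation of the plane. *)
Lemma geo_reverse l g c x y z T : geo l g c x y z -> z T = 0 ->
  geo (ang (g T), - c T) (fun t => g (T - t)) (fun t => - c (T - t))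
    (fun t => x T - x (T - t)) (fun t => y (T - t) - y T) (fun t => - z (T - t)).
Proof.
  intros (El & Dg & Dc & (x0 & y0 & z0) & Dx & Dy & Dz) zT.
  split; [now rewrite Rminus_0_r|].
  split; [|split; [|split; [|split; [|split]]]].
  - intros t; now apply derive_reverse.
  - intros t; rewrite <- (Ropp_involutive (- sin _)).
    apply (@is_derive_opp R_AbsRing R_NormedModule (fun t => c (T - t))).
    now apply derive_reverse.
  - rewrite Rminus_0_r; lra.
  - intros t; replace (cosh (- z (T - t))) with (cosh (z (T - t))).
    + replace (cos (g (T - t) / 2) * cosh (z (T - t))) with
        (0 - - (cos (g (T - t) / 2) * cosh (z (T - t)))) by ring.
      apply (@is_derive_minus R_AbsRing R_NormedModule (fun _ => x T) (fun t => x (T - t))).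
      * apply (@is_derive_const R_AbsRing R_NormedModule).
      * now apply derive_reverse.
    + unfold cosh; rewrite Ropp_involutive; field.
  - intros t; replace (cos (g (T - t) / 2) * sinh (- z (T - t))) with
      (- (cos (g (T - t) / 2) * sinh (z (T - t))) - 0).
    + apply (@is_derive_minus R_AbsRing R_NormedModule (fun t => y (T - t)) (fun _ => y T)).
      * now apply derive_reverse.
      * apply (@is_derive_const R_AbsRing R_NormedModule).
    + unfold sinh; rewrite Ropp_involutive; field.
  - intros t; rewrite <- (Ropp_involutive (sin _)).
    apply (@is_derive_opp R_AbsRing R_NormedModule (fun t => z (T - t))).
    now apply derive_reverse.
Qed.

(** The seven reflections are generated by the change of sign of the state, the
    shift of the angle by [2 PI] and the reversal of time; the hypothesis
    [z t = 0] is what lets the reversed curve be translated back to the origin. *)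
Lemma Exp_reflect l g c x y z t j : (1 <= j <= 7)%nat -> geo l g c x y z ->
  z t = 0 -> Exp (epsN j (l, t)) = epsM j (Exp (l, t)).
Proof.
  intros Hj H zt.
  destruct (geo_spec _ _ _ _ _ _ H t) as [E F].
  assert (Hr := geo_reverse _ _ _ _ _ _ t H zt).
  assert (x0 : x 0 = 0 /\ y 0 = 0 /\ z 0 = 0) by apply H.
  destruct x0 as (x0 & y0 & z0).
  assert (triple : forall a b a' b' : R, a = a' -> b = b' ->
    (a, b, 0) = (a', b', 0)) by (intros; congruence).
  rewrite E, zt.
  assert (J : j = 1%nat \/ j = 2%nat \/ j = 3%nat \/ j = 4%nat \/ j = 5%nat \/
    j = 6%nat \/ j = 7%nat) by lia.
  destruct J as [->|[->|[->|[->|[->|[->| ->]]]]]]; cbn [epsN epsM epsC];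
    rewrite ?F; cbn [mom snd].
  - destruct (gam_ang (g t) (c t)) as [n ->]; rewrite ang_eq.
    rewrite (proj1 (geo_spec _ _ _ _ _ _ Hr t)), Rminus_diag, x0, y0, z0, Ropp_0.
    apply triple; ring.
  - apply geo_neg in Hr; cbn [mom snd] in Hr; rewrite Ropp_involutive in Hr.
    change (gam (ang (g t), c t)) with (gam (ang (g t), - c t)).
    rewrite (proj1 (geo_spec _ _ _ _ _ _ Hr t)), Rminus_diag, x0, y0, z0, !Ropp_0.
    apply triple; ring.
  - apply geo_neg in H.
    rewrite (proj1 (geo_spec _ _ _ _ _ _ H t)), zt, Ropp_0; reflexivity.
  - apply geo_shift in H.
    rewrite (proj1 (geo_spec _ _ _ _ _ _ H t)), zt, Ropp_0; reflexivity.
  - apply geo_shift in Hr; cbn [mom snd] in Hr.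
    change (gam (ang (g t), c t)) with (gam (ang (g t), - c t)).
    rewrite (proj1 (geo_spec _ _ _ _ _ _ Hr t)), Rminus_diag, x0, y0, z0, !Ropp_0.
    apply triple; ring.
  - apply geo_neg, geo_shift in Hr; cbn [mom snd] in Hr; rewrite Ropp_involutive in Hr.
    rewrite ang_shift in Hr.
    change (gam (ang (g t), c t)) with (gam (ang (g t), - c t)).
    rewrite (proj1 (geo_spec _ _ _ _ _ _ Hr t)), Rminus_diag, x0, y0, z0, !Ropp_0.
    apply triple; ring.
  - apply geo_neg, geo_shift in H; cbn [mom snd] in H; rewrite ang_shift in H.
    rewrite (proj1 (geo_spec _ _ _ _ _ _ H t)), zt, !Ropp_0; reflexivity.
Qed.

(** * Transport of a diffeomorphism by a reflection *)

Definition diag_affine (a1 b1 a2 b2 a3 b3 : R) (v : R3) : R3 :=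
  (a1 * px v + b1, a2 * py v + b2, a3 * pz v + b3).

Lemma cont_diag_affine a1 b1 a2 b2 a3 b3 v :
  continuous (diag_affine a1 b1 a2 b2 a3 b3) v.
Proof.
  assert (L : forall a b (p : R3 -> R), continuous p v ->
      continuous (fun w => a * p w + b) v).
  { intros a b p Hc; apply (continuous_plus (V := R_NormedModule) (fun w => a * p w)).
    - apply (continuous_mult (K := R_AbsRing) (fun _ => a)); auto.
      apply continuous_const.
    - apply continuous_const. }
  apply (continuous_triple (fun w => a1 * px w + b1) (fun w => a2 * py w + b2)
    (fun w => a3 * pz w + b3)); apply L;
    [apply continuous_px | apply continuous_py | apply continuous_pz].
Qed.

Lemma open_preimage (T : R3 -> R3) (U : R3 -> Prop) :
  (forall v, continuous T v) -> open U -> open (fun v => U (T v)).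
Proof. intros HT OU v Hv; exact (HT v _ (OU _ Hv)). Qed.

(** An affine change of variables, diagonal in the coordinates, multiplies each
    partial derivative by a constant, so that the classes of the statement are
    preserved without any chain rule in several variables. *)
Lemma class_affine n U f a1 b1 a2 b2 a3 b3 a b :
  class_C n U f ->
  class_C n (fun v => U (diag_affine a1 b1 a2 b2 a3 b3 v))
    (fun v => a * f (diag_affine a1 b1 a2 b2 a3 b3 v) + b).
Proof.
  set (T := diag_affine a1 b1 a2 b2 a3 b3).
  revert f a b; induction n as [|n IH]; intros f a b Hf.
  - intros v Hv; apply (continuous_plus (V := R_NormedModule) (fun w => a * f (T w)));
      [|apply continuous_const].
    apply (continuous_mult (K := R_AbsRing) (fun _ => a)); [apply continuous_const|].
    apply (continuous_comp T f); [apply cont_diag_affine | now apply Hf].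
  - destruct Hf as (f1 & f2 & f3 & Hp & H1 & H2 & H3).
    exists (fun v => (a * a1) * f1 (T v) + 0), (fun v => (a * a2) * f2 (T v) + 0),
      (fun v => (a * a3) * f3 (T v) + 0).
    split; [|auto].
    intros x y z Hv; destruct (Hp _ _ _ Hv) as (d1 & d2 & d3).
    assert (L : forall (h : R -> R) k m s l, is_derive h (k * s + m) l ->
       is_derive (fun u => a * h (k * u + m) + b) s (a * k * l + 0)).
    { intros h k m s l D; auto_derive; [eexists; exact D|].
      rewrite (Derive_eq h _ _ D); ring. }
    split; [|split].
    + exact (L (fun s => f (s, a2 * y + b2, a3 * z + b3)) a1 b1 x _ d1).
    + exact (L (fun s => f (a1 * x + b1, s, a3 * z + b3)) a2 b2 y _ d2).
    + exact (L (fun s => f (a1 * x + b1, a2 * y + b2, s)) a3 b3 z _ d3).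
Qed.

Lemma smooth_affine U F a1 b1 a2 b2 a3 b3 c1 e1 c2 e2 c3 e3 :
  smooth_on U F -> smooth_on (fun v => U (diag_affine a1 b1 a2 b2 a3 b3 v))
    (fun v => diag_affine c1 e1 c2 e2 c3 e3 (F (diag_affine a1 b1 a2 b2 a3 b3 v))).
Proof.
  intros H n; destruct (H n) as (H1 & H2 & H3).
  repeat split; cbn.
  - exact (class_affine n U _ a1 b1 a2 b2 a3 b3 c1 e1 H1).
  - exact (class_affine n U _ a1 b1 a2 b2 a3 b3 c2 e2 H2).
  - exact (class_affine n U _ a1 b1 a2 b2 a3 b3 c3 e3 H3).
Qed.

Lemma cov_surj (nu : N) : exists v, cov v = nu.
Proof.
  destruct nu as [[a c] t]; exists (rep a, c, t); cbn; now rewrite ang_rep.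
Qed.

(** [e], read in the covering, and [eM] are invertible affine maps, by which the
    local extensions of [Exp] and of its inverse are conjugated. The factor [s1] is
    1 or -1 because the lift must preserve the cosets of [4 PI Z]. *)
Lemma diffeo_reflect (A : N -> Prop) (B : R3 -> Prop) (e : N -> N) (eM : R3 -> R3)
    (s1 s2 k r1 r2 : R) :
  s1 * s1 = 1 -> s2 * s2 = 1 -> r1 * r1 = 1 -> r2 * r2 = 1 ->
  (s1 = 1 \/ s1 = -1) ->
  (forall v, eM v = diag_affine r1 0 r2 0 1 0 v) ->
  (forall nu, A nu -> Exp (e nu) = eM (Exp nu)) ->
  (forall v, A (cov v) -> e (cov v) = cov (diag_affine s1 k s2 0 1 0 v)) ->
  diffeomorphism A B Exp ->
  diffeomorphism (image e A) (image eM B) Exp.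
Proof.
  intros Hs1 Hs2 Hr1 Hr2 Hs EM HE HL (Hmap & HF & g & gA & gE & Eg & HG).
  set (L := diag_affine s1 k s2 0 1 0) in *.
  set (L' := diag_affine s1 (- s1 * k) s2 0 1 0).
  assert (LL : forall v, L (L' v) = v).
  { intros [[x y] z]; unfold L, L', diag_affine, px, py, pz; cbn.
    f_equal; [f_equal|]; [| |ring].
    - transitivity ((s1 * s1) * x + k * (1 - s1 * s1)); [ring | rewrite Hs1; ring].
    - transitivity ((s2 * s2) * y); [ring | rewrite Hs2; ring]. }
  assert (EM2 : forall q, eM (eM q) = q).
  { intros [[x y] z]; rewrite !EM; unfold diag_affine, px, py, pz; cbn.
    f_equal; [f_equal|]; [| |ring].
    - transitivity ((r1 * r1) * x); [ring | rewrite Hr1; ring].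
    - transitivity ((r2 * r2) * y); [ring | rewrite Hr2; ring]. }
  assert (back : forall v, image e A (cov v) -> A (cov (L' v))).
  { intros v (a & Ha & E); destruct (cov_surj a) as [w <-].
    rewrite (HL w Ha) in E.
    destruct v as [[x y] z], w as [[x' y'] z'].
    unfold L, diag_affine, px, py, pz in E; cbn in E.
    injection E as E1 E2 E3.
    assert (P := equal_f E1 x); cbn in P.
    assert (P' : exists n, x = s1 * x' + k + 4 * PI * IZR n).
    { rewrite <- P; exists 0%Z; simpl; ring. }
    destruct P' as [n ->].
    assert (Q : cov (L' (s1 * x' + k + 4 * PI * IZR n, y, z)) = cov (x', y', z')).
    { unfold L', diag_affine, px, py, pz; cbn; rewrite E2, E3.
      assert (Ea : ang (s1 * (s1 * x' + k + 4 * PI * IZR n) + - s1 * k) = ang x').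
      { replace (s1 * (s1 * x' + k + 4 * PI * IZR n) + - s1 * k) with
          ((s1 * s1) * x' + 4 * PI * (s1 * IZR n)) by ring.
        rewrite Hs1, Rmult_1_l; destruct Hs as [-> | ->].
        - rewrite Rmult_1_l; apply ang_eq.
        - replace (-1 * IZR n) with (IZR (- n)) by (rewrite opp_IZR; ring).
          apply ang_eq. }
      rewrite Ea; f_equal; [f_equal|ring].
      transitivity ((s2 * s2) * y'); [ring | rewrite Hs2; ring]. }
    rewrite Q; exact Ha. }
  assert (contT : forall a1 b1 a2 b2 a3 b3 U, open U ->
     open (fun v => U (diag_affine a1 b1 a2 b2 a3 b3 v))).
  { intros; apply open_preimage; auto; intros; apply cont_diag_affine. }
  split; [|split].
  - intros nu (a & Ha & ->); exists (Exp a); split; auto.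
  - intros v Hv; assert (Hv' := back v Hv).
    destruct (HF _ Hv') as (U & F & OU & Uv & SF & EF).
    exists (fun w => U (L' w)), (fun w => diag_affine r1 0 r2 0 1 0 (F (L' w))).
    split; [now apply contT|]; split; [exact Uv|].
    split; [now apply smooth_affine|].
    intros w Uw Hw; assert (Hw' := back w Hw).
    rewrite (EF _ Uw Hw'), <- EM, <- HE, HL by exact Hw'.
    now fold L; rewrite LL.
  - exists (fun q => e (g (eM q))).
    assert (Bq : forall q, image eM B q -> B (eM q)).
    { intros q (b & Hb & ->); now rewrite EM2. }
    split; [|split; [|split]].
    + intros q Hq; exists (g (eM q)); auto.
    + intros nu (a & Ha & ->); rewrite HE, EM2, gE; auto.
    + intros q Hq; rewrite HE, Eg, EM2; auto.
    + intros q Hq; destruct (HG _ (Bq q Hq)) as (U & G & OU & Uq & SG & EG).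
      exists (fun w => U (diag_affine r1 0 r2 0 1 0 w)),
        (fun w => L (G (diag_affine r1 0 r2 0 1 0 w))).
      split; [now apply contT|]; split; [now rewrite <- EM|].
      split; [now apply smooth_affine|].
      intros w Uw Hw; rewrite <- EM in *.
      assert (E := EG _ Uw (Bq w Hw)).
      rewrite <- HL, E; auto.
      rewrite E; auto.
Qed.

(** * Elliptic integrals and Jacobi's amplitude *)

Definition Del (k th : R) : R := sqrt (1 - k ^ 2 * sin th ^ 2).
Definition ellEi (phi k : R) : R :=
  RInt (fun th => sqrt (1 - k ^ 2 * sin th ^ 2)) 0 phi.

Lemma sin2_cos2' x : sin x ^ 2 + cos x ^ 2 = 1.
Proof. rewrite <- !Rsqr_pow2; apply sin2_cos2. Qed.

Lemma Del_arg_pos k th : 0 < k < 1 -> 0 < 1 - k ^ 2 * sin th ^ 2.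
Proof. intros Hk; assert (h := sin2_cos2' th); assert (0 <= cos th ^ 2) by nra; nra. Qed.

Lemma Del_pos k th : 0 < k < 1 -> 0 < Del k th.
Proof. intros Hk; apply sqrt_lt_R0, Del_arg_pos, Hk. Qed.

Lemma Del_sq k th : 0 < k < 1 -> Del k th ^ 2 = 1 - k ^ 2 * sin th ^ 2.
Proof. intros Hk; apply pow2_sqrt, Rlt_le, Del_arg_pos, Hk. Qed.

Lemma Del_sq' k th : 0 < k < 1 -> Del k th ^ 2 = 1 - k ^ 2 + k ^ 2 * cos th ^ 2.
Proof. intros Hk; rewrite Del_sq by auto; assert (h := sin2_cos2' th); nra. Qed.

Lemma Del_le_1 k th : 0 < k < 1 -> Del k th <= 1.
Proof.
  intros Hk; assert (h := Del_sq k th Hk); assert (p := Del_pos k th Hk).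
  assert (0 <= k ^ 2 * sin th ^ 2) by (apply Rmult_le_pos; apply pow2_ge_0); nra.
Qed.

Lemma Del_derive k th : 0 < k < 1 ->
  is_derive (Del k) th (- (k ^ 2 * sin th * cos th) / Del k th).
Proof.
  intros Hk; assert (p := Del_pos k th Hk); assert (q := Del_arg_pos k th Hk).
  replace (- (k ^ 2 * sin th * cos th) / Del k th) with
    (- (2 * k ^ 2 * sin th * cos th) / (2 * Del k th)) by (field; lra).
  apply (is_derive_sqrt (fun th => 1 - k ^ 2 * sin th ^ 2)); auto.
  auto_derive; auto; ring.
Qed.

Lemma Del_cont k th : 0 < k < 1 -> continuous (Del k) th.
Proof.
  intros Hk; apply (ex_derive_continuous (Del k)); eexists; apply Del_derive, Hk.
Qed.

Lemma derive_RInt_cont (f : R -> R) : (forall x, continuous f x) ->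
  forall x, is_derive (fun y => RInt f 0 y) x (f x).
Proof.
  intros Hf x; apply (is_derive_RInt (V := R_NormedModule) f _ 0 x); [|apply Hf].
  apply filter_forall; intros y; apply (RInt_correct (V := R_CompleteNormedModule)).
  apply (ex_RInt_continuous (V := R_CompleteNormedModule)); auto.
Qed.

Lemma ellEi_derive k psi : 0 < k < 1 ->
  is_derive (fun x => ellEi x k) psi (Del k psi).
Proof.
  intros Hk; apply (derive_RInt_cont (Del k)); intros; now apply Del_cont.
Qed.

Lemma ellF_derive k psi : 0 < k < 1 ->
  is_derive (fun x => ellF x k) psi (/ Del k psi).
Proof.
  intros Hk; apply (derive_RInt_cont (fun th => / Del k th)); intros x.
  apply (continuous_comp (Del k) Rinv); [now apply Del_cont|].
  apply continuous_Rinv, Rgt_not_eq, Del_pos, Hk.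
Qed.

Lemma RInt_0_0 (f : R -> R) : RInt f 0 0 = 0.
Proof. apply (RInt_point (V := R_CompleteNormedModule)). Qed.

Lemma odd_primitive (G g : R -> R) :
  (forall x, is_derive G x (g x)) -> G 0 = 0 ->
  (forall x, g (- x) = g x) -> forall x, G (- x) = - G x.
Proof.
  intros D G0 ev; apply (eq_of_derive _ _ (fun x => - g x)).
  - intros x; auto_derive; [eexists; apply D|].
    rewrite (Derive_eq G _ _ (D (- x))), ev; ring.
  - intros x; apply (@is_derive_opp R_AbsRing R_NormedModule), D.
  - rewrite Ropp_0, G0; ring.
Qed.

(** The increment over a period is the same at every point, in particular at
    [- PI / 2], where it is computed by parity. *)
Lemma period_primitive (G g : R -> R) :
  (forall x, is_derive G x (g x)) -> G 0 = 0 ->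
  (forall x, g (- x) = g x) -> (forall x, g (x + PI) = g x) ->
  forall x, G (x + PI) = G x + 2 * G (PI / 2).
Proof.
  intros D G0 ev per.
  assert (odd := odd_primitive G g D G0 ev).
  assert (E : forall x, G (x + PI) = G x + G PI).
  { apply (eq_of_derive _ _ g).
    - intros x; auto_derive; [eexists; apply D|].
      rewrite (Derive_eq G _ _ (D (x + PI))), per; ring.
    - intros x; auto_derive; [eexists; apply D|].
      rewrite (Derive_eq G _ _ (D x)); ring.
    - rewrite Rplus_0_l, G0; ring. }
  intros x; rewrite E; f_equal.
  assert (H := E (- (PI / 2))); rewrite odd in H.
  replace (- (PI / 2) + PI) with (PI / 2) in H by field; lra.
Qed.

Lemma Del_even k x : Del k (- x) = Del k x.
Proof. unfold Del; rewrite sin_neg; f_equal; ring. Qed.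

Lemma Del_period k x : Del k (x + PI) = Del k x.
Proof. unfold Del; rewrite neg_sin; f_equal; ring. Qed.

Lemma ellF_0 k : ellF 0 k = 0.
Proof. apply RInt_0_0. Qed.

Lemma ellEi_0 k : ellEi 0 k = 0.
Proof. apply RInt_0_0. Qed.

Lemma ellF_odd k x : 0 < k < 1 -> ellF (- x) k = - ellF x k.
Proof.
  intros Hk; apply (odd_primitive (fun x => ellF x k) (fun x => / Del k x)).
  - intros; now apply ellF_derive.
  - apply ellF_0.
  - intros; now rewrite Del_even.
Qed.

Lemma ellEi_odd k x : 0 < k < 1 -> ellEi (- x) k = - ellEi x k.
Proof.
  intros Hk; apply (odd_primitive (fun x => ellEi x k) (Del k)).
  - intros; now apply ellEi_derive.
  - apply ellEi_0.
  - intros; now rewrite Del_even.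
Qed.

Lemma ellF_period k x : 0 < k < 1 -> ellF (x + PI) k = ellF x k + 2 * ellK k.
Proof.
  intros Hk; apply (period_primitive (fun x => ellF x k) (fun x => / Del k x)).
  - intros; now apply ellF_derive.
  - apply ellF_0.
  - intros; now rewrite Del_even.
  - intros; now rewrite Del_period.
Qed.

Lemma ellEi_period k x : 0 < k < 1 -> ellEi (x + PI) k = ellEi x k + 2 * ellE k.
Proof.
  intros Hk; apply (period_primitive (fun x => ellEi x k) (Del k)).
  - intros; now apply ellEi_derive.
  - apply ellEi_0.
  - intros; now rewrite Del_even.
  - intros; now rewrite Del_period.
Qed.

Lemma derive_continuity_pt (f : R -> R) x l : is_derive f x l -> continuity_pt f x.
Proof.
  intros H; apply continuity_pt_filterlim, (ex_derive_continuous f); now exists l.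
Qed.

Lemma mvt (f df : R -> R) a b : a < b -> (forall x, a <= x <= b -> is_derive f x (df x)) ->
  exists c, a <= c <= b /\ f b - f a = df c * (b - a).
Proof.
  intros Hab H; destruct (MVT_gen f a b df) as (c & Hc & E).
  - rewrite Rmin_left, Rmax_right by lra; intros; apply H; lra.
  - rewrite Rmin_left, Rmax_right by lra; intros x Hx.
    exact (derive_continuity_pt f x _ (H x Hx)).
  - rewrite Rmin_left, Rmax_right in Hc by lra; now exists c.
Qed.

Lemma ellF_expanding k x y : 0 < k < 1 -> x < y -> y - x <= ellF y k - ellF x k.
Proof.
  intros Hk Hxy.
  destruct (mvt (fun x => ellF x k) (fun x => / Del k x) x y Hxy) as (c & _ & E).
  - intros; now apply ellF_derive.
  - rewrite E; assert (p := Del_pos k c Hk); assert (q := Del_le_1 k c Hk).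
    assert (1 <= / Del k c).
    { rewrite <- Rinv_1; now apply Rinv_le_contravar. }
    nra.
Qed.

Lemma ellF_lt k x y : 0 < k < 1 -> x < y -> ellF x k < ellF y k.
Proof. intros Hk H; assert (h := ellF_expanding k x y Hk H); lra. Qed.

Lemma ellF_lt_iff k x y : 0 < k < 1 -> ellF x k < ellF y k <-> x < y.
Proof.
  intros Hk; split; [|now apply ellF_lt].
  intros H; destruct (Rtotal_order x y) as [L|[->|L]]; auto; [lra|].
  apply (ellF_lt k) in L; auto; lra.
Qed.

Lemma ellF_inj k x y : 0 < k < 1 -> ellF x k = ellF y k -> x = y.
Proof.
  intros Hk E; destruct (Rtotal_order x y) as [L|[L|L]]; auto;
    apply (ellF_lt k) in L; auto; lra.
Qed.

Lemma ellF_surj k u : 0 < k < 1 -> exists psi, ellF psi k = u.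
Proof.
  intros Hk.
  assert (H1 : Rabs u <= ellF (Rabs u + 1) k - 1).
  { assert (h := Rabs_pos u).
    assert (h' := ellF_expanding k 0 (Rabs u + 1) Hk ltac:(lra)).
    rewrite ellF_0 in h'; lra. }
  assert (H2 : ellF (- (Rabs u + 1)) k = - ellF (Rabs u + 1) k) by now apply ellF_odd.
  assert (H3 := Rle_abs u); assert (H4 := Rle_abs (- u)); rewrite Rabs_Ropp in H4.
  destruct (IVT_interv (fun x => ellF x k - u) (- (Rabs u + 1)) (Rabs u + 1))
    as (x & _ & E).
  - intros x _; apply continuity_pt_minus.
    + exact (derive_continuity_pt _ _ _ (ellF_derive k x Hk)).
    + apply continuity_pt_const; intros ? ?; reflexivity.
  - assert (h := Rabs_pos u); lra.
  - lra.
  - lra.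
  - exists x; lra.
Qed.

Lemma ellF_am k u : 0 < k < 1 -> ellF (am u k) k = u.
Proof. intros Hk; unfold am; apply epsilon_spec, ellF_surj, Hk. Qed.

Lemma am_ellF k psi : 0 < k < 1 -> am (ellF psi k) k = psi.
Proof. intros Hk; apply (ellF_inj k); auto; now apply ellF_am. Qed.

(** Since [ellF' = 1 / Del >= 1], the inverse cannot expand distances; this gives
    its continuity, which its differentiability presupposes. *)
Lemma am_nonexpanding k u v : 0 < k < 1 -> Rabs (am v k - am u k) <= Rabs (v - u).
Proof.
  intros Hk; rewrite <- (ellF_am k u), <- (ellF_am k v) at 2 by auto.
  destruct (Rtotal_order (am u k) (am v k)) as [L|[->|L]].
  - assert (h := ellF_expanding k _ _ Hk L); rewrite !Rabs_right; lra.
  - rewrite !Rminus_diag; lra.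
  - assert (h := ellF_expanding k _ _ Hk L); rewrite !Rabs_left; lra.
Qed.

Lemma am_derive k u : 0 < k < 1 ->
  is_derive (fun u => am u k) u (Del k (am u k)).
Proof.
  intros Hk.
  destruct (slope_of_derive _ _ _ (ellF_derive k (am u k) Hk)) as (s & Cs & Es & Hs).
  assert (Ca : continuous (fun u => am u k) u).
  { apply cont_R_eps; intros e He; exists e; split; auto; intros v Hv.
    eapply Rle_lt_trans; [now apply am_nonexpanding | exact Hv]. }
  assert (p := Del_pos k (am u k) Hk).
  apply derive_of_slope with (s := fun v => / s (am v k)).
  - apply (continuous_comp (fun v => s (am v k)) Rinv).
    + apply (continuous_comp (fun v => am v k) s); auto.
    + apply continuous_Rinv; rewrite Es; apply Rinv_neq_0_compat; lra.
  - rewrite Es; apply Rinv_inv.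
  - apply filter_forall; intros v.
    assert (E := Hs (am v k)); rewrite !ellF_am in E by auto.
    destruct (Req_dec v u) as [->|n]; [ring|].
    rewrite E; field; intros Z; rewrite Z in E; lra.
Qed.

Lemma derive_div_const (h : R -> R) k t l : is_derive h t l ->
  is_derive (fun s => h s / k) t (l / k).
Proof.
  intros H; auto_derive; [eexists; exact H|]; rewrite (Derive_eq h _ _ H).
  unfold Rdiv; ring.
Qed.

(** * Explicit trajectories *)

(** Here [a] is half the angle and [b] half the velocity of the pendulum. The
    momenta [(cos a + b) e^z] and [(cos a - b) e^(-z)] are first integrals; with
    [u = cos a + b] the first one gives [e^z = u0 / u], and the null coordinates
    [x + y] and [x - y], whose derivatives are [e^z cos a] and [e^(-z) cos a],
    become the quadratures [P] and [Q]. *)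
Lemma geo_quadrature (a b P Q : R -> R) :
  (forall t, is_derive a t (b t)) ->
  (forall t, is_derive b t (- (sin (a t) * cos (a t)))) ->
  (forall t, 0 < cos (a t) + b t) ->
  (forall t, is_derive P t (cos (a t) / (cos (a t) + b t))) ->
  (forall t, is_derive Q t (cos (a t) * (cos (a t) + b t))) ->
  P 0 = 0 -> Q 0 = 0 ->
  let u0 := cos (a 0) + b 0 in
  geo (ang (2 * a 0), 2 * b 0) (fun t => 2 * a t) (fun t => 2 * b t)
    (fun t => (u0 * P t + Q t / u0) / 2) (fun t => (u0 * P t - Q t / u0) / 2)
    (fun t => ln (u0 / (cos (a t) + b t))).
Proof.
  intros Da Db Hu DP DQ P0 Q0 u0.
  assert (H0 : 0 < u0) by apply Hu.
  assert (half : forall t, 2 * a t / 2 = a t) by (intros; field).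
  assert (Hr : forall t, 0 < u0 / (cos (a t) + b t)).
  { intros; apply Rdiv_lt_0_compat; auto. }
  assert (Hc : forall t, exp (ln (u0 / (cos (a t) + b t))) = u0 / (cos (a t) + b t)).
  { intros; now apply exp_ln. }
  assert (Hc' : forall t, exp (- ln (u0 / (cos (a t) + b t))) = (cos (a t) + b t) / u0).
  { intros t; rewrite exp_Ropp, Hc; field; specialize (Hu t); split; lra. }
  split; [reflexivity|].
  split; [|split; [|split; [|split; [|split]]]].
  - intros t; auto_derive; [eexists; apply Da|].
    rewrite (Derive_eq a _ _ (Da t)); ring.
  - intros t; rewrite sin_2a; auto_derive; [eexists; apply Db|].
    rewrite (Derive_eq b _ _ (Db t)); ring.
  - rewrite P0, Q0; fold u0; replace (u0 / u0) with 1 by (field; lra).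
    rewrite ln_1; split; [|split]; [field|field|reflexivity]; lra.
  - intros t; rewrite half; unfold cosh; rewrite Hc, Hc'.
    specialize (Hu t); auto_derive; [split; [|split]; auto; eexists; auto|].
    rewrite (Derive_eq P _ _ (DP t)), (Derive_eq Q _ _ (DQ t)); field; lra.
  - intros t; rewrite half; unfold sinh; rewrite Hc, Hc'.
    specialize (Hu t); auto_derive; [split; [|split]; auto; eexists; auto|].
    rewrite (Derive_eq P _ _ (DP t)), (Derive_eq Q _ _ (DQ t)); field; lra.
  - intros t; rewrite half; specialize (Hu t); specialize (Hr t).
    auto_derive.
    + repeat split; try (eexists; auto; fail); auto; try lra; exact Hr.
    + rewrite (Derive_eq a _ _ (Da t)), (Derive_eq b _ _ (Db t)); field; lra.
Qed.

(** The end of an arc both in the group and on the phase cylinder: the second is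
    needed because four of the reflections act on the final state. *)
Definition reach (l : Cyl) (t : R) (q : R3) (l' : Cyl) : Prop :=
  exists g c x y z, geo l g c x y z /\ q = (x t, y t, z t) /\ l' = (ang (g t), c t).

Lemma reach_Exp l t q l' : reach l t q l' -> Exp (l, t) = q /\ flow l t = l'.
Proof.
  intros (g & c & x & y & z & H & -> & ->); apply (geo_spec _ _ _ _ _ _ H).
Qed.

(** The vertical coordinate is [ln (u0 / u)]: it vanishes exactly when [u] has
    returned to its initial value. *)
Lemma reach_quadrature (a b P Q : R -> R) (t u : R) :
  (forall t, is_derive a t (b t)) ->
  (forall t, is_derive b t (- (sin (a t) * cos (a t)))) ->
  (forall t, 0 < cos (a t) + b t) ->
  (forall t, is_derive P t (cos (a t) / (cos (a t) + b t))) ->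
  (forall t, is_derive Q t (cos (a t) * (cos (a t) + b t))) ->
  P 0 = 0 -> Q 0 = 0 -> cos (a 0) + b 0 = u -> cos (a t) + b t = u ->
  reach (ang (2 * a 0), 2 * b 0) t
    ((u * P t + Q t / u) / 2, (u * P t - Q t / u) / 2, 0)
    (ang (2 * a t), 2 * b t).
Proof.
  intros Da Db Hu DP DQ P0 Q0 E0 Et.
  assert (G := geo_quadrature a b P Q Da Db Hu DP DQ P0 Q0); cbv zeta in G.
  rewrite E0 in G.
  do 5 eexists; split; [exact G|]; split; [|reflexivity]; cbn.
  rewrite Et; replace (u / u) with 1; [now rewrite ln_1|].
  field; specialize (Hu t); lra.
Qed.

Lemma Del_gt_kcos k psi : 0 < k < 1 -> Rabs (k * cos psi) < Del k psi.
Proof.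
  intros Hk; assert (h := Del_sq' k psi Hk); assert (p := Del_pos k psi Hk).
  apply Rabs_def1; nra.
Qed.

Lemma cos_asin_k k psi : 0 < k < 1 -> cos (asin (k * sin psi)) = Del k psi.
Proof.
  intros Hk; assert (h := SIN_bound psi).
  rewrite cos_asin by nra; unfold Del; f_equal; unfold Rsqr; ring.
Qed.

Lemma sin_asin_k k psi : 0 < k < 1 -> sin (asin (k * sin psi)) = k * sin psi.
Proof. intros Hk; assert (h := SIN_bound psi); apply sin_asin; nra. Qed.

Lemma is_derive_asin x : -1 < x < 1 -> is_derive asin x (/ sqrt (1 - x * x)).
Proof.
  intros Hx; apply is_derive_Reals.
  replace (/ sqrt (1 - x * x)) with (1 / sqrt (1 - x²)).
  - rewrite <- (derive_pt_asin x Hx); apply derive_pt_eq_1 with (derivable_pt_asin x Hx).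
    reflexivity.
  - unfold Rsqr; field; apply Rgt_not_eq, sqrt_lt_R0; nra.
Qed.

(** Oscillations, with the amplitude [psi] as parameter: [sin a = k sin psi],
    [cos a = Del k psi], [b = k cos psi]. With [I] the integral of [cos a ^ 2] one
    finds [Q = I + s], and [P = (I - s) / (1 - k ^ 2)] because
    [(cos a + b) (cos a - b)] is the constant [1 - k ^ 2]. *)
Lemma reach_C1 k psi0 psi1 : 0 < k < 1 ->
  Del k psi1 + k * cos psi1 = Del k psi0 + k * cos psi0 ->
  let I := ellEi psi1 k - ellEi psi0 k in
  let s := k * sin psi1 - k * sin psi0 in
  let u := Del k psi0 + k * cos psi0 in
  reach (ang (2 * asin (k * sin psi0)), 2 * (k * cos psi0)) (ellF psi1 k - ellF psi0 k)
    ((u * ((I - s) / (1 - k ^ 2)) + (I + s) / u) / 2,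
     (u * ((I - s) / (1 - k ^ 2)) - (I + s) / u) / 2, 0)
    (ang (2 * asin (k * sin psi1)), 2 * (k * cos psi1)).
Proof.
  intros Hk Eu I s u.
  set (f := fun t => am (t + ellF psi0 k) k).
  assert (f0 : f 0 = psi0) by (unfold f; now rewrite Rplus_0_l, am_ellF).
  set (t1 := ellF psi1 k - ellF psi0 k).
  assert (f1 : f t1 = psi1).
  { unfold f, t1; replace (_ - _ + _) with (ellF psi1 k) by ring; now apply am_ellF. }
  assert (Df : forall t, is_derive f t (Del k (f t))).
  { intros t; unfold f; assert (D := am_derive k (t + ellF psi0 k) Hk).
    auto_derive; [eexists; exact D|].
    rewrite (Derive_eq (fun u => am u k) _ _ D); ring. }
  assert (Dp : forall t, 0 < Del k (f t)) by (intros; now apply Del_pos).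
  assert (Dg : forall t, 0 < Del k (f t) + k * cos (f t)).
  { intros t; assert (h := Del_gt_kcos k (f t) Hk); apply Rabs_def2 in h; lra. }
  assert (Dh : 0 < 1 - k ^ 2) by nra.
  assert (R1 := reach_quadrature (fun t => asin (k * sin (f t))) (fun t => k * cos (f t))
    (fun t => ((ellEi (f t) k - ellEi psi0 k) - (k * sin (f t) - k * sin psi0)) / (1 - k ^ 2))
    (fun t => (ellEi (f t) k - ellEi psi0 k) + (k * sin (f t) - k * sin psi0)) t1 u).
  cbv beta in R1; rewrite f0, f1 in R1; apply R1; clear R1.
  - intros t; assert (h := SIN_bound (f t)).
    replace (k * cos (f t)) with ((k * (cos (f t) * Del k (f t))) * / sqrt (1 - k * sin (f t) * (k * sin (f t)))).
    + apply (@is_derive_comp R_AbsRing R_NormedModule asin (fun t => k * sin (f t))).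
      * apply is_derive_asin; nra.
      * auto_derive; [eexists; apply Df|].
        rewrite (Derive_eq f _ _ (Df t)); ring.
    + replace (sqrt _) with (Del k (f t)) by (unfold Del; f_equal; ring).
      field; specialize (Dp t); lra.
  - intros t; rewrite cos_asin_k, sin_asin_k by auto.
    auto_derive; [eexists; apply Df|]; rewrite (Derive_eq f _ _ (Df t)); ring.
  - intros t; rewrite cos_asin_k by auto; apply Dg.
  - intros t; rewrite cos_asin_k by auto.
    assert (De := ellEi_derive k (f t) Hk).
    assert (h := Del_sq' k (f t) Hk); specialize (Dg t).
    auto_derive.
    + repeat split; eexists; [exact De | apply Df..].
    + rewrite (Derive_eq f _ _ (Df t)), (Derive_eq (fun x => ellEi x k) _ _ De).
      apply Rmult_eq_reg_r with (1 - k ^ 2); [|lra].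
      apply Rmult_eq_reg_r with (Del k (f t) + k * cos (f t)); [|lra].
      transitivity (Del k (f t) * (Del k (f t) ^ 2 - k ^ 2 * cos (f t) ^ 2)).
      * field; lra.
      * rewrite h; field; lra.
  - intros t; rewrite cos_asin_k by auto.
    assert (De := ellEi_derive k (f t) Hk).
    auto_derive.
    + repeat split; eexists; [exact De | apply Df..].
    + rewrite (Derive_eq f _ _ (Df t)), (Derive_eq (fun x => ellEi x k) _ _ De); ring.
  - unfold Rdiv; ring.
  - ring.
  - rewrite cos_asin_k by auto; reflexivity.
  - rewrite cos_asin_k by auto; exact Eu.
Qed.

(** The incomplete form of [ella], equal to the integral of
    [k ^ 2 cos ^ 2 / Del]. *)
Definition ellq (psi k : R) : R := ellEi psi k - (1 - k ^ 2) * ellF psi k.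

Lemma ellq_derive k psi : 0 < k < 1 ->
  is_derive (fun x => ellq x k) psi (k ^ 2 * cos psi ^ 2 / Del k psi).
Proof.
  intros Hk; assert (p := Del_pos k psi Hk).
  replace (k ^ 2 * cos psi ^ 2 / Del k psi) with
    (Del k psi - (1 - k ^ 2) * / Del k psi).
  - apply (@is_derive_minus R_AbsRing R_NormedModule (fun x => ellEi x k)
      (fun x => (1 - k ^ 2) * ellF x k)); [now apply ellEi_derive|].
    apply is_derive_scal; now apply ellF_derive.
  - replace (k ^ 2 * cos psi ^ 2) with (Del k psi ^ 2 - (1 - k ^ 2)).
    + field; lra.
    + rewrite Del_sq' by auto; ring.
Qed.

(** Rotations: [a = psi] and [b = Del k psi / k]. The computation is that of
    [reach_C1], with the constant [(cos a + b) (cos a - b) = - (1 - k ^ 2) / k ^ 2]. *)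
Lemma reach_C2 k psi0 psi1 : 0 < k < 1 ->
  cos psi1 + Del k psi1 / k = cos psi0 + Del k psi0 / k ->
  let I := (ellq psi1 k - ellq psi0 k) / k in
  let s := sin psi1 - sin psi0 in
  let u := cos psi0 + Del k psi0 / k in
  reach (ang (2 * psi0), 2 * (Del k psi0 / k)) (k * (ellF psi1 k - ellF psi0 k))
    ((u * ((s - I) * (k ^ 2 / (1 - k ^ 2))) + (I + s) / u) / 2,
     (u * ((s - I) * (k ^ 2 / (1 - k ^ 2))) - (I + s) / u) / 2, 0)
    (ang (2 * psi1), 2 * (Del k psi1 / k)).
Proof.
  intros Hk Eu I s u.
  set (f := fun t => am (t / k + ellF psi0 k) k).
  assert (f0 : f 0 = psi0).
  { unfold f; replace (0 / k + ellF psi0 k) with (ellF psi0 k) by (field; lra).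
    now apply am_ellF. }
  set (t1 := k * (ellF psi1 k - ellF psi0 k)).
  assert (f1 : f t1 = psi1).
  { unfold f, t1; replace (_ / k + _) with (ellF psi1 k) by (field; lra).
    now apply am_ellF. }
  assert (Df : forall t, is_derive f t (Del k (f t) / k)).
  { intros t; unfold f; assert (D := am_derive k (t / k + ellF psi0 k) Hk).
    auto_derive; [eexists; exact D|].
    change (t * / k) with (t / k).
    rewrite (Derive_eq (fun u => am u k) _ _ D); field; lra. }
  assert (Dp : forall t, 0 < Del k (f t)) by (intros; now apply Del_pos).
  assert (Dg : forall t, 0 < cos (f t) + Del k (f t) / k).
  { intros t; assert (h := Del_gt_kcos k (f t) Hk); apply Rabs_def2 in h.
    apply Rmult_lt_reg_r with k; [lra|]; rewrite Rmult_0_l.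
    replace ((cos (f t) + Del k (f t) / k) * k) with (k * cos (f t) + Del k (f t))
      by (field; lra); lra. }
  assert (Dh : 0 < 1 - k ^ 2) by nra.
  assert (DD : forall t, is_derive (fun t => Del k (f t)) t
    (- (k * sin (f t) * cos (f t)))).
  { intros t; replace (- (k * sin (f t) * cos (f t))) with
      ((Del k (f t) / k) * (- (k ^ 2 * sin (f t) * cos (f t)) / Del k (f t))).
    - apply (@is_derive_comp R_AbsRing R_NormedModule (Del k) f); auto.
      now apply Del_derive.
    - field; specialize (Dp t); lra. }
  assert (R1 := reach_quadrature f (fun t => Del k (f t) / k)
    (fun t => ((sin (f t) - sin psi0) - (ellq (f t) k - ellq psi0 k) / k) * (k ^ 2 / (1 - k ^ 2)))
    (fun t => (ellq (f t) k - ellq psi0 k) / k + (sin (f t) - sin psi0)) t1 u).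
  cbv beta in R1; rewrite f0, f1 in R1; apply R1; clear R1.
  - exact Df.
  - intros t; replace (- (sin (f t) * cos (f t))) with
      (- (k * sin (f t) * cos (f t)) / k) by (field; lra).
    exact (derive_div_const (fun t => Del k (f t)) k t _ (DD t)).
  - exact Dg.
  - intros t; assert (De := ellq_derive k (f t) Hk).
    assert (h := Del_sq' k (f t) Hk); specialize (Dg t).
    auto_derive.
    + repeat split; eexists; try exact De; apply Df.
    + rewrite (Derive_eq f _ _ (Df t)), (Derive_eq (fun x => ellq x k) _ _ De).
      apply Rmult_eq_reg_r with (1 - k ^ 2); [|lra].
      apply Rmult_eq_reg_r with (cos (f t) + Del k (f t) / k); [|lra].
      transitivity (cos (f t) * (Del k (f t) ^ 2 - k ^ 2 * cos (f t) ^ 2)).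
      * field; specialize (Dp t); repeat split; nra.
      * rewrite h; set (w := cos (f t) + Del k (f t) / k) in *; clearbody w; field; lra.
  - intros t; assert (De := ellq_derive k (f t) Hk); specialize (Dp t).
    auto_derive.
    + repeat split; eexists; try exact De; apply Df.
    + rewrite (Derive_eq f _ _ (Df t)), (Derive_eq (fun x => ellq x k) _ _ De).
      field; lra.
  - unfold Rdiv; ring.
  - unfold Rdiv; ring.
  - reflexivity.
  - exact Eu.
Qed.

Lemma cosh_pos x : 0 < cosh x.
Proof. unfold cosh; assert (h := exp_pos x); assert (h' := exp_pos (- x)); lra. Qed.

Lemma cosh_sq x : cosh x ^ 2 = 1 + sinh x ^ 2.
Proof.
  assert (E : exp x * exp (- x) = 1) by (rewrite <- exp_plus, Rplus_opp_r; apply exp_0).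
  unfold cosh, sinh; nra.
Qed.

Lemma cos_atan_sinh x : cos (atan (sinh x)) = / cosh x.
Proof.
  rewrite cos_atan; replace (1 + (sinh x)²) with (cosh x ^ 2).
  - rewrite sqrt_pow2 by (apply Rlt_le, cosh_pos); field.
    apply Rgt_not_eq, cosh_pos.
  - rewrite cosh_sq; unfold Rsqr; ring.
Qed.

Lemma sin_atan_sinh x : sin (atan (sinh x)) = tanh x.
Proof.
  rewrite sin_atan; replace (1 + (sinh x)²) with (cosh x ^ 2).
  - rewrite sqrt_pow2 by (apply Rlt_le, cosh_pos); reflexivity.
  - rewrite cosh_sq; unfold Rsqr; ring.
Qed.

Lemma is_derive_sinh x : is_derive sinh x (cosh x).
Proof. unfold sinh, cosh; auto_derive; auto; field. Qed.

Lemma is_derive_cosh x : is_derive cosh x (sinh x).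
Proof. unfold sinh, cosh; auto_derive; auto; field. Qed.

Lemma cosh_neg x : cosh (- x) = cosh x.
Proof. unfold cosh; rewrite Ropp_involutive; field. Qed.

Lemma sinh_neg x : sinh (- x) = - sinh x.
Proof. unfold sinh; rewrite Ropp_involutive; field. Qed.

(** The separatrix: [cos a = b = 1 / cosh], so that [u = 2 / cosh] and the
    integrands of [P] and [Q] become [1 / 2] and [2 / cosh ^ 2]. *)
Lemma reach_C3 p :
  reach (ang (2 * atan (sinh (- p))), 2 * / cosh p) (2 * p)
    (p / cosh p + sinh p, p / cosh p - sinh p, 0)
    (ang (2 * atan (sinh p)), 2 * / cosh p).
Proof.
  assert (cp := cosh_pos).
  assert (cnz : forall t, cosh t <> 0) by (intros; apply Rgt_not_eq, cp).
  assert (Da : forall t, is_derive (fun s => s - p) t 1).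
  { intros t; auto_derive; auto; ring. }
  assert (Dc : forall t, is_derive (fun s => cosh (s - p)) t (sinh (t - p))).
  { intros t; rewrite <- (Rmult_1_l (sinh _)).
    apply (@is_derive_comp R_AbsRing R_NormedModule cosh (fun s => s - p)); auto.
    apply is_derive_cosh. }
  assert (Ds : forall t, is_derive (fun s => sinh (s - p)) t (cosh (t - p))).
  { intros t; rewrite <- (Rmult_1_l (cosh _)).
    apply (@is_derive_comp R_AbsRing R_NormedModule sinh (fun s => s - p)); auto.
    apply is_derive_sinh. }
  assert (R1 := reach_quadrature (fun t => atan (sinh (t - p))) (fun t => / cosh (t - p))
    (fun t => t / 2) (fun t => 2 * (sinh (t - p) / cosh (t - p) + sinh p / cosh p))
    (2 * p) (2 / cosh p)).
  cbv beta in R1; rewrite Rminus_0_l in R1.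
  replace (2 * p - p) with p in R1 by ring.
  replace ((p / cosh p + sinh p, p / cosh p - sinh p, 0) : R3) with
   ((2 / cosh p * (2 * p / 2) +
        2 * (sinh p / cosh p + sinh p / cosh p) / (2 / cosh p)) / 2,
       (2 / cosh p * (2 * p / 2) -
        2 * (sinh p / cosh p + sinh p / cosh p) / (2 / cosh p)) / 2, 0).
  2:{ f_equal; f_equal; field; apply cnz. }
  rewrite (cosh_neg p) in R1; apply R1; clear R1.
  - intros t; replace (/ cosh (t - p)) with
      (cosh (t - p) * / (1 + (sinh (t - p))²)).
    + apply (@is_derive_comp R_AbsRing R_NormedModule atan (fun s => sinh (s - p))); auto.
      apply is_derive_atan.
    + replace (1 + (sinh (t - p))²) with (cosh (t - p) ^ 2).
      * field; auto.
      * rewrite cosh_sq; unfold Rsqr; ring.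
  - intros t; rewrite cos_atan_sinh, sin_atan_sinh; unfold tanh.
    replace (- (sinh (t - p) / cosh (t - p) * / cosh (t - p))) with
      (- sinh (t - p) / cosh (t - p) ^ 2) by (field; auto).
    now apply (is_derive_inv (fun s => cosh (s - p))).
  - intros t; rewrite cos_atan_sinh.
    assert (h := Rinv_0_lt_compat _ (cp (t - p))); lra.
  - intros t; rewrite cos_atan_sinh; auto_derive; auto; field; auto.
  - intros t; rewrite cos_atan_sinh.
    replace (/ cosh (t - p) * (/ cosh (t - p) + / cosh (t - p))) with
      (2 * ((cosh (t - p) * cosh (t - p) - sinh (t - p) * sinh (t - p)) /
         cosh (t - p) ^ 2 + 0)).
    + apply is_derive_scal.
      apply (@is_derive_plus R_AbsRing R_NormedModule
        (fun t => sinh (t - p) / cosh (t - p)) (fun _ => sinh p / cosh p)).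
      * apply (is_derive_div (fun t => sinh (t - p)) (fun t => cosh (t - p))); auto.
      * apply (@is_derive_const R_AbsRing R_NormedModule).
    + replace (cosh (t - p) * cosh (t - p) - sinh (t - p) * sinh (t - p)) with 1.
      * field; auto.
      * assert (h := cosh_sq (t - p)); simpl in h; lra.
  - field.
  - rewrite sinh_neg; field; auto.
  - rewrite cos_atan_sinh, cosh_neg; field; auto.
  - rewrite cos_atan_sinh; field; auto.
Qed.

Lemma reach_C4 t : reach (ang 0, 0) t (t, 0, 0) (ang 0, 0).
Proof.
  assert (R1 := reach_quadrature (fun _ => 0) (fun _ => 0) (fun t => t) (fun t => t) t 1).
  cbv beta in R1; rewrite !Rmult_0_r in R1.
  replace ((1 * t + t / 1) / 2) with t in R1 by field.
  replace ((1 * t - t / 1) / 2) with 0 in R1 by field.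
  rewrite sin_0, cos_0 in R1; apply R1; try ring; intros s.
  - apply (@is_derive_const R_AbsRing R_NormedModule).
  - replace (- (0 * 1)) with 0 by ring; apply (@is_derive_const R_AbsRing R_NormedModule).
  - lra.
  - replace (1 / (1 + 0)) with 1 by field; apply (@is_derive_id R_AbsRing).
  - replace (1 * (1 + 0)) with 1 by ring; apply (@is_derive_id R_AbsRing).
Qed.

(** * Momentum coordinates on the base sets *)

Lemma ang_half g g' : cos (g / 2) = cos (g' / 2) -> sin (g / 2) = sin (g' / 2) ->
  ang g = ang g'.
Proof.
  intros Ec Es.
  set (d := g / 2 - g' / 2).
  assert (Cd : cos d = 1).
  { unfold d; rewrite cos_minus, Ec, Es; assert (h := sin2_cos2' (g' / 2)); lra. }
  assert (Sd : sin (d / 2) = 0).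
  { replace d with (2 * (d / 2)) in Cd by field; rewrite cos_2a_sin in Cd; nra. }
  destruct (sin_eq_0_0 _ Sd) as [n Hn].
  rewrite <- (ang_eq g' n); f_equal.
  replace (4 * PI * IZR n) with (4 * (IZR n * PI)) by ring.
  rewrite <- Hn; unfold d; field.
Qed.

Lemma cos_gam_half g c : cos (gam (ang g, c) / 2) = cos (g / 2) /\
  sin (gam (ang g, c) / 2) = sin (g / 2) /\ cos (gam (ang g, c)) = cos g.
Proof.
  destruct (gam_ang g c) as [n ->].
  replace ((g + 4 * PI * IZR n) / 2) with (g / 2 + 2 * PI * IZR n) by field.
  rewrite cos_period_Z, sin_period_Z; repeat split.
  replace (g + 4 * PI * IZR n) with (g + 2 * PI * IZR (2 * n)).
  - apply cos_period_Z.
  - rewrite mult_IZR; ring.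
Qed.

Lemma Cyl_eta (l : Cyl) g c : ang (gam l) = ang g -> mom l = c -> l = (ang g, c).
Proof.
  destruct l as [a m]; unfold gam, mom; cbn; intros E ->; rewrite <- E.
  now rewrite ang_rep.
Qed.

Lemma sqrt_lt_one x : 0 <= x < 1 -> sqrt x < 1.
Proof. intros H; apply sqrt_lt_1_alt in H; now rewrite sqrt_1 in H. Qed.

Definition C1_state (k psi : R) : Cyl :=
  (ang (2 * asin (k * sin psi)), 2 * (k * cos psi)).
Definition C2_state (k psi : R) : Cyl := (ang (2 * psi), 2 * (Del k psi / k)).
Definition C3_state (w : R) : Cyl := (ang (2 * atan (sinh w)), 2 * / cosh w).

Lemma half_2 a : 2 * a / 2 = a.
Proof. field. Qed.

Lemma energy_half l : energy l = mom l ^ 2 / 2 - 1 + 2 * sin (gam l / 2) ^ 2.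
Proof.
  unfold energy; replace (gam l) with (2 * (gam l / 2)) at 1 by field.
  rewrite cos_2a_sin; ring.
Qed.

(** The elliptic coordinate [phi] is replaced by the amplitude [psi], with
    [phi = ellF psi k]; the modulus is then read off the state itself, which makes
    the conditions on the energy automatic. *)
Lemma on_C1_0_iff (Pd : R -> R -> R -> Prop) l t : on_C1_0 Pd (l, t) <->
  0 < t /\ exists psi k, 0 < k < 1 /\ l = C1_state k psi /\
    Pd k (t / 2) (ellF psi k + t / 2).
Proof.
  split.
  - intros (Ht & [[H1 H2] Hc] & phi & k & (Ek & Es & Ec & Em) & HP).
    split; [exact Ht|]; exists (am phi k), k.
    assert (Hk : 0 < k < 1).
    { rewrite Ek; split; [apply sqrt_lt_R0; lra|].
      apply sqrt_lt_one; lra. }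
    rewrite ellF_am by auto.
    split; [exact Hk|]; split; [|exact HP].
    apply Cyl_eta; [|unfold cn in Em; lra].
    apply ang_half; rewrite half_2.
    + rewrite cos_asin_k by auto; exact Ec.
    + rewrite sin_asin_k by auto; exact Es.
  - intros (Ht & psi & k & Hk & -> & HP); split; [exact Ht|].
    set (l := C1_state k psi).
    destruct (cos_gam_half (2 * asin (k * sin psi)) (2 * (k * cos psi))) as (Ec & Es & _).
    fold (C1_state k psi) in Ec, Es; fold l in Ec, Es.
    rewrite half_2 in Ec, Es; rewrite cos_asin_k in Ec by auto;
      rewrite sin_asin_k in Es by auto.
    assert (Ee : energy l = 2 * k ^ 2 - 1).
    { rewrite energy_half, Es; unfold l, C1_state, mom; cbn [snd].
      transitivity (2 * k ^ 2 * (sin psi ^ 2 + cos psi ^ 2) - 1); [field|].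
      rewrite sin2_cos2'; ring. }
    split.
    + split; [unfold C1; rewrite Ee; nra | rewrite Ec; now apply Del_pos].
    + exists (ellF psi k), k; split; [|exact HP].
      repeat split.
      * rewrite Ee; replace ((2 * k ^ 2 - 1 + 1) / 2) with (k ^ 2) by field.
        rewrite sqrt_pow2; lra.
      * unfold sn; now rewrite am_ellF.
      * unfold dn, sn; now rewrite am_ellF.
      * unfold cn; rewrite am_ellF by auto; unfold l, C1_state, mom; cbn [snd]; field.
Qed.

Lemma on_C2_plus_iff (Pd : R -> R -> R -> Prop) l t : on_C2_plus Pd (l, t) <->
  0 < t /\ exists psi k, 0 < k < 1 /\ l = C2_state k psi /\
    Pd k (t / (2 * k)) ((k * ellF psi k + t / 2) / k).
Proof.
  split.
  - intros (Ht & [H1 H2] & phi & k & (Ek & Es & Ec & Em) & HP).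
    split; [exact Ht|]; exists (am (phi / k) k), k.
    unfold C2 in H1.
    assert (Hq : 0 < 2 / (energy l + 1) < 1).
    { split; [apply Rdiv_lt_0_compat; lra|].
      apply Rmult_lt_reg_r with (energy l + 1); [lra|]; field_simplify; lra. }
    assert (Hk : 0 < k < 1).
    { rewrite Ek; split; [apply sqrt_lt_R0; lra|].
      apply sqrt_lt_one; lra. }
    rewrite ellF_am by auto.
    replace (k * (phi / k)) with phi by (field; lra).
    split; [exact Hk|]; split; [|exact HP].
    apply Cyl_eta.
    + apply ang_half; rewrite half_2; [exact Ec | exact Es].
    + unfold dn, sn in Em; fold (Del k (am (phi / k) k)) in Em.
      replace (mom l) with (2 * (mom l / 2)) by field; rewrite Em; field; lra.
  - intros (Ht & psi & k & Hk & -> & HP); split; [exact Ht|].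
    set (l := C2_state k psi).
    destruct (cos_gam_half (2 * psi) (2 * (Del k psi / k))) as (Ec & Es & _).
    fold (C2_state k psi) in Ec, Es; fold l in Ec, Es; rewrite half_2 in Ec, Es.
    assert (Ee : energy l = 2 / k ^ 2 - 1).
    { rewrite energy_half, Es; unfold l, C2_state, mom; cbn [snd].
      replace ((2 * (Del k psi / k)) ^ 2) with (4 * Del k psi ^ 2 / k ^ 2) by (field; lra).
      rewrite Del_sq by auto; field; lra. }
    assert (Hq : 1 < / k ^ 2).
    { rewrite <- Rinv_1; apply Rinv_lt_contravar; nra. }
    assert (Dp := Del_pos k psi Hk).
    split.
    + split; [unfold C2; rewrite Ee; unfold Rdiv; lra|].
      unfold l, C2_state, mom; cbn [snd].
      assert (0 < Del k psi / k) by (apply Rdiv_lt_0_compat; lra); lra.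
    + exists (k * ellF psi k), k; split; [|exact HP].
      replace (k * ellF psi k / k) with (ellF psi k) by (field; lra).
      unfold coords_C2_plus.
      replace (k * ellF psi k / k) with (ellF psi k) by (field; lra).
      repeat split.
      * rewrite Ee; replace (2 / (2 / k ^ 2 - 1 + 1)) with (k ^ 2) by (field; lra).
        rewrite sqrt_pow2; lra.
      * unfold sn; now rewrite am_ellF.
      * unfold cn; now rewrite am_ellF.
      * unfold dn, sn; rewrite am_ellF by auto; unfold l, C2_state, mom; cbn [snd].
        unfold Del; field; lra.
Qed.

Lemma on_C3_0plus_iff (Pd : R -> R -> Prop) l t : on_C3_0plus Pd (l, t) <->
  0 < t /\ exists w, l = C3_state w /\ Pd (t / 2) (w + t / 2).
Proof.
  split.
  - intros (Ht & _ & w & (Es & Ec & Em) & HP).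
    split; [exact Ht|]; exists w; split; [|exact HP].
    apply Cyl_eta; [|lra].
    apply ang_half; rewrite half_2.
    + now rewrite cos_atan_sinh.
    + now rewrite sin_atan_sinh.
  - intros (Ht & w & -> & HP); split; [exact Ht|].
    set (l := C3_state w).
    destruct (cos_gam_half (2 * atan (sinh w)) (2 * / cosh w)) as (Ec & Es & _).
    fold (C3_state w) in Ec, Es; fold l in Ec, Es; rewrite half_2 in Ec, Es.
    rewrite cos_atan_sinh in Ec; rewrite sin_atan_sinh in Es.
    assert (cp := cosh_pos w); assert (ip := Rinv_0_lt_compat _ cp).
    split.
    + split; [split|].
      * rewrite energy_half, Es; unfold l, C3_state, mom, tanh; cbn [snd].
        assert (h := cosh_sq w).
        replace ((2 * / cosh w) ^ 2 / 2 - 1 + 2 * (sinh w / cosh w) ^ 2) with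
          ((2 + 2 * sinh w ^ 2) / cosh w ^ 2 - 1) by (field; lra).
        replace (2 + 2 * sinh w ^ 2) with (2 * cosh w ^ 2) by lra; field; lra.
      * unfold l, C3_state, mom; cbn [snd]; lra.
      * split; [rewrite Ec; exact ip | unfold l, C3_state, mom; cbn [snd]; lra].
    + exists w; split; [|exact HP]; repeat split; auto.
      unfold l, C3_state, mom; cbn [snd]; lra.
Qed.

(** The states with [sin (gamma / 2) <= 0], which contain all the base sets, in
    terms of the momenta [C = cos (gamma / 2)] and [b = c / 2]. *)
Definition state_of (C b : R) : Cyl := (ang (- (2 * acos C)), 2 * b).

Lemma half_neg_2 a : - (2 * a) / 2 = - a.
Proof. field. Qed.

Lemma state_of_half g c C b : -1 <= C <= 1 -> cos (g / 2) = C -> sin (g / 2) <= 0 ->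
  c = 2 * b -> (ang g, c) = state_of C b.
Proof.
  intros HC Ec Es ->; unfold state_of; f_equal; apply ang_half; rewrite half_neg_2.
  - now rewrite cos_neg, cos_acos.
  - rewrite sin_neg, sin_acos by auto; unfold Rsqr.
    assert (h := sin2_cos2' (g / 2)); rewrite Ec in h.
    replace (1 - C * C) with ((- sin (g / 2)) ^ 2) by nra.
    rewrite sqrt_pow2; lra.
Qed.

Lemma state_of_eq g c C b : -1 <= C <= 1 -> (ang g, c) = state_of C b ->
  cos (g / 2) = C /\ sin (g / 2) = - sqrt (1 - C * C) /\ c = 2 * b.
Proof.
  intros HC E; unfold state_of in E; injection E; intros Ecc Ea; split; [|split; auto].
  - assert (H := cos_gam_half g c); assert (K := cos_gam_half (- (2 * acos C)) (2 * b)).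
    rewrite E in H; unfold state_of in H.
    destruct H as (H & _), K as (K & _); rewrite <- H, K, half_neg_2.
    now rewrite cos_neg, cos_acos.
  - assert (H := cos_gam_half g c); assert (K := cos_gam_half (- (2 * acos C)) (2 * b)).
    rewrite E in H; unfold state_of in H.
    destruct H as (_ & H & _), K as (_ & K & _); rewrite <- H, K, half_neg_2.
    rewrite sin_neg, sin_acos by auto; reflexivity.
Qed.

Lemma C1_state_of k psi : 0 < k < 1 -> sin psi <= 0 ->
  C1_state k psi = state_of (Del k psi) (k * cos psi).
Proof.
  intros Hk Hs; assert (p := Del_pos k psi Hk); assert (q := Del_le_1 k psi Hk).
  apply state_of_half; [lra| | |reflexivity]; rewrite half_2.
  - now apply cos_asin_k.
  - rewrite sin_asin_k by auto; nra.
Qed.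

Lemma C2_state_of k psi : 0 < k < 1 -> sin psi <= 0 ->
  C2_state k psi = state_of (cos psi) (Del k psi / k).
Proof.
  intros Hk Hs; apply state_of_half; [apply COS_bound| | |reflexivity]; now rewrite half_2.
Qed.

Lemma sinh_lt_0 w : w < 0 -> sinh w < 0.
Proof.
  intros H; unfold sinh; assert (h := exp_increasing w (- w) ltac:(lra)); lra.
Qed.

Lemma C3_state_of w : w <= 0 -> C3_state w = state_of (/ cosh w) (/ cosh w).
Proof.
  intros Hw; assert (cp := cosh_pos w); assert (ip := Rinv_0_lt_compat _ cp).
  assert (cs := cosh_sq w); assert (s2 := pow2_ge_0 (sinh w)).
  assert (1 <= cosh w) by nra.
  assert (/ cosh w <= 1) by (rewrite <- Rinv_1; apply Rinv_le_contravar; lra).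
  apply state_of_half; [lra| | |reflexivity]; rewrite half_2.
  - apply cos_atan_sinh.
  - rewrite sin_atan_sinh; unfold tanh.
    destruct Hw as [Hw| ->].
    + apply sinh_lt_0 in Hw; apply Rlt_le, Rmult_neg_pos; auto.
    + unfold sinh; rewrite Ropp_0; replace (exp 0 - exp 0) with 0 by ring; unfold Rdiv; lra.
Qed.

(** Over a period [s = 0], and the factors [u] and [1 / u] combine into
    [u + (1 - k ^ 2) / u = 2 Del] and [u - (1 - k ^ 2) / u = 2 k cos]: the end point
    is a multiple of the momentum vector. *)
Lemma reach_period_C1 k psi : 0 < k < 1 ->
  reach (C1_state k psi) (4 * ellK k)
    (4 * ellE k * Del k psi / (1 - k ^ 2), 4 * ellE k * (k * cos psi) / (1 - k ^ 2), 0)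
    (C1_state k psi).
Proof.
  intros Hk.
  assert (E2 : psi + 2 * PI = psi + PI + PI) by ring.
  assert (EF : ellF (psi + 2 * PI) k = ellF psi k + 4 * ellK k).
  { rewrite E2, !ellF_period by auto; ring. }
  assert (EE : ellEi (psi + 2 * PI) k = ellEi psi k + 4 * ellE k).
  { rewrite E2, !ellEi_period by auto; ring. }
  assert (ES : sin (psi + 2 * PI) = sin psi).
  { rewrite E2, !neg_sin; ring. }
  assert (EC : cos (psi + 2 * PI) = cos psi).
  { rewrite E2, !neg_cos; ring. }
  assert (ED : Del k (psi + 2 * PI) = Del k psi).
  { now rewrite E2, !Del_period. }
  assert (R1 := reach_C1 k psi (psi + 2 * PI) Hk).
  cbv zeta in R1; rewrite EF, EE, ES, EC, ED in R1; specialize (R1 eq_refl).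
  assert (h := Del_gt_kcos k psi Hk); apply Rabs_def2 in h.
  assert (h' := Del_sq' k psi Hk).
  assert (hk : 0 < 1 - k ^ 2) by nra.
  replace (ellF psi k + 4 * ellK k - ellF psi k) with (4 * ellK k) in R1 by ring.
  unfold C1_state.
  match goal with |- reach _ _ ?q _ => match type of R1 with reach _ _ ?q' _ =>
    replace q with q'; [exact R1|] end end.
  set (D := Del k psi) in *; set (c := cos psi) in *; set (E := ellE k).
  assert (EI : / (D + k * c) = (D - k * c) / (1 - k ^ 2)).
  { apply Rmult_eq_reg_l with (D + k * c); [|lra].
    transitivity ((D ^ 2 - k ^ 2 * c ^ 2) / (1 - k ^ 2)); [|field; lra].
    rewrite h'; field; lra. }
  unfold Rdiv at 3 6; rewrite !EI; f_equal; f_equal; field; lra.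
Qed.

Lemma reach_period_C2 k psi : 0 < k < 1 ->
  reach (C2_state k psi) (4 * k * ellK k)
    (- (4 * k * ella k * cos psi / (1 - k ^ 2)), - (4 * ella k * Del k psi / (1 - k ^ 2)), 0)
    (C2_state k psi).
Proof.
  intros Hk.
  assert (E2 : psi + 2 * PI = psi + PI + PI) by ring.
  assert (EF : ellF (psi + 2 * PI) k = ellF psi k + 4 * ellK k).
  { rewrite E2, !ellF_period by auto; ring. }
  assert (EE : ellq (psi + 2 * PI) k = ellq psi k + 4 * ella k).
  { unfold ellq, ella; rewrite E2, !ellEi_period, !ellF_period by auto; ring. }
  assert (ES : sin (psi + 2 * PI) = sin psi).
  { rewrite E2, !neg_sin; ring. }
  assert (EC : cos (psi + 2 * PI) = cos psi).
  { rewrite E2, !neg_cos; ring. }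
  assert (ED : Del k (psi + 2 * PI) = Del k psi).
  { now rewrite E2, !Del_period. }
  assert (EA : ang (2 * (psi + 2 * PI)) = ang (2 * psi)).
  { rewrite <- (ang_eq (2 * psi) 1); f_equal; simpl; ring. }
  assert (R1 := reach_C2 k psi (psi + 2 * PI) Hk).
  cbv zeta in R1; rewrite EF, EE, ES, EC, ED, EA in R1; specialize (R1 eq_refl).
  assert (h := Del_gt_kcos k psi Hk); apply Rabs_def2 in h.
  assert (h' := Del_sq' k psi Hk).
  assert (hk : 0 < 1 - k ^ 2) by nra.
  replace (k * (ellF psi k + 4 * ellK k - ellF psi k)) with (4 * k * ellK k) in R1 by ring.
  unfold C2_state.
  match goal with |- reach _ _ ?q _ => match type of R1 with reach _ _ ?q' _ =>
    replace q with q'; [exact R1|] end end.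
  set (D := Del k psi) in *; set (c := cos psi) in *; set (A := ella k).
  assert (EI : / (c + D / k) = (D / k - c) * (k ^ 2 / (1 - k ^ 2))).
  { apply Rmult_eq_reg_l with (c + D / k).
    - transitivity ((D ^ 2 - k ^ 2 * c ^ 2) / (1 - k ^ 2)); [|field; lra].
      rewrite h'; field; split; lra.
    - apply Rgt_not_eq; apply Rmult_lt_reg_r with k; [lra|].
      replace ((c + D / k) * k) with (D + k * c) by (field; lra); lra. }
  set (u := c + D / k) in *.
  replace ((ellq psi k + 4 * A - ellq psi k) / k) with (4 * A / k) by (field; lra).
  unfold Rdiv; rewrite !EI; unfold u; f_equal; f_equal; field; lra.
Qed.

(** * Diffeomorphisms in momentum coordinates *)

Lemma cinf_comp (U V : R3 -> Prop) f g1 g2 g3 :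
  open V -> (forall v, U v -> V (g1 v, g2 v, g3 v)) ->
  cinf V f -> cinf U g1 -> cinf U g2 -> cinf U g3 ->
  cinf U (fun v => f (g1 v, g2 v, g3 v)).
Proof. intros OV HU Hf H1 H2 H3 n; now apply (sc_comp n U V). Qed.

Lemma cinf_const U c : cinf U (fun _ => c). Proof. intros n; apply sc_const. Qed.
Lemma cinf_px U : cinf U px. Proof. intros n; apply sc_px. Qed.
Lemma cinf_py U : cinf U py. Proof. intros n; apply sc_py. Qed.
Lemma cinf_plus U f g : cinf U f -> cinf U g -> cinf U (fun v => f v + g v).
Proof. intros Hf Hg n; now apply sc_plus. Qed.
Lemma cinf_minus U f g : cinf U f -> cinf U g -> cinf U (fun v => f v - g v).
Proof. intros Hf Hg n; now apply sc_minus. Qed.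
Lemma cinf_opp U f : cinf U f -> cinf U (fun v => - f v).
Proof. intros Hf n; now apply sc_opp. Qed.
Lemma cinf_mult U f g : cinf U f -> cinf U g -> cinf U (fun v => f v * g v).
Proof. intros Hf Hg n; now apply sc_mult. Qed.
Lemma cinf_sq U f : cinf U f -> cinf U (fun v => f v ^ 2).
Proof.
  intros Hf; change (cinf U (fun v => f v * (f v * 1))).
  apply cinf_mult, cinf_mult; auto; apply cinf_const.
Qed.
Lemma cinf_inv U f : (forall v, U v -> f v <> 0) -> cinf U f -> cinf U (fun v => / f v).
Proof. intros H Hf n; now apply sc_inv. Qed.
Lemma cinf_div U f g : (forall v, U v -> g v <> 0) -> cinf U f -> cinf U g ->
  cinf U (fun v => f v / g v).
Proof. intros H Hf Hg n; now apply sc_div. Qed.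
Lemma cinf_sqrt U f : (forall v, U v -> 0 < f v) -> cinf U f ->
  cinf U (fun v => sqrt (f v)).
Proof. intros H Hf n; now apply sc_sqrt. Qed.
Lemma cinf_acos U f : (forall v, U v -> -1 < f v < 1) -> cinf U f ->
  cinf U (fun v => acos (f v)).
Proof. intros H Hf n; now apply sc_acos. Qed.
Lemma cinf_sin U f : cinf U f -> cinf U (fun v => sin (f v)).
Proof. intros Hf n; now apply sc_trig. Qed.
Lemma cinf_cos U f : cinf U f -> cinf U (fun v => cos (f v)).
Proof. intros Hf n; now apply sc_trig. Qed.
Lemma cinf_mono (U V : R3 -> Prop) f :
  (forall v, V v -> U v) -> cinf U f -> cinf V f.
Proof. intros H Hf n; now apply (sc_mono n U V). Qed.
Lemma cinf_ext (U : R3 -> Prop) f g : open U -> (forall v, U v -> f v = g v) ->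
  cinf U f -> cinf U g.
Proof. intros OU E Hf n; now apply (sc_ext n U f g). Qed.
Lemma cinf_continuous U f : cinf U f -> forall v, U v -> continuous f v.
Proof. intros H; apply (sc_cont 0), H. Qed.

Lemma open_gt (f g : R3 -> R) (V : R3 -> Prop) : open V ->
  (forall v, V v -> continuous f v) -> (forall v, V v -> continuous g v) ->
  open (fun v => V v /\ f v < g v).
Proof.
  intros OV Cf Cg v [Vv H]; apply filter_and; [exact (OV v Vv)|].
  set (e := (g v - f v) / 2); assert (He : 0 < e) by (unfold e; lra).
  destruct (proj1 (cont_box _ _) (Cf v Vv) e He) as (d & Hd & Hf).
  destruct (proj1 (cont_box _ _) (Cg v Vv) e He) as (d' & Hd' & Hg).
  apply locally_box; exists (Rmin d d'); split; [now apply Rmin_glb_lt|].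
  intros w Hw.
  assert (A := Hf w (box_mono _ _ _ _ (Rmin_l d d') Hw)).
  assert (B := Hg w (box_mono _ _ _ _ (Rmin_r d d') Hw)).
  apply Rabs_def2 in A; apply Rabs_def2 in B; unfold e in *; lra.
Qed.

Lemma open_lt_cinf (f g : R3 -> R) : cinf (fun _ => True) f -> cinf (fun _ => True) g ->
  open (fun v => f v < g v).
Proof.
  intros Hf Hg v Hv.
  assert (H := open_gt f g (fun _ => True) open_true
    (cinf_continuous _ _ Hf) (cinf_continuous _ _ Hg) v (conj I Hv)).
  revert H; apply filter_imp; tauto.
Qed.

(** A criterion in the coordinates [(C, b)]: the angle is recovered as
    [- 2 acos C], which is smooth only for [|C| < 1]. The smoothness conditions
    are therefore local extensions along [D] and along [B], so that the sets lying
    on [C = 1] or [C = -1] are covered as well, with a constant angle. *)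
Lemma diffeo_base (A : N -> Prop) (B : R3 -> Prop) (D : R -> R -> Prop)
    (T X Y : R -> R -> R) (Cq bq : R3 -> R) :
  (forall l t, A (l, t) <-> exists C b, D C b /\ l = state_of C b /\ t = T C b) ->
  (forall C b, D C b -> -1 <= C <= 1) ->
  (forall C b, D C b -> Exp (state_of C b, T C b) = (X C b, Y C b, 0)) ->
  (forall C b, D C b -> B (X C b, Y C b, 0) /\ Cq (X C b, Y C b, 0) = C /\
     bq (X C b, Y C b, 0) = b) ->
  (forall q, B q -> D (Cq q) (bq q) /\ (X (Cq q) (bq q), Y (Cq q) (bq q), 0) = q) ->
  (forall C b, D C b -> exists (W : R3 -> Prop) f g, open W /\ W (C, b, 0) /\
     cinf W f /\ cinf W g /\ forall C' b', W (C', b', 0) -> D C' b' ->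
       f (C', b', 0) = X C' b' /\ g (C', b', 0) = Y C' b') ->
  (forall q, B q -> exists (W : R3 -> Prop) G1 G2 G3, open W /\ W q /\
     cinf W G1 /\ cinf W G2 /\ cinf W G3 /\ forall w, W w -> B w ->
       G1 w = - (2 * acos (Cq w)) /\ G2 w = 2 * bq w /\ G3 w = T (Cq w) (bq w)) ->
  diffeomorphism A B Exp.
Proof.
  intros HA HD HE HB HB' HF HG.
  split; [|split].
  - intros [l t] H; apply HA in H; destruct H as (C & b & HDC & -> & ->).
    rewrite HE by auto; now apply HB.
  - intros [[g c] t] Hv; apply HA in Hv; destruct Hv as (C & b & HDC & El & Et).
    destruct (state_of_eq _ _ _ _ (HD _ _ HDC) El) as (EC & _ & Eb).
    destruct (HF C b HDC) as (W & f & h & OW & Wv & Cf & Ch & Hfh).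
    set (Tr := fun v : R3 => ((cos (px v / 2), py v / 2, 0) : R3)).
    assert (S1 : forall U, cinf U (fun v => cos (px v / 2))).
    { intros U; apply cinf_cos, cinf_div; [intros; lra|apply cinf_px|apply cinf_const]. }
    assert (S2 : forall U, cinf U (fun v => py v / 2)).
    { intros U; apply cinf_div; [intros; lra|apply cinf_py|apply cinf_const]. }
    exists (fun v => W (Tr v)), (fun v => (f (Tr v), h (Tr v), 0)).
    split; [|split; [|split]].
    + apply open_preimage; auto; intros v; apply continuous_triple.
      * apply (cinf_continuous _ _ (S1 (fun _ => True))); exact I.
      * apply (cinf_continuous _ _ (S2 (fun _ => True))); exact I.
      * apply continuous_const.
    + unfold Tr, px, py; cbn [fst snd]; rewrite EC, Eb.
      replace (2 * b / 2) with b by field; exact Wv.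
    + intros n; cbn [fst snd]; split; [|split]; apply sc_class.
      * apply (cinf_comp _ W f (fun v => cos (px v / 2)) (fun v => py v / 2) (fun _ => 0));
          auto; apply cinf_const.
      * apply (cinf_comp _ W h (fun v => cos (px v / 2)) (fun v => py v / 2) (fun _ => 0));
          auto; apply cinf_const.
      * apply sc_const.
    + intros [[g' c'] t'] Ww Hw; apply HA in Hw.
      destruct Hw as (C' & b' & HDC' & El' & ->).
      destruct (state_of_eq _ _ _ _ (HD _ _ HDC') El') as (EC' & _ & Eb').
      unfold Tr, px, py in *; cbn [fst snd] in *.
      rewrite EC', Eb' in *; replace (2 * b' / 2) with b' in * by field.
      cbn [cov]; rewrite El', HE by auto.
      destruct (Hfh C' b' Ww HDC') as [-> ->]; reflexivity.
  - exists (fun q => (state_of (Cq q) (bq q), T (Cq q) (bq q))).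
    split; [|split; [|split]].
    + intros q Hq; apply HA; exists (Cq q), (bq q); split; auto; now apply HB'.
    + intros [l t] H; apply HA in H; destruct H as (C & b & HDC & -> & ->).
      rewrite HE by auto; destruct (HB C b HDC) as (_ & -> & ->); reflexivity.
    + intros q Hq; destruct (HB' q Hq) as [H E]; rewrite HE; auto.
    + intros q Hq; destruct (HG q Hq) as (W & G1 & G2 & G3 & OW & Wq & C1 & C2 & C3 & H).
      exists W, (fun v => (G1 v, G2 v, G3 v)).
      split; [auto|split; [auto|split]].
      * intros n; cbn [fst snd]; split; [|split]; apply sc_class; auto.
      * intros w Ww Bw; destruct (H w Ww Bw) as (-> & -> & ->); reflexivity.
Qed.

(** * Complete elliptic integrals *)

(** With [n = k^2 / (1 - k^2)] one has E = sqrt(1 - k^2) Et(n) and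
    E - (1 - k^2) K = sqrt(1 - k^2) At(n), where the integrands of Et and At
    increase with [n]: the monotonicity of all quantities attached to a full
    period is visible under the integral sign. Unlike the modulus, [n] may also be
    slightly negative, so that [n = 0] is an interior point. *)
Definition fE (v : R3) : R := sqrt (1 + px v * cos (py v) ^ 2).
Definition fK (v : R3) : R := / fE v.
Definition Et (n : R) : R := cut_int fE (n, PI / 2, 0).
Definition Kt (n : R) : R := cut_int fK (n, PI / 2, 0).
Definition At (n : R) : R := Et n - Kt n.

Definition VE (v : R3) : Prop := 0 < 1 + px v * cos (py v) ^ 2.
Definition UE (v : R3) : Prop := -1 < px v.

Lemma open_VE : open VE.
Proof.
  apply (open_lt_cinf (fun _ => 0) (fun v => 1 + px v * cos (py v) ^ 2)).
  - apply cinf_const.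
  - apply cinf_plus; [apply cinf_const|apply cinf_mult; [apply cinf_px|]].
    apply cinf_sq, cinf_cos, cinf_py.
Qed.

Lemma open_UE : open UE.
Proof. apply (open_lt_cinf (fun _ => -1) px); [apply cinf_const | apply cinf_px]. Qed.

Lemma cos2_le_1 x : 0 <= cos x ^ 2 <= 1.
Proof. assert (h := sin2_cos2' x); assert (p := pow2_ge_0 (sin x)); assert (q := pow2_ge_0 (cos x)); lra. Qed.

Lemma VE_UE n t z : -1 < n -> VE (n, t, z).
Proof. intros H; unfold VE, px, py; cbn [fst snd]; assert (h := cos2_le_1 t).
  destruct (proj1 h) as [p|<-]; [nra|lra]. Qed.

Lemma segments_UE : segments UE VE.
Proof. intros x y z H t _; apply VE_UE; exact H. Qed.

Lemma cinf_fE : cinf VE fE.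
Proof.
  apply cinf_sqrt; [auto|].
  apply cinf_plus; [apply cinf_const|apply cinf_mult; [apply cinf_px|]].
  apply cinf_sq, cinf_cos, cinf_py.
Qed.

Lemma fE_pos v : VE v -> 0 < fE v.
Proof. intros H; now apply sqrt_lt_R0. Qed.

Lemma cinf_fK : cinf VE fK.
Proof.
  apply cinf_inv; [intros v Hv; apply Rgt_not_eq, fE_pos, Hv | apply cinf_fE].
Qed.

Lemma cinf_Et U (f : R3 -> R) : (forall v, U v -> -1 < f v) -> cinf U f ->
  cinf U (fun v => Et (f v)).
Proof.
  intros H Hf; unfold Et.
  apply (cinf_comp U UE (cut_int fE) f (fun _ => PI / 2) (fun _ => 0)); auto.
  - apply open_UE.
  - exact (sc_cut_int UE VE fE open_UE open_VE segments_UE cinf_fE).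
  - apply cinf_const.
  - apply cinf_const.
Qed.

Lemma cinf_Kt U (f : R3 -> R) : (forall v, U v -> -1 < f v) -> cinf U f ->
  cinf U (fun v => Kt (f v)).
Proof.
  intros H Hf; unfold Kt.
  apply (cinf_comp U UE (cut_int fK) f (fun _ => PI / 2) (fun _ => 0)); auto.
  - apply open_UE.
  - exact (sc_cut_int UE VE fK open_UE open_VE segments_UE cinf_fK).
  - apply cinf_const.
  - apply cinf_const.
Qed.

Lemma cinf_At U (f : R3 -> R) : (forall v, U v -> -1 < f v) -> cinf U f ->
  cinf U (fun v => At (f v)).
Proof. intros H Hf; apply cinf_minus; [now apply cinf_Et | now apply cinf_Kt]. Qed.

Lemma PI2_pos : 0 < PI / 2.
Proof. assert (h := PI_RGT_0); lra. Qed.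

Lemma sqrt_px_derive n t : -1 < n ->
  is_derive (fun s => fE (s, t, 0)) n (cos t ^ 2 / (2 * fE (n, t, 0))).
Proof.
  intros H; unfold fE, px, py; cbn [fst snd].
  apply (is_derive_sqrt (fun s => 1 + s * cos t ^ 2)); [|apply (VE_UE n t 0 H)].
  auto_derive; auto; ring.
Qed.

Lemma complete_derive (f : R3 -> R) n : cinf VE f -> -1 < n ->
  is_derive (fun s => cut_int f (s, PI / 2, 0)) n (cut_int (D1 f) (n, PI / 2, 0)).
Proof.
  intros Hf H; destruct (cinf_partials VE f open_VE Hf) as (Hp & F1 & _ & _).
  apply (derive_cut_int_x UE VE f (D1 f) (D2 f) (D3 f)); auto.
  - apply open_UE.
  - apply open_VE.
  - apply segments_UE.
  - apply (cinf_continuous _ _ Hf).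
  - apply (cinf_continuous _ _ F1).
Qed.

Lemma complete_pos (f : R3 -> R) n : cinf VE f -> -1 < n ->
  (forall t, 0 < t < PI / 2 -> 0 < f (n, t, 0)) -> 0 < cut_int f (n, PI / 2, 0).
Proof.
  intros Hf H Hpos; unfold cut_int, px, py; cbn [fst snd].
  assert (h := PI2_pos).
  apply RInt_gt_0; auto.
  intros x _; apply cont_second, (cinf_continuous _ _ Hf), VE_UE, H.
Qed.

Lemma cos_pos_open t : 0 < t < PI / 2 -> 0 < cos t.
Proof. intros H; apply cos_gt_0; lra. Qed.

Lemma Et_derive n : -1 < n -> exists d, 0 < d /\ is_derive Et n d.
Proof.
  intros H; exists (cut_int (D1 fE) (n, PI / 2, 0)); split.
  - apply complete_pos; auto.
    + apply cinf_partials; [apply open_VE | apply cinf_fE].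
    + intros t Ht; unfold D1, px, py, pz; cbn [fst snd].
      rewrite (is_derive_unique (fun s : R => fE (s, t, 0)) _ _ (sqrt_px_derive n t H)).
      assert (c := cos_pos_open t Ht); assert (e := fE_pos _ (VE_UE n t 0 H)).
      apply Rdiv_lt_0_compat; nra.
  - apply complete_derive; auto; apply cinf_fE.
Qed.

Lemma Kt_derive n : -1 < n -> exists d, d < 0 /\ is_derive Kt n d.
Proof.
  intros H.
  assert (E : forall t, is_derive (fun s => - fK (s, t, 0)) n
     (cos t ^ 2 / (2 * fE (n, t, 0)) / fE (n, t, 0) ^ 2)).
  { intros t; assert (e := fE_pos _ (VE_UE n t 0 H)).
    replace (cos t ^ 2 / (2 * fE (n, t, 0)) / fE (n, t, 0) ^ 2) with
      (- (- (cos t ^ 2 / (2 * fE (n, t, 0))) / fE (n, t, 0) ^ 2))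
      by (field; lra).
    apply (@is_derive_opp R_AbsRing R_NormedModule (fun s => / fE (s, t, 0))).
    apply is_derive_inv; [now apply sqrt_px_derive | exact (Rgt_not_eq _ _ e)]. }
  exists (- (cut_int (D1 (fun v => - fK v)) (n, PI / 2, 0))); split.
  - apply Ropp_lt_gt_0_contravar, Rlt_gt.
    apply complete_pos; auto.
    + apply cinf_partials; [apply open_VE | apply cinf_opp, cinf_fK].
    + intros t Ht; unfold D1, px, py, pz; cbn [fst snd].
      rewrite (is_derive_unique (fun s : R => - fK (s, t, 0)) _ _ (E t)).
      assert (c := cos_pos_open t Ht); assert (e := fE_pos _ (VE_UE n t 0 H)).
      repeat apply Rdiv_lt_0_compat; nra.
  - apply derive_ext_loc with (fun s => - cut_int (fun v => - fK v) (s, PI / 2, 0)).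
    + assert (O := open_UE (n, 0, 0) H).
      destruct (open_lines UE n 0 0 open_UE H) as (L & _ & _).
      revert L; apply filter_imp; intros s Hs.
      unfold Kt, cut_int, px, py; cbn [fst snd].
      rewrite (RInt_opp (V := R_CompleteNormedModule) (fun t => fK (s, t, 0))).
      * apply Ropp_involutive.
      * apply (ex_cut_int VE); [apply (cinf_continuous _ _ cinf_fK)|].
        intros t _; now apply VE_UE.
    + apply (@is_derive_opp R_AbsRing R_NormedModule
        (fun s => cut_int (fun v => - fK v) (s, PI / 2, 0))).
      apply complete_derive; auto; apply cinf_opp, cinf_fK.
Qed.

Lemma At_derive n : -1 < n -> exists d, 0 < d /\ is_derive At n d.
Proof.
  intros H; destruct (Et_derive n H) as (d & Hd & D), (Kt_derive n H) as (e & He & E).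
  exists (d - e); split; [lra|].
  now apply (@is_derive_minus R_AbsRing R_NormedModule).
Qed.

Lemma increasing_of_derive (f : R -> R) :
  (forall n, -1 < n -> exists d, 0 < d /\ is_derive f n d) ->
  forall a b, -1 < a -> a < b -> f a < f b.
Proof.
  intros H a b Ha Hab.
  destruct (MVT_gen f a b (Derive f)) as (c & Hc & E).
  - rewrite Rmin_left, Rmax_right by lra; intros x Hx.
    destruct (H x) as (d & _ & D); [lra|]; rewrite (is_derive_unique _ _ _ D); auto.
  - rewrite Rmin_left, Rmax_right by lra; intros x Hx.
    destruct (H x) as (d & _ & D); [lra|]; exact (derive_continuity_pt _ _ _ D).
  - rewrite Rmin_left, Rmax_right in Hc by lra.
    destruct (H c) as (d & Hd & D); [lra|]; rewrite (is_derive_unique _ _ _ D) in E; nra.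
Qed.

Lemma Et_increasing a b : -1 < a -> a < b -> Et a < Et b.
Proof. apply increasing_of_derive, Et_derive. Qed.

Lemma At_increasing a b : -1 < a -> a < b -> At a < At b.
Proof. apply increasing_of_derive, At_derive. Qed.

Lemma fE_0 t : fE (0, t, 0) = 1.
Proof. unfold fE, px, py; cbn [fst snd]; rewrite Rmult_0_l, Rplus_0_r; apply sqrt_1. Qed.

Lemma Et_0 : Et 0 = PI / 2.
Proof.
  unfold Et, cut_int, px, py; cbn [fst snd].
  rewrite (RInt_ext (V := R_CompleteNormedModule) _ (fun _ => 1)).
  - rewrite RInt_const; unfold scal; cbn; unfold mult; cbn; ring.
  - intros x _; apply fE_0.
Qed.

Lemma At_0 : At 0 = 0.
Proof.
  unfold At; rewrite Et_0; unfold Kt, cut_int, px, py; cbn [fst snd].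
  rewrite (RInt_ext (V := R_CompleteNormedModule) _ (fun _ => 1)).
  - rewrite RInt_const; unfold scal; cbn; unfold mult; cbn; ring.
  - intros x _; unfold fK; rewrite fE_0; apply Rinv_1.
Qed.

Lemma Et_pos n : -1 < n -> 0 < Et n.
Proof.
  intros H; apply complete_pos; auto; [apply cinf_fE|].
  intros t _; apply fE_pos, VE_UE, H.
Qed.

Lemma At_pos n : 0 < n -> 0 < At n.
Proof. intros H; rewrite <- At_0; apply At_increasing; lra. Qed.

(** The integrand is at least [sqrt n * cos t]. *)
Lemma Et_ge n : 0 <= n -> sqrt n <= Et n.
Proof.
  intros H; assert (h := PI2_pos).
  assert (I : is_RInt (fun t => sqrt n * cos t) 0 (PI / 2)
     (minus (sqrt n * sin (PI / 2)) (sqrt n * sin 0))).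
  { apply (is_RInt_derive (V := R_CompleteNormedModule) (fun t => sqrt n * sin t)).
    - intros x _; auto_derive; auto; ring.
    - intros x _; apply (continuous_mult (K := R_AbsRing) (fun _ => sqrt n));
        [apply continuous_const | apply continuous_cos]. }
  replace (sqrt n) with (RInt (fun t => sqrt n * cos t) 0 (PI / 2)).
  2:{ rewrite (is_RInt_unique (V := R_CompleteNormedModule) _ _ _ _ I).
      rewrite sin_PI2, sin_0; unfold minus, plus, opp; cbn; ring. }
  unfold Et, cut_int, px, py; cbn [fst snd]; apply RInt_le.
  - lra.
  - eexists; exact I.
  - apply (ex_cut_int VE); [apply (cinf_continuous _ _ cinf_fE)|].
    intros t _; apply VE_UE; lra.
  - intros t Ht; assert (c := cos_pos_open t Ht); unfold fE, px, py; cbn [fst snd].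
    rewrite <- (sqrt_pow2 (cos t)) by lra; rewrite <- sqrt_mult_alt by auto.
    apply sqrt_le_1_alt; rewrite pow2_sqrt; [lra|apply pow2_ge_0].
Qed.

Lemma Kt_le n : 0 <= n -> Kt n <= PI / 2.
Proof.
  assert (a := At_0); unfold At in a; rewrite Et_0 in a.
  intros [H| <-]; [|lra].
  assert (b : - Kt 0 < - Kt n); [|lra].
  apply (increasing_of_derive (fun n => - Kt n)); try lra.
  intros m Hm; destruct (Kt_derive m Hm) as (d & Hd & D); exists (- d).
  split; [lra|]; now apply (@is_derive_opp R_AbsRing R_NormedModule).
Qed.

(** ** In terms of the modulus *)

(** [1 - k ^ 2 sin ^ 2 = (1 - k ^ 2) (1 + n cos ^ 2)]. *)
Lemma ellE_Et k : 0 < k < 1 -> ellE k = sqrt (1 - k ^ 2) * Et (k ^ 2 / (1 - k ^ 2)).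
Proof.
  intros Hk; assert (h : 0 < 1 - k ^ 2) by nra.
  assert (Hn : -1 < k ^ 2 / (1 - k ^ 2)).
  { assert (0 < k ^ 2 / (1 - k ^ 2)) by (apply Rdiv_lt_0_compat; nra); lra. }
  unfold ellE, Et, cut_int, px, py; cbn [fst snd].
  rewrite <- (RInt_scal (V := R_CompleteNormedModule) (fun t => fE (k ^ 2 / (1 - k ^ 2), t, 0))).
  - apply (RInt_ext (V := R_CompleteNormedModule)); intros t _.
    unfold scal; cbn; unfold mult; cbn.
    unfold fE, px, py; cbn [fst snd]; rewrite <- sqrt_mult_alt by lra.
    apply f_equal; assert (s := sin2_cos2' t).
    transitivity (1 - k ^ 2 + k ^ 2 * cos t ^ 2); [simpl in *; nra | field; lra].
  - apply (ex_cut_int VE); [apply (cinf_continuous _ _ cinf_fE)|].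
    intros t _; now apply VE_UE.
Qed.

Lemma ellK_Kt k : 0 < k < 1 -> ellK k = Kt (k ^ 2 / (1 - k ^ 2)) / sqrt (1 - k ^ 2).
Proof.
  intros Hk; assert (h : 0 < 1 - k ^ 2) by nra.
  assert (hs := sqrt_lt_R0 _ h).
  assert (Hn : -1 < k ^ 2 / (1 - k ^ 2)).
  { assert (0 < k ^ 2 / (1 - k ^ 2)) by (apply Rdiv_lt_0_compat; nra); lra. }
  unfold ellK, ellF, Kt, cut_int, px, py; cbn [fst snd].
  change (RInt (fun th => / sqrt (1 - k ^ 2 * sin th ^ 2)) 0 (PI / 2) =
    RInt (fun t => fK (k ^ 2 / (1 - k ^ 2), t, 0)) 0 (PI / 2) * / sqrt (1 - k ^ 2)).
  rewrite (Rmult_comm (RInt (fun t => fK (k ^ 2 / (1 - k ^ 2), t, 0)) _ _)).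
  rewrite <- (RInt_scal (V := R_CompleteNormedModule) (fun t => fK (k ^ 2 / (1 - k ^ 2), t, 0))).
  - apply (RInt_ext (V := R_CompleteNormedModule)); intros t _.
    unfold scal; cbn; unfold mult; cbn.
    unfold fK, fE, px, py; cbn [fst snd]; rewrite <- Rinv_mult, <- sqrt_mult_alt by lra.
    do 2 apply f_equal; assert (s := sin2_cos2' t).
    transitivity (1 - k ^ 2 + k ^ 2 * cos t ^ 2); [simpl in *; nra | field; lra].
  - apply (ex_cut_int VE); [apply (cinf_continuous _ _ cinf_fK)|].
    intros t _; now apply VE_UE.
Qed.

Lemma ella_At k : 0 < k < 1 -> ella k = sqrt (1 - k ^ 2) * At (k ^ 2 / (1 - k ^ 2)).
Proof.
  intros Hk; assert (h : 0 < 1 - k ^ 2) by nra.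
  assert (hs := sqrt_lt_R0 _ h).
  unfold ella, At; rewrite ellE_Et, ellK_Kt by auto.
  assert (e := pow2_sqrt (1 - k ^ 2) (Rlt_le _ _ h)).
  set (n := k ^ 2 / (1 - k ^ 2)); set (kap := sqrt (1 - k ^ 2)) in *.
  rewrite <- e; field; lra.
Qed.

Lemma ellK_pos k : 0 < k < 1 -> 0 < ellK k.
Proof.
  intros Hk; rewrite <- (ellF_0 k); apply ellF_lt; auto; apply PI2_pos.
Qed.

Lemma ellF_mPI k : 0 < k < 1 -> ellF (- PI) k = - (2 * ellK k).
Proof.
  intros Hk; assert (h := ellF_period k (- PI) Hk).
  rewrite Rplus_opp_l, ellF_0 in h; lra.
Qed.

Lemma ellF_mPI2 k : 0 < k < 1 -> ellF (- (PI / 2)) k = - ellK k.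
Proof. intros Hk; now apply ellF_odd. Qed.

(** * The sets whose time is a full period *)

Definition T1 (C b : R) : R := 4 * ellK (sqrt (1 - (C ^ 2 - b ^ 2))).
Definition T2 (C b : R) : R :=
  4 * / sqrt (1 - (C ^ 2 - b ^ 2)) * ellK (/ sqrt (1 - (C ^ 2 - b ^ 2))).

Definition region1 (C b : R) : Prop :=
  0 < C <= 1 /\ b <= 0 /\ b ^ 2 < C ^ 2 /\ C ^ 2 < 1 + b ^ 2.
Definition region2 (C b : R) : Prop := -1 <= C <= 0 /\ - C < b.

Lemma sin_nonpos x : - PI <= x <= 0 -> sin x <= 0.
Proof.
  intros H; assert (h := sin_ge_0 (- x)); rewrite sin_neg in h; lra.
Qed.

Lemma neg_acos_range x : -1 <= x <= 0 -> - PI <= - acos x <= - (PI / 2).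
Proof.
  intros H; assert (b := acos_bound x); split; [lra|].
  apply Ropp_le_contravar.
  destruct (Rle_or_lt (PI / 2) (acos x)) as [L|L]; auto.
  assert (c := cos_gt_0 (acos x)); rewrite cos_acos in c by lra.
  assert (p := PI2_pos); assert (x <> 0 -> False); [|lra].
  intros n; assert (0 < x) by (apply c; lra); lra.
Qed.

(** The inverse of [(k, psi) -> (Del k psi, k cos psi)] for oscillations. The
    amplitude is minus an [acos] because the base sets have [sin psi <= 0]. *)
Lemma C1_of_momenta C b : 0 < C -> b ^ 2 < C ^ 2 -> C ^ 2 < 1 + b ^ 2 -> C <= 1 ->
  let k := sqrt (1 - (C ^ 2 - b ^ 2)) in
  0 < k < 1 /\ k ^ 2 = 1 - (C ^ 2 - b ^ 2) /\ -1 <= b / k <= 1 /\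
  Del k (- acos (b / k)) = C /\ k * cos (- acos (b / k)) = b.
Proof.
  intros HC Hb H1 H2 k.
  assert (Hk : 0 < k < 1) by (split; [apply sqrt_lt_R0 | apply sqrt_lt_one]; lra).
  assert (Ek : k ^ 2 = 1 - (C ^ 2 - b ^ 2)) by (apply pow2_sqrt; lra).
  assert (Hbk : -1 <= b / k <= 1).
  { assert (b ^ 2 <= k ^ 2) by nra.
    assert (- k <= b <= k) by nra.
    split; apply Rmult_le_reg_r with k; try lra; unfold Rdiv;
      rewrite Rmult_assoc, Rinv_l by lra; lra. }
  split; [exact Hk|split; [exact Ek|split; [exact Hbk|]]].
  assert (Ec : k * cos (- acos (b / k)) = b).
  { rewrite cos_neg, cos_acos by auto; field; lra. }
  split; [|exact Ec].
  assert (D := Del_sq' k (- acos (b / k)) Hk); assert (P := Del_pos k (- acos (b / k)) Hk).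
  replace (k ^ 2 * cos (- acos (b / k)) ^ 2) with (b ^ 2) in D
    by (rewrite <- Ec at 1; ring).
  nra.
Qed.

Lemma C2_of_momenta C b : -1 <= C <= 1 -> 0 < b -> C ^ 2 < b ^ 2 ->
  let k := / sqrt (1 - (C ^ 2 - b ^ 2)) in
  0 < k < 1 /\ (/ k) ^ 2 = 1 - (C ^ 2 - b ^ 2) /\
  cos (- acos C) = C /\ Del k (- acos C) / k = b.
Proof.
  intros HC Hb H1 k.
  set (m := sqrt (1 - (C ^ 2 - b ^ 2))).
  assert (Em : m ^ 2 = 1 - (C ^ 2 - b ^ 2)) by (apply pow2_sqrt; lra).
  assert (Hm : 1 < m).
  { assert (0 <= m) by apply sqrt_pos; nra. }
  assert (Hk : 0 < k < 1).
  { unfold k; fold m; split; [apply Rinv_0_lt_compat; lra|].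
    rewrite <- Rinv_1; apply Rinv_lt_contravar; lra. }
  assert (Ek : / k = m) by apply Rinv_inv.
  split; [exact Hk|split; [now rewrite Ek|]].
  assert (Ec : cos (- acos C) = C) by (now rewrite cos_neg, cos_acos).
  split; [exact Ec|].
  assert (D := Del_sq' k (- acos C) Hk); assert (P := Del_pos k (- acos C) Hk).
  rewrite Ec in D.
  set (d := Del k (- acos C) / k).
  assert (0 < d) by (apply Rdiv_lt_0_compat; lra).
  assert (d ^ 2 = b ^ 2).
  { unfold d; replace ((Del k (- acos C) / k) ^ 2) with
      (Del k (- acos C) ^ 2 * (/ k) ^ 2) by (field; lra).
    rewrite D; replace ((1 - k ^ 2 + k ^ 2 * C ^ 2) * (/ k) ^ 2) with
      ((/ k) ^ 2 - 1 + C ^ 2) by (field; lra).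
    rewrite Ek, Em; ring. }
  nra.
Qed.

(** With [p = 2 K] one has [tau = phi + 2 K], so that the position of [tau] in the
    period is a condition on the amplitude of the initial state alone. *)
Lemma C1_period_iff (Q D : R -> R -> Prop) l t :
  (forall C b, D C b -> region1 C b) ->
  (forall k psi, 0 < k < 1 -> Q k (ellF psi k + 2 * ellK k) <->
     - PI <= psi <= - (PI / 2) /\ D (Del k psi) (k * cos psi)) ->
  on_C1_0 (fun k p tau => p = 2 * ellK k /\ Q k tau) (l, t) <->
  exists C b, D C b /\ l = state_of C b /\ t = T1 C b.
Proof.
  intros HD HQ; rewrite on_C1_0_iff; split.
  - intros (Ht & psi & k & Hk & -> & Ep & Hq).
    rewrite Ep in Hq; apply HQ in Hq; auto; destruct Hq as [Hpsi Hd].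
    assert (p := PI2_pos).
    exists (Del k psi), (k * cos psi); split; [exact Hd|split].
    + apply C1_state_of; auto; apply sin_nonpos; lra.
    + unfold T1; replace (1 - (Del k psi ^ 2 - (k * cos psi) ^ 2)) with (k ^ 2).
      * rewrite sqrt_pow2; lra.
      * rewrite Del_sq' by auto; ring.
  - intros (C & b & Hd & -> & ->).
    destruct (HD C b Hd) as (r1 & r2 & r3 & r4).
    destruct (C1_of_momenta C b) as (Hk & Ek & Hbk & E1 & E2); try lra.
    unfold T1; set (k := sqrt (1 - (C ^ 2 - b ^ 2))) in *.
    assert (Kp := ellK_pos k Hk).
    split; [lra|]; exists (- acos (b / k)), k; split; [exact Hk|].
    assert (Hr : - PI <= - acos (b / k) <= - (PI / 2)).
    { apply neg_acos_range; split; [lra|].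
      apply Rmult_le_reg_r with k; [lra|]; unfold Rdiv.
      rewrite Rmult_assoc, Rinv_l; lra. }
    assert (p := PI2_pos).
    split; [|split; [field|]].
    + rewrite C1_state_of, E1, E2; auto; apply sin_nonpos; lra.
    + replace (4 * ellK k / 2) with (2 * ellK k) by field; apply HQ; auto.
      rewrite E1, E2; auto.
Qed.

Lemma C2_period_iff (Q D : R -> R -> Prop) l t :
  (forall C b, D C b -> region2 C b) ->
  (forall k psi, 0 < k < 1 -> Q k (ellF psi k + 2 * ellK k) <->
     - PI <= psi <= - (PI / 2) /\ D (cos psi) (Del k psi / k)) ->
  on_C2_plus (fun k p tau => p = 2 * ellK k /\ Q k tau) (l, t) <->
  exists C b, D C b /\ l = state_of C b /\ t = T2 C b.
Proof.
  intros HD HQ; rewrite on_C2_plus_iff; split.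
  - intros (Ht & psi & k & Hk & -> & Ep & Hq).
    assert (Et : t = 4 * k * ellK k).
    { replace t with (t / (2 * k) * (2 * k)) by (field; lra); rewrite Ep; ring. }
    replace ((k * ellF psi k + t / 2) / k) with (ellF psi k + 2 * ellK k) in Hq
      by (rewrite Et; field; lra).
    apply HQ in Hq; auto; destruct Hq as [Hpsi Hd].
    assert (p := PI2_pos).
    exists (cos psi), (Del k psi / k); split; [exact Hd|split].
    + apply C2_state_of; auto; apply sin_nonpos; lra.
    + unfold T2; replace (1 - (cos psi ^ 2 - (Del k psi / k) ^ 2)) with ((/ k) ^ 2).
      * rewrite sqrt_pow2, Rinv_inv by (apply Rlt_le, Rinv_0_lt_compat; lra); exact Et.
      * replace ((Del k psi / k) ^ 2) with (Del k psi ^ 2 / k ^ 2) by (field; lra).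
        rewrite Del_sq' by auto; field; lra.
  - intros (C & b & Hd & -> & ->).
    destruct (HD C b Hd) as (r1 & r2).
    destruct (C2_of_momenta C b) as (Hk & Ek & E1 & E2); try nra.
    unfold T2; set (k := / sqrt (1 - (C ^ 2 - b ^ 2))) in *.
    assert (Kp := ellK_pos k Hk).
    split; [nra|]; exists (- acos C), k; split; [exact Hk|].
    assert (Hr : - PI <= - acos C <= - (PI / 2)) by (apply neg_acos_range; lra).
    assert (p := PI2_pos).
    split; [|split; [field; lra|]].
    + rewrite C2_state_of, E1, E2; auto; apply sin_nonpos; lra.
    + replace ((k * ellF (- acos C) k + 4 * k * ellK k / 2) / k) with
        (ellF (- acos C) k + 2 * ellK k) by (field; lra).
      apply HQ; auto; rewrite E1, E2; auto.
Qed.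

Lemma Del_lt_1 k psi : 0 < k < 1 -> sin psi <> 0 -> Del k psi < 1.
Proof.
  intros Hk H; assert (D := Del_sq k psi Hk); assert (P := Del_pos k psi Hk).
  assert (0 < sin psi ^ 2) by (apply pow2_gt_0; auto).
  assert (0 < k ^ 2 * sin psi ^ 2) by (apply Rmult_lt_0_compat; nra); nra.
Qed.

Lemma Del_eq_1 k psi : 0 < k < 1 -> sin psi = 0 -> Del k psi = 1.
Proof. intros Hk H; unfold Del; rewrite H; replace (1 - k ^ 2 * 0 ^ 2) with 1 by ring; apply sqrt_1. Qed.

Lemma sin_neg_open x : - PI < x < 0 -> sin x < 0.
Proof. intros H; apply sin_lt_0_var; lra. Qed.

Lemma cos_neg_open x : - PI <= x < - (PI / 2) -> cos x < 0.
Proof.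
  intros H; rewrite <- cos_neg; assert (p := PI_RGT_0); apply cos_lt_0; lra.
Qed.

Lemma cos_mPI : cos (- PI) = -1.
Proof. rewrite cos_neg; apply cos_PI. Qed.
Lemma sin_mPI : sin (- PI) = 0.
Proof. rewrite sin_neg, sin_PI; ring. Qed.
Lemma cos_mPI2 : cos (- (PI / 2)) = 0.
Proof. rewrite cos_neg; apply cos_PI2. Qed.
Lemma sin_mPI2 : sin (- (PI / 2)) = -1.
Proof. rewrite sin_neg, sin_PI2; ring. Qed.

(** Since [ellF] increases and takes the values [- 2 K] and [- K] at [- PI] and
    [- PI / 2], the conditions on [tau] become conditions on the amplitude. *)
Lemma tau_interior k psi : 0 < k < 1 ->
  0 < ellF psi k + 2 * ellK k < ellK k <-> - PI < psi < - (PI / 2).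
Proof.
  intros Hk; rewrite <- (ellF_lt_iff k (- PI) psi), <- (ellF_lt_iff k psi (- (PI / 2))) by auto.
  rewrite ellF_mPI, ellF_mPI2 by auto; split; intros; lra.
Qed.

Lemma tau_K k psi : 0 < k < 1 ->
  ellF psi k + 2 * ellK k = ellK k <-> psi = - (PI / 2).
Proof.
  intros Hk; split.
  - intros H; apply (ellF_inj k); auto; rewrite ellF_mPI2 by auto; lra.
  - intros ->; rewrite ellF_mPI2 by auto; ring.
Qed.

Lemma tau_0 k psi : 0 < k < 1 -> ellF psi k + 2 * ellK k = 0 <-> psi = - PI.
Proof.
  intros Hk; split.
  - intros H; apply (ellF_inj k); auto; rewrite ellF_mPI by auto; lra.
  - intros ->; rewrite ellF_mPI by auto; ring.
Qed.

Lemma quarter_cases psi : - PI <= psi <= - (PI / 2) ->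
  psi = - PI \/ psi = - (PI / 2) \/ (- PI < psi < - (PI / 2)).
Proof. intros; lra. Qed.

Definition dom1 C b : Prop := 0 < C < 1 /\ - C < b < 0.
Definition dom17 C b : Prop := 0 < C < 1 /\ b = 0.
Definition dom21 C b : Prop := C = 1 /\ -1 < b < 0.
Definition dom9 C b : Prop := -1 < C < 0 /\ - C < b.
Definition dom29 C b : Prop := C = 0 /\ 0 < b.
Definition dom25 C b : Prop := C = -1 /\ 1 < b.

Lemma N1_iff l t : N1 (l, t) <-> exists C b, dom1 C b /\ l = state_of C b /\ t = T1 C b.
Proof.
  apply (C1_period_iff (fun k tau => 0 < tau < ellK k)).
  - unfold dom1, region1; intros; nra.
  - intros k psi Hk; rewrite tau_interior by auto; assert (p := PI2_pos).
    assert (P := Del_pos k psi Hk); assert (G := Del_gt_kcos k psi Hk).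
    apply Rabs_def2 in G; unfold dom1; split.
    + intros H; split; [lra|].
      assert (s := sin_neg_open psi ltac:(lra)); assert (c := cos_neg_open psi ltac:(lra)).
      assert (L := Del_lt_1 k psi Hk ltac:(lra)); nra.
    + intros [H (h1 & h2)]; destruct (quarter_cases psi H) as [-> |[-> |I]]; auto.
      * rewrite (Del_eq_1 k (- PI)) in h1 by (auto using sin_mPI); lra.
      * rewrite cos_mPI2 in h2; lra.
Qed.

Lemma N17_iff l t : N17 (l, t) <-> exists C b, dom17 C b /\ l = state_of C b /\ t = T1 C b.
Proof.
  apply (C1_period_iff (fun k tau => tau = ellK k)).
  - unfold dom17, region1; intros; nra.
  - intros k psi Hk; rewrite tau_K by auto; assert (p := PI2_pos).
    assert (P := Del_pos k psi Hk); unfold dom17; split.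
    + intros ->; split; [lra|].
      assert (L := Del_lt_1 k (- (PI / 2)) Hk); rewrite sin_mPI2 in L.
      rewrite cos_mPI2; lra.
    + intros [H (h1 & h2)]; destruct (quarter_cases psi H) as [-> |[-> |I]]; auto.
      * rewrite cos_mPI in h2; lra.
      * assert (c := cos_neg_open psi ltac:(lra)); nra.
Qed.

Lemma N21_iff l t : N21 (l, t) <-> exists C b, dom21 C b /\ l = state_of C b /\ t = T1 C b.
Proof.
  apply (C1_period_iff (fun k tau => tau = 0)).
  - unfold dom21, region1; intros; nra.
  - intros k psi Hk; rewrite tau_0 by auto; assert (p := PI2_pos).
    unfold dom21; split.
    + intros ->; rewrite cos_mPI, (Del_eq_1 k (- PI)) by (auto using sin_mPI); lra.
    + intros [H (h1 & h2)]; destruct (quarter_cases psi H) as [-> |[-> |I]]; auto.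
      * assert (L := Del_lt_1 k (- (PI / 2)) Hk); rewrite sin_mPI2 in L; lra.
      * assert (s := sin_neg_open psi ltac:(lra)).
        assert (L := Del_lt_1 k psi Hk ltac:(lra)); lra.
Qed.

Lemma N9_iff l t : N9 (l, t) <-> exists C b, dom9 C b /\ l = state_of C b /\ t = T2 C b.
Proof.
  apply (C2_period_iff (fun k tau => 0 < tau < ellK k)).
  - unfold dom9, region2; intros; lra.
  - intros k psi Hk; rewrite tau_interior by auto; assert (p := PI2_pos).
    assert (P := Del_pos k psi Hk); assert (G := Del_gt_kcos k psi Hk).
    apply Rabs_def2 in G; unfold dom9; split.
    + intros H; split; [lra|].
      assert (s := sin_neg_open psi ltac:(lra)); assert (c := cos_neg_open psi ltac:(lra)).
      assert (e := sin2_cos2' psi).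
      split; [nra|].
      apply Rmult_lt_reg_r with k; [lra|]; unfold Rdiv; rewrite Rmult_assoc, Rinv_l; lra.
    + intros [H (h1 & h2)]; destruct (quarter_cases psi H) as [-> |[-> |I]]; auto.
      * rewrite cos_mPI in h1; lra.
      * rewrite cos_mPI2 in h1; lra.
Qed.

Lemma N29_iff l t : N29 (l, t) <-> exists C b, dom29 C b /\ l = state_of C b /\ t = T2 C b.
Proof.
  apply (C2_period_iff (fun k tau => tau = ellK k)).
  - unfold dom29, region2; intros; lra.
  - intros k psi Hk; rewrite tau_K by auto; assert (p := PI2_pos).
    assert (P := Del_pos k psi Hk); unfold dom29; split.
    + intros ->; split; [lra|].
      rewrite cos_mPI2; split; [auto|]; apply Rdiv_lt_0_compat; lra.
    + intros [H (h1 & h2)]; destruct (quarter_cases psi H) as [-> |[-> |I]]; auto.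
      * rewrite cos_mPI in h1; lra.
      * assert (c := cos_neg_open psi ltac:(lra)); lra.
Qed.

Lemma N25_iff l t : N25 (l, t) <-> exists C b, dom25 C b /\ l = state_of C b /\ t = T2 C b.
Proof.
  apply (C2_period_iff (fun k tau => tau = 0)).
  - unfold dom25, region2; intros; lra.
  - intros k psi Hk; rewrite tau_0 by auto; assert (p := PI2_pos).
    unfold dom25; split.
    + intros ->; rewrite cos_mPI, (Del_eq_1 k (- PI)) by (auto using sin_mPI).
      split; [lra|]; split; [auto|].
      unfold Rdiv; rewrite Rmult_1_l, <- Rinv_1; apply Rinv_lt_contravar; lra.
    + intros [H (h1 & h2)]; destruct (quarter_cases psi H) as [-> |[-> |I]]; auto.
      * rewrite cos_mPI2 in h1; lra.
      * assert (s := sin_neg_open psi ltac:(lra)).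
        assert (e := sin2_cos2' psi); nra.
Qed.

(** ** Inverting the complete integrals *)

Lemma ivt_value (f : R -> R) (a b v : R) : a < b ->
  (forall x, a <= x <= b -> continuity_pt f x) -> f a < v < f b ->
  exists x, a < x < b /\ f x = v.
Proof.
  intros Hab Hc Hv.
  destruct (IVT_interv (fun x => f x - v) a b) as (x & Hx & E); try lra.
  - intros x Hx; apply continuity_pt_minus; [now apply Hc|].
    apply continuity_pt_const; intros ? ?; reflexivity.
  - exists x; split; [|lra].
    destruct (Req_dec x a) as [->|]; [lra|]; destruct (Req_dec x b) as [->|]; lra.
Qed.

Lemma Et_cont n : -1 < n -> continuity_pt Et n.
Proof. intros H; destruct (Et_derive n H) as (d & _ & D); exact (derive_continuity_pt _ _ _ D). Qed.

Lemma At_cont n : -1 < n -> continuity_pt At n.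
Proof. intros H; destruct (At_derive n H) as (d & _ & D); exact (derive_continuity_pt _ _ _ D). Qed.

Lemma At_ge n : 0 <= n -> sqrt n - 2 <= At n.
Proof.
  intros H; unfold At; assert (a := Et_ge n H); assert (b := Kt_le n H).
  assert (c := PI_4); lra.
Qed.

Definition nu1 (rho : R) : R := epsilon (inhabits 0) (fun n => 0 < n /\ 4 * Et n = rho).
Definition nu2 (rho : R) : R := epsilon (inhabits 0) (fun n => 0 < n /\ 4 * At n = rho).

Lemma nu1_spec rho : 2 * PI < rho -> 0 < nu1 rho /\ 4 * Et (nu1 rho) = rho.
Proof.
  intros H; unfold nu1; apply epsilon_spec.
  assert (p := PI_RGT_0).
  (* by [Et_ge] the value at [rho ^ 2] is at least [4 rho] *)
  destruct (ivt_value (fun n => 4 * Et n) 0 (rho ^ 2) rho) as (n & Hn & E).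
  - nra.
  - intros x Hx; apply continuity_pt_scal, Et_cont; lra.
  - rewrite Et_0; assert (h := Et_ge (rho ^ 2) ltac:(nra)).
    rewrite sqrt_pow2 in h by lra; lra.
  - exists n; split; [lra | exact E].
Qed.

Lemma nu1_Et n : 0 < n -> nu1 (4 * Et n) = n.
Proof.
  intros H; assert (L : 2 * PI < 4 * Et n).
  { assert (h := Et_increasing 0 n ltac:(lra) H); rewrite Et_0 in h; lra. }
  destruct (nu1_spec _ L) as [H1 H2].
  destruct (Rtotal_order (nu1 (4 * Et n)) n) as [A|[A|A]]; auto.
  - apply Et_increasing in A; lra.
  - apply Et_increasing in A; lra.
Qed.

Lemma nu2_spec rho : 0 < rho -> 0 < nu2 rho /\ 4 * At (nu2 rho) = rho.
Proof.
  intros H; unfold nu2; apply epsilon_spec.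
  (* by [At_ge] the value at [(rho + 2) ^ 2] is at least [4 rho] *)
  destruct (ivt_value (fun n => 4 * At n) 0 ((rho + 2) ^ 2) rho) as (n & Hn & E).
  - nra.
  - intros x Hx; apply continuity_pt_scal, At_cont; lra.
  - rewrite At_0; assert (h := At_ge ((rho + 2) ^ 2) ltac:(nra)).
    rewrite sqrt_pow2 in h by lra; lra.
  - exists n; split; [lra | exact E].
Qed.

Lemma nu2_At n : 0 < n -> nu2 (4 * At n) = n.
Proof.
  intros H; assert (L := At_pos n H).
  destruct (nu2_spec (4 * At n) ltac:(lra)) as [H1 H2].
  destruct (Rtotal_order (nu2 (4 * At n)) n) as [A|[A|A]]; auto.
  - apply At_increasing in A; lra.
  - apply At_increasing in A; lra.
Qed.

(** The inverse function theorem in one variable is the case of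
    [cinf_param_inverse] in which the parameters do not occur. *)
Lemma cinf_inverse (f g : R -> R) (a c : R) :
  cinf (fun v => a < px v) (fun v => f (px v)) ->
  (forall n, a < n -> exists d, 0 < d /\ is_derive f n d) ->
  (forall n, a < n -> c < f n) ->
  (forall r, c < r -> a < g r /\ f (g r) = r) ->
  forall (U : R3 -> Prop) h, (forall v, U v -> c < h v) -> cinf U h ->
    cinf U (fun v => g (h v)).
Proof.
  intros Cf Df Hc Hg U h Hh Ch.
  destruct (cinf_param_inverse (fun v => a < px v) (fun v => c < px v)
    (fun v => f (px v)) (fun v => g (px v))) as [OV Cg].
  - apply (open_lt_cinf (fun _ => a) px); [apply cinf_const | apply cinf_px].
  - unfold px; cbn [fst snd]; intros; lra.
  - exact Cf.
  - intros [[n y] z] Hv; unfold px in Hv; cbn [fst snd] in Hv.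
    destruct (Df n Hv) as (d & Hd & D); unfold D1, px; cbn [fst snd].
    replace (Derive (fun s => f s) n) with d; auto.
    symmetry; now apply Derive_eq.
  - unfold px; cbn [fst snd]; intros; now apply Hc.
  - unfold px; cbn [fst snd]; intros t y z H; now apply Hg.
  - apply (cinf_comp U (fun v => c < px v) (fun v => g (px v)) h (fun _ => 0) (fun _ => 0));
      auto; apply cinf_const.
Qed.

Lemma cinf_nu1 (U : R3 -> Prop) h : (forall v, U v -> 2 * PI < h v) -> cinf U h ->
  cinf U (fun v => nu1 (h v)).
Proof.
  apply (cinf_inverse (fun n => 4 * Et n) nu1 0 (2 * PI)).
  - apply cinf_mult; [apply cinf_const|]; apply cinf_Et; [intros; lra|apply cinf_px].
  - intros n Hn; destruct (Et_derive n ltac:(lra)) as (d & Hd & D).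
    exists (4 * d); split; [lra|]; now apply is_derive_scal.
  - intros n Hn; assert (h1 := Et_increasing 0 n ltac:(lra) Hn); rewrite Et_0 in h1; lra.
  - apply nu1_spec.
Qed.

Lemma cinf_nu2 (U : R3 -> Prop) h : (forall v, U v -> 0 < h v) -> cinf U h ->
  cinf U (fun v => nu2 (h v)).
Proof.
  apply (cinf_inverse (fun n => 4 * At n) nu2 0 0).
  - apply cinf_mult; [apply cinf_const|]; apply cinf_At; [intros; lra|apply cinf_px].
  - intros n Hn; destruct (At_derive n ltac:(lra)) as (d & Hd & D).
    exists (4 * d); split; [lra|]; now apply is_derive_scal.
  - intros n Hn; assert (h1 := At_pos n Hn); lra.
  - apply nu2_spec.
Qed.

Lemma n_of_k n : 0 < n -> let k := sqrt (n / (1 + n)) in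
  0 < k < 1 /\ k ^ 2 / (1 - k ^ 2) = n /\ 1 - k ^ 2 = / (1 + n).
Proof.
  intros Hn k.
  assert (H : 0 < n / (1 + n) < 1).
  { split; [apply Rdiv_lt_0_compat; lra|].
    apply Rmult_lt_reg_r with (1 + n); [lra|]; unfold Rdiv; rewrite Rmult_assoc, Rinv_l; lra. }
  assert (E : k ^ 2 = n / (1 + n)) by (apply pow2_sqrt; lra).
  split; [split; [apply sqrt_lt_R0 | apply sqrt_lt_one]; lra|].
  rewrite E; split; field; lra.
Qed.

Lemma k_of_n k : 0 < k < 1 -> let n := k ^ 2 / (1 - k ^ 2) in
  0 < n /\ sqrt n = k / sqrt (1 - k ^ 2) /\ sqrt (1 + n) = / sqrt (1 - k ^ 2).
Proof.
  intros Hk n; assert (h : 0 < 1 - k ^ 2) by nra.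
  split; [apply Rdiv_lt_0_compat; nra|split].
  - unfold n; rewrite sqrt_div_alt, sqrt_pow2 by lra; reflexivity.
  - replace (1 + n) with (/ (1 - k ^ 2)) by (unfold n; field; lra).
    apply sqrt_inv.
Qed.

(** In the parameter [n] the height on the curve is [- 4 sqrt n Et n], a product of
    increasing factors: it takes every negative value, which gives a meaning to
    the modulus chosen in the definition of [x3]. *)
Lemma x3_spec y : y < 0 -> exists n, 0 < n /\ - y = 4 * sqrt n * Et n /\
  x3 y = 4 * sqrt (1 + n) * Et n.
Proof.
  intros Hy.
  assert (HE : exists k, 0 < k < 1 /\ y = - (4 * k * ellE k / (1 - k ^ 2))).
  { destruct (ivt_value (fun n => 4 * sqrt n * Et n) 0 (- y) (- y)) as (n & Hn & E).
    - lra.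
    - intros x Hx; apply (continuity_pt_mult (fun n => 4 * sqrt n)).
      + apply continuity_pt_scal, continuity_pt_sqrt; lra.
      + apply Et_cont; lra.
    - rewrite sqrt_0; assert (h := Et_ge (- y) ltac:(lra)).
      assert (s := sqrt_lt_R0 (- y) ltac:(lra)); assert (q := pow2_sqrt (- y) ltac:(lra)).
      nra.
    - destruct (n_of_k n (proj1 Hn)) as (Hk & E1 & _); set (k := sqrt (n / (1 + n))) in *.
      exists k; split; [exact Hk|].
      rewrite ellE_Et, E1 by auto.
      destruct (k_of_n k Hk) as (_ & E3 & _); rewrite E1 in E3; rewrite E3 in E.
      assert (h : 0 < 1 - k ^ 2) by nra; assert (hs := sqrt_lt_R0 _ h).
      assert (e := pow2_sqrt (1 - k ^ 2) (Rlt_le _ _ h)).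
      rewrite <- (Ropp_involutive y), <- E; rewrite <- e at 3; field; lra. }
  assert (K : 0 < k3 y < 1 /\ y = - (4 * k3 y * ellE (k3 y) / (1 - k3 y ^ 2)))
    by (unfold k3 at 1 2 3 4 5; apply epsilon_spec; exact HE).
  destruct K as [Hk E]; unfold x3; set (k := k3 y) in *.
  destruct (k_of_n k Hk) as (Hn & E1 & E2); set (n := k ^ 2 / (1 - k ^ 2)) in *.
  exists n; split; [exact Hn|]; rewrite E1, E2.
  rewrite ellE_Et in E by auto; rewrite ellE_Et by auto; fold n in E; fold n.
  assert (h : 0 < 1 - k ^ 2) by nra; assert (hs := sqrt_lt_R0 _ h).
  assert (e := pow2_sqrt (1 - k ^ 2) (Rlt_le _ _ h)).
  set (kap := sqrt (1 - k ^ 2)) in *; clearbody n.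
  split; [rewrite E|]; rewrite <- e; field; lra.
Qed.

(** As for [x3], with the height [- 4 sqrt (1 + n) At n]. *)
Lemma x2_spec y : y < 0 -> exists n, 0 < n /\ - y = 4 * sqrt (1 + n) * At n /\
  x2 y = 4 * sqrt n * At n.
Proof.
  intros Hy.
  assert (HE : exists k, 0 < k < 1 /\ y = - (4 * ella k / (1 - k ^ 2))).
  { destruct (ivt_value (fun n => 4 * sqrt (1 + n) * At n) 0 ((- y + 2) ^ 2) (- y)) as (n & Hn & E).
    - nra.
    - intros x Hx; apply (continuity_pt_mult (fun n => 4 * sqrt (1 + n))).
      + apply continuity_pt_scal.
        apply (continuity_pt_comp (fun n => 1 + n) sqrt).
        * apply continuity_pt_plus; [|apply derivable_continuous_pt, derivable_pt_id].
          apply continuity_pt_const; intros ? ?; reflexivity.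
        * apply continuity_pt_sqrt; lra.
      + apply At_cont; lra.
    - rewrite At_0; assert (h := At_ge ((- y + 2) ^ 2) ltac:(nra)).
      rewrite sqrt_pow2 in h by lra.
      assert (s := sqrt_le_1_alt 1 (1 + (- y + 2) ^ 2) ltac:(nra)); rewrite sqrt_1 in s.
      nra.
    - destruct (n_of_k n (proj1 Hn)) as (Hk & E1 & _); set (k := sqrt (n / (1 + n))) in *.
      exists k; split; [exact Hk|].
      rewrite ella_At, E1 by auto.
      destruct (k_of_n k Hk) as (_ & _ & E3); rewrite E1 in E3; rewrite E3 in E.
      assert (h : 0 < 1 - k ^ 2) by nra; assert (hs := sqrt_lt_R0 _ h).
      assert (e := pow2_sqrt (1 - k ^ 2) (Rlt_le _ _ h)).
      rewrite <- (Ropp_involutive y), <- E; rewrite <- e at 3; field; lra. }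
  assert (K : 0 < k2 y < 1 /\ y = - (4 * ella (k2 y) / (1 - k2 y ^ 2)))
    by (unfold k2 at 1 2 3 4; apply epsilon_spec; exact HE).
  destruct K as [Hk E]; unfold x2; set (k := k2 y) in *.
  destruct (k_of_n k Hk) as (Hn & E1 & E2); set (n := k ^ 2 / (1 - k ^ 2)) in *.
  exists n; split; [exact Hn|]; rewrite E1, E2.
  rewrite ella_At in E by auto; rewrite ella_At by auto; fold n in E; fold n.
  assert (h : 0 < 1 - k ^ 2) by nra; assert (hs := sqrt_lt_R0 _ h).
  assert (e := pow2_sqrt (1 - k ^ 2) (Rlt_le _ _ h)).
  set (kap := sqrt (1 - k ^ 2)) in *; clearbody n.
  split; [rewrite E|]; rewrite <- e; field; lra.
Qed.

(** ** Full periods of oscillations *)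

(** The end point [(X1, Y1)] is the multiple of [(C, b)] by a function of
    [C ^ 2 - b ^ 2 = 1 - k ^ 2] only. Hence [X1 ^ 2 - Y1 ^ 2 = 16 Et (n1) ^ 2], from
    which [nu1] recovers [n1], the multiple, and finally [C1q] and [b1q]. *)
Definition n1 (C b : R) : R := / (C ^ 2 - b ^ 2) - 1.
Definition X1 (C b : R) : R := 4 * Et (n1 C b) * C / sqrt (C ^ 2 - b ^ 2).
Definition Y1 (C b : R) : R := 4 * Et (n1 C b) * b / sqrt (C ^ 2 - b ^ 2).

Definition quad1 (q : R3) : Prop := 0 < px q /\ (2 * PI) ^ 2 < px q ^ 2 - py q ^ 2.
Definition rho1 (q : R3) : R := sqrt (px q ^ 2 - py q ^ 2).
Definition m1 (q : R3) : R := nu1 (rho1 q).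
Definition C1q (q : R3) : R := px q / (rho1 q * sqrt (1 + m1 q)).
Definition b1q (q : R3) : R := py q / (rho1 q * sqrt (1 + m1 q)).

Lemma reach_T1 C b : region1 C b -> reach (state_of C b) (T1 C b) (X1 C b, Y1 C b, 0) (state_of C b).
Proof.
  intros (r1 & r2 & r3 & r4).
  destruct (C1_of_momenta C b) as (Hk & Ek & Hbk & E1 & E2); try lra.
  unfold T1, X1, Y1, n1; set (k := sqrt (1 - (C ^ 2 - b ^ 2))) in *.
  assert (H := reach_period_C1 k (- acos (b / k)) Hk).
  rewrite C1_state_of, E1, E2 in H; auto.
  2:{ apply sin_nonpos; assert (h := acos_bound (b / k)); lra. }
  rewrite ellE_Et in H by auto.
  replace (k ^ 2 / (1 - k ^ 2)) with (/ (C ^ 2 - b ^ 2) - 1) in H by (rewrite Ek; field; lra).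
  replace (1 - k ^ 2) with (C ^ 2 - b ^ 2) in H by lra.
  assert (hs := sqrt_lt_R0 (C ^ 2 - b ^ 2) ltac:(lra)).
  assert (e := pow2_sqrt (C ^ 2 - b ^ 2) ltac:(lra)).
  set (n := / (C ^ 2 - b ^ 2) - 1) in *; clearbody n.
  set (s := sqrt (C ^ 2 - b ^ 2)) in *.
  replace (4 * Et n * C / s) with (4 * (s * Et n) * C / (C ^ 2 - b ^ 2)).
  - replace (4 * Et n * b / s) with (4 * (s * Et n) * b / (C ^ 2 - b ^ 2)); [exact H|].
    rewrite <- e; field; lra.
  - rewrite <- e; field; lra.
Qed.

Lemma chart1_forward C b : region1 C b ->
  quad1 (X1 C b, Y1 C b, 0) /\ C1q (X1 C b, Y1 C b, 0) = C /\ b1q (X1 C b, Y1 C b, 0) = b /\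
  m1 (X1 C b, Y1 C b, 0) = n1 C b.
Proof.
  intros (r1 & r2 & r3 & r4).
  assert (hs := sqrt_lt_R0 (C ^ 2 - b ^ 2) ltac:(lra)).
  assert (e := pow2_sqrt (C ^ 2 - b ^ 2) ltac:(lra)).
  assert (Hn : 0 < n1 C b).
  { unfold n1; assert (1 < / (C ^ 2 - b ^ 2)); [|lra].
    rewrite <- Rinv_1; apply Rinv_lt_contravar; lra. }
  assert (He := Et_increasing 0 (n1 C b) ltac:(lra) Hn); rewrite Et_0 in He.
  assert (p := PI_RGT_0).
  assert (En : sqrt (1 + n1 C b) = / sqrt (C ^ 2 - b ^ 2)).
  { replace (1 + n1 C b) with (/ (C ^ 2 - b ^ 2)) by (unfold n1; ring); apply sqrt_inv. }
  assert (Eq : X1 C b ^ 2 - Y1 C b ^ 2 = (4 * Et (n1 C b)) ^ 2).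
  { unfold X1, Y1; set (s := sqrt (C ^ 2 - b ^ 2)) in *.
    transitivity ((4 * Et (n1 C b)) ^ 2 * (C ^ 2 - b ^ 2) / s ^ 2); [field; lra|].
    rewrite e; field; lra. }
  assert (Er : rho1 (X1 C b, Y1 C b, 0) = 4 * Et (n1 C b)).
  { unfold rho1, px, py; cbn [fst snd]; rewrite Eq; apply sqrt_pow2; lra. }
  assert (Em : m1 (X1 C b, Y1 C b, 0) = n1 C b) by (unfold m1; rewrite Er; now apply nu1_Et).
  split; [|split; [|split]]; auto.
  - unfold quad1, px, py; cbn [fst snd]; rewrite Eq; split; [|nra].
    unfold X1; apply Rdiv_lt_0_compat; nra.
  - unfold C1q; rewrite Er, Em, En; unfold px; cbn [fst snd]; unfold X1; field; lra.
  - unfold b1q; rewrite Er, Em, En; unfold py; cbn [fst snd]; unfold Y1; field; lra.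
Qed.

Lemma quad1_facts q : quad1 q ->
  2 * PI < rho1 q /\ rho1 q ^ 2 = px q ^ 2 - py q ^ 2 /\ 0 < m1 q /\
  4 * Et (m1 q) = rho1 q /\ 0 < rho1 q * sqrt (1 + m1 q).
Proof.
  intros [H1 H2]; assert (p := PI_RGT_0).
  assert (A : 2 * PI < rho1 q).
  { unfold rho1; rewrite <- (sqrt_pow2 (2 * PI)) by lra; apply sqrt_lt_1_alt; nra. }
  destruct (nu1_spec _ A) as [B D].
  split; [exact A|split; [apply pow2_sqrt; nra|split; [exact B|split; [exact D|]]]].
  apply Rmult_lt_0_compat; [lra|]; apply sqrt_lt_R0; unfold m1; lra.
Qed.

Lemma chart1_backward q : quad1 q -> pz q = 0 ->
  0 < C1q q /\ C1q q ^ 2 - b1q q ^ 2 = / (1 + m1 q) /\ b1q q ^ 2 < C1q q ^ 2 /\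
  C1q q ^ 2 < 1 + b1q q ^ 2 /\
  (X1 (C1q q) (b1q q), Y1 (C1q q) (b1q q), 0) = q /\ n1 (C1q q) (b1q q) = m1 q.
Proof.
  intros Hq Hz; destruct (quad1_facts q Hq) as (A & B & D & E & F).
  assert (p := PI_RGT_0); destruct Hq as [Hx _].
  assert (es := pow2_sqrt (1 + m1 q) ltac:(lra)).
  assert (hs := sqrt_lt_R0 (1 + m1 q) ltac:(lra)).
  assert (Ed : C1q q ^ 2 - b1q q ^ 2 = / (1 + m1 q)).
  { unfold C1q, b1q; set (s := sqrt (1 + m1 q)) in *.
    transitivity ((px q ^ 2 - py q ^ 2) / (rho1 q ^ 2 * s ^ 2)); [field; lra|].
    rewrite es, <- B; field; lra. }
  assert (Hd : 0 < / (1 + m1 q) < 1).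
  { split; [apply Rinv_0_lt_compat; lra|].
    rewrite <- Rinv_1; apply Rinv_lt_contravar; lra. }
  assert (En : n1 (C1q q) (b1q q) = m1 q).
  { unfold n1; rewrite Ed, Rinv_inv; ring. }
  split; [apply Rdiv_lt_0_compat; auto|].
  split; [exact Ed|split; [lra|split; [lra|split; [|exact En]]]].
  unfold X1, Y1; rewrite En, Ed, sqrt_inv, E; unfold C1q, b1q.
  apply eq_trans with (px q, py q, 0).
  - f_equal; f_equal; field; lra.
  - rewrite <- Hz; symmetry; apply R3_eta.
Qed.

Lemma open_quad1 : open quad1.
Proof.
  apply (open_gt (fun _ => (2 * PI) ^ 2) (fun q => px q ^ 2 - py q ^ 2) (fun q => 0 < px q)).
  - apply (open_lt_cinf (fun _ => 0) px); [apply cinf_const|apply cinf_px].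
  - intros v _; apply continuous_const.
  - intros v _; apply (cinf_continuous (fun _ => True)); auto.
    apply cinf_minus; apply cinf_sq; [apply cinf_px|apply cinf_py].
Qed.

Lemma cinf_rho1 : cinf quad1 rho1.
Proof.
  apply cinf_sqrt.
  - intros v [_ H]; assert (p := PI_RGT_0); nra.
  - apply cinf_minus; apply cinf_sq; [apply cinf_px|apply cinf_py].
Qed.

Lemma cinf_m1 : cinf quad1 m1.
Proof. apply cinf_nu1; [apply quad1_facts | apply cinf_rho1]. Qed.

Lemma cinf_sqrt_m1 : cinf quad1 (fun q => sqrt (1 + m1 q)).
Proof.
  apply cinf_sqrt.
  - intros v Hv; destruct (quad1_facts v Hv); lra.
  - apply cinf_plus; [apply cinf_const | apply cinf_m1].
Qed.

Lemma cinf_C1q : cinf quad1 C1q.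
Proof.
  apply cinf_div; [|apply cinf_px|apply cinf_mult; [apply cinf_rho1|apply cinf_sqrt_m1]].
  intros v Hv; destruct (quad1_facts v Hv); lra.
Qed.

Lemma cinf_b1q : cinf quad1 b1q.
Proof.
  apply cinf_div; [|apply cinf_py|apply cinf_mult; [apply cinf_rho1|apply cinf_sqrt_m1]].
  intros v Hv; destruct (quad1_facts v Hv); lra.
Qed.

Lemma T1_Kt C b : region1 C b -> T1 C b = 4 * (Kt (n1 C b) * sqrt (1 + n1 C b)).
Proof.
  intros (r1 & r2 & r3 & r4).
  destruct (C1_of_momenta C b) as (Hk & Ek & _); try lra.
  unfold T1; set (k := sqrt (1 - (C ^ 2 - b ^ 2))) in *.
  rewrite ellK_Kt by auto; destruct (k_of_n k Hk) as (_ & _ & E).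
  replace (k ^ 2 / (1 - k ^ 2)) with (n1 C b) in * by (unfold n1; rewrite Ek; field; lra).
  rewrite E; reflexivity.
Qed.

(** All sets of full periods of oscillations are pieces of one chart; what remains
    for each of them is to match the conditions on [(C, b)] and on [(x, y)]. The
    alternative on [C] separates the open strip, where the angle is a smooth
    function of [C], from the line [C = 1], where it is constant. *)
Lemma diffeo_period1 (A : N -> Prop) (B : R3 -> Prop) (D : R -> R -> Prop) :
  (forall l t, A (l, t) <-> exists C b, D C b /\ l = state_of C b /\ t = T1 C b) ->
  (forall C b, D C b -> region1 C b) ->
  (forall C b, D C b -> C < 1) \/ (forall C b, D C b -> C = 1) ->
  (forall C b, D C b -> B (X1 C b, Y1 C b, 0)) ->
  (forall q, B q -> pz q = 0 /\ quad1 q /\ D (C1q q) (b1q q)) ->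
  diffeomorphism A B Exp.
Proof.
  intros HA HD Hor HB HB'.
  apply (diffeo_base A B D T1 X1 Y1 C1q b1q); auto.
  - intros C b H; apply HD in H; destruct H; lra.
  - intros C b H; apply (reach_Exp _ _ _ _ (reach_T1 C b (HD C b H))).
  - intros C b H; split; [now apply HB|].
    destruct (chart1_forward C b (HD C b H)) as (_ & -> & -> & _); auto.
  - intros q Hq; destruct (HB' q Hq) as (Hz & Q1 & HDq); split; auto.
    apply (chart1_backward q Q1 Hz).
  - intros C b H; destruct (HD C b H) as (r1 & r2 & r3 & r4).
    set (W := fun v : R3 => 0 < px v ^ 2 - py v ^ 2).
    assert (Cd : forall U, cinf U (fun v => px v ^ 2 - py v ^ 2)).
    { intros U; apply cinf_minus; apply cinf_sq; [apply cinf_px|apply cinf_py]. }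
    assert (Cs : cinf W (fun v => sqrt (px v ^ 2 - py v ^ 2))) by now apply cinf_sqrt.
    assert (Ce : cinf W (fun v => Et (n1 (px v) (py v)))).
    { apply cinf_Et.
      - intros v Hv; unfold n1; assert (h := Rinv_0_lt_compat _ Hv); lra.
      - apply cinf_minus; [|apply cinf_const].
        apply cinf_inv; auto; intros v Hv; apply Rgt_not_eq, Hv. }
    exists W, (fun v => X1 (px v) (py v)), (fun v => Y1 (px v) (py v)).
    split; [|split; [|split; [|split]]].
    + apply (open_lt_cinf (fun _ => 0)); [apply cinf_const|apply Cd].
    + unfold W, px, py; cbn [fst snd]; lra.
    + apply cinf_div; auto.
      * intros v Hv; apply Rgt_not_eq, sqrt_lt_R0, Hv.
      * apply cinf_mult; [apply cinf_mult; [apply cinf_const|auto]|apply cinf_px].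
    + apply cinf_div; auto.
      * intros v Hv; apply Rgt_not_eq, sqrt_lt_R0, Hv.
      * apply cinf_mult; [apply cinf_mult; [apply cinf_const|auto]|apply cinf_py].
    + intros; split; reflexivity.
  - intros q Hq; destruct (HB' q Hq) as (Hz & Qq & HDq).
    assert (CT : forall V : R3 -> Prop, (forall v, V v -> quad1 v) ->
      cinf V (fun q => 4 * (Kt (m1 q) * sqrt (1 + m1 q)))).
    { intros V HV; apply (cinf_mono quad1); auto.
      apply cinf_mult; [apply cinf_const|apply cinf_mult; [|apply cinf_sqrt_m1]].
      apply cinf_Kt; [|apply cinf_m1].
      intros v Hv; destruct (quad1_facts v Hv); lra. }
    assert (ET : forall w, B w -> 4 * (Kt (m1 w) * sqrt (1 + m1 w)) = T1 (C1q w) (b1q w)).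
    { intros w Hw; destruct (HB' w Hw) as (Hzw & Qw & HDw).
      rewrite T1_Kt by auto; destruct (chart1_backward w Qw Hzw) as (_ & _ & _ & _ & _ & E).
      now rewrite E. }
    destruct Hor as [Hlt|Heq].
    + exists (fun v => quad1 v /\ C1q v < 1), (fun v => - (2 * acos (C1q v))),
        (fun v => 2 * b1q v), (fun q => 4 * (Kt (m1 q) * sqrt (1 + m1 q))).
      split; [|split; [|split; [|split; [|split]]]].
      * apply (open_gt C1q (fun _ => 1) quad1 open_quad1).
        -- apply (cinf_continuous _ _ cinf_C1q).
        -- intros; apply continuous_const.
      * split; auto; eapply Hlt; eauto.
      * apply cinf_opp, cinf_mult; [apply cinf_const|]; apply cinf_acos.
        -- intros v [Qv Hv]; assert (0 < C1q v); [|lra].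
           apply Rdiv_lt_0_compat; [apply Qv | apply (quad1_facts v Qv)].
        -- apply (cinf_mono quad1); [intros; tauto | apply cinf_C1q].
      * apply cinf_mult; [apply cinf_const|].
        apply (cinf_mono quad1); [intros; tauto | apply cinf_b1q].
      * apply CT; intros; tauto.
      * intros w _ Hw; split; [|split]; auto.
    + exists quad1, (fun v => - (2 * acos 1)),
        (fun v => 2 * b1q v), (fun q => 4 * (Kt (m1 q) * sqrt (1 + m1 q))).
      split; [|split; [|split; [|split; [|split]]]]; auto.
      * apply open_quad1.
      * apply cinf_const.
      * apply cinf_mult; [apply cinf_const|]; apply cinf_b1q.
      * intros w _ Hw; split; [|split]; auto.
        destruct (HB' w Hw) as (_ & _ & HDw); now rewrite (Heq _ _ HDw).
Qed.

(** Where a point of [quad1] lies with respect to the curve [x = x3 y] is decided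
    by comparing the parameters [n], hence by comparing [C] with 1. *)
Lemma quad1_position q : quad1 q -> pz q = 0 -> py q < 0 ->
  (x3 (py q) < px q /\ C1q q < 1) \/ (px q = x3 (py q) /\ C1q q = 1) \/
  (px q < x3 (py q) /\ 1 < C1q q).
Proof.
  intros Hq Hz Hy; destruct (quad1_facts q Hq) as (A & B & D & E & F).
  destruct (chart1_backward q Hq Hz) as (Cp & Ed & _).
  destruct (x3_spec (py q) Hy) as (n & Hn & Ey & ->).
  assert (p := PI_RGT_0); destruct Hq as [Hx _].
  assert (es := pow2_sqrt (1 + m1 q) ltac:(lra)).
  assert (hs := sqrt_lt_R0 (1 + m1 q) ltac:(lra)).
  assert (en := pow2_sqrt n ltac:(lra)); assert (hn := sqrt_lt_R0 n Hn).
  assert (en' := pow2_sqrt (1 + n) ltac:(lra)); assert (hn' := sqrt_lt_R0 (1 + n) ltac:(lra)).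
  assert (PE := Et_pos n ltac:(lra)).
  assert (PE' := Et_pos (m1 q) ltac:(lra)).
  set (x3v := 4 * sqrt (1 + n) * Et n).
  assert (X3p : 0 < x3v) by (unfold x3v; repeat apply Rmult_lt_0_compat; lra).
  assert (Ex : x3v ^ 2 = py q ^ 2 + 16 * Et n ^ 2).
  { replace (py q ^ 2) with ((- py q) ^ 2) by ring; rewrite Ey; unfold x3v.
    transitivity (16 * (sqrt (1 + n) ^ 2) * Et n ^ 2); [ring|]; rewrite en'.
    transitivity (16 * (sqrt n ^ 2) * Et n ^ 2 + 16 * Et n ^ 2); [rewrite en|]; ring. }
  assert (Exq : px q ^ 2 = py q ^ 2 + 16 * Et (m1 q) ^ 2).
  { replace (16 * Et (m1 q) ^ 2) with ((4 * Et (m1 q)) ^ 2) by ring; rewrite E; lra. }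
  assert (EC : C1q q ^ 2 = px q ^ 2 / (16 * Et (m1 q) ^ 2 * (1 + m1 q))).
  { unfold C1q; rewrite <- E; transitivity
      (px q ^ 2 / (16 * Et (m1 q) ^ 2 * sqrt (1 + m1 q) ^ 2)); [field; lra|].
    now rewrite es. }
  assert (Ey2 : py q ^ 2 = 16 * (n * Et n ^ 2)).
  { replace (py q ^ 2) with ((- py q) ^ 2) by ring; rewrite Ey.
    transitivity (16 * (sqrt n ^ 2) * Et n ^ 2); [ring|]; rewrite en; ring. }
  set (m := m1 q) in *; set (c := C1q q) in *; set (x := px q) in *.
  assert (Pm : 0 < 16 * Et m ^ 2 * (1 + m)) by (apply Rmult_lt_0_compat; nra).
  assert (Ec : c ^ 2 * (16 * Et m ^ 2 * (1 + m)) = 16 * (n * Et n ^ 2) + 16 * Et m ^ 2).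
  { rewrite EC, Exq, Ey2; field; split; nra. }
  destruct (Rtotal_order n m) as [L|[L|L]].
  - left; assert (I := Et_increasing n m ltac:(lra) L).
    assert (I2 : Et n ^ 2 < Et m ^ 2) by nra.
    assert (I3 : n * Et n ^ 2 < m * Et m ^ 2) by nra.
    split; [nra|].
    assert (c ^ 2 < 1) by nra; nra.
  - right; left; subst m; rewrite <- L in *.
    split; [nra|].
    assert (c ^ 2 = 1) by nra; nra.
  - right; right; assert (I := Et_increasing m n ltac:(lra) L).
    assert (I2 : Et m ^ 2 < Et n ^ 2) by nra.
    assert (I3 : m * Et m ^ 2 < n * Et n ^ 2) by nra.
    split; [nra|].
    assert (1 < c ^ 2) by nra; nra.
Qed.

Lemma quad1_of_x3 q : py q < 0 -> x3 (py q) <= px q -> quad1 q.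
Proof.
  intros Hy Hx; destruct (x3_spec (py q) Hy) as (n & Hn & Ey & E3).
  rewrite E3 in Hx.
  assert (en := pow2_sqrt n ltac:(lra)); assert (hn := sqrt_lt_R0 n Hn).
  assert (en' := pow2_sqrt (1 + n) ltac:(lra)); assert (hn' := sqrt_lt_R0 (1 + n) ltac:(lra)).
  assert (I := Et_increasing 0 n ltac:(lra) Hn); rewrite Et_0 in I.
  assert (p := PI_RGT_0).
  assert (Ey2 : py q ^ 2 = 16 * (n * Et n ^ 2)).
  { replace (py q ^ 2) with ((- py q) ^ 2) by ring; rewrite Ey.
    transitivity (16 * (sqrt n ^ 2) * Et n ^ 2); [ring|]; rewrite en; ring. }
  assert (X3p : 0 < 4 * sqrt (1 + n) * Et n) by (repeat apply Rmult_lt_0_compat; lra).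
  split; [lra|].
  assert (Ex : (4 * sqrt (1 + n) * Et n) ^ 2 = 16 * (n * Et n ^ 2) + 16 * Et n ^ 2).
  { transitivity (16 * (sqrt (1 + n) ^ 2) * Et n ^ 2); [ring|]; rewrite en'; ring. }
  assert ((4 * sqrt (1 + n) * Et n) ^ 2 <= px q ^ 2) by (apply pow_incr; lra).
  rewrite Ey2; nra.
Qed.

Lemma in_plane_pz P q : in_plane P q <-> pz q = 0 /\ P (px q) (py q).
Proof. destruct q as [[x y] z]; reflexivity. Qed.

Lemma b1q_sign q : quad1 q -> (py q < 0 -> b1q q < 0) /\ (py q = 0 -> b1q q = 0).
Proof.
  intros Hq; destruct (quad1_facts q Hq) as (_ & _ & _ & _ & F).
  unfold b1q; split.
  - intros H; apply Rmult_neg_pos; auto; now apply Rinv_0_lt_compat.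
  - intros ->; unfold Rdiv; ring.
Qed.

Lemma Y1_sign C b : region1 C b -> (b < 0 -> Y1 C b < 0) /\ (b = 0 -> Y1 C b = 0).
Proof.
  intros (r1 & r2 & r3 & r4).
  assert (hs := sqrt_lt_R0 (C ^ 2 - b ^ 2) ltac:(lra)).
  assert (E : 0 < Et (n1 C b)).
  { apply Et_pos; unfold n1; assert (h := Rinv_0_lt_compat (C ^ 2 - b ^ 2)); lra. }
  unfold Y1; split.
  - intros H; apply Rmult_neg_pos; [nra | now apply Rinv_0_lt_compat].
  - intros ->; unfold Rdiv; ring.
Qed.

Lemma dom1_region C b : dom1 C b -> region1 C b.
Proof. unfold dom1, region1; intros; nra. Qed.
Lemma dom17_region C b : dom17 C b -> region1 C b.
Proof. unfold dom17, region1; intros; nra. Qed.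
Lemma dom21_region C b : dom21 C b -> region1 C b.
Proof. unfold dom21, region1; intros; nra. Qed.

Lemma diffeo_1 : diffeomorphism N1 M1 Exp.
Proof.
  apply (diffeo_period1 N1 M1 dom1 N1_iff dom1_region).
  - left; unfold dom1; intros; lra.
  - intros C b H; assert (r := dom1_region _ _ H).
    destruct (chart1_forward C b r) as (Q & EC & _).
    apply in_plane_pz; split; [reflexivity|].
    assert (Yn : py (X1 C b, Y1 C b, 0) < 0) by (apply Y1_sign; auto; apply H).
    split; [exact Yn|].
    destruct (quad1_position _ Q eq_refl Yn) as [P|P]; [apply P|].
    rewrite EC in P; unfold dom1 in H; lra.
  - intros q Hq; apply in_plane_pz in Hq; destruct Hq as (Hz & Hy & Hx).
    assert (Q := quad1_of_x3 q Hy ltac:(lra)).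
    split; [auto|split; [auto|]].
    destruct (chart1_backward q Q Hz) as (Cp & _ & h1 & _).
    assert (B := proj1 (b1q_sign q Q) Hy).
    destruct (quad1_position _ Q Hz Hy) as [P|P]; [|lra].
    unfold dom1; nra.
Qed.

Lemma diffeo_21 : diffeomorphism N21 M21 Exp.
Proof.
  apply (diffeo_period1 N21 M21 dom21 N21_iff dom21_region).
  - right; unfold dom21; intros; lra.
  - intros C b H; assert (r := dom21_region _ _ H).
    destruct (chart1_forward C b r) as (Q & EC & _).
    apply in_plane_pz; split; [reflexivity|].
    assert (Yn : py (X1 C b, Y1 C b, 0) < 0) by (apply Y1_sign; auto; apply H).
    split; [exact Yn|].
    destruct (quad1_position _ Q eq_refl Yn) as [P|[P|P]]; [|apply P|];
      rewrite EC in P; unfold dom21 in H; lra.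
  - intros q Hq; apply in_plane_pz in Hq; destruct Hq as (Hz & Hy & Hx).
    assert (Q := quad1_of_x3 q Hy ltac:(lra)).
    split; [auto|split; [auto|]].
    destruct (chart1_backward q Q Hz) as (Cp & _ & h1 & _).
    assert (B := proj1 (b1q_sign q Q) Hy).
    destruct (quad1_position _ Q Hz Hy) as [P|[P|P]]; try lra.
    unfold dom21; nra.
Qed.

Lemma diffeo_17 : diffeomorphism N17 M17 Exp.
Proof.
  apply (diffeo_period1 N17 M17 dom17 N17_iff dom17_region).
  - left; unfold dom17; intros; lra.
  - intros C b H; assert (r := dom17_region _ _ H).
    destruct (chart1_forward C b r) as (Q & EC & _).
    apply in_plane_pz; split; [reflexivity|].
    assert (Yz : Y1 C b = 0) by (apply Y1_sign; auto; apply H).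
    destruct Q as [Q1 Q2]; unfold px, py in *; cbn [fst snd] in *.
    rewrite Yz in Q2; assert (p := PI_RGT_0); split; [auto|]; nra.
  - intros q Hq; apply in_plane_pz in Hq; destruct Hq as (Hz & Hy & Hx).
    assert (p := PI_RGT_0).
    assert (Q : quad1 q) by (split; rewrite ?Hy; nra).
    split; [auto|split; [auto|]].
    destruct (chart1_backward q Q Hz) as (Cp & _ & _ & h1 & _).
    assert (B := proj2 (b1q_sign q Q) Hy); rewrite B in h1.
    unfold dom17; nra.
Qed.

(** ** Full periods of rotations *)

(** The same construction as for the oscillations; now the multiple is negative and
    [Y2 ^ 2 - X2 ^ 2 = 16 At (n2) ^ 2]. *)
Definition n2 (C b : R) : R := / (b ^ 2 - C ^ 2).
Definition X2 (C b : R) : R := - (4 * sqrt (n2 C b) * At (n2 C b) * C).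
Definition Y2 (C b : R) : R := - (4 * sqrt (n2 C b) * At (n2 C b) * b).

Definition quad2 (q : R3) : Prop := py q < 0 /\ px q ^ 2 < py q ^ 2.
Definition rho2 (q : R3) : R := sqrt (py q ^ 2 - px q ^ 2).
Definition m2 (q : R3) : R := nu2 (rho2 q).
Definition C2q (q : R3) : R := - px q / (rho2 q * sqrt (m2 q)).
Definition b2q (q : R3) : R := - py q / (rho2 q * sqrt (m2 q)).

Lemma region2_facts C b : region2 C b -> 0 < b /\ 0 < b ^ 2 - C ^ 2 /\ 0 < n2 C b.
Proof.
  unfold region2; intros H; assert (0 < b) by lra.
  assert (0 < b ^ 2 - C ^ 2) by nra.
  split; [auto|split; [auto|]]; now apply Rinv_0_lt_compat.
Qed.

Lemma period2_k C b : region2 C b -> let k := / sqrt (1 - (C ^ 2 - b ^ 2)) in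
  0 < k < 1 /\ k ^ 2 / (1 - k ^ 2) = n2 C b /\ cos (- acos C) = C /\
  Del k (- acos C) / k = b.
Proof.
  intros H; destruct (region2_facts C b H) as (Hb & Hd & Hn).
  destruct H as [H1 H2].
  destruct (C2_of_momenta C b) as (Hk & Ek & E1 & E2); try lra.
  cbv zeta; set (k := / sqrt (1 - (C ^ 2 - b ^ 2))) in *.
  split; [exact Hk|split; [|split; [exact E1|exact E2]]].
  unfold n2; replace (b ^ 2 - C ^ 2) with ((/ k) ^ 2 - 1) by lra.
  field; split; nra.
Qed.

Lemma reach_T2 C b : region2 C b -> reach (state_of C b) (T2 C b) (X2 C b, Y2 C b, 0) (state_of C b).
Proof.
  intros H; destruct (period2_k C b H) as (Hk & En & E1 & E2).
  unfold T2, X2, Y2; set (k := / sqrt (1 - (C ^ 2 - b ^ 2))) in *.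
  assert (R := reach_period_C2 k (- acos C) Hk).
  rewrite C2_state_of, E1, E2 in R; auto.
  2:{ apply sin_nonpos; assert (h := acos_bound C); lra. }
  rewrite ella_At in R by auto.
  destruct (k_of_n k Hk) as (Hn & E3 & _); rewrite En in *.
  replace (Del k (- acos C)) with (k * b) in R by (rewrite <- E2; field; lra).
  rewrite E3.
  assert (h : 0 < 1 - k ^ 2) by nra; assert (hs := sqrt_lt_R0 _ h).
  assert (e := pow2_sqrt (1 - k ^ 2) (Rlt_le _ _ h)).
  set (s := sqrt (1 - k ^ 2)) in *.
  replace (- (4 * (k / s) * At (n2 C b) * C)) with
    (- (4 * k * (s * At (n2 C b)) * C / (1 - k ^ 2))) by (rewrite <- e; field; lra).
  replace (- (4 * (k / s) * At (n2 C b) * b)) with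
    (- (4 * (s * At (n2 C b)) * (k * b) / (1 - k ^ 2))) by (rewrite <- e; field; lra).
  exact R.
Qed.

Lemma T2_Kt C b : region2 C b -> T2 C b = 4 * (sqrt (n2 C b) * Kt (n2 C b)).
Proof.
  intros H; destruct (period2_k C b H) as (Hk & En & _).
  unfold T2; set (k := / sqrt (1 - (C ^ 2 - b ^ 2))) in *.
  destruct (k_of_n k Hk) as (_ & E3 & _); rewrite ellK_Kt by auto; rewrite En in *.
  rewrite E3; assert (h : 0 < 1 - k ^ 2) by nra; assert (hs := sqrt_lt_R0 _ h).
  field; lra.
Qed.

Lemma chart2_forward C b : region2 C b ->
  quad2 (X2 C b, Y2 C b, 0) /\ C2q (X2 C b, Y2 C b, 0) = C /\ b2q (X2 C b, Y2 C b, 0) = b /\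
  m2 (X2 C b, Y2 C b, 0) = n2 C b.
Proof.
  intros H; destruct (region2_facts C b H) as (Hb & Hd & Hn).
  assert (A := At_pos _ Hn).
  assert (hs := sqrt_lt_R0 _ Hn); assert (e := pow2_sqrt (n2 C b) ltac:(lra)).
  assert (Eq : Y2 C b ^ 2 - X2 C b ^ 2 = (4 * At (n2 C b)) ^ 2).
  { unfold X2, Y2; transitivity (16 * (sqrt (n2 C b) ^ 2) * At (n2 C b) ^ 2 *
      (b ^ 2 - C ^ 2)); [ring|]; rewrite e; unfold n2 at 1; field; lra. }
  assert (Er : rho2 (X2 C b, Y2 C b, 0) = 4 * At (n2 C b)).
  { unfold rho2, px, py; cbn [fst snd]; rewrite Eq; apply sqrt_pow2; lra. }
  assert (Em : m2 (X2 C b, Y2 C b, 0) = n2 C b) by (unfold m2; rewrite Er; now apply nu2_At).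
  split; [|split; [|split]]; auto.
  - unfold quad2, px, py; cbn [fst snd]; split; [|nra].
    unfold Y2; apply Ropp_lt_gt_0_contravar, Rlt_gt; repeat apply Rmult_lt_0_compat; lra.
  - unfold C2q; rewrite Er, Em; unfold px; cbn [fst snd]; unfold X2; field; lra.
  - unfold b2q; rewrite Er, Em; unfold py; cbn [fst snd]; unfold Y2; field; lra.
Qed.

Lemma quad2_facts q : quad2 q ->
  0 < rho2 q /\ rho2 q ^ 2 = py q ^ 2 - px q ^ 2 /\ 0 < m2 q /\
  4 * At (m2 q) = rho2 q /\ 0 < rho2 q * sqrt (m2 q).
Proof.
  intros [H1 H2].
  assert (A : 0 < rho2 q) by (apply sqrt_lt_R0; lra).
  destruct (nu2_spec _ A) as [B D].
  split; [exact A|split; [apply pow2_sqrt; nra|split; [exact B|split; [exact D|]]]].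
  apply Rmult_lt_0_compat; [lra|]; now apply sqrt_lt_R0.
Qed.

Lemma chart2_backward q : quad2 q -> pz q = 0 ->
  0 < b2q q /\ b2q q ^ 2 - C2q q ^ 2 = / m2 q /\
  (X2 (C2q q) (b2q q), Y2 (C2q q) (b2q q), 0) = q /\ n2 (C2q q) (b2q q) = m2 q.
Proof.
  intros Hq Hz; destruct (quad2_facts q Hq) as (A & B & D & E & F).
  assert (es := pow2_sqrt (m2 q) ltac:(lra)); assert (hs := sqrt_lt_R0 _ D).
  assert (Ed : b2q q ^ 2 - C2q q ^ 2 = / m2 q).
  { unfold C2q, b2q; set (s := sqrt (m2 q)) in *.
    transitivity ((py q ^ 2 - px q ^ 2) / (rho2 q ^ 2 * s ^ 2)); [field; lra|].
    rewrite es, <- B; field; lra. }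
  assert (En : n2 (C2q q) (b2q q) = m2 q) by (unfold n2; rewrite Ed; apply Rinv_inv).
  split; [|split; [exact Ed|split; [|exact En]]].
  - destruct Hq; apply Rdiv_lt_0_compat; lra.
  - unfold X2, Y2; rewrite En.
    replace (4 * sqrt (m2 q) * At (m2 q)) with (rho2 q * sqrt (m2 q)) by (rewrite <- E; ring).
    unfold C2q, b2q; apply eq_trans with (px q, py q, 0).
    + f_equal; f_equal; field; lra.
    + rewrite <- Hz; symmetry; apply R3_eta.
Qed.

Lemma open_quad2 : open quad2.
Proof.
  apply (open_gt (fun q => px q ^ 2) (fun q => py q ^ 2) (fun q => py q < 0)).
  - apply (open_lt_cinf py (fun _ => 0)); [apply cinf_py|apply cinf_const].
  - intros v _; apply (cinf_continuous (fun _ => True)); auto; apply cinf_sq, cinf_px.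
  - intros v _; apply (cinf_continuous (fun _ => True)); auto; apply cinf_sq, cinf_py.
Qed.

Lemma cinf_rho2 : cinf quad2 rho2.
Proof.
  apply cinf_sqrt; [intros v [_ H]; lra|].
  apply cinf_minus; apply cinf_sq; [apply cinf_py|apply cinf_px].
Qed.

Lemma cinf_m2 : cinf quad2 m2.
Proof. apply cinf_nu2; [apply quad2_facts | apply cinf_rho2]. Qed.

Lemma cinf_sqrt_m2 : cinf quad2 (fun q => sqrt (m2 q)).
Proof. apply cinf_sqrt; [apply quad2_facts | apply cinf_m2]. Qed.

Lemma cinf_C2q : cinf quad2 C2q.
Proof.
  apply cinf_div; [|apply cinf_opp, cinf_px|apply cinf_mult; [apply cinf_rho2|apply cinf_sqrt_m2]].
  intros v Hv; destruct (quad2_facts v Hv); lra.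
Qed.

Lemma cinf_b2q : cinf quad2 b2q.
Proof.
  apply cinf_div; [|apply cinf_opp, cinf_py|apply cinf_mult; [apply cinf_rho2|apply cinf_sqrt_m2]].
  intros v Hv; destruct (quad2_facts v Hv); lra.
Qed.

Lemma diffeo_period2 (A : N -> Prop) (B : R3 -> Prop) (D : R -> R -> Prop) :
  (forall l t, A (l, t) <-> exists C b, D C b /\ l = state_of C b /\ t = T2 C b) ->
  (forall C b, D C b -> region2 C b) ->
  (forall C b, D C b -> -1 < C) \/ (forall C b, D C b -> C = -1) ->
  (forall C b, D C b -> B (X2 C b, Y2 C b, 0)) ->
  (forall q, B q -> pz q = 0 /\ quad2 q /\ D (C2q q) (b2q q)) ->
  diffeomorphism A B Exp.
Proof.
  intros HA HD Hor HB HB'.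
  apply (diffeo_base A B D T2 X2 Y2 C2q b2q); auto.
  - intros C b H; apply HD in H; destruct H; lra.
  - intros C b H; apply (reach_Exp _ _ _ _ (reach_T2 C b (HD C b H))).
  - intros C b H; split; [now apply HB|].
    destruct (chart2_forward C b (HD C b H)) as (_ & -> & -> & _); auto.
  - intros q Hq; destruct (HB' q Hq) as (Hz & Q1 & HDq); split; auto.
    apply (chart2_backward q Q1 Hz).
  - intros C b H; destruct (region2_facts C b (HD C b H)) as (_ & Hd & _).
    set (W := fun v : R3 => 0 < py v ^ 2 - px v ^ 2).
    assert (Cd : forall U, cinf U (fun v => py v ^ 2 - px v ^ 2)).
    { intros U; apply cinf_minus; apply cinf_sq; [apply cinf_py|apply cinf_px]. }
    assert (Cn : cinf W (fun v => n2 (px v) (py v))).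
    { apply cinf_inv; auto; intros v Hv; apply Rgt_not_eq, Hv. }
    assert (Pn : forall v, W v -> 0 < n2 (px v) (py v)).
    { intros v Hv; now apply Rinv_0_lt_compat. }
    assert (Cs : cinf W (fun v => 4 * sqrt (n2 (px v) (py v)) * At (n2 (px v) (py v)))).
    { apply cinf_mult; [apply cinf_mult; [apply cinf_const|now apply cinf_sqrt]|].
      apply cinf_At; auto; intros v Hv; specialize (Pn v Hv); lra. }
    exists W, (fun v => X2 (px v) (py v)), (fun v => Y2 (px v) (py v)).
    split; [|split; [|split; [|split]]].
    + apply (open_lt_cinf (fun _ => 0)); [apply cinf_const|apply Cd].
    + exact Hd.
    + apply cinf_opp, cinf_mult; auto; apply cinf_px.
    + apply cinf_opp, cinf_mult; auto; apply cinf_py.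
    + intros; split; reflexivity.
  - intros q Hq; destruct (HB' q Hq) as (Hz & Qq & HDq).
    assert (CT : forall V : R3 -> Prop, (forall v, V v -> quad2 v) ->
      cinf V (fun q => 4 * (sqrt (m2 q) * Kt (m2 q)))).
    { intros V HV; apply (cinf_mono quad2); auto.
      apply cinf_mult; [apply cinf_const|apply cinf_mult; [apply cinf_sqrt_m2|]].
      apply cinf_Kt; [|apply cinf_m2].
      intros v Hv; destruct (quad2_facts v Hv); lra. }
    assert (ET : forall w, B w -> 4 * (sqrt (m2 w) * Kt (m2 w)) = T2 (C2q w) (b2q w)).
    { intros w Hw; destruct (HB' w Hw) as (Hzw & Qw & HDw).
      rewrite T2_Kt by auto; destruct (chart2_backward w Qw Hzw) as (_ & _ & _ & E).
      now rewrite E. }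
    destruct Hor as [Hlt|Heq].
    + exists (fun v => (quad2 v /\ -1 < C2q v) /\ C2q v < 1), (fun v => - (2 * acos (C2q v))),
        (fun v => 2 * b2q v), (fun q => 4 * (sqrt (m2 q) * Kt (m2 q))).
      split; [|split; [|split; [|split; [|split]]]].
      * apply (open_gt C2q (fun _ => 1) (fun v => quad2 v /\ -1 < C2q v)).
        -- apply (open_gt (fun _ => -1) C2q quad2 open_quad2).
           ++ intros; apply continuous_const.
           ++ apply (cinf_continuous _ _ cinf_C2q).
        -- intros v [Hv _]; now apply (cinf_continuous _ _ cinf_C2q).
        -- intros; apply continuous_const.
      * split; [split; auto; eapply Hlt; eauto|].
        apply HD in HDq; destruct HDq; lra.
      * apply cinf_opp, cinf_mult; [apply cinf_const|]; apply cinf_acos; [tauto|].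
        apply (cinf_mono quad2); [intros; tauto | apply cinf_C2q].
      * apply cinf_mult; [apply cinf_const|].
        apply (cinf_mono quad2); [intros; tauto | apply cinf_b2q].
      * apply CT; intros; tauto.
      * intros w _ Hw; split; [|split]; auto.
    + exists quad2, (fun v => - (2 * acos (-1))),
        (fun v => 2 * b2q v), (fun q => 4 * (sqrt (m2 q) * Kt (m2 q))).
      split; [|split; [|split; [|split; [|split]]]]; auto.
      * apply open_quad2.
      * apply cinf_const.
      * apply cinf_mult; [apply cinf_const|]; apply cinf_b2q.
      * intros w _ Hw; split; [|split]; auto.
        destruct (HB' w Hw) as (_ & _ & HDw); now rewrite (Heq _ _ HDw).
Qed.

(** As in [quad1_position]: the curves [x = x2 y] and [x = - x2 y] are the locus
    [C ^ 2 = 1]. *)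
Lemma quad2_position q : quad2 q -> pz q = 0 ->
  0 < x2 (py q) /\
  ((px q ^ 2 < x2 (py q) ^ 2 /\ C2q q ^ 2 < 1) \/
   (px q ^ 2 = x2 (py q) ^ 2 /\ C2q q ^ 2 = 1) \/
   (x2 (py q) ^ 2 < px q ^ 2 /\ 1 < C2q q ^ 2)).
Proof.
  intros Hq Hz; destruct (quad2_facts q Hq) as (A & B & D & E & F).
  destruct Hq as [Hy _].
  destruct (x2_spec (py q) Hy) as (n & Hn & Ey & ->).
  assert (es := pow2_sqrt (m2 q) ltac:(lra)); assert (hs := sqrt_lt_R0 _ D).
  assert (en := pow2_sqrt n ltac:(lra)); assert (hn := sqrt_lt_R0 n Hn).
  assert (en' := pow2_sqrt (1 + n) ltac:(lra)); assert (hn' := sqrt_lt_R0 (1 + n) ltac:(lra)).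
  assert (PE := At_pos n Hn); assert (PE' := At_pos (m2 q) D).
  set (x2v := 4 * sqrt n * At n).
  assert (X2p : 0 < x2v) by (unfold x2v; repeat apply Rmult_lt_0_compat; lra).
  split; [exact X2p|].
  assert (Ex : x2v ^ 2 = 16 * (n * At n ^ 2)).
  { unfold x2v; transitivity (16 * (sqrt n ^ 2) * At n ^ 2); [ring|]; rewrite en; ring. }
  assert (Ey2 : py q ^ 2 = 16 * (n * At n ^ 2) + 16 * At n ^ 2).
  { replace (py q ^ 2) with ((- py q) ^ 2) by ring; rewrite Ey.
    transitivity (16 * (sqrt (1 + n) ^ 2) * At n ^ 2); [ring|]; rewrite en'; ring. }
  assert (Exq : px q ^ 2 = py q ^ 2 - 16 * At (m2 q) ^ 2).
  { replace (16 * At (m2 q) ^ 2) with ((4 * At (m2 q)) ^ 2) by ring; rewrite E; lra. }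
  assert (EC : C2q q ^ 2 * (16 * (m2 q * At (m2 q) ^ 2)) = px q ^ 2).
  { unfold C2q; rewrite <- E.
    transitivity (px q ^ 2 * m2 q / sqrt (m2 q) ^ 2); [field; lra|].
    rewrite es; field; lra. }
  set (m := m2 q) in *; set (c := C2q q) in *; set (x := px q) in *.
  assert (Pm : 0 < 16 * (m * At m ^ 2)) by (apply Rmult_lt_0_compat; nra).
  destruct (Rtotal_order n m) as [L|[L|L]].
  - left; assert (I := At_increasing n m ltac:(lra) L).
    assert (I2 : At n ^ 2 < At m ^ 2) by nra.
    assert (I3 : n * At n ^ 2 < m * At m ^ 2) by nra.
    split; [nra|nra].
  - right; left; subst m; rewrite <- L in *.
    split; [nra|nra].
  - right; right; assert (I := At_increasing m n ltac:(lra) L).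
    assert (I2 : At m ^ 2 < At n ^ 2) by nra.
    assert (I3 : m * At m ^ 2 < n * At n ^ 2) by nra.
    split; [nra|nra].
Qed.

Lemma x2_lt y : y < 0 -> 0 < x2 y < - y.
Proof.
  intros Hy; destruct (x2_spec y Hy) as (n & Hn & -> & ->).
  assert (h := sqrt_lt_R0 n Hn); assert (A := At_pos n Hn).
  assert (s := sqrt_lt_1_alt n (1 + n) ltac:(lra)).
  split; [repeat apply Rmult_lt_0_compat; lra|].
  apply Rmult_lt_compat_r; lra.
Qed.

Lemma C2q_sign q : quad2 q -> (0 < px q -> C2q q < 0) /\ (px q = 0 -> C2q q = 0).
Proof.
  intros Hq; destruct (quad2_facts q Hq) as (_ & _ & _ & _ & F).
  assert (i := Rinv_0_lt_compat _ F).
  unfold C2q; split.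
  - intros H; apply Rmult_neg_pos; lra.
  - intros ->; unfold Rdiv; ring.
Qed.

Lemma X2_sign C b : region2 C b -> (C < 0 -> 0 < X2 C b) /\ (C = 0 -> X2 C b = 0).
Proof.
  intros H; destruct (region2_facts C b H) as (_ & _ & Hn).
  assert (h := sqrt_lt_R0 _ Hn); assert (A := At_pos _ Hn).
  assert (0 < sqrt (n2 C b) * At (n2 C b)) by nra.
  unfold X2; split; [intros; nra | intros ->; ring].
Qed.

Lemma dom9_region C b : dom9 C b -> region2 C b.
Proof. unfold dom9, region2; intros; lra. Qed.
Lemma dom29_region C b : dom29 C b -> region2 C b.
Proof. unfold dom29, region2; intros; lra. Qed.
Lemma dom25_region C b : dom25 C b -> region2 C b.
Proof. unfold dom25, region2; intros; lra. Qed.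

Lemma diffeo_9 : diffeomorphism N9 M9 Exp.
Proof.
  apply (diffeo_period2 N9 M9 dom9 N9_iff dom9_region).
  - left; unfold dom9; intros; lra.
  - intros C b H; assert (r := dom9_region _ _ H).
    destruct (chart2_forward C b r) as (Q & EC & _).
    apply in_plane_pz; split; [reflexivity|].
    split; [apply Q|].
    assert (Xp : 0 < px (X2 C b, Y2 C b, 0)) by (apply X2_sign; auto; apply H).
    split; [exact Xp|].
    destruct (quad2_position _ Q eq_refl) as [P0 P]; rewrite EC in P.
    unfold dom9 in H; destruct P as [P|[P|P]]; nra.
  - intros q Hq; apply in_plane_pz in Hq; destruct Hq as (Hz & Hy & Hx).
    assert (L := x2_lt _ Hy).
    assert (Q : quad2 q) by (split; nra).
    split; [auto|split; [auto|]].
    destruct (chart2_backward q Q Hz) as (Bp & Ed & _).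
    destruct (quad2_facts q Q) as (_ & _ & Pm & _).
    assert (i := Rinv_0_lt_compat _ Pm).
    assert (S := proj1 (C2q_sign q Q) (proj1 Hx)).
    destruct (quad2_position _ Q Hz) as [P0 P].
    assert (C2q q ^ 2 < 1) by (destruct P as [P|[P|P]]; nra).
    unfold dom9; split; nra.
Qed.

Lemma diffeo_29 : diffeomorphism N29 M29 Exp.
Proof.
  apply (diffeo_period2 N29 M29 dom29 N29_iff dom29_region).
  - left; unfold dom29; intros; lra.
  - intros C b H; assert (r := dom29_region _ _ H).
    destruct (chart2_forward C b r) as (Q & EC & _).
    apply in_plane_pz; split; [reflexivity|].
    split; [apply Q|].
    apply X2_sign; auto; apply H.
  - intros q Hq; apply in_plane_pz in Hq; destruct Hq as (Hz & Hy & Hx).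
    assert (Q : quad2 q) by (split; [auto|rewrite Hx; nra]).
    split; [auto|split; [auto|]].
    split; [now apply C2q_sign | now apply chart2_backward].
Qed.

Lemma diffeo_25 : diffeomorphism N25 M25 Exp.
Proof.
  apply (diffeo_period2 N25 M25 dom25 N25_iff dom25_region).
  - right; unfold dom25; intros; lra.
  - intros C b H; assert (r := dom25_region _ _ H).
    destruct (chart2_forward C b r) as (Q & EC & _).
    apply in_plane_pz; split; [reflexivity|].
    split; [apply Q|].
    assert (Xp : 0 < px (X2 C b, Y2 C b, 0)).
    { apply X2_sign; auto; unfold dom25 in H; lra. }
    destruct (quad2_position _ Q eq_refl) as [P0 P]; rewrite EC in P.
    unfold dom25 in H; destruct P as [P|[P|P]]; nra.
  - intros q Hq; apply in_plane_pz in Hq; destruct Hq as (Hz & Hy & Hx).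
    assert (L := x2_lt _ Hy).
    assert (Q : quad2 q) by (split; nra).
    split; [auto|split; [auto|]].
    destruct (chart2_backward q Q Hz) as (Bp & Ed & _).
    destruct (quad2_facts q Q) as (_ & _ & Pm & _).
    assert (i := Rinv_0_lt_compat _ Pm).
    assert (S := proj1 (C2q_sign q Q) ltac:(lra)).
    destruct (quad2_position _ Q Hz) as [P0 P].
    assert (E : C2q q ^ 2 = 1) by (destruct P as [P|[P|P]]; nra).
    assert (E' : C2q q = -1) by nra.
    unfold dom25; split; [auto|nra].
Qed.

(** * The stable equilibrium *)

(** At the stable equilibrium the arc is the segment [x = t] itself, and the
    inverse is the coordinate [x]. *)
Lemma diffeo_equilibrium (A : N -> Prop) (B : R3 -> Prop) (I : R -> Prop) :
  (forall l t, A (l, t) <-> C4_0 l /\ I t) ->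
  (forall q, B q <-> pz q = 0 /\ py q = 0 /\ I (px q)) ->
  diffeomorphism A B Exp.
Proof.
  intros HA HB.
  assert (HE : forall t, Exp ((ang 0, 0), t) = (t, 0, 0)).
  { intros t; apply (reach_Exp _ _ _ _ (reach_C4 t)). }
  split; [|split].
  - intros [l t] H; apply HA in H; destruct H as [-> It]; rewrite HE.
    apply HB; auto.
  - intros v Hv; exists (fun _ => True), (fun w => (pz w, 0, 0)).
    split; [apply open_true|split; [auto|split]].
    + intros n; cbn [fst snd]; split; [|split]; apply sc_class;
        [apply sc_pz|apply sc_const|apply sc_const].
    + intros [[g c] t] _ Hw; apply HA in Hw; destruct Hw as [El _].
      cbn [cov]; unfold C4_0 in El; rewrite El, HE; reflexivity.
  - exists (fun q => ((ang 0, 0), px q)).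
    split; [|split; [|split]].
    + intros q Hq; apply HB in Hq; apply HA; split; [reflexivity | apply Hq].
    + intros [l t] H; apply HA in H; destruct H as [-> It]; rewrite HE; reflexivity.
    + intros q Hq; apply HB in Hq; destruct Hq as (Hz & Hy & _); rewrite HE.
      rewrite <- Hz at 2; rewrite <- Hy at 1; symmetry; apply R3_eta.
    + intros q Hq; exists (fun _ => True), (fun w => (0, 0, px w)).
      split; [apply open_true|split; [auto|split]].
      * intros n; cbn [fst snd]; split; [|split]; apply sc_class;
          [apply sc_const|apply sc_const|apply sc_px].
      * intros w _ _; reflexivity.
Qed.

Lemma diffeo_33 : diffeomorphism N33 M33 Exp.
Proof.
  apply (diffeo_equilibrium N33 M33 (fun t => t = 2 * PI)).
  - intros; reflexivity.
  - intros q; unfold M33; rewrite in_plane_pz; reflexivity.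
Qed.

Lemma diffeo_39 : diffeomorphism N39 M39 Exp.
Proof.
  apply (diffeo_equilibrium N39 M39 (fun t => 0 < t < 2 * PI)).
  - intros; reflexivity.
  - intros q; unfold M39; rewrite in_plane_pz; reflexivity.
Qed.

(** * Two inequalities for incomplete elliptic integrals *)

(** In the Jacobian of the end point map the derivatives of the elliptic integrals
    can be eliminated; what remains are the two combinations [ellS] and [ellN]
    below. They are positive, and the point is to see it up to the amplitude [PI]
    and with enough uniformity to let the modulus tend to 1. *)
Section Elliptic.
Variable k : R.
Hypothesis Hk : 0 < k < 1.

Let s (x : R) := sin x.
Let c (x : R) := cos x.
Let D (x : R) := Del k x.
Let p (x : R) := ellF x k.
Let E (x : R) := ellEi x k.
Let q (x : R) := ellq x k.
Let e (x : R) := c x ^ 2 + D x ^ 2.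

Definition ellS (x : R) : R :=
  cos x ^ 2 * ellq x k + Del k x ^ 2 * ellEi x k - (1 + k ^ 2) * (cos x * sin x * Del k x).
Definition ellN (x : R) : R :=
  1 - (sin x * ellEi x k + cos x * Del k x) * (sin x * ellq x k + cos x * Del k x).

Lemma k'_pos : 0 < 1 - k ^ 2.
Proof. nra. Qed.

Lemma nonneg_of_derive (f df : R -> R) a b :
  (forall x, a <= x <= b -> is_derive f x (df x)) ->
  (forall x, a <= x <= b -> 0 <= df x) -> a <= b -> f a <= f b.
Proof.
  intros Hf Hd [Hab| ->]; [|lra].
  destruct (mvt f df a b Hab Hf) as (x & Hx & Ex); specialize (Hd x Hx); nra.
Qed.

Lemma pos_of_derive (f df : R -> R) a b :
  (forall x, a <= x <= b -> is_derive f x (df x)) ->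
  (forall x, a <= x <= b -> 0 < df x) -> a < b -> f a < f b.
Proof.
  intros Hf Hd Hab.
  destruct (mvt f df a b Hab Hf) as (x & Hx & Ex); specialize (Hd x Hx); nra.
Qed.

Lemma D_pos x : 0 < D x. Proof. now apply Del_pos. Qed.
Lemma D_le_1 x : D x <= 1. Proof. now apply Del_le_1. Qed.
Lemma D_sq x : D x ^ 2 = 1 - k ^ 2 * s x ^ 2. Proof. now apply Del_sq. Qed.
Lemma sc_sq x : s x ^ 2 + c x ^ 2 = 1. Proof. apply sin2_cos2'. Qed.

Lemma dE x : is_derive E x (D x). Proof. now apply ellEi_derive. Qed.
Lemma dq x : is_derive q x (k ^ 2 * c x ^ 2 / D x). Proof. now apply ellq_derive. Qed.
Lemma dD x : is_derive D x (- (k ^ 2 * s x * c x) / D x). Proof. now apply Del_derive. Qed.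
Lemma ds x : is_derive s x (c x). Proof. apply is_derive_sin. Qed.
Lemma dc x : is_derive c x (- s x). Proof. apply is_derive_cos. Qed.

Lemma E_bounds x : 0 <= x -> 0 <= E x <= x.
Proof.
  intros Hx; split.
  - rewrite <- (ellEi_0 k); apply (nonneg_of_derive E D); auto; intros.
    + apply dE.
    + apply Rlt_le, D_pos.
  - assert (H : 0 - E 0 <= x - E x).
    { apply (nonneg_of_derive (fun x => x - E x) (fun x => 1 - D x)); auto; intros y _.
      - apply (@is_derive_minus R_AbsRing R_NormedModule (fun x => x) E).
        + apply (@is_derive_id R_AbsRing).
        + apply dE.
      - assert (h := D_le_1 y); lra. }
    unfold E in *; rewrite ellEi_0 in H; lra.
Qed.

Lemma E_pos x : 0 < x -> 0 < E x.
Proof.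
  intros Hx; rewrite <- (ellEi_0 k); apply (pos_of_derive E D); auto; intros.
  - apply dE.
  - apply D_pos.
Qed.

Lemma ellq_0 : q 0 = 0.
Proof. unfold q, ellq; rewrite ellEi_0, ellF_0; ring. Qed.

Lemma q_bounds x : 0 <= x -> 0 <= q x <= k ^ 2 * x.
Proof.
  intros Hx.
  assert (P : forall y, 0 <= k ^ 2 * c y ^ 2 / D y).
  { intros y; assert (h := D_pos y); apply Rmult_le_pos.
    - apply Rmult_le_pos; apply pow2_ge_0.
    - apply Rlt_le, Rinv_0_lt_compat, h. }
  split.
  - rewrite <- ellq_0; apply (nonneg_of_derive q (fun x => k ^ 2 * c x ^ 2 / D x)); auto; intros.
    apply dq.
  - assert (H : k ^ 2 * 0 - q 0 <= k ^ 2 * x - q x).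
    { apply (nonneg_of_derive (fun x => k ^ 2 * x - q x)
        (fun x => k ^ 2 - k ^ 2 * c x ^ 2 / D x)); auto; intros y _.
      - apply (@is_derive_minus R_AbsRing R_NormedModule (fun x => k ^ 2 * x) q).
        + auto_derive; auto; ring.
        + apply dq.
      - assert (h := D_pos y); assert (h1 := D_le_1 y); assert (h2 := D_sq y).
        assert (h3 := sc_sq y); assert (c y ^ 2 <= D y).
        { assert (z := pow2_ge_0 (s y)); assert (k ^ 2 <= 1) by nra.
          assert (k ^ 2 * s y ^ 2 <= 1 * s y ^ 2) by (apply Rmult_le_compat_r; auto).
          assert (D y ^ 2 <= D y) by nra; lra. }
        replace (k ^ 2 - k ^ 2 * c y ^ 2 / D y) with (k ^ 2 * (D y - c y ^ 2) / D y)
          by (field; lra).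
        apply Rmult_le_pos; [|apply Rlt_le, Rinv_0_lt_compat, h].
        apply Rmult_le_pos; [apply pow2_ge_0 | lra]. }
    rewrite ellq_0 in H; lra.
Qed.

Lemma e_bounds x : 0 < e x <= 2.
Proof.
  unfold e; assert (h := D_pos x); assert (h1 := D_le_1 x); assert (h3 := sc_sq x).
  assert (z := pow2_ge_0 (s x)); assert (z' := pow2_ge_0 (c x)); split; nra.
Qed.

(** The quotient S / e is a primitive of a function that is visibly positive
    up to the quarter period, and that carries the factor [(1 - k^2)^2]. The
    same factor divides [ellS] and [ellN] in the derivatives of the end point, so
    that the estimates become uniform up to the separatrix [k = 1]. *)
Lemma ellS_quotient_derive x : is_derive (fun x => ellS x / e x) x
  (2 * (1 - k ^ 2) ^ 2 * s x * (s x + p x * c x * D x) / (e x ^ 2 * D x)).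
Proof.
  assert (hD := D_pos x); assert (he := proj1 (e_bounds x)).
  assert (a1 := dE x); assert (a2 := dq x); assert (a3 := dD x).
  assert (a4 := ds x); assert (a5 := dc x).
  assert (hq : q x = E x - (1 - k ^ 2) * p x) by reflexivity.
  assert (i1 := D_sq x); assert (i2 := sc_sq x).
  set (dS := - (2 * c x * s x) * q x + c x ^ 2 * (k ^ 2 * c x ^ 2 / D x)
     + (2 * D x * (- (k ^ 2 * s x * c x) / D x)) * E x + D x ^ 2 * D x
     - (1 + k ^ 2) * ((- s x * s x + c x * c x) * D x + c x * s x * (- (k ^ 2 * s x * c x) / D x))).
  set (de := - (2 * c x * s x) + 2 * D x * (- (k ^ 2 * s x * c x) / D x)).
  assert (HS : is_derive ellS x dS).
  { unfold ellS; fold (c x); change (is_derive (fun x => c x ^ 2 * q x + D x ^ 2 * E x -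
      (1 + k ^ 2) * (c x * s x * D x)) x dS).
    clearbody s c D E q; auto_derive.
    - repeat split; eexists; eauto.
    - rewrite (Derive_eq _ _ _ a1), (Derive_eq _ _ _ a2), (Derive_eq _ _ _ a3),
        (Derive_eq _ _ _ a4), (Derive_eq _ _ _ a5); unfold dS; ring. }
  assert (He : is_derive e x de).
  { unfold e; clearbody s c D E q; auto_derive.
    - repeat split; eexists; eauto.
    - rewrite (Derive_eq _ _ _ a3), (Derive_eq _ _ _ a5); unfold de; ring. }
  replace (2 * (1 - k ^ 2) ^ 2 * s x * (s x + p x * c x * D x) / (e x ^ 2 * D x)) with
    ((dS * e x - ellS x * de) / e x ^ 2).
  - apply is_derive_div; auto; lra.
  - apply Rmult_eq_reg_r with (e x ^ 2 * D x); [|apply Rgt_not_eq, Rmult_lt_0_compat; [apply pow_lt|]; auto].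
    transitivity ((dS * D x) * e x - ellS x * (de * D x)); [field; lra|].
    transitivity (2 * (1 - k ^ 2) ^ 2 * s x * (s x + p x * c x * D x)); [|field; lra].
    replace (dS * D x) with (- (2 * c x * s x) * q x * D x + c x ^ 2 * (k ^ 2 * c x ^ 2)
     + (2 * D x * (- (k ^ 2 * s x * c x))) * E x + D x ^ 2 * D x ^ 2
     - (1 + k ^ 2) * ((- s x * s x + c x * c x) * D x ^ 2 + c x * s x * (- (k ^ 2 * s x * c x))))
     by (unfold dS; field; lra).
    replace (de * D x) with (- (2 * c x * s x) * D x + 2 * D x * (- (k ^ 2 * s x * c x)))
      by (unfold de; field; lra).
    change (ellS x) with (c x ^ 2 * q x + D x ^ 2 * E x - (1 + k ^ 2) * (c x * s x * D x)).
    unfold e; rewrite hq.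
    assert (j : s x ^ 2 = 1 - c x ^ 2) by lra; rewrite j in i1; ring [j i1].
Qed.

(** The derivative of [S / e] is at least [2 (1 - k^2)^2 s^2 / (e^2 D)], and
    [e <= 2], [D <= 1]; so it dominates [(1 - k^2)^2] times the derivative
    [s^2 c / 2] of [s^3 / 6]. *)
Lemma ellS_lower x : 0 <= x <= PI / 2 ->
  (c x ^ 2 + D x ^ 2) * ((1 - k ^ 2) ^ 2 * (s x ^ 3 / 6)) <= ellS x.
Proof.
  intros Hx; assert (kp := k'_pos); assert (he := proj1 (e_bounds x)).
  assert (L : ellS 0 / e 0 - (1 - k ^ 2) ^ 2 * (s 0 ^ 3 / 6) <=
     ellS x / e x - (1 - k ^ 2) ^ 2 * (s x ^ 3 / 6)).
  { apply (nonneg_of_derive (fun x => ellS x / e x - (1 - k ^ 2) ^ 2 * (s x ^ 3 / 6))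
     (fun x => 2 * (1 - k ^ 2) ^ 2 * s x * (s x + p x * c x * D x) / (e x ^ 2 * D x) -
        (1 - k ^ 2) ^ 2 * (s x ^ 2 * c x / 2))); [| |lra].
    - intros y Hy.
      apply (@is_derive_minus R_AbsRing R_NormedModule (fun x => ellS x / e x)
        (fun x => (1 - k ^ 2) ^ 2 * (s x ^ 3 / 6))); [apply ellS_quotient_derive|].
      assert (a4 := ds y); clearbody s; auto_derive; [eexists; eauto|].
      rewrite (Derive_eq _ _ _ a4); field.
    - intros y Hy.
      assert (hs : 0 <= s y) by (apply sin_ge_0; lra).
      assert (hc : 0 <= c y) by (apply cos_ge_0; lra).
      assert (hc1 : c y <= 1) by apply COS_bound.
      assert (hD := D_pos y); assert (hD1 := D_le_1 y); assert (hE := e_bounds y).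
      assert (hp : 0 <= p y).
      { destruct (proj1 Hy) as [P| <-].
        - apply Rlt_le; unfold p; rewrite <- (ellF_0 k); now apply ellF_lt.
        - unfold p; rewrite ellF_0; lra. }
      replace (_ - _) with ((1 - k ^ 2) ^ 2 * s y *
        (2 * (s y + p y * c y * D y) / (e y ^ 2 * D y) - s y * c y / 2))
        by (field; lra).
      apply Rmult_le_pos; [apply Rmult_le_pos; [apply pow2_ge_0|auto]|].
      assert (P1 : 0 <= p y * c y * D y) by (repeat apply Rmult_le_pos; lra).
      assert (P2 : 0 < e y ^ 2 * D y) by (apply Rmult_lt_0_compat; [apply pow_lt|]; lra).
      assert (P3 : e y ^ 2 * D y <= 4) by (assert (e y ^ 2 <= 4) by nra; nra).
      assert (P4 : s y * c y / 2 <= 2 * s y / (e y ^ 2 * D y)).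
      { apply Rmult_le_reg_r with (e y ^ 2 * D y); auto.
        replace (2 * s y / (e y ^ 2 * D y) * (e y ^ 2 * D y)) with (2 * s y) by (field; lra).
        assert (0 <= s y * c y <= s y) by nra; nra. }
      assert (P5 : 0 <= 2 * (p y * c y * D y) / (e y ^ 2 * D y)).
      { apply Rmult_le_pos; [lra|]; apply Rlt_le, Rinv_0_lt_compat; auto. }
      replace (2 * (s y + p y * c y * D y) / (e y ^ 2 * D y)) with
        (2 * s y / (e y ^ 2 * D y) + 2 * (p y * c y * D y) / (e y ^ 2 * D y)) by (field; lra).
      lra. }
  assert (Z : ellS 0 = 0).
  { unfold ellS; fold (q 0); rewrite ellEi_0, ellq_0, sin_0; ring. }
  rewrite Z in L; unfold s at 1 in L; rewrite sin_0 in L.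
  replace (0 / e 0 - (1 - k ^ 2) ^ 2 * (0 ^ 3 / 6)) with 0 in L
    by (unfold Rdiv; ring).
  fold (e x); apply Rmult_le_reg_r with (/ e x); [now apply Rinv_0_lt_compat|].
  unfold Rdiv at 1 in L.
  replace (e x * ((1 - k ^ 2) ^ 2 * (s x ^ 3 / 6)) * / e x) with
    ((1 - k ^ 2) ^ 2 * (s x ^ 3 / 6)) by (field; lra); lra.
Qed.

(** Beyond the quarter period the cosine is negative, and no term of [ellS] is. *)
Lemma ellS_pos x : 0 < x < PI -> 0 < ellS x.
Proof.
  intros Hx; assert (kp := k'_pos).
  assert (hs : 0 < s x) by (apply sin_gt_0; lra).
  destruct (Rle_or_lt x (PI / 2)) as [L|L].
  - eapply Rlt_le_trans; [|apply ellS_lower; lra].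
    assert (he := proj1 (e_bounds x)); fold (e x).
    apply Rmult_lt_0_compat; auto; apply Rmult_lt_0_compat; [now apply pow_lt|].
    assert (0 < s x ^ 3) by (apply pow_lt; auto); lra.
  - assert (hc : c x < 0) by (apply cos_lt_0; lra).
    assert (hD := D_pos x); assert (hE := E_pos x (proj1 Hx)).
    assert (hq := q_bounds x ltac:(lra)).
    unfold ellS; fold (c x) (s x) (D x) (E x) (q x).
    assert (0 <= c x ^ 2 * q x) by (apply Rmult_le_pos; [apply pow2_ge_0|lra]).
    assert (0 < D x ^ 2 * E x) by (apply Rmult_lt_0_compat; [apply pow_lt|]; auto).
    assert (0 < - c x * s x * D x) by (repeat apply Rmult_lt_0_compat; lra).
    assert (0 < (1 + k ^ 2) * (- c x * s x * D x)) by (apply Rmult_lt_0_compat; nra).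
    lra.
Qed.

(** After division by [s^2] the derivative of [ellN] reproduces [ellS]. *)
Lemma ellN_quotient_derive x : s x <> 0 ->
  is_derive (fun x => ellN x / s x ^ 2) x (ellS x / (s x ^ 2 * D x)).
Proof.
  intros hs; assert (hD := D_pos x).
  assert (a1 := dE x); assert (a2 := dq x); assert (a3 := dD x).
  assert (a4 := ds x); assert (a5 := dc x).
  assert (i1 := D_sq x); assert (i2 := sc_sq x).
  set (dN := - ((c x * E x - k ^ 2 * s x * c x ^ 2 / D x) * (s x * q x + c x * D x) +
     (s x * E x + c x * D x) * (c x * q x - s x * D x))).
  assert (HN : is_derive ellN x dN).
  { change (is_derive (fun x => 1 - (s x * E x + c x * D x) * (s x * q x + c x * D x)) x dN).
    clearbody s c D E q; auto_derive.
    - repeat split; eexists; eauto.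
    - rewrite (Derive_eq _ _ _ a1), (Derive_eq _ _ _ a2), (Derive_eq _ _ _ a3),
        (Derive_eq _ _ _ a4), (Derive_eq _ _ _ a5); unfold dN; field; lra. }
  assert (Hs : is_derive (fun x => s x ^ 2) x (2 * s x * c x)).
  { clearbody s; auto_derive; [eexists; eauto|]; rewrite (Derive_eq _ _ _ a4); ring. }
  replace (ellS x / (s x ^ 2 * D x)) with
    ((dN * s x ^ 2 - ellN x * (2 * s x * c x)) / (s x ^ 2) ^ 2).
  - apply is_derive_div; auto; apply pow_nonzero; auto.
  - apply Rmult_eq_reg_r with (s x ^ 3 * D x).
    2:{ apply Rmult_integral_contrapositive; split; [apply pow_nonzero; auto|lra]. }
    transitivity ((dN * D x) * s x - 2 * c x * D x * ellN x); [field; try split; auto; lra|].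
    transitivity (s x * ellS x); [|field; try split; auto; lra].
    replace (dN * D x) with (- ((c x * E x * D x - k ^ 2 * s x * c x ^ 2) *
      (s x * q x + c x * D x) + (s x * E x + c x * D x) * (c x * q x - s x * D x) * D x))
      by (unfold dN; field; lra).
    change (ellS x) with (c x ^ 2 * q x + D x ^ 2 * E x - (1 + k ^ 2) * (c x * s x * D x)).
    change (ellN x) with (1 - (s x * E x + c x * D x) * (s x * q x + c x * D x)).
    assert (j : s x ^ 2 = 1 - c x ^ 2) by lra; rewrite j in i1; ring [j i1].
Qed.

Lemma x_cos_le_sin x : 0 <= x <= PI / 2 -> x * cos x <= sin x.
Proof.
  intros Hx; assert (L : sin 0 - 0 * cos 0 <= sin x - x * cos x).
  { apply (nonneg_of_derive (fun x => sin x - x * cos x) (fun x => x * sin x)); [| |lra].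
    - intros y _; auto_derive; auto; ring.
    - intros y Hy; apply Rmult_le_pos; [lra|]; apply sin_ge_0; lra. }
  rewrite sin_0 in L; lra.
Qed.

(** An initial value for the integration of the derivative of [N / s^2], whose
    limit at 0 is 0. *)
Lemma ellN_near_0 x : 0 < x < PI / 2 -> - (2 * x ^ 2) <= ellN x / s x ^ 2.
Proof.
  intros Hx.
  assert (hs : 0 < s x) by (apply sin_gt_0; lra).
  assert (hc : 0 < c x) by (apply cos_gt_0; lra).
  assert (hD := D_pos x); assert (hD1 := D_le_1 x).
  assert (i1 := D_sq x); assert (i2 := sc_sq x).
  assert (hE := E_bounds x ltac:(lra)); assert (hq := q_bounds x ltac:(lra)).
  assert (xs := x_cos_le_sin x ltac:(lra)); fold (c x) (s x) in xs.
  assert (sx : s x <= x) by (apply Rlt_le, sin_lt_x; lra).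
  assert (EM : ellN x / s x ^ 2 = (1 + k ^ 2) - k ^ 2 * s x ^ 2 - E x * q x
     - (c x * (E x + q x) / s x) * D x).
  { apply Rmult_eq_reg_r with (s x ^ 2); [|apply pow_nonzero; lra].
    transitivity (ellN x); [field; lra|].
    transitivity ((1 + k ^ 2) * s x ^ 2 - k ^ 2 * s x ^ 4 - E x * q x * s x ^ 2 -
      c x * s x * (E x + q x) * D x); [|field; lra].
    change (ellN x) with (1 - (s x * E x + c x * D x) * (s x * q x + c x * D x)).
    assert (j : s x ^ 2 = 1 - c x ^ 2) by lra; rewrite j in i1; ring [j i1]. }
  rewrite EM.
  assert (k2 : 0 <= k ^ 2 <= 1) by nra.
  assert (B1 : c x * (E x + q x) / s x <= 1 + k ^ 2).
  { apply Rmult_le_reg_r with (s x); auto.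
    replace (c x * (E x + q x) / s x * s x) with (c x * (E x + q x)) by (field; lra).
    apply Rle_trans with (c x * ((1 + k ^ 2) * x)).
    - apply Rmult_le_compat_l; lra.
    - replace (c x * ((1 + k ^ 2) * x)) with ((1 + k ^ 2) * (x * c x)) by ring.
      apply Rmult_le_compat_l; lra. }
  assert (B0 : 0 <= c x * (E x + q x) / s x).
  { apply Rmult_le_pos; [apply Rmult_le_pos; lra|apply Rlt_le, Rinv_0_lt_compat, hs]. }
  assert (B2 : (c x * (E x + q x) / s x) * D x <= 1 + k ^ 2).
  { apply Rle_trans with ((c x * (E x + q x) / s x) * 1); [|lra].
    apply Rmult_le_compat_l; auto. }
  assert (B3 : E x * q x <= x ^ 2).
  { apply Rle_trans with (x * (k ^ 2 * x)); [apply Rmult_le_compat; lra|]; nra. }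
  assert (B4 : k ^ 2 * s x ^ 2 <= x ^ 2).
  { apply Rle_trans with (1 * s x ^ 2); [apply Rmult_le_compat_r; [apply pow2_ge_0|lra]|].
    nra. }
  lra.
Qed.

(** By [ellS_lower] and [2 c D <= c^2 + D^2] the derivative of [N / s^2] is at least
    that of [(1 - k^2)^2 s^2 / 6]. *)
Lemma ellN_lower x : 0 < x <= PI / 2 ->
  (1 - k ^ 2) ^ 2 * (s x ^ 4 / 6) <= ellN x.
Proof.
  intros Hx; assert (kp := k'_pos).
  assert (hs : 0 < s x) by (apply sin_gt_0; lra).
  set (K := (1 - k ^ 2) ^ 2).
  assert (HK : 0 < K <= 1) by (unfold K; assert (h := pow2_ge_0 k); nra).
  set (M := fun x => ellN x / s x ^ 2 - K * (s x ^ 2 / 6)).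
  assert (mono : forall y, 0 < y < x -> M y <= M x).
  { intros y Hy; apply (nonneg_of_derive M
      (fun x => ellS x / (s x ^ 2 * D x) - K * (s x * c x / 3))); [| |lra].
    - intros z Hz; assert (hz : 0 < s z) by (apply sin_gt_0; lra).
      apply (@is_derive_minus R_AbsRing R_NormedModule (fun x => ellN x / s x ^ 2)
        (fun x => K * (s x ^ 2 / 6))); [apply ellN_quotient_derive; lra|].
      assert (a4 := ds z); clearbody s; auto_derive; [eexists; eauto|].
      rewrite (Derive_eq _ _ _ a4); field.
    - intros z Hz; assert (hz : 0 < s z) by (apply sin_gt_0; lra).
      assert (hc : 0 <= c z) by (apply cos_ge_0; lra).
      assert (hD := D_pos z).
      assert (L := ellS_lower z ltac:(lra)); fold K in L.
      assert (AM : 2 * (c z * D z) <= c z ^ 2 + D z ^ 2).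
      { assert (h := pow2_ge_0 (c z - D z)); lra. }
      assert (P : 0 < s z ^ 2 * D z) by (apply Rmult_lt_0_compat; [apply pow_lt|]; auto).
      assert (P3 : 0 < s z ^ 3) by (apply pow_lt; auto).
      assert (L2 : K * (s z * c z / 3) * (s z ^ 2 * D z) <= ellS z).
      { eapply Rle_trans; [|exact L].
        replace (K * (s z * c z / 3) * (s z ^ 2 * D z)) with
          ((2 * (c z * D z)) * (K * (s z ^ 3 / 6))) by field.
        apply Rmult_le_compat_r; auto; apply Rmult_le_pos; lra. }
      assert (K * (s z * c z / 3) <= ellS z / (s z ^ 2 * D z)); [|lra].
      apply Rmult_le_reg_r with (s z ^ 2 * D z); auto.
      replace (ellS z / (s z ^ 2 * D z) * (s z ^ 2 * D z)) with (ellS z); auto.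
      field; split; lra. }
  assert (Mx : 0 <= M x).
  { destruct (Rle_or_lt 0 (M x)) as [L|L]; auto; exfalso.
    (* so small that [M y >= - (2 y ^ 2 + y ^ 2 / 6)] exceeds [M x] *)
    set (y := Rmin (x / 2) (Rmin (1 / 2) (- M x / 4))).
    assert (Hy : 0 < y) by (unfold y; repeat apply Rmin_glb_lt; lra).
    assert (y1 : y <= x / 2) by apply Rmin_l.
    assert (y2 : y <= 1 / 2) by (eapply Rle_trans; [apply Rmin_r|apply Rmin_l]).
    assert (y3 : y <= - M x / 4) by (eapply Rle_trans; [apply Rmin_r|apply Rmin_r]).
    assert (A := mono y ltac:(lra)).
    assert (B := ellN_near_0 y ltac:(lra)).
    assert (C : s y <= y) by (apply Rlt_le, sin_lt_x; lra).
    assert (C0 : 0 < s y) by (apply sin_gt_0; lra).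
    unfold M at 1 in A.
    assert (s y ^ 2 <= y ^ 2) by nra.
    assert (K * (s y ^ 2 / 6) <= y ^ 2 / 6).
    { apply Rle_trans with (1 * (s y ^ 2 / 6)); [|lra].
      apply Rmult_le_compat_r; [|lra]; assert (h := pow2_ge_0 (s y)); lra. }
    assert (y ^ 2 <= y / 2) by nra.
    lra. }
  unfold M in Mx.
  assert (P : 0 < s x ^ 2) by (apply pow_lt; auto).
  assert (F : K * (s x ^ 2 / 6) * s x ^ 2 <= ellN x / s x ^ 2 * s x ^ 2)
    by (apply Rmult_le_compat_r; lra).
  replace (ellN x / s x ^ 2 * s x ^ 2) with (ellN x) in F by (field; lra).
  replace (K * (s x ^ 4 / 6)) with (K * (s x ^ 2 / 6) * s x ^ 2) by field; exact F.
Qed.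

Lemma ellN_pos x : 0 < x < PI -> 0 < ellN x.
Proof.
  intros Hx; assert (kp := k'_pos); assert (p2 := PI2_pos).
  assert (low : forall y, 0 < y <= PI / 2 -> 0 < ellN y).
  { intros y Hy; assert (hs : 0 < s y) by (apply sin_gt_0; lra).
    eapply Rlt_le_trans; [|now apply ellN_lower].
    apply Rmult_lt_0_compat; [now apply pow_lt|].
    assert (0 < s y ^ 4) by (now apply pow_lt); lra. }
  destruct (Rle_or_lt x (PI / 2)) as [L|L]; [apply low; lra|].
  assert (A : ellN (PI / 2) / s (PI / 2) ^ 2 < ellN x / s x ^ 2).
  { apply (pos_of_derive (fun x => ellN x / s x ^ 2)
      (fun x => ellS x / (s x ^ 2 * D x))); auto.
    - intros z Hz; apply ellN_quotient_derive, Rgt_not_eq, sin_gt_0; lra.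
    - intros z Hz; assert (hz : 0 < s z) by (apply sin_gt_0; lra).
      apply Rdiv_lt_0_compat; [apply ellS_pos; lra|].
      apply Rmult_lt_0_compat; [now apply pow_lt | apply D_pos]. }
  assert (B := low (PI / 2) ltac:(lra)).
  assert (s2 : 0 < s (PI / 2) ^ 2) by (unfold s; rewrite sin_PI2; lra).
  assert (hs : 0 < s x) by (apply sin_gt_0; lra).
  assert (sx : 0 < s x ^ 2) by now apply pow_lt.
  assert (B' : 0 < ellN (PI / 2) / s (PI / 2) ^ 2) by now apply Rdiv_lt_0_compat.
  assert (A' : 0 < ellN x / s x ^ 2) by lra.
  replace (ellN x) with (ellN x / s x ^ 2 * s x ^ 2) by (field; lra).
  now apply Rmult_lt_0_compat.
Qed.
End Elliptic.

(** * Quadratures regular at the separatrix *)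

(** On a symmetric arc the half angle runs from [- a] to [a]. With
    [mu = sin a ^ 2 + b ^ 2], which is constant, one has [b = beta] and [dt = da / beta],
    so that half the time and half the quadratures of the arc are integrals over
    the half angle. In contrast with Legendre's form, nothing special happens in
    them at the separatrix [mu = 1]; they fail only where [b] vanishes, that is, on
    part of the oscillations. *)

Definition beta (v : R3) : R := sqrt (px v - sin (py v) ^ 2).
Definition VA (v : R3) : Prop := 0 < px v - sin (py v) ^ 2 /\ 0 < cos (py v) + beta v.
Definition UA (v : R3) : Prop :=
  ((0 < px v - sin (py v) ^ 2 /\ 0 < cos (py v) + beta v) /\ - PI < py v) /\ py v < PI.

Definition fR (v : R3) : R := / beta v.
Definition fI (v : R3) : R := cos (py v) ^ 2 / beta v.
Definition fP (v : R3) : R := cos (py v) / ((cos (py v) + beta v) * beta v).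

Definition V0 (v : R3) : Prop := 0 < px v - sin (py v) ^ 2.

Lemma cinf_beta_arg U : cinf U (fun v => px v - sin (py v) ^ 2).
Proof. apply cinf_minus; [apply cinf_px|apply cinf_sq, cinf_sin, cinf_py]. Qed.

Lemma open_V0 : open V0.
Proof.
  apply (open_lt_cinf (fun _ => 0) (fun v => px v - sin (py v) ^ 2));
    [apply cinf_const|apply cinf_beta_arg].
Qed.

Lemma cinf_beta : cinf V0 beta.
Proof. apply cinf_sqrt; [auto|apply cinf_beta_arg]. Qed.

Lemma open_VA : open VA.
Proof.
  apply (open_gt (fun _ => 0) (fun v => cos (py v) + beta v) V0 open_V0).
  - intros; apply continuous_const.
  - apply cinf_continuous, cinf_plus; [apply cinf_cos, cinf_py|apply cinf_beta].
Qed.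

Lemma open_UA : open UA.
Proof.
  apply (open_gt py (fun _ => PI) (fun v => VA v /\ - PI < py v)).
  - apply (open_gt (fun _ => - PI) py VA open_VA); intros;
      [apply continuous_const|apply continuous_py].
  - intros; apply continuous_py.
  - intros; apply continuous_const.
Qed.

Lemma beta_pos v : V0 v -> 0 < beta v.
Proof. intros H; now apply sqrt_lt_R0. Qed.

Lemma beta_sq v : V0 v -> beta v ^ 2 = px v - sin (py v) ^ 2.
Proof. intros H; apply pow2_sqrt; unfold V0 in H; lra. Qed.

Lemma beta_eq mu t z : beta (mu, t, z) = sqrt (mu - sin t ^ 2).
Proof. reflexivity. Qed.

Lemma VA_of_gt1 mu t z : 1 < mu -> VA (mu, t, z).
Proof.
  intros H; assert (h := sin2_cos2' t); assert (h1 := pow2_ge_0 (cos t)).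
  assert (H0 : V0 (mu, t, z)) by (unfold V0, px, py; cbn [fst snd]; lra).
  split; [exact H0|].
  assert (b1 := beta_pos _ H0); assert (b2 := beta_sq _ H0).
  unfold px, py in *; cbn [fst snd] in *; nra.
Qed.

Lemma VA_of_acute mu t z : - (PI / 2) <= t <= PI / 2 -> sin t ^ 2 < mu -> VA (mu, t, z).
Proof.
  intros Ht H.
  assert (H0 : V0 (mu, t, z)) by (unfold V0, px, py; cbn [fst snd]; lra).
  split; [exact H0|].
  assert (b1 := beta_pos _ H0); unfold py; cbn [fst snd].
  assert (h := cos_ge_0 t ltac:(lra) ltac:(lra)); lra.
Qed.

(** If the cosine is negative, [0 < cos + beta] amounts to [cos ^ 2 < beta ^ 2], that
    is, to [1 < mu]. *)
Lemma UA_cases mu t z : UA (mu, t, z) ->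
  1 < mu \/ (- (PI / 2) <= t <= PI / 2 /\ sin t ^ 2 < mu).
Proof.
  intros (((H0 & H1) & H2) & H3).
  assert (b1 := beta_pos _ H0); assert (b2 := beta_sq _ H0).
  unfold px, py in *; cbn [fst snd] in *.
  assert (h := sin2_cos2' t).
  destruct (Rle_or_lt 0 (cos t)) as [L|L].
  - right; split; [|lra].
    split.
    + destruct (Rle_or_lt (- (PI / 2)) t) as [A|A]; auto.
      assert (c := cos_neg_open t ltac:(lra)); lra.
    + destruct (Rle_or_lt t (PI / 2)) as [A|A]; auto.
      assert (c := cos_lt_0 t A ltac:(lra)); lra.
  - left; nra.
Qed.

Lemma segments_UA : segments UA VA.
Proof.
  intros mu a z H t Ht.
  destruct (UA_cases mu a z H) as [L|[L1 L2]]; [now apply VA_of_gt1|].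
  assert (Hs : Rabs (sin t) <= Rabs (sin a)).
  { unfold Rmin, Rmax in Ht; destruct (Rle_dec 0 a) as [P|P].
    - assert (0 <= sin t) by (apply sin_ge_0; lra).
      assert (0 <= sin a) by (apply sin_ge_0; lra).
      rewrite !Rabs_right by lra; apply sin_incr_1; lra.
    - assert (sin t <= 0) by (apply sin_nonpos; lra).
      assert (sin a <= 0) by (apply sin_nonpos; lra).
      rewrite !Rabs_left1 by lra; apply Ropp_le_contravar, sin_incr_1; lra. }
  apply VA_of_acute.
  - unfold Rmin, Rmax in Ht; destruct (Rle_dec 0 a); lra.
  - rewrite <- (pow2_abs (sin t)); rewrite <- (pow2_abs (sin a)) in L2.
    assert (h := Rabs_pos (sin t)); nra.
Qed.

Lemma VA_V0 v : VA v -> V0 v. Proof. intros H; apply H. Qed.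

Lemma cinf_fR : cinf VA fR.
Proof.
  apply cinf_inv; [intros v Hv; apply Rgt_not_eq, beta_pos, VA_V0, Hv|].
  apply (cinf_mono V0); [exact VA_V0|apply cinf_beta].
Qed.

Lemma cinf_fI : cinf VA fI.
Proof.
  apply cinf_div; [intros v Hv; apply Rgt_not_eq, beta_pos, VA_V0, Hv| |].
  - apply cinf_sq, cinf_cos, cinf_py.
  - apply (cinf_mono V0); [exact VA_V0|apply cinf_beta].
Qed.

Lemma cinf_fP : cinf VA fP.
Proof.
  assert (cb : cinf VA beta) by (apply (cinf_mono V0); [exact VA_V0|apply cinf_beta]).
  apply cinf_div.
  - intros v Hv; apply Rgt_not_eq, Rmult_lt_0_compat; [apply Hv|apply beta_pos, VA_V0, Hv].
  - apply cinf_cos, cinf_py.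
  - apply cinf_mult; auto; apply cinf_plus; auto; apply cinf_cos, cinf_py.
Qed.

Lemma cinf_cut_A f : cinf VA f -> cinf UA (cut_int f).
Proof. intros H; exact (sc_cut_int UA VA f open_UA open_VA segments_UA H). Qed.

Lemma cut_A_derive f mu a : cinf VA f -> UA (mu, a, 0) ->
  is_derive (fun s => cut_int f (mu, s, 0)) a (f (mu, a, 0)).
Proof.
  intros Hf H; apply (derive_cut_int_y UA VA f mu a 0); auto.
  - apply open_UA.
  - apply segments_UA.
  - apply (cinf_continuous _ _ Hf).
Qed.

Lemma cut_int_0 f mu : cut_int f (mu, 0, 0) = 0.
Proof. apply RInt_0_0. Qed.

Lemma eq_of_derive_on (f g df : R -> R) a : 0 <= a ->
  (forall t, 0 <= t <= a -> is_derive f t (df t)) ->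
  (forall t, 0 <= t <= a -> is_derive g t (df t)) -> f 0 = g 0 -> f a = g a.
Proof.
  intros [Ha| <-] Hf Hg E; auto.
  destruct (mvt (fun t => f t - g t) (fun _ => 0) 0 a Ha) as (c & _ & H); [|lra].
  intros t Ht; replace 0 with (df t - df t) by ring.
  apply (@is_derive_minus R_AbsRing R_NormedModule); auto.
Qed.

Lemma UA_segment mu a t : 0 <= a -> UA (mu, a, 0) -> 0 <= t <= a -> UA (mu, t, 0).
Proof.
  intros Ha H Ht; assert (V := segments_UA mu a 0 H t).
  rewrite Rmin_left, Rmax_right in V by auto; specialize (V Ht).
  destruct H as (_ & H); assert (p := PI_RGT_0).
  unfold py in *; cbn [fst snd] in *.
  split; [split; [exact V|]|]; unfold py; cbn [fst snd]; lra.
Qed.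

Lemma UA_VA v : UA v -> VA v. Proof. intros H; apply H. Qed.

(** The product [(cos + beta) (cos - beta)] is the constant [1 - mu]. *)
Lemma cut_fP mu a : 0 <= a -> UA (mu, a, 0) -> mu <> 1 ->
  cut_int fP (mu, a, 0) = (cut_int fI (mu, a, 0) - sin a) / (1 - mu).
Proof.
  intros Ha H Hmu.
  apply (eq_of_derive_on (fun t => cut_int fP (mu, t, 0))
    (fun t => (cut_int fI (mu, t, 0) - sin t) / (1 - mu)) (fun t => fP (mu, t, 0))); auto.
  - intros t Ht; apply cut_A_derive; [apply cinf_fP|]; now apply (UA_segment mu a).
  - intros t Ht; assert (Ut := UA_segment mu a t Ha H Ht).
    assert (Vt := UA_VA _ Ut).
    replace (fP (mu, t, 0)) with ((fI (mu, t, 0) - cos t) / (1 - mu)).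
    + apply (derive_div_const (fun t => cut_int fI (mu, t, 0) - sin t)).
      apply (@is_derive_minus R_AbsRing R_NormedModule (fun t => cut_int fI (mu, t, 0)) sin).
      * apply cut_A_derive; [apply cinf_fI|exact Ut].
      * apply is_derive_sin.
    + assert (b1 := beta_pos _ (VA_V0 _ Vt)); assert (b2 := beta_sq _ (VA_V0 _ Vt)).
      assert (b3 := proj2 Vt); assert (h := sin2_cos2' t).
      unfold fI, fP; unfold px, py in *; cbn [fst snd] in *.
      set (b := beta (mu, t, 0)) in *.
      assert (E : 1 - mu = (cos t - b) * (cos t + b)).
      { replace ((cos t - b) * (cos t + b)) with (cos t ^ 2 - b ^ 2) by ring; lra. }
      rewrite E in *; field.
      split; [lra|split; [lra|]]; intros Z; apply Hmu.
      assert (1 - mu = 0) by (rewrite E, Z; ring); lra.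
  - rewrite !cut_int_0, sin_0; unfold Rdiv; ring.
Qed.

(** Differentiation under the integral sign produces [- cos ^ 2 / (2 beta ^ 3)],
    which is, up to the derivative of [sin cos / beta], a combination of the
    integrands of [I] and [r]: the usual reduction of elliptic integrals. *)
Lemma cut_fI_derive_mu mu a : 0 <= a -> UA (mu, a, 0) -> 0 < mu ->
  is_derive (fun s => cut_int fI (s, a, 0)) mu
    ((cut_int fI (mu, a, 0) - cut_int fR (mu, a, 0) - sin a * cos a / beta (mu, a, 0))
       / (2 * mu)).
Proof.
  intros Ha H Hmu.
  destruct (cinf_partials VA fI open_VA cinf_fI) as (Hp & F1 & _ & _).
  assert (ED : forall t, VA (mu, t, 0) ->
     D1 fI (mu, t, 0) = - (cos t ^ 2 / (2 * beta (mu, t, 0) ^ 3))).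
  { intros t Vt; assert (b1 := beta_pos _ (VA_V0 _ Vt)).
    unfold D1, px, py, pz; cbn [fst snd]; apply is_derive_unique.
    replace (- (cos t ^ 2 / (2 * beta (mu, t, 0) ^ 3))) with
      (cos t ^ 2 * (- (1 / (2 * beta (mu, t, 0))) / beta (mu, t, 0) ^ 2)) by (field; lra).
    apply (is_derive_scal (fun s => / beta (s, t, 0))).
    apply is_derive_inv; [|exact (Rgt_not_eq _ _ b1)].
    apply (is_derive_sqrt (fun s => s - sin t ^ 2)).
    - auto_derive; auto; ring.
    - apply (VA_V0 _ Vt). }
  assert (Der : is_derive (fun s => cut_int fI (s, a, 0)) mu (cut_int (D1 fI) (mu, a, 0))).
  { apply (derive_cut_int_x UA VA fI (D1 fI) (D2 fI) (D3 fI)); auto.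
    - apply open_UA.
    - apply open_VA.
    - apply segments_UA.
    - apply (cinf_continuous _ _ cinf_fI).
    - apply (cinf_continuous _ _ F1). }
  replace (_ / (2 * mu)) with (cut_int (D1 fI) (mu, a, 0)); [exact Der|].
  apply (eq_of_derive_on (fun t => cut_int (D1 fI) (mu, t, 0))
    (fun t => (cut_int fI (mu, t, 0) - cut_int fR (mu, t, 0) -
       sin t * cos t / beta (mu, t, 0)) / (2 * mu)) (fun t => D1 fI (mu, t, 0))); auto.
  - intros t Ht; apply cut_A_derive; [exact F1|]; now apply (UA_segment mu a).
  - intros t Ht; assert (Ut := UA_segment mu a t Ha H Ht).
    assert (Vt := UA_VA _ Ut).
    assert (b1 := beta_pos _ (VA_V0 _ Vt)); assert (b2 := beta_sq _ (VA_V0 _ Vt)).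
    rewrite ED by auto.
    assert (Db : is_derive (fun t => beta (mu, t, 0)) t
       (- (2 * sin t * cos t) / (2 * beta (mu, t, 0)))).
    { apply (is_derive_sqrt (fun t => mu - sin t ^ 2)).
      - auto_derive; auto; ring.
      - apply (VA_V0 _ Vt). }
    assert (Dn : is_derive (fun t => sin t * cos t) t (cos t * cos t - sin t * sin t)).
    { auto_derive; auto; ring. }
    replace (- (cos t ^ 2 / (2 * beta (mu, t, 0) ^ 3))) with
     ((fI (mu, t, 0) - fR (mu, t, 0) -
       ((cos t * cos t - sin t * sin t) * beta (mu, t, 0) -
        (sin t * cos t) * (- (2 * sin t * cos t) / (2 * beta (mu, t, 0)))) /
         beta (mu, t, 0) ^ 2) / (2 * mu)).
    + apply (derive_div_const (fun t => cut_int fI (mu, t, 0) - cut_int fR (mu, t, 0) -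
        sin t * cos t / beta (mu, t, 0))).
      apply (@is_derive_minus R_AbsRing R_NormedModule
        (fun t => cut_int fI (mu, t, 0) - cut_int fR (mu, t, 0))
        (fun t => sin t * cos t / beta (mu, t, 0))).
      * apply (@is_derive_minus R_AbsRing R_NormedModule
          (fun t => cut_int fI (mu, t, 0)) (fun t => cut_int fR (mu, t, 0)));
          apply cut_A_derive; auto; [apply cinf_fI|apply cinf_fR].
      * apply (is_derive_div (fun t => sin t * cos t) (fun t => beta (mu, t, 0))); auto.
        exact (Rgt_not_eq _ _ b1).
    + unfold fI, fR, py; cbn [fst snd].
      unfold px, py in b2; cbn [fst snd] in b2.
      assert (h := sin2_cos2' t); set (b := beta (mu, t, 0)) in *.
      assert (E : mu = b ^ 2 + sin t ^ 2) by lra.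
      apply Rmult_eq_reg_r with (2 * mu * b ^ 3).
      2:{ apply Rgt_not_eq; repeat apply Rmult_lt_0_compat; try lra; now apply pow_lt. }
      transitivity (cos t ^ 2 * b ^ 2 - b ^ 2 - (cos t * cos t - sin t * sin t) * b ^ 2
        - sin t ^ 2 * cos t ^ 2); [field; lra|].
      transitivity (- (cos t ^ 2 * mu)); [|field; lra].
      assert (j : sin t ^ 2 = 1 - cos t ^ 2) by lra.
      rewrite E; ring [j].
  - rewrite !cut_int_0, sin_0; unfold Rdiv; ring.
Qed.

(** ** Comparison with Legendre's integrals *)

Lemma UA_C1 k psi : 0 < k < 1 -> 0 <= psi < PI / 2 ->
  UA (k ^ 2, asin (k * sin psi), 0) /\ beta (k ^ 2, asin (k * sin psi), 0) = k * cos psi.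
Proof.
  intros Hk Hp; assert (h := SIN_bound psi); assert (p := PI_RGT_0).
  assert (B := asin_bound (k * sin psi)).
  assert (hc : 0 < cos psi) by (apply cos_gt_0; lra).
  assert (e := sin2_cos2' psi).
  assert (S : sin (asin (k * sin psi)) = k * sin psi) by now apply sin_asin_k.
  assert (E : k ^ 2 - (k * sin psi) ^ 2 = (k * cos psi) ^ 2).
  { transitivity (k ^ 2 * (1 - sin psi ^ 2)); [ring|].
    replace (1 - sin psi ^ 2) with (cos psi ^ 2) by lra; ring. }
  assert (P : 0 < (k * cos psi) ^ 2) by (apply pow_lt; nra).
  split.
  - assert (V := VA_of_acute (k ^ 2) (asin (k * sin psi)) 0 ltac:(lra)).
    rewrite S in V; specialize (V ltac:(lra)).
    split; [split; [exact V|]|]; unfold py; cbn [fst snd]; lra.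
  - rewrite beta_eq, S, E; apply sqrt_pow2; nra.
Qed.

Lemma cut_C1_derive f k psi : cinf VA f -> 0 < k < 1 -> 0 <= psi < PI / 2 ->
  is_derive (fun t => cut_int f (k ^ 2, asin (k * sin t), 0)) psi
    ((k * cos psi / Del k psi) * f (k ^ 2, asin (k * sin psi), 0)).
Proof.
  intros Hf Hk Hp; destruct (UA_C1 k psi Hk Hp) as [U _].
  apply (@is_derive_comp R_AbsRing R_NormedModule (fun s => cut_int f (k ^ 2, s, 0))
    (fun t => asin (k * sin t))); [now apply cut_A_derive|].
  assert (h := SIN_bound psi).
  replace (k * cos psi / Del k psi) with
    ((k * cos psi) * / sqrt (1 - k * sin psi * (k * sin psi))).
  - apply (@is_derive_comp R_AbsRing R_NormedModule asin (fun t => k * sin t)).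
    + apply is_derive_asin; nra.
    + auto_derive; auto; ring.
  - unfold Rdiv; do 2 f_equal; unfold Del; f_equal; ring.
Qed.

Lemma cut_C1 k psi : 0 < k < 1 -> 0 <= psi < PI / 2 ->
  cut_int fR (k ^ 2, asin (k * sin psi), 0) = ellF psi k /\
  cut_int fI (k ^ 2, asin (k * sin psi), 0) = ellEi psi k.
Proof.
  intros Hk Hp.
  assert (a0 : asin (k * sin 0) = 0) by (rewrite sin_0, Rmult_0_r; apply asin_0).
  assert (hc : forall t, 0 <= t <= psi -> 0 < k * cos t).
  { intros t Ht; assert (0 < cos t) by (apply cos_gt_0; lra); nra. }
  split.
  - apply (eq_of_derive_on (fun t => cut_int fR (k ^ 2, asin (k * sin t), 0))
      (fun t => ellF t k) (fun t => / Del k t)); [lra| | |].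
    + intros t Ht; assert (c := hc t Ht); assert (d := Del_pos k t Hk).
      replace (/ Del k t) with ((k * cos t / Del k t) * fR (k ^ 2, asin (k * sin t), 0)).
      * apply cut_C1_derive; auto; [apply cinf_fR|lra].
      * unfold fR; rewrite (proj2 (UA_C1 k t Hk ltac:(lra))); field; split; try lra; nra.
    + intros; now apply ellF_derive.
    + now rewrite a0, cut_int_0, ellF_0.
  - apply (eq_of_derive_on (fun t => cut_int fI (k ^ 2, asin (k * sin t), 0))
      (fun t => ellEi t k) (fun t => Del k t)); [lra| | |].
    + intros t Ht; assert (c := hc t Ht); assert (d := Del_pos k t Hk).
      replace (Del k t) with ((k * cos t / Del k t) * fI (k ^ 2, asin (k * sin t), 0)).
      * apply cut_C1_derive; auto; [apply cinf_fI|lra].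
      * unfold fI; rewrite (proj2 (UA_C1 k t Hk ltac:(lra))); unfold py; cbn [fst snd].
        rewrite cos_asin_k by auto; field; split; try lra; nra.
    + intros; now apply ellEi_derive.
    + now rewrite a0, cut_int_0, ellEi_0.
Qed.

Lemma beta_C2 k t : 0 < k < 1 -> beta ((/ k) ^ 2, t, 0) = Del k t / k.
Proof.
  intros Hk; rewrite beta_eq; assert (d := Del_pos k t Hk).
  replace ((/ k) ^ 2 - sin t ^ 2) with ((Del k t / k) ^ 2).
  - apply sqrt_pow2, Rlt_le, Rdiv_lt_0_compat; lra.
  - replace ((Del k t / k) ^ 2) with (Del k t ^ 2 * (/ k) ^ 2) by (field; lra).
    rewrite Del_sq by auto; field; lra.
Qed.

Lemma UA_C2 k psi : 0 < k < 1 -> - PI < psi < PI -> UA ((/ k) ^ 2, psi, 0).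
Proof.
  intros Hk Hp; assert (1 < / k) by (rewrite <- Rinv_1; apply Rinv_lt_contravar; lra).
  split; [split; [apply VA_of_gt1; nra|]|]; unfold py; cbn [fst snd]; lra.
Qed.

Lemma cut_C2 k psi : 0 < k < 1 -> 0 <= psi < PI ->
  cut_int fR ((/ k) ^ 2, psi, 0) = k * ellF psi k /\
  cut_int fI ((/ k) ^ 2, psi, 0) = ellq psi k / k.
Proof.
  intros Hk Hp; split.
  - apply (eq_of_derive_on (fun t => cut_int fR ((/ k) ^ 2, t, 0))
      (fun t => k * ellF t k) (fun t => fR ((/ k) ^ 2, t, 0))); [lra| | |].
    + intros t Ht; apply cut_A_derive; [apply cinf_fR|apply UA_C2; auto; lra].
    + intros t Ht; unfold fR; rewrite beta_C2 by auto; assert (d := Del_pos k t Hk).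
      replace (/ (Del k t / k)) with (k * / Del k t) by (field; lra).
      apply is_derive_scal; now apply ellF_derive.
    + rewrite cut_int_0, ellF_0; ring.
  - apply (eq_of_derive_on (fun t => cut_int fI ((/ k) ^ 2, t, 0))
      (fun t => ellq t k / k) (fun t => fI ((/ k) ^ 2, t, 0))); [lra| | |].
    + intros t Ht; apply cut_A_derive; [apply cinf_fI|apply UA_C2; auto; lra].
    + intros t Ht; unfold fI; rewrite beta_C2 by auto; assert (d := Del_pos k t Hk).
      unfold py; cbn [fst snd].
      replace (cos t ^ 2 / (Del k t / k)) with ((k ^ 2 * cos t ^ 2 / Del k t) / k)
        by (field; lra).
      apply (derive_div_const (fun t => ellq t k)); now apply ellq_derive.
    + rewrite cut_int_0, ellq_0 by auto; unfold Rdiv; ring.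
Qed.

Lemma beta_C3 t : - (PI / 2) < t < PI / 2 -> beta (1, t, 0) = cos t.
Proof.
  intros Ht; rewrite beta_eq; assert (h := sin2_cos2' t).
  replace (1 - sin t ^ 2) with (cos t ^ 2) by lra; apply sqrt_pow2, Rlt_le, cos_gt_0; lra.
Qed.

Lemma cut_C3 a : 0 <= a < PI / 2 ->
  cut_int fR (1, a, 0) = ln ((1 + sin a) / cos a) /\
  cut_int fI (1, a, 0) = sin a /\ cut_int fP (1, a, 0) = cut_int fR (1, a, 0) / 2.
Proof.
  intros Ha.
  assert (U : forall t, 0 <= t <= a -> UA (1, t, 0)).
  { intros t Ht; assert (c : 0 < cos t) by (apply cos_gt_0; lra).
    assert (h := sin2_cos2' t); assert (0 < cos t ^ 2) by now apply pow_lt.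
    split; [split; [apply VA_of_acute; lra|]|]; unfold py; cbn [fst snd]; lra. }
  assert (hc : forall t, 0 <= t <= a -> 0 < cos t) by (intros; apply cos_gt_0; lra).
  assert (hs : forall t, 0 <= t <= a -> 0 <= sin t) by (intros; apply sin_ge_0; lra).
  split; [|split].
  - apply (eq_of_derive_on (fun t => cut_int fR (1, t, 0))
      (fun t => ln ((1 + sin t) / cos t)) (fun t => / cos t)); [lra| | |].
    + intros t Ht; replace (/ cos t) with (fR (1, t, 0)).
      * apply cut_A_derive; [apply cinf_fR|auto].
      * unfold fR; rewrite beta_C3 by lra; reflexivity.
    + intros t Ht; specialize (hc t Ht); specialize (hs t Ht); auto_derive.
      * split; [lra|]; split; [|auto]; apply Rdiv_lt_0_compat; lra.
      * assert (j : sin t ^ 2 = 1 - cos t ^ 2) by (assert (h := sin2_cos2' t); lra).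
        field_simplify_eq; [ring [j]|lra].
    + rewrite cut_int_0, sin_0, cos_0; replace ((1 + 0) / 1) with 1 by field.
      symmetry; apply ln_1.
  - apply (eq_of_derive_on (fun t => cut_int fI (1, t, 0)) sin cos); [lra| | |].
    + intros t Ht; specialize (hc t Ht); replace (cos t) with (fI (1, t, 0)).
      * apply cut_A_derive; [apply cinf_fI|auto].
      * unfold fI; rewrite beta_C3 by lra; unfold py; cbn [fst snd]; field; lra.
    + intros; apply is_derive_sin.
    + now rewrite cut_int_0, sin_0.
  - apply (eq_of_derive_on (fun t => cut_int fP (1, t, 0))
      (fun t => cut_int fR (1, t, 0) / 2) (fun t => / cos t / 2)); [lra| | |].
    + intros t Ht; specialize (hc t Ht); replace (/ cos t / 2) with (fP (1, t, 0)).
      * apply cut_A_derive; [apply cinf_fP|auto].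
      * unfold fP; rewrite beta_C3 by lra; unfold py; cbn [fst snd]; field; lra.
    + intros t Ht; apply (derive_div_const (fun t => cut_int fR (1, t, 0))).
      replace (/ cos t) with (fR (1, t, 0)).
      * apply cut_A_derive; [apply cinf_fR|auto].
      * unfold fR; rewrite beta_C3 by lra; reflexivity.
    + rewrite !cut_int_0; unfold Rdiv; ring.
Qed.

(** * Symmetric arcs in momentum coordinates *)

(** Points of R^3 stand for momenta: the first coordinate is [b = c / 2], the
    second [C = cos (gamma / 2)]; the third one is a dummy. The order puts first the
    variable in which the height of the end point is to be inverted. [mu] is
    [(h + 1) / 2] for the energy [h], and [delta = 1 - mu] vanishes on the
    separatrix. *)
Definition mu (v : R3) : R := 1 - py v ^ 2 + px v ^ 2.
Definition delta (v : R3) : R := py v ^ 2 - px v ^ 2.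
Definition sg (v : R3) : R := sqrt (1 - py v ^ 2).
Definition uu (v : R3) : R := py v + px v.

(** Half the time [r], the half integral [I] of [cos ^ 2] and the end point [(x, y)]
    of the symmetric arc, in two charts: [rA] etc. by the regular quadratures, for
    [b > 0], and [rB] etc. by Legendre's integrals, for the oscillations. They
    overlap, and together cover all the momenta [OM] of symmetric arcs. *)
Definition rA (v : R3) : R := cut_int fR (mu v, acos (py v), 0).
Definition IA (v : R3) : R := cut_int fI (mu v, acos (py v), 0).
Definition PA (v : R3) : R := cut_int fP (mu v, acos (py v), 0).
Definition xA (v : R3) : R := uu v * PA v + (IA v + sg v) / uu v.
Definition yA (v : R3) : R := uu v * PA v - (IA v + sg v) / uu v.

Definition kB (v : R3) : R := sqrt (mu v).
Definition pB (v : R3) : R := acos (px v / kB v).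
Definition rB (v : R3) : R := ellF (pB v) (kB v).
Definition IB (v : R3) : R := ellEi (pB v) (kB v).
Definition xB (v : R3) : R := 2 * (py v * IB v - px v * sg v) / delta v.
Definition yB (v : R3) : R := 2 * (px v * IB v - sg v * py v) / delta v.

Definition glue (f g : R3 -> R) (v : R3) : R := if Rlt_dec 0 (px v) then f v else g v.
Definition rO := glue rA rB.
Definition IO := glue IA IB.
Definition xO := glue xA xB.
Definition yO := glue yA yB.

Definition strip (v : R3) : Prop := -1 < py v /\ py v < 1.
Definition OM (v : R3) : Prop := strip v /\ - py v < px v.
Definition WA (v : R3) : Prop := OM v /\ 0 < px v.
Definition WB (v : R3) : Prop := OM v /\ px v < py v.

Lemma open_strip : open strip.
Proof.
  apply (open_gt py (fun _ => 1) (fun v => -1 < py v)).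
  - apply (open_lt_cinf (fun _ => -1) py); [apply cinf_const|apply cinf_py].
  - intros; apply continuous_py.
  - intros; apply continuous_const.
Qed.

Lemma open_OM : open OM.
Proof.
  apply (open_gt (fun v => - py v) px strip open_strip).
  - apply cinf_continuous, cinf_opp, cinf_py.
  - intros; apply continuous_px.
Qed.

Lemma open_WA : open WA.
Proof.
  apply (open_gt (fun _ => 0) px OM open_OM).
  - intros; apply continuous_const.
  - intros; apply continuous_px.
Qed.

Lemma open_WB : open WB.
Proof.
  apply (open_gt px py OM open_OM).
  - intros; apply continuous_px.
  - intros; apply continuous_py.
Qed.

Lemma sg_pos v : strip v -> 0 < sg v.
Proof. intros [H1 H2]; apply sqrt_lt_R0; nra. Qed.

Lemma sg_sq v : strip v -> sg v ^ 2 = 1 - py v ^ 2.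
Proof. intros [H1 H2]; apply pow2_sqrt; nra. Qed.

Lemma mu_sq v : strip v -> mu v = sg v ^ 2 + px v ^ 2.
Proof. intros H; rewrite sg_sq by auto; unfold mu; ring. Qed.

Lemma mu_pos v : strip v -> 0 < mu v.
Proof. intros H; rewrite mu_sq by auto; assert (h := sg_pos v H); nra. Qed.

Lemma cinf_mu U : cinf U mu.
Proof.
  apply cinf_plus; [apply cinf_minus; [apply cinf_const|]|]; apply cinf_sq;
    [apply cinf_py|apply cinf_px].
Qed.

Lemma cinf_delta U : cinf U delta.
Proof. apply cinf_minus; apply cinf_sq; [apply cinf_py|apply cinf_px]. Qed.

Lemma cinf_sg : cinf strip sg.
Proof.
  apply cinf_sqrt; [intros v [H1 H2]; nra|].
  apply cinf_minus; [apply cinf_const|apply cinf_sq, cinf_py].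
Qed.

Lemma cinf_uu U : cinf U uu.
Proof. apply cinf_plus; [apply cinf_py|apply cinf_px]. Qed.

Lemma sin_acos_sg v : strip v -> sin (acos (py v)) = sg v.
Proof.
  intros [H1 H2]; rewrite sin_acos by lra; unfold sg, Rsqr; f_equal; ring.
Qed.

Lemma acos_open x : -1 < x < 1 -> 0 < acos x < PI.
Proof. apply acos_bound_lt. Qed.

Lemma WA_UA v : WA v -> UA (mu v, acos (py v), 0) /\ beta (mu v, acos (py v), 0) = px v.
Proof.
  intros [[[H1 H2] H3] H4].
  assert (B := acos_open (py v) ltac:(lra)).
  assert (S : strip v) by (split; auto).
  assert (E : mu v - sin (acos (py v)) ^ 2 = px v ^ 2).
  { rewrite sin_acos_sg, mu_sq by auto; ring. }
  assert (Eb : beta (mu v, acos (py v), 0) = px v).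
  { rewrite beta_eq, E; apply sqrt_pow2; lra. }
  split; [|exact Eb].
  split; [split; [split|]|].
  - change (0 < mu v - sin (acos (py v)) ^ 2); rewrite E; now apply pow_lt.
  - change (0 < cos (acos (py v)) + beta (mu v, acos (py v), 0)).
    rewrite Eb, cos_acos by lra; lra.
  - change (- PI < acos (py v)); lra.
  - change (acos (py v) < PI); lra.
Qed.

Lemma cinf_cutA f : cinf VA f -> cinf WA (fun v => cut_int f (mu v, acos (py v), 0)).
Proof.
  intros Hf; apply (cinf_comp WA UA (cut_int f) mu (fun v => acos (py v)) (fun _ => 0)).
  - apply open_UA.
  - intros v Hv; now apply WA_UA.
  - now apply cinf_cut_A.
  - apply cinf_mu.
  - apply cinf_acos; [|apply cinf_py]; intros v [[H _] _]; exact H.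
  - apply cinf_const.
Qed.

Lemma WA_strip v : WA v -> strip v. Proof. intros H; apply H. Qed.
Lemma WA_uu v : WA v -> 0 < uu v. Proof. intros [[_ H] _]; unfold uu; lra. Qed.

Lemma cinf_QA : cinf WA (fun v => (IA v + sg v) / uu v).
Proof.
  apply cinf_div; [intros v Hv; apply Rgt_not_eq, WA_uu, Hv| |apply cinf_uu].
  apply cinf_plus; [apply cinf_cutA, cinf_fI|].
  apply (cinf_mono strip); [exact WA_strip|apply cinf_sg].
Qed.

Lemma cinf_xA : cinf WA xA.
Proof.
  apply cinf_plus; [|apply cinf_QA].
  apply cinf_mult; [apply cinf_uu|apply cinf_cutA, cinf_fP].
Qed.

Lemma cinf_yA : cinf WA yA.
Proof.
  apply cinf_minus; [|apply cinf_QA].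
  apply cinf_mult; [apply cinf_uu|apply cinf_cutA, cinf_fP].
Qed.

Lemma delta_mu v : delta v = 1 - mu v.
Proof. unfold delta, mu; ring. Qed.

Lemma delta_uu v : delta v = uu v * (py v - px v).
Proof. unfold delta, uu; ring. Qed.

Lemma xA_formula v : WA v -> delta v <> 0 ->
  xA v = 2 * (py v * IA v - px v * sg v) / delta v /\
  yA v = 2 * (px v * IA v - sg v * py v) / delta v.
Proof.
  intros Hv Hd; assert (Hu := WA_uu v Hv).
  destruct (WA_UA v Hv) as [U _].
  assert (Hm : mu v <> 1) by (intros E; apply Hd; rewrite delta_mu, E; ring).
  assert (EP := cut_fP (mu v) (acos (py v)) (proj1 (acos_bound (py v))) U Hm).
  fold (PA v) (IA v) in EP; rewrite sin_acos_sg, <- delta_mu in EP by (now apply WA_strip).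
  assert (Hw : py v - px v <> 0).
  { intros E; apply Hd; rewrite delta_uu, E; ring. }
  unfold xA, yA; rewrite EP, delta_uu; unfold uu in *; split; field; split; auto; lra.
Qed.

(** ** Legendre's integrals as functions of amplitude and modulus *)

Definition UK (v : R3) : Prop := 0 < px v /\ px v < 1.
Definition Dl (v : R3) : R := Del (px v) (py v).
Definition FF (v : R3) : R := ellF (py v) (px v).
Definition EE (v : R3) : R := ellEi (py v) (px v).

Lemma open_UK : open UK.
Proof.
  apply (open_gt px (fun _ => 1) (fun v => 0 < px v)).
  - apply (open_lt_cinf (fun _ => 0) px); [apply cinf_const|apply cinf_px].
  - intros; apply continuous_px.
  - intros; apply continuous_const.
Qed.

Lemma cinf_Dl : cinf UK Dl.
Proof.
  apply cinf_sqrt; [intros v Hv; apply Del_arg_pos, Hv|].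
  apply cinf_minus; [apply cinf_const|apply cinf_mult; apply cinf_sq];
    [apply cinf_px|apply cinf_sin, cinf_py].
Qed.

Lemma Dl_pos v : UK v -> 0 < Dl v.
Proof. intros H; apply Del_pos, H. Qed.

Lemma segments_UK : segments UK UK.
Proof. intros x y z H t _; exact H. Qed.

Lemma cinf_EE : cinf UK EE.
Proof. exact (sc_cut_int UK UK Dl open_UK open_UK segments_UK cinf_Dl). Qed.

Lemma cinf_FF : cinf UK FF.
Proof.
  assert (H : cinf UK (fun v => / Dl v)).
  { apply cinf_inv; [intros v Hv; apply Rgt_not_eq, Dl_pos, Hv|apply cinf_Dl]. }
  exact (sc_cut_int UK UK (fun v => / Dl v) open_UK open_UK segments_UK H).
Qed.

Lemma WB_facts v : WB v -> 0 < delta v < 1 /\ 0 < kB v < 1 /\ kB v ^ 2 = mu v /\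
  -1 < px v / kB v < 1.
Proof.
  intros [[S H3] H4]; assert (Hd : 0 < delta v).
  { rewrite delta_uu; unfold uu; nra. }
  assert (hm := mu_pos v S); assert (e := delta_mu v).
  assert (Hk : 0 < kB v < 1) by (split; [apply sqrt_lt_R0|apply sqrt_lt_one]; lra).
  assert (Ek : kB v ^ 2 = mu v) by (apply pow2_sqrt; lra).
  split; [lra|split; [auto|split; [auto|]]].
  assert (hs := sg_pos v S); assert (es := mu_sq v S).
  assert (- kB v < px v < kB v) by (split; nra).
  split; apply Rmult_lt_reg_r with (kB v); try lra; unfold Rdiv;
    rewrite Rmult_assoc, Rinv_l by lra; lra.
Qed.

Lemma cinf_kB : cinf strip kB.
Proof. apply cinf_sqrt; [apply mu_pos|apply cinf_mu]. Qed.

Lemma WB_strip v : WB v -> strip v. Proof. intros H; apply H. Qed.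

Lemma cinf_legB f : cinf UK f -> cinf WB (fun v => f (kB v, pB v, 0)).
Proof.
  intros Hf; apply (cinf_comp WB UK f kB pB (fun _ => 0)); auto.
  - apply open_UK.
  - intros v Hv; destruct (WB_facts v Hv) as (_ & H & _); exact H.
  - apply (cinf_mono strip); [exact WB_strip|apply cinf_kB].
  - apply cinf_acos; [intros v Hv; apply (WB_facts v Hv)|].
    apply cinf_div; [|apply cinf_px|].
    + intros v Hv; destruct (WB_facts v Hv) as (_ & H & _); lra.
    + apply (cinf_mono strip); [exact WB_strip|apply cinf_kB].
  - apply cinf_const.
Qed.

Lemma cinf_rB : cinf WB rB.
Proof. exact (cinf_legB FF cinf_FF). Qed.

Lemma cinf_IB : cinf WB IB.
Proof. exact (cinf_legB EE cinf_EE). Qed.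

Lemma cinf_xB : cinf WB xB.
Proof.
  assert (hs : cinf WB sg) by (apply (cinf_mono strip); [exact WB_strip|apply cinf_sg]).
  apply cinf_div; [|apply cinf_mult; [apply cinf_const|]|apply cinf_delta].
  - intros v Hv; destruct (WB_facts v Hv); lra.
  - apply cinf_minus; apply cinf_mult; auto;
      [apply cinf_py|apply cinf_IB|apply cinf_px].
Qed.

Lemma cinf_yB : cinf WB yB.
Proof.
  assert (hs : cinf WB sg) by (apply (cinf_mono strip); [exact WB_strip|apply cinf_sg]).
  apply cinf_div; [|apply cinf_mult; [apply cinf_const|]|apply cinf_delta].
  - intros v Hv; destruct (WB_facts v Hv); lra.
  - apply cinf_minus; apply cinf_mult; auto;
      [apply cinf_px|apply cinf_IB|apply cinf_py].
Qed.

(** ** The three kinds of momenta *)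

(** The momenta in the three regimes, parametrized by modulus and amplitude. The
    amplitude ranges over [(0, PI)], and the parametrization remains smooth at
    [PI]; this is how the boundary of [OM] will be approached. *)
Definition hat1 (k psi : R) : R3 := (k * cos psi, Del k psi, 0).
Definition hat2 (k psi : R) : R3 := (Del k psi / k, cos psi, 0).
Definition hat3 (p : R) : R3 := (/ cosh p, / cosh p, 0).

Lemma hat1_facts k psi : 0 < k < 1 -> 0 < psi < PI ->
  WB (hat1 k psi) /\ mu (hat1 k psi) = k ^ 2 /\ delta (hat1 k psi) = 1 - k ^ 2 /\
  sg (hat1 k psi) = k * sin psi /\ rB (hat1 k psi) = ellF psi k /\
  IB (hat1 k psi) = ellEi psi k /\
  (0 < cos psi -> rA (hat1 k psi) = ellF psi k /\ IA (hat1 k psi) = ellEi psi k).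
Proof.
  intros Hk Hp; assert (g := Del_gt_kcos k psi Hk); apply Rabs_def2 in g.
  assert (hs := sin_gt_0 psi (proj1 Hp) (proj2 Hp)).
  assert (D1 := Del_lt_1 k psi Hk ltac:(lra)); assert (D0 := Del_pos k psi Hk).
  assert (Ds := Del_sq k psi Hk); assert (Ds' := Del_sq' k psi Hk).
  assert (S : strip (hat1 k psi)).
  { unfold strip, hat1, py; cbn [fst snd]; lra. }
  assert (W : WB (hat1 k psi)).
  { split; [split; [exact S|]|]; unfold hat1, px, py; cbn [fst snd]; lra. }
  assert (Em : mu (hat1 k psi) = k ^ 2).
  { unfold mu, hat1, px, py; cbn [fst snd]; rewrite Ds'; ring. }
  assert (Es : sg (hat1 k psi) = k * sin psi).
  { unfold sg, hat1, py; cbn [fst snd]; rewrite Ds.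
    replace (1 - (1 - k ^ 2 * sin psi ^ 2)) with ((k * sin psi) ^ 2) by ring.
    apply sqrt_pow2; nra. }
  assert (Ek : kB (hat1 k psi) = k).
  { unfold kB; rewrite Em; apply sqrt_pow2; lra. }
  assert (Ep : pB (hat1 k psi) = psi).
  { unfold pB; rewrite Ek; unfold hat1, px; cbn [fst snd].
    replace (k * cos psi / k) with (cos psi) by (field; lra); apply acos_cos; lra. }
  split; [exact W|split; [exact Em|split; [|split; [exact Es|split; [|split]]]]].
  - rewrite delta_mu, Em; ring.
  - unfold rB; now rewrite Ep, Ek.
  - unfold IB; now rewrite Ep, Ek.
  - intros hc.
    assert (Hp2 : psi < PI / 2).
    { destruct (Rlt_or_le psi (PI / 2)) as [L|L]; auto.
      assert (cos psi <= 0) by (apply cos_le_0; lra); lra. }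
    assert (Ea : acos (py (hat1 k psi)) = asin (k * sin psi)).
    { unfold hat1, py; cbn [fst snd]; rewrite <- cos_asin_k by auto.
      apply acos_cos; split.
      - rewrite <- asin_0; destruct (Rle_or_lt (asin 0) (asin (k * sin psi))) as [L|L]; auto.
        exfalso; assert (A := asin_bound (k * sin psi)); rewrite asin_0 in L.
        assert (Q := sin_nonpos (asin (k * sin psi)) ltac:(assert (p := PI_RGT_0); lra)).
        rewrite sin_asin_k in Q by auto; nra.
      - assert (A := asin_bound (k * sin psi)); assert (p := PI_RGT_0); lra. }
    unfold rA, IA; rewrite Em, Ea; apply cut_C1; auto; lra.
Qed.

Lemma hat2_facts k psi : 0 < k < 1 -> 0 < psi < PI ->
  WA (hat2 k psi) /\ mu (hat2 k psi) = (/ k) ^ 2 /\ delta (hat2 k psi) = 1 - (/ k) ^ 2 /\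
  sg (hat2 k psi) = sin psi /\ rA (hat2 k psi) = k * ellF psi k /\
  IA (hat2 k psi) = ellq psi k / k.
Proof.
  intros Hk Hp; assert (g := Del_gt_kcos k psi Hk); apply Rabs_def2 in g.
  assert (hs := sin_gt_0 psi (proj1 Hp) (proj2 Hp)).
  assert (D0 := Del_pos k psi Hk).
  assert (Ds := Del_sq k psi Hk); assert (e := sin2_cos2' psi).
  assert (db : 0 < Del k psi / k) by (apply Rdiv_lt_0_compat; lra).
  assert (S : strip (hat2 k psi)).
  { unfold strip, hat2, py; cbn [fst snd]; split; nra. }
  assert (W : WA (hat2 k psi)).
  { split; [split; [exact S|]|]; unfold hat2, px, py; cbn [fst snd]; [|exact db].
    apply Rmult_lt_reg_r with k; [lra|]; unfold Rdiv; rewrite Rmult_assoc, Rinv_l; lra. }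
  assert (Em : mu (hat2 k psi) = (/ k) ^ 2).
  { unfold mu, hat2, px, py; cbn [fst snd].
    replace ((Del k psi / k) ^ 2) with (Del k psi ^ 2 * (/ k) ^ 2) by (field; lra).
    rewrite Ds; replace (cos psi ^ 2) with (1 - sin psi ^ 2) by lra; field; lra. }
  split; [exact W|split; [exact Em|split; [|split]]].
  - rewrite delta_mu, Em; ring.
  - unfold sg, hat2, py; cbn [fst snd].
    replace (1 - cos psi ^ 2) with (sin psi ^ 2) by lra; apply sqrt_pow2; lra.
  - unfold rA, IA; rewrite Em; unfold hat2, py; cbn [fst snd]; rewrite acos_cos by lra.
    apply cut_C2; auto; lra.
Qed.

Lemma exp_cosh_sinh p : cosh p + sinh p = exp p.
Proof. unfold cosh, sinh; field. Qed.

Lemma sinh_pos p : 0 < p -> 0 < sinh p.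
Proof. intros H; rewrite <- (Ropp_involutive p), sinh_neg; assert (h := sinh_lt_0 (- p)); lra. Qed.

Lemma hat3_facts p : 0 < p ->
  WA (hat3 p) /\ mu (hat3 p) = 1 /\ rA (hat3 p) = p /\
  xA (hat3 p) = p / cosh p + sinh p /\ yA (hat3 p) = p / cosh p - sinh p.
Proof.
  intros Hp; assert (cp := cosh_pos p); assert (sp := sinh_pos p Hp).
  assert (cs := cosh_sq p).
  assert (c1 : 1 < cosh p) by nra.
  assert (i0 := Rinv_0_lt_compat _ cp).
  assert (i1 : / cosh p < 1) by (rewrite <- Rinv_1; apply Rinv_lt_contravar; lra).
  assert (S : strip (hat3 p)) by (unfold strip, hat3, py; cbn [fst snd]; lra).
  assert (W : WA (hat3 p)).
  { split; [split; [exact S|]|]; unfold hat3, px, py; cbn [fst snd]; lra. }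
  assert (Em : mu (hat3 p) = 1) by (unfold mu, hat3, px, py; cbn [fst snd]; ring).
  assert (Es : sg (hat3 p) = sinh p / cosh p).
  { unfold sg, hat3, py; cbn [fst snd].
    replace (1 - (/ cosh p) ^ 2) with ((sinh p / cosh p) ^ 2).
    - apply sqrt_pow2, Rlt_le, Rdiv_lt_0_compat; auto.
    - apply Rmult_eq_reg_r with (cosh p ^ 2); [|apply pow_nonzero; lra].
      transitivity (sinh p ^ 2); [field; lra|].
      transitivity (cosh p ^ 2 - 1); [lra|field; lra]. }
  assert (Ea : 0 <= acos (py (hat3 p)) < PI / 2).
  { assert (B := acos_bound (py (hat3 p))); split; [lra|].
    destruct (Rlt_or_le (acos (py (hat3 p))) (PI / 2)) as [L|L]; auto; exfalso.
    assert (Q := cos_le_0 (acos (py (hat3 p))) L ltac:(assert (q := PI_RGT_0); lra)).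
    rewrite cos_acos in Q by (destruct S; lra).
    unfold hat3, py in Q; cbn [fst snd] in Q; lra. }
  destruct (cut_C3 _ Ea) as (E1 & E2 & E3).
  assert (Er : rA (hat3 p) = p).
  { unfold rA; rewrite Em, E1, sin_acos_sg, cos_acos by (auto; destruct S; lra).
    rewrite Es; unfold hat3, py; cbn [fst snd].
    replace ((1 + sinh p / cosh p) / / cosh p) with (cosh p + sinh p) by (field; lra).
    rewrite exp_cosh_sinh; apply ln_exp. }
  assert (EI : IA (hat3 p) = sinh p / cosh p).
  { unfold IA; rewrite Em, E2, sin_acos_sg by auto; exact Es. }
  assert (EP : PA (hat3 p) = p / 2).
  { assert (Er' := Er); unfold rA in Er'; rewrite Em in Er'.
    unfold PA; rewrite Em, E3, Er'; reflexivity. }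
  split; [exact W|split; [exact Em|split; [exact Er|]]].
  unfold xA, yA; rewrite EP, EI, Es; unfold uu, hat3, px, py; cbn [fst snd].
  split; field; lra.
Qed.

(** [delta] is positive, zero or negative according as [b] is smaller than, equal to
    or greater than [C]. *)
Lemma OM_cases v : OM v -> exists w, px w = px v /\ py w = py v /\
  ((exists k psi, 0 < k < 1 /\ 0 < psi < PI /\ w = hat1 k psi) \/
   (exists k psi, 0 < k < 1 /\ 0 < psi < PI /\ w = hat2 k psi) \/
   (exists p, 0 < p /\ w = hat3 p)).
Proof.
  intros [[H1 H2] H3]; exists (px v, py v, 0).
  split; [reflexivity|split; [reflexivity|]].
  set (b := px v) in *; set (C := py v) in *.
  destruct (Rtotal_order b C) as [L|[L|L]].
  - left; destruct (C1_of_momenta C b) as (Hk & Ek & Hbk & E1 & E2); try nra.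
    set (k := sqrt (1 - (C ^ 2 - b ^ 2))) in *.
    exists k, (acos (b / k)); rewrite Del_even in E1; rewrite cos_neg in E2.
    split; [auto|split].
    + apply acos_open.
      assert (- k < b < k) by nra.
      split; apply Rmult_lt_reg_r with k; try lra; unfold Rdiv;
        rewrite Rmult_assoc, Rinv_l by lra; lra.
    + unfold hat1; now rewrite E1, E2.
  - right; right; assert (Cp : 0 < C) by lra.
    assert (Hi : 1 < / C) by (rewrite <- Rinv_1; apply Rinv_lt_contravar; lra).
    set (s := sqrt ((/ C) ^ 2 - 1)).
    assert (hs : 0 < s) by (apply sqrt_lt_R0; nra).
    assert (es : s ^ 2 = (/ C) ^ 2 - 1) by (apply pow2_sqrt; nra).
    exists (ln (/ C + s)).
    assert (h : 1 < / C + s) by lra.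
    split; [rewrite <- ln_1; apply ln_increasing; lra|].
    assert (Ec : / cosh (ln (/ C + s)) = C).
    { unfold cosh; rewrite exp_Ropp, exp_ln by lra.
      replace (/ (/ C + s)) with (/ C - s).
      - field; lra.
      - apply Rmult_eq_reg_l with (/ C + s); [|lra].
        rewrite Rinv_r by lra; transitivity ((/ C) ^ 2 - s ^ 2); [ring|lra]. }
    unfold hat3; rewrite Ec, L; reflexivity.
  - right; left; assert (Hb : 0 < b) by lra.
    destruct (C2_of_momenta C b) as (Hk & Ek & E1 & E2); try nra.
    set (k := / sqrt (1 - (C ^ 2 - b ^ 2))) in *.
    exists k, (acos C); rewrite Del_even in E2; rewrite cos_neg in E1.
    split; [auto|split; [apply acos_open; lra|]].
    unfold hat2; now rewrite E1, E2.
Qed.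

Lemma dummy_eq (f : R3 -> R) (v w : R3) : px w = px v -> py w = py v ->
  (forall a b z z', f (a, b, z) = f (a, b, z')) -> f v = f w.
Proof.
  intros E1 E2 H; rewrite (R3_eta v), (R3_eta w), E1, E2; apply H.
Qed.

Lemma WB_hat1 v : WB v -> exists k psi, 0 < k < 1 /\ 0 < psi < PI /\
  px (hat1 k psi) = px v /\ py (hat1 k psi) = py v.
Proof.
  intros [H L]; destruct (OM_cases v H) as (w & E1 & E2 & [K|[K|K]]).
  - destruct K as (k & psi & Hk & Hp & ->); exists k, psi; auto.
  - destruct K as (k & psi & Hk & Hp & ->); exfalso.
    destruct (hat2_facts k psi Hk Hp) as (_ & _ & E & _).
    assert (1 < / k) by (rewrite <- Rinv_1; apply Rinv_lt_contravar; lra).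
    destruct H as [S H]; unfold delta in E; rewrite E1, E2 in E; nra.
  - destruct K as (p & Hp & ->); exfalso.
    unfold hat3, px, py in E1, E2; cbn [fst snd] in E1, E2; unfold px, py in L; lra.
Qed.

Lemma agree v : WA v -> WB v -> rA v = rB v /\ IA v = IB v.
Proof.
  intros HA HB; destruct (WB_hat1 v HB) as (k & psi & Hk & Hp & E1 & E2).
  destruct (hat1_facts k psi Hk Hp) as (_ & _ & _ & _ & B1 & B2 & A).
  assert (hc : 0 < cos psi).
  { destruct HA as [_ H]; rewrite <- E1 in H; unfold hat1, px in H; cbn [fst snd] in H; nra. }
  destruct (A hc) as [A1 A2].
  rewrite (dummy_eq rA v (hat1 k psi)), (dummy_eq rB v (hat1 k psi)),
    (dummy_eq IA v (hat1 k psi)), (dummy_eq IB v (hat1 k psi)) by auto.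
  rewrite A1, A2, B1, B2; auto.
Qed.

Lemma OM_WA_or_WB v : OM v -> (0 < px v /\ WA v) \/ (~ 0 < px v /\ WB v).
Proof.
  intros H; destruct (Rlt_dec 0 (px v)) as [L|L]; [left|right]; split; auto.
  - split; auto.
  - split; auto; destruct H as [S H]; lra.
Qed.

Lemma glue_A f g v : 0 < px v -> glue f g v = f v.
Proof. intros H; unfold glue; destruct (Rlt_dec 0 (px v)); tauto. Qed.

Lemma glue_B f g v : WB v -> (WA v -> f v = g v) -> glue f g v = g v.
Proof.
  intros HB E; unfold glue; destruct (Rlt_dec 0 (px v)); auto.
  apply E; split; auto; apply HB.
Qed.

Lemma cinf_glue f g : cinf WA f -> cinf WB g ->
  (forall v, WA v -> WB v -> f v = g v) -> cinf OM (glue f g).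
Proof.
  intros Hf Hg E; apply cinf_local; intros v Hv.
  destruct (OM_WA_or_WB v Hv) as [[L W]|[L W]].
  - exists WA; split; [apply open_WA|split; [auto|]].
    apply (cinf_ext WA f); auto; [apply open_WA|].
    intros w Hw; symmetry; apply glue_A, Hw.
  - exists WB; split; [apply open_WB|split; [auto|]].
    apply (cinf_ext WB g); auto; [apply open_WB|].
    intros w Hw; symmetry; apply glue_B; auto.
Qed.

Lemma agree_xy v : WA v -> WB v -> xA v = xB v /\ yA v = yB v.
Proof.
  intros HA HB; assert (Hd : delta v <> 0) by (destruct (WB_facts v HB); lra).
  destruct (xA_formula v HA Hd) as [-> ->]; destruct (agree v HA HB) as [_ ->].
  split; reflexivity.
Qed.

Lemma cinf_rO : cinf OM rO.
Proof.
  apply cinf_glue; [apply cinf_cutA, cinf_fR|apply cinf_rB|]; intros; now apply agree.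
Qed.

Lemma cinf_xO : cinf OM xO.
Proof. apply cinf_glue; [apply cinf_xA|apply cinf_xB|]; intros; now apply agree_xy. Qed.

Lemma cinf_yO : cinf OM yO.
Proof. apply cinf_glue; [apply cinf_yA|apply cinf_yB|]; intros; now apply agree_xy. Qed.

Lemma xyO_formula v : OM v -> delta v <> 0 ->
  xO v = 2 * (py v * IO v - px v * sg v) / delta v /\
  yO v = 2 * (px v * IO v - sg v * py v) / delta v.
Proof.
  intros H Hd; destruct (OM_WA_or_WB v H) as [[L W]|[L W]].
  - unfold xO, yO, IO; rewrite !glue_A by auto; now apply xA_formula.
  - unfold xO, yO, IO; rewrite !glue_B by (auto; intros; apply agree || apply agree_xy; auto).
    split; reflexivity.
Qed.

Lemma hat1_O k psi : 0 < k < 1 -> 0 < psi < PI ->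
  OM (hat1 k psi) /\ delta (hat1 k psi) = 1 - k ^ 2 /\ sg (hat1 k psi) = k * sin psi /\
  mu (hat1 k psi) = k ^ 2 /\
  rO (hat1 k psi) = ellF psi k /\ IO (hat1 k psi) = ellEi psi k.
Proof.
  intros Hk Hp; destruct (hat1_facts k psi Hk Hp) as (W & Em & Ed & Es & B1 & B2 & _).
  split; [apply W|split; [auto|split; [auto|split; [auto|]]]].
  unfold rO, IO; rewrite !glue_B by (auto; intros; apply agree; auto); auto.
Qed.

Lemma hat2_O k psi : 0 < k < 1 -> 0 < psi < PI ->
  OM (hat2 k psi) /\ delta (hat2 k psi) = 1 - (/ k) ^ 2 /\ sg (hat2 k psi) = sin psi /\
  mu (hat2 k psi) = (/ k) ^ 2 /\
  rO (hat2 k psi) = k * ellF psi k /\ IO (hat2 k psi) = ellq psi k / k.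
Proof.
  intros Hk Hp; destruct (hat2_facts k psi Hk Hp) as (W & Em & Ed & Es & A1 & A2).
  split; [apply W|split; [auto|split; [auto|split; [auto|]]]].
  unfold rO, IO; rewrite !glue_A by apply W; auto.
Qed.

Lemma hat3_O p : 0 < p ->
  OM (hat3 p) /\ rO (hat3 p) = p /\
  xO (hat3 p) = p / cosh p + sinh p /\ yO (hat3 p) = p / cosh p - sinh p.
Proof.
  intros Hp; destruct (hat3_facts p Hp) as (W & _ & Er & Ex & Ey).
  split; [apply W|]; unfold rO, xO, yO; rewrite !glue_A by apply W; auto.
Qed.

(** ** Endpoints of the symmetric arcs *)

Lemma null_coordinates (C b I s : R) : C + b <> 0 -> C - b <> 0 ->
  (C + b) * ((2 * I - 2 * s) / (C ^ 2 - b ^ 2)) / 2 + (2 * I + 2 * s) / (C + b) / 2 =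
    2 * (C * I - b * s) / (C ^ 2 - b ^ 2) /\
  (C + b) * ((2 * I - 2 * s) / (C ^ 2 - b ^ 2)) / 2 - (2 * I + 2 * s) / (C + b) / 2 =
    2 * (b * I - s * C) / (C ^ 2 - b ^ 2).
Proof.
  intros H1 H2; replace (C ^ 2 - b ^ 2) with ((C + b) * (C - b)) by ring.
  split; field; auto.
Qed.

Definition end_state (C b : R) : Cyl := (ang (2 * acos C), 2 * b).

Lemma end_state_of_half g c C b : -1 <= C <= 1 -> cos (g / 2) = C -> 0 <= sin (g / 2) ->
  c = 2 * b -> (ang g, c) = end_state C b.
Proof.
  intros HC Ec Es ->; unfold end_state; f_equal; apply ang_half; rewrite half_2.
  - now rewrite cos_acos.
  - rewrite sin_acos by auto; unfold Rsqr.
    assert (h := sin2_cos2' (g / 2)); rewrite Ec in h.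
    replace (1 - C * C) with (sin (g / 2) ^ 2) by nra.
    rewrite sqrt_pow2; lra.
Qed.

Lemma reach_hat1 k psi : 0 < k < 1 -> 0 < psi < PI ->
  C1_state k (- psi) = state_of (Del k psi) (k * cos psi) /\
  reach (state_of (Del k psi) (k * cos psi)) (2 * rO (hat1 k psi))
    (xO (hat1 k psi), yO (hat1 k psi), 0) (end_state (Del k psi) (k * cos psi)).
Proof.
  intros Hk Hp; destruct (hat1_O k psi Hk Hp) as (HO & Ed & Es & _ & Er & EI).
  assert (hs := sin_gt_0 psi (proj1 Hp) (proj2 Hp)).
  assert (D0 := Del_pos k psi Hk); assert (D1 := Del_le_1 k psi Hk).
  assert (Ds := Del_sq' k psi Hk).
  assert (g := Del_gt_kcos k psi Hk); apply Rabs_def2 in g.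
  assert (Est : C1_state k (- psi) = state_of (Del k psi) (k * cos psi)).
  { rewrite C1_state_of, Del_even, cos_neg; auto; rewrite sin_neg; lra. }
  split; [exact Est|].
  assert (Hd : delta (hat1 k psi) <> 0) by (rewrite Ed; nra).
  destruct (xyO_formula _ HO Hd) as [Ex Ey].
  rewrite EI, Es, Ed in Ex, Ey.
  change (py (hat1 k psi)) with (Del k psi) in Ex, Ey.
  change (px (hat1 k psi)) with (k * cos psi) in Ex, Ey.
  assert (R := reach_C1 k (- psi) psi Hk); cbv zeta in R.
  fold (C1_state k (- psi)) in R; rewrite Est in R.
  rewrite Del_even, cos_neg, sin_neg, ellEi_odd, ellF_odd in R by auto.
  specialize (R eq_refl).
  rewrite (end_state_of_half (2 * asin (k * sin psi)) (2 * (k * cos psi)) (Del k psi) (k * cos psi)) in R;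
    [|lra|rewrite half_2; now apply cos_asin_k|rewrite half_2, sin_asin_k by auto; nra|reflexivity].
  replace (ellF psi k - - ellF psi k) with (2 * rO (hat1 k psi)) in R by (rewrite Er; ring).
  replace (ellEi psi k - - ellEi psi k) with (2 * ellEi psi k) in R by ring.
  replace (k * sin psi - k * - sin psi) with (2 * (k * sin psi)) in R by ring.
  destruct (null_coordinates (Del k psi) (k * cos psi) (ellEi psi k) (k * sin psi)) as [N1 N2];
    [lra|lra|].
  replace (Del k psi ^ 2 - (k * cos psi) ^ 2) with (1 - k ^ 2) in N1, N2 by (rewrite Ds; ring).
  rewrite Ex, Ey, <- N1, <- N2.
  match goal with |- reach _ _ ?q _ => match type of R with reach _ _ ?q' _ =>
    replace q with q'; [exact R|] end end.
  f_equal; f_equal; field; lra.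
Qed.

Lemma reach_hat2 k psi : 0 < k < 1 -> 0 < psi < PI ->
  C2_state k (- psi) = state_of (cos psi) (Del k psi / k) /\
  reach (state_of (cos psi) (Del k psi / k)) (2 * rO (hat2 k psi))
    (xO (hat2 k psi), yO (hat2 k psi), 0) (end_state (cos psi) (Del k psi / k)).
Proof.
  intros Hk Hp; destruct (hat2_O k psi Hk Hp) as (HO & Ed & Es & _ & Er & EI).
  assert (hs := sin_gt_0 psi (proj1 Hp) (proj2 Hp)).
  assert (D0 := Del_pos k psi Hk).
  assert (Ds := Del_sq' k psi Hk).
  assert (g := Del_gt_kcos k psi Hk); apply Rabs_def2 in g.
  assert (Est : C2_state k (- psi) = state_of (cos psi) (Del k psi / k)).
  { rewrite C2_state_of, Del_even, cos_neg; auto; rewrite sin_neg; lra. }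
  split; [exact Est|].
  assert (i1 : 1 < / k) by (rewrite <- Rinv_1; apply Rinv_lt_contravar; lra).
  assert (Hd : delta (hat2 k psi) <> 0) by (rewrite Ed; nra).
  destruct (xyO_formula _ HO Hd) as [Ex Ey].
  rewrite EI, Es, Ed in Ex, Ey.
  change (py (hat2 k psi)) with (cos psi) in Ex, Ey.
  change (px (hat2 k psi)) with (Del k psi / k) in Ex, Ey.
  assert (R := reach_C2 k (- psi) psi Hk); cbv zeta in R.
  fold (C2_state k (- psi)) in R; rewrite Est in R.
  assert (Eq : ellq (- psi) k = - ellq psi k).
  { unfold ellq; rewrite ellEi_odd, ellF_odd by auto; ring. }
  rewrite Del_even, cos_neg, sin_neg, Eq, ellF_odd in R by auto.
  specialize (R eq_refl).
  rewrite (end_state_of_half (2 * psi) (2 * (Del k psi / k)) (cos psi) (Del k psi / k)) in R;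
    [|apply COS_bound|now rewrite half_2|rewrite half_2; lra|reflexivity].
  replace (k * (ellF psi k - - ellF psi k)) with (2 * rO (hat2 k psi)) in R by (rewrite Er; ring).
  replace ((ellq psi k - - ellq psi k) / k) with (2 * (ellq psi k / k)) in R by (field; lra).
  replace (sin psi - - sin psi) with (2 * sin psi) in R by ring.
  assert (dk : Del k psi / k * k = Del k psi) by (field; lra).
  destruct (null_coordinates (cos psi) (Del k psi / k) (ellq psi k / k) (sin psi)) as [N1 N2];
    [intros Z; nra|intros Z; nra|].
  assert (Edd : cos psi ^ 2 - (Del k psi / k) ^ 2 = 1 - (/ k) ^ 2).
  { replace ((Del k psi / k) ^ 2) with (Del k psi ^ 2 * (/ k) ^ 2) by (field; lra).
    rewrite Ds; field; lra. }
  rewrite Edd in N1, N2.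
  rewrite Ex, Ey, <- N1, <- N2.
  match goal with |- reach _ _ ?q _ => match type of R with reach _ _ ?q' _ =>
    replace q with q'; [exact R|] end end.
  assert (up : cos psi + Del k psi / k <> 0) by (intros Z; nra).
  set (u := cos psi + Del k psi / k) in *; clearbody u.
  f_equal; f_equal; field; repeat split; auto; try lra; nra.
Qed.

Lemma reach_hat3 p : 0 < p ->
  C3_state (- p) = state_of (/ cosh p) (/ cosh p) /\
  reach (state_of (/ cosh p) (/ cosh p)) (2 * rO (hat3 p))
    (xO (hat3 p), yO (hat3 p), 0) (end_state (/ cosh p) (/ cosh p)).
Proof.
  intros Hp; destruct (hat3_O p Hp) as (_ & -> & -> & ->).
  assert (Est : C3_state (- p) = state_of (/ cosh p) (/ cosh p)).
  { rewrite C3_state_of by lra; now rewrite cosh_neg. }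
  split; [exact Est|].
  assert (R := reach_C3 p); rewrite <- Est.
  unfold C3_state; rewrite cosh_neg.
  assert (cp := cosh_pos p); assert (sp := sinh_pos p Hp); assert (cs := cosh_sq p).
  assert (c1 : 1 < cosh p) by nra.
  assert (i0 := Rinv_0_lt_compat _ cp).
  assert (i1 : / cosh p < 1) by (rewrite <- Rinv_1; apply Rinv_lt_contravar; lra).
  rewrite (end_state_of_half (2 * atan (sinh p)) (2 * / cosh p) (/ cosh p) (/ cosh p)) in R;
    [exact R|lra|rewrite half_2; apply cos_atan_sinh| |reflexivity].
  rewrite half_2, sin_atan_sinh; unfold tanh; apply Rlt_le, Rdiv_lt_0_compat; auto.
Qed.

Lemma glue_dummy f g a b z z' :
  (forall a b z z', f (a, b, z) = f (a, b, z')) ->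
  (forall a b z z', g (a, b, z) = g (a, b, z')) ->
  glue f g (a, b, z) = glue f g (a, b, z').
Proof.
  intros Hf Hg; unfold glue, px; cbn [fst snd].
  destruct (Rlt_dec 0 a); auto.
Qed.

Lemma rO_dummy a b z z' : rO (a, b, z) = rO (a, b, z').
Proof. apply glue_dummy; reflexivity. Qed.
Lemma xO_dummy a b z z' : xO (a, b, z) = xO (a, b, z').
Proof. apply glue_dummy; reflexivity. Qed.
Lemma yO_dummy a b z z' : yO (a, b, z) = yO (a, b, z').
Proof. apply glue_dummy; reflexivity. Qed.
Lemma IO_dummy a b z z' : IO (a, b, z) = IO (a, b, z').
Proof. apply glue_dummy; reflexivity. Qed.

(** The end point is [2 (C I - b s, b I - s C) / delta] in the first two regimes, by
    combining the null coordinates, and explicit on the separatrix. *)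
Lemma reach_OM v : OM v ->
  reach (state_of (py v) (px v)) (2 * rO v) (xO v, yO v, 0) (end_state (py v) (px v)).
Proof.
  intros H; destruct (OM_cases v H) as (w & E1 & E2 & K).
  rewrite (dummy_eq rO v w), (dummy_eq xO v w), (dummy_eq yO v w) by
    (auto using rO_dummy, xO_dummy, yO_dummy).
  rewrite <- E1, <- E2.
  destruct K as [(k & psi & Hk & Hp & ->)|[(k & psi & Hk & Hp & ->)|(p & Hp & ->)]].
  - now apply reach_hat1.
  - now apply reach_hat2.
  - now apply reach_hat3.
Qed.

Lemma ellF_PI k : 0 < k < 1 -> ellF PI k = 2 * ellK k.
Proof.
  intros Hk; assert (h := ellF_period k 0 Hk); rewrite Rplus_0_l, ellF_0 in h; lra.
Qed.

Lemma amplitude_range k psi : 0 < k < 1 -> 0 < ellF psi k < 2 * ellK k <-> 0 < psi < PI.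
Proof.
  intros Hk; rewrite <- (ellF_lt_iff k 0 psi), <- (ellF_lt_iff k psi PI) by auto.
  rewrite ellF_0, ellF_PI by auto; reflexivity.
Qed.

(** The condition [tau = 0] means that the arc is symmetric about its midpoint: it
    starts at the amplitude [- psi] and ends at [psi], with [ellF psi k = p]. The
    three sets become the single open set [OM]. *)
Lemma N35_iff l t : N35 (l, t) <-> exists C b, OM (b, C, 0) /\ l = state_of C b /\
  t = 2 * rO (b, C, 0).
Proof.
  unfold N35; rewrite on_C1_0_iff, on_C2_plus_iff, on_C3_0plus_iff; split.
  - intros [K|[K|K]].
    + destruct K as (Ht & psi & k & Hk & -> & Hr & Ez).
      assert (Ep : ellF (- psi) k = t / 2) by (rewrite ellF_odd by auto; lra).
      rewrite <- Ep in Hr; apply amplitude_range in Hr; auto.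
      destruct (reach_hat1 k (- psi) Hk Hr) as [E _]; rewrite Ropp_involutive in E.
      destruct (hat1_O k (- psi) Hk Hr) as (HO & _ & _ & _ & Er & _).
      exists (Del k (- psi)), (k * cos (- psi)).
      split; [exact HO|split; [exact E|]]; fold (hat1 k (- psi)); rewrite Er; lra.
    + destruct K as (Ht & psi & k & Hk & -> & Hr & Ez).
      assert (Ep : ellF (- psi) k = t / (2 * k)).
      { rewrite ellF_odd by auto.
        replace ((k * ellF psi k + t / 2) / k) with (ellF psi k + t / (2 * k)) in Ez
          by (field; lra); lra. }
      rewrite <- Ep in Hr; apply amplitude_range in Hr; auto.
      destruct (reach_hat2 k (- psi) Hk Hr) as [E _]; rewrite Ropp_involutive in E.
      destruct (hat2_O k (- psi) Hk Hr) as (HO & _ & _ & _ & Er & _).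
      exists (cos (- psi)), (Del k (- psi) / k).
      split; [exact HO|split; [exact E|]]; fold (hat2 k (- psi)); rewrite Er, Ep.
      field; lra.
    + destruct K as (Ht & w & -> & Hp & Ez).
      assert (Ew : w = - (t / 2)) by lra; subst w.
      destruct (reach_hat3 (t / 2) Hp) as [E _].
      destruct (hat3_O (t / 2) Hp) as (HO & Er & _).
      exists (/ cosh (t / 2)), (/ cosh (t / 2)).
      split; [exact HO|split; [exact E|]]; fold (hat3 (t / 2)); rewrite Er; field.
  - intros (C & b & HO & -> & ->).
    destruct (OM_cases _ HO) as (w & E1 & E2 & K); unfold px, py in E1, E2;
      cbn [fst snd] in E1, E2; fold (px w) in E1; fold (py w) in E2.
    rewrite (dummy_eq rO (b, C, 0) w) by (auto using rO_dummy).
    rewrite <- E1, <- E2.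
    destruct K as [(k & psi & Hk & Hp & ->)|[(k & psi & Hk & Hp & ->)|(p & Hp & ->)]].
    + left; destruct (reach_hat1 k psi Hk Hp) as [E _].
      destruct (hat1_O k psi Hk Hp) as (_ & _ & _ & _ & Er & _).
      assert (A := proj2 (amplitude_range k psi Hk) Hp).
      split; [lra|]; exists (- psi), k; split; [auto|split; [symmetry; exact E|]].
      rewrite Er, ellF_odd by auto; split; lra.
    + right; left; destruct (reach_hat2 k psi Hk Hp) as [E _].
      destruct (hat2_O k psi Hk Hp) as (_ & _ & _ & _ & Er & _).
      assert (A := proj2 (amplitude_range k psi Hk) Hp).
      split; [rewrite Er; nra|]; exists (- psi), k; split; [auto|split; [symmetry; exact E|]].
      rewrite Er, ellF_odd by auto.
      replace (2 * (k * ellF psi k) / (2 * k)) with (ellF psi k) by (field; lra).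
      split; [lra|field; lra].
    + right; right; destruct (reach_hat3 p Hp) as [E _].
      destruct (hat3_O p Hp) as (_ & Er & _).
      split; [lra|]; exists (- p); split; [symmetry; exact E|].
      rewrite Er; split; lra.
Qed.

(** * The Jacobian of the endpoint map *)

Lemma chain_cinf (U : R3 -> Prop) (f : R3 -> R) (g1 g2 : R -> R) z t l1 l2 :
  open U -> cinf U f -> U (g1 t, g2 t, z) -> is_derive g1 t l1 -> is_derive g2 t l2 ->
  is_derive (fun s => f (g1 s, g2 s, z)) t
    (D1 f (g1 t, g2 t, z) * l1 + D2 f (g1 t, g2 t, z) * l2).
Proof.
  intros OU Hf Hv d1 d2; destruct (cinf_partials U f OU Hf) as (Hp & F1 & F2 & F3).
  replace (D1 f (g1 t, g2 t, z) * l1 + D2 f (g1 t, g2 t, z) * l2) with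
    (D1 f (g1 t, g2 t, z) * l1 + D2 f (g1 t, g2 t, z) * l2 + D3 f (g1 t, g2 t, z) * 0) by ring.
  apply (chain3 U f (D1 f) (D2 f) (D3 f) g1 g2 (fun _ => z)); auto.
  - intros v Vv; split; [|split]; apply (cinf_continuous U); auto.
  - apply (@is_derive_const R_AbsRing R_NormedModule).
Qed.

Lemma D1_eq (f : R3 -> R) a b z l : is_derive (fun s => f (s, b, z)) a l ->
  D1 f (a, b, z) = l.
Proof. intros H; exact (is_derive_unique _ _ _ H). Qed.

Lemma D2_eq (f : R3 -> R) a b z l : is_derive (fun s => f (a, s, z)) b l ->
  D2 f (a, b, z) = l.
Proof. intros H; exact (is_derive_unique _ _ _ H). Qed.

(** The partial derivatives of [I] in [b] and [C]; they have the same form in both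
    charts, and contain no other integral than [I] and [r]. *)
Definition Ib (v : R3) : R := (px v * (IO v - rO v) - sg v * py v) / mu v.
Definition IC (v : R3) : R :=
  - (py v * (IO v - rO v)) / mu v - px v * py v ^ 2 / (mu v * sg v).

Lemma D1_cut_fI v : WA v -> D1 (cut_int fI) (mu v, acos (py v), 0) =
  (IA v - rA v - sg v * py v / px v) / (2 * mu v).
Proof.
  intros H; destruct (WA_UA v H) as [U Eb]; assert (S := WA_strip v H).
  apply D1_eq; assert (D := cut_fI_derive_mu _ _ (proj1 (acos_bound (py v))) U (mu_pos v S)).
  rewrite Eb, sin_acos_sg in D by auto; rewrite cos_acos in D by (destruct S; lra).
  exact D.
Qed.

Lemma D2_cut_fI v : WA v -> D2 (cut_int fI) (mu v, acos (py v), 0) = py v ^ 2 / px v.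
Proof.
  intros H; destruct (WA_UA v H) as [U Eb]; assert (S := WA_strip v H).
  apply D2_eq; assert (D := cut_A_derive fI _ _ cinf_fI U).
  unfold fI at 2 in D; rewrite Eb in D; unfold py at 2 in D; cbn [fst snd] in D.
  rewrite cos_acos in D by (destruct S; lra); exact D.
Qed.

Lemma IA_partials b C z : WA (b, C, z) ->
  is_derive (fun s => IA (s, C, z)) b
    ((b * (IA (b, C, z) - rA (b, C, z)) - sg (b, C, z) * C) / mu (b, C, z)) /\
  is_derive (fun s => IA (b, s, z)) C
    (- (C * (IA (b, C, z) - rA (b, C, z))) / mu (b, C, z) -
       b * C ^ 2 / (mu (b, C, z) * sg (b, C, z))).
Proof.
  intros H; set (v := (b, C, z)) in *.
  destruct (WA_UA v H) as [U Eb]; assert (S := WA_strip v H).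
  assert (hm := mu_pos v S); assert (hs := sg_pos v S); assert (es := sg_sq v S).
  assert (em := mu_sq v S).
  assert (hb : 0 < b) by apply H.
  assert (E1 := D1_cut_fI v H); assert (E2 := D2_cut_fI v H).
  change (px v) with b in *; change (py v) with C in *.
  split.
  - assert (D := chain_cinf UA (cut_int fI) (fun s => 1 - C ^ 2 + s ^ 2) (fun _ => acos C)
      0 b (2 * b) 0 open_UA (cinf_cut_A fI cinf_fI) U).
    cbv beta in D; change (1 - C ^ 2 + b ^ 2) with (mu v) in D; rewrite E1, E2 in D.
    replace (_ / mu v) with ((IA v - rA v - sg v * C / b) / (2 * mu v) * (2 * b) + C ^ 2 / b * 0)
      by (field; lra).
    apply D.
    + auto_derive; auto; ring.
    + apply (@is_derive_const R_AbsRing R_NormedModule).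
  - assert (D := chain_cinf UA (cut_int fI) (fun s => 1 - s ^ 2 + b ^ 2) acos
      0 C (- (2 * C)) (- / sqrt (1 - C * C)) open_UA (cinf_cut_A fI cinf_fI) U).
    cbv beta in D; change (1 - C ^ 2 + b ^ 2) with (mu v) in D; rewrite E1, E2 in D.
    replace (sqrt (1 - C * C)) with (sg v) in D
      by (unfold sg; change (py v) with C; f_equal; ring).
    replace (_ - _) with ((IA v - rA v - sg v * C / b) / (2 * mu v) * - (2 * C) +
      C ^ 2 / b * - / sg v).
    + apply D.
      * auto_derive; auto; ring.
      * replace (sg v) with (sqrt (1 - C * C))
          by (unfold sg; change (py v) with C; f_equal; ring).
        apply is_derive_acos; apply S.
    + apply Rmult_eq_reg_r with (mu v * sg v * b).
      2:{ apply Rgt_not_eq; repeat apply Rmult_lt_0_compat; lra. }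
      transitivity (- C * sg v * b * (IA v - rA v) + sg v ^ 2 * C ^ 2 - C ^ 2 * mu v);
        [field; lra|].
      transitivity (- C * sg v * b * (IA v - rA v) - b ^ 2 * C ^ 2); [|field; lra].
      rewrite em; ring.
Qed.

Lemma D1_EE k psi z : 0 < k < 1 -> D1 EE (k, psi, z) = (ellEi psi k - ellF psi k) / k.
Proof.
  intros Hk.
  destruct (cinf_partials UK Dl open_UK cinf_Dl) as (Hp & F1 & _ & _).
  assert (E : forall t, D1 Dl (k, t, 0) = - (k * sin t ^ 2) / Del k t).
  { intros t; assert (p := Del_pos k t Hk); apply D1_eq; unfold Dl, Del, px, py; cbn [fst snd].
    replace (- (k * sin t ^ 2) / sqrt (1 - k ^ 2 * sin t ^ 2)) with
      (- (2 * k * sin t ^ 2) / (2 * sqrt (1 - k ^ 2 * sin t ^ 2))).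
    - apply (is_derive_sqrt (fun s => 1 - s ^ 2 * sin t ^ 2)); [|now apply Del_arg_pos].
      auto_derive; auto; ring.
    - unfold Del in p; field; lra. }
  assert (D : is_derive (fun s => cut_int Dl (s, psi, z)) k (cut_int (D1 Dl) (k, psi, z))).
  { apply (derive_cut_int_x UK UK Dl (D1 Dl) (D2 Dl) (D3 Dl)); auto.
    - apply open_UK.
    - apply open_UK.
    - apply segments_UK.
    - apply (cinf_continuous _ _ cinf_Dl).
    - apply (cinf_continuous _ _ F1). }
  transitivity (cut_int (D1 Dl) (k, psi, z)); [exact (D1_eq EE k psi z _ D)|].
  apply (eq_of_derive (fun t => cut_int (D1 Dl) (k, t, z)) (fun t => (ellEi t k - ellF t k) / k)
    (fun t => D1 Dl (k, t, 0))).
  - intros t; apply (derive_cut_int_y UK UK (D1 Dl) k t z); auto.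
    + apply open_UK.
    + apply segments_UK.
    + apply (cinf_continuous _ _ F1).
  - intros t; assert (p := Del_pos k t Hk); rewrite E.
    replace (- (k * sin t ^ 2) / Del k t) with ((Del k t - / Del k t) / k).
    + apply (derive_div_const (fun t => ellEi t k - ellF t k)).
      apply (@is_derive_minus R_AbsRing R_NormedModule (fun t => ellEi t k) (fun t => ellF t k));
        [now apply ellEi_derive|now apply ellF_derive].
    + transitivity ((Del k t ^ 2 - 1) / (k * Del k t)); [field; lra|].
      rewrite Del_sq by auto; field; lra.
  - unfold cut_int, py; cbn [fst snd]; rewrite RInt_0_0, ellEi_0, ellF_0; field; lra.
Qed.

Lemma D2_EE k psi z : 0 < k < 1 -> D2 EE (k, psi, z) = Del k psi.
Proof. intros Hk; apply D2_eq; exact (ellEi_derive k psi Hk). Qed.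

Lemma IB_partials b C z : WB (b, C, z) ->
  is_derive (fun s => IB (s, C, z)) b
    ((b * (IB (b, C, z) - rB (b, C, z)) - sg (b, C, z) * C) / mu (b, C, z)) /\
  is_derive (fun s => IB (b, s, z)) C
    (- (C * (IB (b, C, z) - rB (b, C, z))) / mu (b, C, z) -
       b * C ^ 2 / (mu (b, C, z) * sg (b, C, z))).
Proof.
  intros H; set (v := (b, C, z)) in *.
  destruct (WB_facts v H) as (Hd & Hk & Ek & Hbk); assert (S := WB_strip v H).
  assert (hm := mu_pos v S); assert (hs := sg_pos v S).
  assert (em := mu_sq v S); assert (es := sg_sq v S).
  assert (Bd : kB v = sqrt (1 - C ^ 2 + b ^ 2)) by reflexivity.
  assert (HD : Del (kB v) (pB v) = C).
  { assert (W := WB_hat1 v H); destruct W as (k & psi & Hk' & Hp & E1 & E2).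
    change (px v) with b in *; change (py v) with C in *.
    destruct (hat1_facts k psi Hk' Hp) as (_ & Em' & _).
    assert (K : kB v = k).
    { unfold kB; replace (mu v) with (k ^ 2); [apply sqrt_pow2; lra|].
      rewrite <- Em'; unfold mu; rewrite E1, E2; reflexivity. }
    assert (P : pB v = psi).
    { unfold pB; rewrite K; change (px v) with b; rewrite <- E1; unfold hat1, px; cbn [fst snd].
      replace (k * cos psi / k) with (cos psi) by (field; lra); apply acos_cos; lra. }
    rewrite K, P; exact E2. }
  change (px v) with b in *; change (py v) with C in *.
  assert (Ekk : sqrt (1 - b / kB v * (b / kB v)) = sg v / kB v).
  { replace (1 - b / kB v * (b / kB v)) with ((sg v / kB v) ^ 2).
    - apply sqrt_pow2, Rlt_le, Rdiv_lt_0_compat; lra.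
    - transitivity ((mu v - b ^ 2) / kB v ^ 2); [rewrite em; field; lra|].
      rewrite <- Ek; field; lra. }
  assert (E1 := D1_EE (kB v) (pB v) 0 Hk); assert (E2 := D2_EE (kB v) (pB v) 0 Hk).
  fold (rB v) in E1; fold (IB v) in E1; rewrite HD in E2.
  assert (U : UK (kB v, pB v, 0)) by exact Hk.
  split.
  - assert (Dk : is_derive (fun s => kB (s, C, z)) b (b / kB v)).
    { replace (b / kB v) with (2 * b / (2 * sqrt (1 - C ^ 2 + b ^ 2))) by (rewrite <- Bd; field; lra).
      apply (is_derive_sqrt (fun s => 1 - C ^ 2 + s ^ 2)); [|exact hm].
      auto_derive; auto; ring. }
    assert (Dp : is_derive (fun s => pB (s, C, z)) b (- sg v / mu v)).
    { replace (- sg v / mu v) with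
        ((1 * kB v - b * (b / kB v)) / kB v ^ 2 * - / sqrt (1 - b / kB v * (b / kB v))).
      - apply (@is_derive_comp R_AbsRing R_NormedModule acos (fun s => s / kB (s, C, z))).
        + now apply is_derive_acos.
        + apply (is_derive_div (fun s => s) (fun s => kB (s, C, z))); auto.
          * apply (@is_derive_id R_AbsRing).
          * change (kB v <> 0); lra.
      - rewrite Ekk; apply Rmult_eq_reg_r with (kB v ^ 2 * sg v).
        2:{ apply Rgt_not_eq, Rmult_lt_0_compat; [apply pow_lt|]; lra. }
        transitivity (- (kB v ^ 2 - b ^ 2)); [field; lra|].
        transitivity (- sg v ^ 2); [rewrite Ek, em; ring|].
        rewrite Ek; field; lra. }
    assert (D := chain_cinf UK EE (fun s => kB (s, C, z)) (fun s => pB (s, C, z)) 0 b _ _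
      open_UK cinf_EE U Dk Dp); cbv beta in D; fold v in D.
    rewrite E1, E2 in D.
    replace (_ / mu v) with ((IB v - rB v) / kB v * (b / kB v) + C * (- sg v / mu v)); [exact D|].
    rewrite <- Ek; field; lra.
  - assert (Dk : is_derive (fun s => kB (b, s, z)) C (- C / kB v)).
    { replace (- C / kB v) with (- (2 * C) / (2 * sqrt (1 - C ^ 2 + b ^ 2)))
        by (rewrite <- Bd; field; lra).
      apply (is_derive_sqrt (fun s => 1 - s ^ 2 + b ^ 2)); [|exact hm].
      auto_derive; auto; ring. }
    assert (Dp : is_derive (fun s => pB (b, s, z)) C (- (b * C) / (mu v * sg v))).
    { replace (- (b * C) / (mu v * sg v)) with
        ((0 * kB v - b * (- C / kB v)) / kB v ^ 2 * - / sqrt (1 - b / kB v * (b / kB v))).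
      - apply (@is_derive_comp R_AbsRing R_NormedModule acos (fun s => b / kB (b, s, z))).
        + now apply is_derive_acos.
        + apply (is_derive_div (fun _ => b) (fun s => kB (b, s, z))); auto.
          * apply (@is_derive_const R_AbsRing R_NormedModule).
          * change (kB v <> 0); lra.
      - rewrite Ekk, <- Ek; field; lra. }
    assert (D := chain_cinf UK EE (fun s => kB (b, s, z)) (fun s => pB (b, s, z)) 0 C _ _
      open_UK cinf_EE U Dk Dp); cbv beta in D; fold v in D.
    rewrite E1, E2 in D.
    replace (_ - _) with ((IB v - rB v) / kB v * (- C / kB v) + C * (- (b * C) / (mu v * sg v)));
      [exact D|].
    rewrite <- Ek; field; lra.
Qed.

Lemma IO_partials b C z : OM (b, C, z) ->
  is_derive (fun s => IO (s, C, z)) b (Ib (b, C, z)) /\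
  is_derive (fun s => IO (b, s, z)) C (IC (b, C, z)).
Proof.
  intros H; unfold Ib, IC; destruct (OM_WA_or_WB _ H) as [[L W]|[L W]].
  - destruct (open_lines WA b C z open_WA W) as (l1 & l2 & _).
    unfold IO, rO; rewrite !glue_A by auto.
    destruct (IA_partials b C z W) as [A1 A2]; split.
    + refine (derive_ext_loc _ _ _ _ _ A1); revert l1; apply filter_imp.
      intros s Hs; symmetry; apply glue_A, Hs.
    + refine (derive_ext_loc _ _ _ _ _ A2); revert l2; apply filter_imp.
      intros s Hs; symmetry; apply glue_A, Hs.
  - destruct (open_lines WB b C z open_WB W) as (l1 & l2 & _).
    unfold IO, rO; rewrite !glue_B by (auto; intros; apply agree; auto).
    destruct (IB_partials b C z W) as [A1 A2]; split.
    + refine (derive_ext_loc _ _ _ _ _ A1); revert l1; apply filter_imp.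
      intros s Hs; symmetry; apply glue_B; auto; intros; apply agree; auto.
    + refine (derive_ext_loc _ _ _ _ _ A2); revert l2; apply filter_imp.
      intros s Hs; symmetry; apply glue_B; auto; intros; apply agree; auto.
Qed.

Definition OMd (v : R3) : Prop := OM v /\ delta v <> 0.

Lemma open_OMd : open OMd.
Proof.
  intros v [H Hd]; apply filter_and; [exact (open_OM v H)|].
  destruct (Rtotal_order (delta v) 0) as [L|[L|L]]; [|tauto|].
  - assert (O := open_lt_cinf delta (fun _ => 0) (cinf_delta _) (cinf_const _ 0) v L).
    revert O; apply filter_imp; intros; lra.
  - assert (O := open_lt_cinf (fun _ => 0) delta (cinf_const _ 0) (cinf_delta _) v L).
    revert O; apply filter_imp; intros; lra.
Qed.

Lemma sg_derive b C z : strip (b, C, z) ->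
  is_derive (fun s => sg (b, s, z)) C (- C / sg (b, C, z)).
Proof.
  intros S; assert (hs := sg_pos _ S).
  replace (- C / sg (b, C, z)) with (- (2 * C) / (2 * sg (b, C, z))) by (field; lra).
  apply (is_derive_sqrt (fun s => 1 - s ^ 2)).
  - auto_derive; auto; ring.
  - destruct S as [S1 S2]; unfold py in *; cbn [fst snd] in *; nra.
Qed.

(** The combinations of [I] and [r] to which the derivative of [y] and the Jacobian
    reduce; in terms of modulus and amplitude they are [ellS] and [ellN]. *)
Definition Sg (v : R3) : R :=
  (px v ^ 2 / mu v * (sg v * (IO v - delta v * rO v) + px v * py v) +
   py v ^ 2 * (sg v * IO v + px v * py v) - 2 * (px v * py v)) / sg v.
Definition Ng (v : R3) : R :=
  1 - (sg v * IO v + px v * py v) * (sg v * (IO v - delta v * rO v) + px v * py v) / mu v.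

Definition Jac (v : R3) : R := D2 xO v * D1 yO v - D1 xO v * D2 yO v.

Lemma xyO_partials b C z : OMd (b, C, z) ->
  let v := (b, C, z) in
  D1 yO v = 2 * (IO v + b * Ib v) / delta v + 4 * b * (b * IO v - sg v * C) / delta v ^ 2 /\
  D1 xO v = 2 * (C * Ib v - sg v) / delta v + 4 * b * (C * IO v - b * sg v) / delta v ^ 2 /\
  D2 yO v = 2 * (b * IC v + C * C / sg v - sg v) / delta v
    - 4 * C * (b * IO v - sg v * C) / delta v ^ 2 /\
  D2 xO v = 2 * (IO v + C * IC v + b * C / sg v) / delta v
    - 4 * C * (C * IO v - b * sg v) / delta v ^ 2.
Proof.
  intros [H Hd] v; assert (S : strip v) by apply H.
  assert (hs := sg_pos v S).
  destruct (IO_partials b C z H) as [A1 A2]; fold v in A1, A2.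
  assert (A3 := sg_derive b C z S); fold v in A3.
  destruct (open_lines OMd b C z open_OMd (conj H Hd)) as (l1 & l2 & _).
  assert (B1 : is_derive (fun s => delta (s, C, z)) b (- (2 * b))).
  { unfold delta, px, py; cbn [fst snd]; auto_derive; auto; ring. }
  assert (B2 : is_derive (fun s => delta (b, s, z)) C (2 * C)).
  { unfold delta, px, py; cbn [fst snd]; auto_derive; auto; ring. }
  assert (quot : forall (n d : R -> R) t n' d' l, is_derive n t n' -> is_derive d t d' ->
     d t <> 0 -> (n' * d t - n t * d') / d t ^ 2 = l -> is_derive (fun s => n s / d s) t l).
  { intros n d t n' d' l h1 h2 h3 <-; now apply is_derive_div. }
  split; [|split; [|split]].
  - apply D1_eq.
    apply derive_ext_loc with (fun s => 2 * (s * IO (s, C, z) - sg v * C) / delta (s, C, z)).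
    { revert l1; apply filter_imp; intros s [Hs Hs']; symmetry.
      exact (proj2 (xyO_formula _ Hs Hs')). }
    apply (quot (fun s => 2 * (s * IO (s, C, z) - sg v * C)) (fun s => delta (s, C, z)) b
      (2 * (IO v + b * Ib v)) (- (2 * b))); auto.
    + pose (f := fun s => IO (s, C, z)); assert (F : is_derive f b (Ib v)) by exact A1.
      change (is_derive (fun s => 2 * (s * f s - sg v * C)) b (2 * (IO v + b * Ib v))).
      change (IO v) with (f b); clearbody f; auto_derive; [eexists; eauto|].
      rewrite (Derive_eq f _ _ F); ring.
    + fold v; field; auto.
  - apply D1_eq.
    apply derive_ext_loc with (fun s => 2 * (C * IO (s, C, z) - s * sg v) / delta (s, C, z)).
    { revert l1; apply filter_imp; intros s [Hs Hs']; symmetry.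
      exact (proj1 (xyO_formula _ Hs Hs')). }
    apply (quot (fun s => 2 * (C * IO (s, C, z) - s * sg v)) (fun s => delta (s, C, z)) b
      (2 * (C * Ib v - sg v)) (- (2 * b))); auto.
    + pose (f := fun s => IO (s, C, z)); assert (F : is_derive f b (Ib v)) by exact A1.
      change (is_derive (fun s => 2 * (C * f s - s * sg v)) b (2 * (C * Ib v - sg v))).
      clearbody f; auto_derive; [eexists; eauto|].
      rewrite (Derive_eq f _ _ F); ring.
    + fold v; field; auto.
  - apply D2_eq.
    apply derive_ext_loc with (fun s => 2 * (b * IO (b, s, z) - sg (b, s, z) * s) / delta (b, s, z)).
    { revert l2; apply filter_imp; intros s [Hs Hs']; symmetry.
      exact (proj2 (xyO_formula _ Hs Hs')). }
    apply (quot (fun s => 2 * (b * IO (b, s, z) - sg (b, s, z) * s)) (fun s => delta (b, s, z)) C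
      (2 * (b * IC v + C * C / sg v - sg v)) (2 * C)); auto.
    + pose (f := fun s => IO (b, s, z)); pose (g := fun s => sg (b, s, z)).
      assert (F : is_derive f C (IC v)) by exact A2.
      assert (G : is_derive g C (- C / g C)) by exact A3.
      change (is_derive (fun s => 2 * (b * f s - g s * s)) C (2 * (b * IC v + C * C / g C - g C))).
      change (sg v) with (g C) in hs; clearbody f g; auto_derive; [repeat split; eexists; eauto|].
      rewrite (Derive_eq f _ _ F), (Derive_eq g _ _ G); field; lra.
    + fold v; field; split; auto; lra.
  - apply D2_eq.
    apply derive_ext_loc with (fun s => 2 * (s * IO (b, s, z) - b * sg (b, s, z)) / delta (b, s, z)).
    { revert l2; apply filter_imp; intros s [Hs Hs']; symmetry.
      exact (proj1 (xyO_formula _ Hs Hs')). }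
    apply (quot (fun s => 2 * (s * IO (b, s, z) - b * sg (b, s, z))) (fun s => delta (b, s, z)) C
      (2 * (IO v + C * IC v + b * C / sg v)) (2 * C)); auto.
    + pose (f := fun s => IO (b, s, z)); pose (g := fun s => sg (b, s, z)).
      assert (F : is_derive f C (IC v)) by exact A2.
      assert (G : is_derive g C (- C / g C)) by exact A3.
      change (is_derive (fun s => 2 * (s * f s - b * g s)) C (2 * (f C + C * IC v + b * C / g C))).
      change (sg v) with (g C) in hs; clearbody f g; auto_derive; [repeat split; eexists; eauto|].
      rewrite (Derive_eq f _ _ F), (Derive_eq g _ _ G); field; lra.
    + fold v; field; split; auto; lra.
Qed.

(** With [A], [B] the two brackets below, the gradients of [x] and [y] become
    linear in [A] and [B / mu], and their cross terms cancel in the Jacobian. *)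
Lemma partials_algebra (b C s I r A B d m : R) : s <> 0 -> d <> 0 -> m <> 0 ->
  s ^ 2 = 1 - C ^ 2 -> d = C ^ 2 - b ^ 2 -> m = 1 - d ->
  A = s * I + b * C -> B = s * (I - d * r) + b * C ->
  let ib := (b * (I - r) - s * C) / m in
  let ic := - (C * (I - r)) / m - b * C ^ 2 / (m * s) in
  2 * (I + b * ib) / d + 4 * b * (b * I - s * C) / d ^ 2 =
    2 / (s * d ^ 2) * (C ^ 2 * A + b ^ 2 * (B / m) - 2 * (b * C)) /\
  2 * (C * ib - s) / d + 4 * b * (C * I - b * s) / d ^ 2 =
    2 / (s * d ^ 2) * (b * C * (A + B / m) - (C ^ 2 + b ^ 2)) /\
  2 * (b * ic + C * C / s - s) / d - 4 * C * (b * I - s * C) / d ^ 2 =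
    - (2 / (s * d ^ 2) * (b * C * (A + B / m) - (C ^ 2 + b ^ 2))) /\
  2 * (I + C * ic + b * C / s) / d - 4 * C * (C * I - b * s) / d ^ 2 =
    2 / (s * d ^ 2) * (2 * (b * C) - b ^ 2 * A - C ^ 2 * (B / m)).
Proof.
  intros hs hd hm es ed em eA eB ib ic.
  assert (eI : I = (A - b * C) / s) by (rewrite eA; field; auto).
  assert (ej : C ^ 2 = 1 - s ^ 2) by lra.
  assert (eb : b ^ 2 = m - s ^ 2) by lra.
  assert (ed' : d = 1 - m) by lra.
  assert (eir : I - r = (B - m * A - d * (b * C)) / (s * d)).
  { rewrite eA, eB, em; field; auto. }
  unfold ib, ic; rewrite eir, eI; clear eA eB eI eir ib ic ed em es.
  split; [|split; [|split]]; field_simplify_eq; auto; ring [ej eb ed'].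
Qed.

Lemma jacobian_formulas v : OMd v ->
  D1 yO v = 2 * Sg v / delta v ^ 2 /\ Jac v = 4 * Ng v / (sg v ^ 2 * delta v ^ 2).
Proof.
  destruct v as [[b C] z]; intros H; destruct (xyO_partials b C z H) as (E1 & E2 & E3 & E4).
  destruct H as [H Hd]; assert (S : strip (b, C, z)) by apply H.
  assert (hs := sg_pos _ S); assert (es := sg_sq _ S); assert (em := delta_mu (b, C, z)).
  assert (hm := mu_pos _ S).
  unfold Jac; rewrite E1, E2, E3, E4; unfold Sg, Ng, Ib, IC.
  set (v := (b, C, z)) in *; change (px v) with b in *; change (py v) with C in *.
  destruct (partials_algebra b C (sg v) (IO v) (rO v) _ _ (delta v) (mu v)
    (Rgt_not_eq _ _ hs) Hd (Rgt_not_eq _ _ hm) es eq_refl ltac:(lra) eq_refl eq_refl)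
    as (F1 & F2 & F3 & F4).
  rewrite F1, F2, F3, F4.
  set (A := sg v * IO v + b * C) in *; set (B := sg v * (IO v - delta v * rO v) + b * C) in *.
  assert (ed : delta v = C ^ 2 - b ^ 2) by reflexivity.
  assert (hm' : mu v <> 0) by lra; assert (hs' : sg v <> 0) by lra.
  clearbody A B; split.
  - field; auto.
  - transitivity (4 / (sg v ^ 2 * delta v ^ 4) * ((C ^ 2 - b ^ 2) ^ 2 * (1 - A * (B / mu v)))).
    + field; auto.
    + rewrite <- ed; field; auto.
Qed.

(** ** Positivity of the Jacobian *)

Lemma Sg_dummy a b z z' : Sg (a, b, z) = Sg (a, b, z').
Proof.
  unfold Sg; rewrite (IO_dummy a b z z'), (rO_dummy a b z z'); reflexivity.
Qed.

Lemma Ng_dummy a b z z' : Ng (a, b, z) = Ng (a, b, z').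
Proof.
  unfold Ng; rewrite (IO_dummy a b z z'), (rO_dummy a b z z'); reflexivity.
Qed.

Lemma signs_hat1 k psi : 0 < k < 1 -> 0 < psi < PI ->
  Sg (hat1 k psi) = ellS k psi /\ Ng (hat1 k psi) = ellN k psi.
Proof.
  intros Hk Hp; destruct (hat1_O k psi Hk Hp) as (_ & Ed & Es & Em & Er & EI).
  assert (hs := sin_gt_0 psi (proj1 Hp) (proj2 Hp)).
  unfold Sg, Ng; rewrite Ed, Es, Em, Er, EI.
  change (px (hat1 k psi)) with (k * cos psi); change (py (hat1 k psi)) with (Del k psi).
  fold (ellq psi k); unfold ellS, ellN.
  assert (e := sin2_cos2' psi); assert (De := Del_sq k psi Hk).
  split.
  - transitivity (cos psi ^ 2 * ellq psi k + Del k psi ^ 2 * ellEi psi k +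
      cos psi * Del k psi * (cos psi ^ 2 + Del k psi ^ 2 - 2) / sin psi); [field; lra|].
    rewrite De; replace (cos psi ^ 2 + (1 - k ^ 2 * sin psi ^ 2) - 2) with
      (- (1 + k ^ 2) * sin psi ^ 2) by lra.
    field; lra.
  - field; lra.
Qed.

Lemma signs_hat2 k psi : 0 < k < 1 -> 0 < psi < PI ->
  Sg (hat2 k psi) = ellS k psi / k /\ Ng (hat2 k psi) = ellN k psi.
Proof.
  intros Hk Hp; destruct (hat2_O k psi Hk Hp) as (_ & Ed & Es & Em & Er & EI).
  assert (hs := sin_gt_0 psi (proj1 Hp) (proj2 Hp)).
  unfold Sg, Ng; rewrite Ed, Es, Em, Er, EI.
  change (px (hat2 k psi)) with (Del k psi / k); change (py (hat2 k psi)) with (cos psi).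
  replace (ellq psi k / k - (1 - (/ k) ^ 2) * (k * ellF psi k)) with (ellEi psi k / k)
    by (unfold ellq; field; lra).
  unfold ellS, ellN.
  assert (e := sin2_cos2' psi); assert (De := Del_sq k psi Hk).
  split.
  - transitivity ((cos psi ^ 2 * ellq psi k + Del k psi ^ 2 * ellEi psi k +
      cos psi * Del k psi * (cos psi ^ 2 + Del k psi ^ 2 - 2) / sin psi) / k); [field; lra|].
    rewrite De; replace (cos psi ^ 2 + (1 - k ^ 2 * sin psi ^ 2) - 2) with
      (- (1 + k ^ 2) * sin psi ^ 2) by lra.
    field; lra.
  - field; lra.
Qed.

Lemma limit_lower (f : R3 -> R) b C z m : continuous f (b, C, z) -> 0 < b ->
  (forall b', 0 < b' < b -> m <= f (b', C, z)) -> m <= f (b, C, z).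
Proof.
  intros Hf Hb H; destruct (Rle_or_lt m (f (b, C, z))) as [L|L]; auto; exfalso.
  destruct (proj1 (cont_box f _) Hf (m - f (b, C, z)) ltac:(lra)) as (d & Hd & Hw).
  set (b' := Rmax (b / 2) (b - d / 2)).
  assert (B : b / 2 <= b' /\ b - d / 2 <= b' /\ b' < b).
  { unfold b'; split; [apply Rmax_l|split; [apply Rmax_r|]]; apply Rmax_lub_lt; lra. }
  assert (A := H b' ltac:(lra)).
  assert (K : box d (b, C, z) (b', C, z)).
  { unfold box, px, py, pz; cbn [fst snd]; rewrite !Rminus_diag, !Rabs_R0.
    split; [|split; auto]; rewrite Rabs_left; lra. }
  specialize (Hw _ K); apply Rabs_def2 in Hw; lra.
Qed.

(** The denominators [delta ^ 2] vanish on the separatrix [b = C], but the lower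
    estimates of [ellS] and [ellN] contain the factor [(1 - k ^ 2) ^ 2 = delta ^ 2].
    After cancellation the bounds are positive and depend on [C] only, so that they
    persist in the limit. *)
Lemma below_separatrix b C z : OM (b, C, z) -> 0 < b < C ->
  C ^ 2 * (sg (b, C, z) ^ 3 / 3) <= D1 yO (b, C, z) /\
  2 / 3 * sg (b, C, z) ^ 2 <= Jac (b, C, z).
Proof.
  intros H L; assert (W : WB (b, C, z)).
  { split; auto; unfold px, py; cbn [fst snd]; lra. }
  destruct (WB_hat1 _ W) as (k & psi & Hk & Hp & E1 & E2).
  destruct (hat1_O k psi Hk Hp) as (_ & Ed & Es & Em & _).
  unfold hat1, px, py in E1, E2; cbn [fst snd] in E1, E2.
  assert (hs := sin_gt_0 psi (proj1 Hp) (proj2 Hp)).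
  assert (Hp2 : psi <= PI / 2).
  { destruct (Rle_or_lt psi (PI / 2)) as [A|A]; auto; exfalso.
    assert (Q := cos_lt_0 psi A ltac:(lra)); nra. }
  assert (Ed' : delta (b, C, z) = 1 - k ^ 2).
  { rewrite <- Ed; unfold hat1; rewrite E1, E2; reflexivity. }
  assert (Es' : sg (b, C, z) = k * sin psi).
  { rewrite <- Es; unfold hat1; rewrite E1, E2; reflexivity. }
  assert (k2 : 0 < 1 - k ^ 2) by nra.
  destruct (jacobian_formulas (b, C, z)) as [J1 J2]; [split; auto; lra|].
  destruct (signs_hat1 k psi Hk Hp) as [S1 S2]; unfold hat1 in S1, S2; rewrite E1, E2 in S1, S2.
  rewrite J1, J2, (Sg_dummy b C z 0), (Ng_dummy b C z 0), S1, S2, Ed', Es'.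
  assert (k4 : 0 < (1 - k ^ 2) ^ 2) by now apply pow_lt.
  assert (A := ellS_lower k Hk psi ltac:(lra)); assert (B := ellN_lower k Hk psi ltac:(lra)).
  cbv beta in A; rewrite E2 in A.
  assert (s3 : 0 < sin psi ^ 3) by now apply pow_lt.
  assert (s2 : 0 < sin psi ^ 2) by now apply pow_lt.
  split.
  - apply Rmult_le_reg_r with ((1 - k ^ 2) ^ 2); auto.
    replace (2 * ellS k psi / (1 - k ^ 2) ^ 2 * (1 - k ^ 2) ^ 2) with (2 * ellS k psi)
      by (field; lra).
    apply Rle_trans with (2 * (C ^ 2 * ((1 - k ^ 2) ^ 2 * (sin psi ^ 3 / 6)))).
    + replace (C ^ 2 * ((k * sin psi) ^ 3 / 3) * (1 - k ^ 2) ^ 2) with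
        (2 * (C ^ 2 * ((1 - k ^ 2) ^ 2 * (k ^ 3 * sin psi ^ 3 / 6)))) by field.
      apply Rmult_le_compat_l; [lra|]; apply Rmult_le_compat_l; [apply pow2_ge_0|].
      apply Rmult_le_compat_l; [lra|].
      assert (k ^ 3 <= 1) by (rewrite <- (pow1 3); apply pow_incr; lra); nra.
    + assert (q := pow2_ge_0 (cos psi)).
      assert (0 <= (1 - k ^ 2) ^ 2 * (sin psi ^ 3 / 6)) by (apply Rmult_le_pos; lra).
      nra.
  - apply Rmult_le_reg_r with ((k * sin psi) ^ 2 * (1 - k ^ 2) ^ 2).
    { apply Rmult_lt_0_compat; auto; apply pow_lt; nra. }
    replace (4 * ellN k psi / _ * _) with (4 * ellN k psi) by (field; lra).
    apply Rle_trans with (4 * ((1 - k ^ 2) ^ 2 * (sin psi ^ 4 / 6))); [|lra].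
    replace (2 / 3 * (k * sin psi) ^ 2 * ((k * sin psi) ^ 2 * (1 - k ^ 2) ^ 2)) with
      (4 * ((1 - k ^ 2) ^ 2 * (k ^ 4 * sin psi ^ 4 / 6))) by field.
    apply Rmult_le_compat_l; [lra|]; apply Rmult_le_compat_l; [lra|].
    assert (k ^ 4 <= 1) by (rewrite <- (pow1 4); apply pow_incr; lra).
    assert (0 <= sin psi ^ 4) by (apply pow_le; lra); nra.
Qed.

Lemma continuous_Jac v : OM v -> continuous (D1 yO) v /\ continuous Jac v.
Proof.
  intros H.
  destruct (cinf_partials OM yO open_OM cinf_yO) as (_ & F1 & F2 & _).
  destruct (cinf_partials OM xO open_OM cinf_xO) as (_ & G1 & G2 & _).
  split; [now apply (cinf_continuous OM)|].
  apply (cinf_continuous OM); auto.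
  apply cinf_minus; apply cinf_mult; auto.
Qed.

Lemma Jac_pos v : OM v -> 0 < D1 yO v /\ 0 < Jac v.
Proof.
  destruct v as [[b C] z]; intros H; assert (S : strip (b, C, z)) by apply H.
  assert (hs := sg_pos _ S).
  destruct (Req_dec (delta (b, C, z)) 0) as [E|E].
  - assert (Eb : b = C /\ 0 < b).
    { destruct H as [_ H]; unfold delta, px, py in *; cbn [fst snd] in *.
      assert (F : (C + b) * (C - b) = 0) by (rewrite <- E; ring).
      apply Rmult_integral in F; lra. }
    destruct Eb as [Eb hb]; destruct (continuous_Jac _ H) as [C1 C2].
    assert (K : forall b', 0 < b' < b -> OM (b', C, z) /\ sg (b', C, z) = sg (b, C, z)).
    { intros b' Hb'; split; [|reflexivity]; destruct S as [S1 S2].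
      unfold OM, strip, px, py in *; cbn [fst snd] in *; lra. }
    split; eapply Rlt_le_trans.
    2:{ apply (limit_lower (D1 yO) b C z (C ^ 2 * (sg (b, C, z) ^ 3 / 3))); auto.
        intros b' Hb'; destruct (K b' Hb') as [K1 <-]; apply below_separatrix; auto; lra. }
    + apply Rmult_lt_0_compat; [apply pow_lt; lra|].
      apply Rdiv_lt_0_compat; [now apply pow_lt|lra].
    + apply (Rmult_lt_0_compat (2 / 3) (sg (b, C, z) ^ 2)); [lra|now apply pow_lt].
    + apply (limit_lower Jac b C z (2 / 3 * sg (b, C, z) ^ 2)); auto.
      intros b' Hb'; destruct (K b' Hb') as [K1 <-]; apply below_separatrix; auto; lra.
  - destruct (jacobian_formulas (b, C, z) (conj H E)) as [-> ->].
    assert (d2 : 0 < delta (b, C, z) ^ 2) by (apply pow2_gt_0; auto).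
    assert (P : 0 < Sg (b, C, z) /\ 0 < Ng (b, C, z)).
    { destruct (OM_cases _ H) as (w & E1 & E2 & K).
      rewrite (dummy_eq Sg (b, C, z) w), (dummy_eq Ng (b, C, z) w) by
        (auto using Sg_dummy, Ng_dummy).
      destruct K as [(k & psi & Hk & Hp & ->)|[(k & psi & Hk & Hp & ->)|(p & Hp & ->)]].
      - destruct (signs_hat1 k psi Hk Hp) as [-> ->].
        split; [now apply ellS_pos|now apply ellN_pos].
      - destruct (signs_hat2 k psi Hk Hp) as [-> ->].
        split; [apply Rdiv_lt_0_compat; [now apply ellS_pos|lra]|now apply ellN_pos].
      - exfalso; apply E; unfold delta; rewrite <- E1, <- E2; unfold hat3, px, py;
          cbn [fst snd]; ring. }
    destruct P as [P1 P2]; split; apply Rdiv_lt_0_compat; try lra.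
    apply Rmult_lt_0_compat; auto; now apply pow_lt.
Qed.

(** * The symmetric arcs fill the region between the two curves *)

Lemma yO_line b C z : OM (b, C, z) ->
  is_derive (fun s => yO (s, C, z)) b (D1 yO (b, C, z)).
Proof.
  intros H; destruct (cinf_partials OM yO open_OM cinf_yO) as (P & _).
  destruct (P b C z H) as (P1 & _); exact P1.
Qed.

Lemma yO_increasing b b' C z : OM (b, C, z) -> b < b' -> yO (b, C, z) < yO (b', C, z).
Proof.
  intros [S H] L.
  assert (K : forall s, b <= s <= b' -> OM (s, C, z)).
  { intros s Hs; split; [exact S|]; unfold px, py in *; cbn [fst snd] in *; lra. }
  apply (pos_of_derive (fun s => yO (s, C, z)) (fun s => D1 yO (s, C, z))); auto.
  - intros s Hs; apply yO_line, K, Hs.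
  - intros s Hs; apply Jac_pos, K, Hs.
Qed.

(** The integrand [k ^ 2 cos ^ 2 / Del] is at least [k ^ 2 cos ^ 2]. *)
Lemma ellq_lower k x : 0 < k < 1 -> 0 <= x ->
  k ^ 2 * ((x + sin x * cos x) / 2) <= ellq x k.
Proof.
  intros Hk Hx.
  assert (H : ellq 0 k - k ^ 2 * ((0 + sin 0 * cos 0) / 2) <=
              ellq x k - k ^ 2 * ((x + sin x * cos x) / 2)).
  { apply (nonneg_of_derive (fun x => ellq x k - k ^ 2 * ((x + sin x * cos x) / 2))
      (fun x => k ^ 2 * cos x ^ 2 / Del k x - k ^ 2 * cos x ^ 2)); auto; intros t _.
    - apply (@is_derive_minus R_AbsRing R_NormedModule (fun x => ellq x k)
        (fun x => k ^ 2 * ((x + sin x * cos x) / 2))); [now apply ellq_derive|].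
      auto_derive; auto; assert (e := sin2_cos2' t).
      transitivity (k ^ 2 * ((1 + cos t ^ 2 - sin t ^ 2) / 2)); [field|].
      replace (sin t ^ 2) with (1 - cos t ^ 2) by lra; field.
    - assert (h := Del_pos k t Hk); assert (h1 := Del_le_1 k t Hk).
      assert (0 <= k ^ 2 * cos t ^ 2) by (apply Rmult_le_pos; apply pow2_ge_0).
      assert (1 <= / Del k t) by (rewrite <- Rinv_1; apply Rinv_le_contravar; lra).
      unfold Rdiv; nra. }
  rewrite ellq_0, sin_0 in H; lra.
Qed.

(** For large [b] the numerator [b I - s C] of the height remains bounded, since
    [b I <= PI], whereas [delta] grows like [b ^ 2]. *)
Lemma yO_far b C : -1 < C < 1 -> 2 <= b -> Rabs (yO (b, C, 0)) <= 2 * (PI + 1) / b.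
Proof.
  intros HC Hb.
  assert (H : OM (b, C, 0)) by (unfold OM, strip, px, py; cbn [fst snd]; lra).
  assert (ed : delta (b, C, 0) = C ^ 2 - b ^ 2) by reflexivity.
  assert (Hd : b < - delta (b, C, 0)) by (rewrite ed; nra).
  assert (Hd0 : delta (b, C, 0) <> 0) by lra.
  destruct (xyO_formula _ H Hd0) as [_ ->].
  assert (hs := sg_pos _ (proj1 H)); assert (es := sg_sq _ (proj1 H)).
  assert (HI : 0 <= b * IO (b, C, 0) <= PI).
  { destruct (OM_cases _ H) as (w & E1 & E2 & K).
    rewrite (dummy_eq IO (b, C, 0) w) by (auto using IO_dummy).
    unfold px at 2 in E1; unfold py at 2 in E2; cbn [fst snd] in E1, E2.
    destruct K as [(k & psi & Hk & Hp & ->)|[(k & psi & Hk & Hp & ->)|(p & Hp & ->)]].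
    - exfalso; unfold hat1, px in E1; cbn [fst snd] in E1; assert (c := COS_bound psi); nra.
    - destruct (hat2_O k psi Hk Hp) as (_ & _ & _ & _ & _ & ->).
      unfold hat2, px in E1; cbn [fst snd] in E1; rewrite <- E1.
      destruct (q_bounds k Hk psi ltac:(lra)) as [q1 q2].
      assert (D0 := Del_pos k psi Hk); assert (D1 := Del_le_1 k psi Hk).
      replace (Del k psi / k * (ellq psi k / k)) with (Del k psi * (ellq psi k / k ^ 2))
        by (field; lra).
      assert (0 <= ellq psi k / k ^ 2 <= psi).
      { assert (0 < k ^ 2) by nra; split; [apply Rmult_le_pos; [lra|]|].
        - now apply Rlt_le, Rinv_0_lt_compat.
        - apply Rmult_le_reg_r with (k ^ 2); auto; unfold Rdiv.
          rewrite Rmult_assoc, Rinv_l; lra. }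
      nra.
    - exfalso; unfold hat3, px, py in E1, E2; cbn [fst snd] in E1, E2; lra. }
  change (px (b, C, 0)) with b; change (py (b, C, 0)) with C in *.
  set (s := sg (b, C, 0)) in *; set (d := delta (b, C, 0)) in *.
  set (I := IO (b, C, 0)) in *.
  assert (hsC : - 1 <= s * C <= 1) by (split; nra).
  assert (p := PI_RGT_0).
  unfold Rdiv; rewrite Rabs_mult, Rabs_inv, (Rabs_left d) by lra.
  apply Rmult_le_compat; [apply Rabs_pos| |apply Rabs_le; lra|].
  - apply Rlt_le, Rinv_0_lt_compat; lra.
  - apply Rinv_le_contravar; lra.
Qed.

Lemma yO_small C e : -1 < C < 1 -> 0 < e ->
  exists b0, forall b, b0 <= b -> OM (b, C, 0) /\ Rabs (yO (b, C, 0)) < e.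
Proof.
  intros HC He; assert (p := PI_RGT_0); exists (2 + 2 * (PI + 1) / e); intros b Hb.
  assert (h : 0 < 2 * (PI + 1) / e) by (apply Rdiv_lt_0_compat; lra).
  split; [unfold OM, strip, px, py; cbn [fst snd]; lra|].
  eapply Rle_lt_trans; [apply yO_far; lra|].
  apply Rmult_lt_reg_r with (b / e); [apply Rdiv_lt_0_compat; lra|].
  replace (2 * (PI + 1) / b * (b / e)) with (2 * (PI + 1) / e) by (field; lra).
  replace (e * (b / e)) with b by (field; lra); lra.
Qed.

(** The height increases with [b] towards the limit 0. *)
Lemma yO_neg v : OM v -> yO v < 0.
Proof.
  destruct v as [[b C] z]; intros H; rewrite (yO_dummy b C z 0).
  destruct (Rlt_or_le (yO (b, C, 0)) 0) as [L|L]; auto; exfalso.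
  assert (HC : -1 < C < 1) by (destruct H as [S _]; exact S).
  assert (P := yO_increasing b (b + 1) C 0 H ltac:(lra)).
  assert (H1 : OM (b + 1, C, 0)).
  { destruct H as [S H]; split; [exact S|]; unfold px, py in *; cbn [fst snd] in *; lra. }
  destruct (yO_small C (yO (b + 1, C, 0)) HC ltac:(lra)) as (b0 & Hb0).
  assert (N0 := Rmax_l b0 (b + 2)); assert (N1 := Rmax_r b0 (b + 2)).
  destruct (Hb0 _ N0) as [_ A].
  assert (Q := yO_increasing (b + 1) (Rmax b0 (b + 2)) C 0 H1 ltac:(lra)).
  apply Rabs_def2 in A; lra.
Qed.

Lemma IO_nonneg v : OM v -> delta v <> 0 -> 0 <= IO v.
Proof.
  intros H Hd; destruct (OM_cases _ H) as (w & E1 & E2 & K).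
  rewrite (dummy_eq IO v w) by (auto using IO_dummy).
  destruct K as [(k & psi & Hk & Hp & ->)|[(k & psi & Hk & Hp & ->)|(p & Hp & ->)]].
  - destruct (hat1_O k psi Hk Hp) as (_ & _ & _ & _ & _ & ->).
    apply Rlt_le, (E_pos k Hk); lra.
  - destruct (hat2_O k psi Hk Hp) as (_ & _ & _ & _ & _ & ->).
    destruct (q_bounds k Hk psi ltac:(lra)) as [q1 q2].
    apply Rmult_le_pos; [lra|apply Rlt_le, Rinv_0_lt_compat; lra].
  - exfalso; apply Hd; unfold delta; rewrite <- E1, <- E2; unfold hat3, px, py; cbn [fst snd].
    ring.
Qed.

(** As [u = C + b] tends to zero, [delta = u (C - b)] does too, whereas the
    numerator of the height does not: it is dominated by [s C], with the sign
    opposite to that of [delta]. If [C = 0], the numerator is [u I] and [delta] is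
    [- u ^ 2], while [I] stays away from 0. *)
Lemma yO_low C y : -1 < C < 1 -> exists b, OM (b, C, 0) /\ yO (b, C, 0) < y.
Proof.
  intros HC.
  assert (far : forall m c, 0 < m -> 0 < c -> exists u, 0 < u <= c /\ - (m / u) < y).
  { intros m c Hm Hc; exists (Rmin c (m / (1 + Rabs y))).
    assert (a := Rabs_pos y); assert (a' := Rle_abs (- y)); rewrite Rabs_Ropp in a'.
    assert (q : 0 < m / (1 + Rabs y)) by (apply Rdiv_lt_0_compat; lra).
    assert (r := Rmin_l c (m / (1 + Rabs y))); assert (r' := Rmin_r c (m / (1 + Rabs y))).
    assert (r0 : 0 < Rmin c (m / (1 + Rabs y))) by (apply Rmin_glb_lt; lra).
    split; [lra|].
    enough (1 + Rabs y <= m / Rmin c (m / (1 + Rabs y))) by lra.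
    apply Rmult_le_reg_r with (Rmin c (m / (1 + Rabs y)) / (1 + Rabs y)).
    - apply Rdiv_lt_0_compat; lra.
    - replace ((1 + Rabs y) * (_ / _)) with (Rmin c (m / (1 + Rabs y))) by (field; lra).
      replace (m / _ * _) with (m / (1 + Rabs y)) by (field; lra); exact r'. }
  assert (key : forall m c, 0 < m -> 0 < c -> (forall u, 0 < u <= c -> 2 * C - u <> 0) ->
    (forall u, 0 < u <= c -> OM (u - C, C, 0) -> 0 <= IO (u - C, C, 0) ->
       2 * ((u - C) * IO (u - C, C, 0) - sg (u - C, C, 0) * C) / (u * (2 * C - u)) <= - (m / u)) ->
    exists b, OM (b, C, 0) /\ yO (b, C, 0) < y).
  { intros m c Hm Hc H0 H; destruct (far m c Hm Hc) as (u & Hu & Hy); exists (u - C).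
    assert (HO : OM (u - C, C, 0)) by (unfold OM, strip, px, py; cbn [fst snd]; lra).
    assert (Ed : delta (u - C, C, 0) = u * (2 * C - u)).
    { unfold delta, px, py; cbn [fst snd]; ring. }
    assert (Hd : delta (u - C, C, 0) <> 0).
    { rewrite Ed; apply Rmult_integral_contrapositive; split; [lra|now apply H0]. }
    split; [exact HO|].
    destruct (xyO_formula _ HO Hd) as [_ ->]; rewrite Ed.
    specialize (H u Hu HO (IO_nonneg _ HO Hd)).
    change (px (u - C, C, 0)) with (u - C); change (py (u - C, C, 0)) with C; lra. }
  set (s := sqrt (1 - C ^ 2)); assert (hs : 0 < s) by (apply sqrt_lt_R0; nra).
  assert (div : forall x d m u, 0 < u -> 0 < d -> m * d <= x -> m / u <= x / (u * d)).
  { intros x d m u hu hd hx; apply Rmult_le_reg_r with (u * d); [nra|].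
    replace (m / u * (u * d)) with (m * d) by (field; lra).
    replace (x / (u * d) * (u * d)) with x by (field; lra); auto. }
  destruct (Rtotal_order C 0) as [L|[L|L]].
  - apply (key (s * - C / 2) 1); [nra|lra|intros; lra|intros u Hu HO HI].
    change (sg (u - C, C, 0)) with s; set (I := IO (u - C, C, 0)) in *.
    replace (2 * _ / _) with (- (2 * ((u - C) * I + s * - C) / (u * (u - 2 * C))))
      by (field; lra).
    apply Ropp_le_contravar, div; try lra.
    assert (0 <= (u - C) * I) by (apply Rmult_le_pos; lra).
    assert (0 < s * - C) by nra; nra.
  - (* the integral over a quarter of the period does not degenerate *)
    apply (key (1 / 2) 1); [lra|lra|intros; lra|intros u Hu HO HI].
    rewrite L in *; replace (u - 0) with u in * by ring.
    assert (HI' : 1 / 4 <= IO (u, 0, 0)).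
    { destruct (OM_cases _ HO) as (w & E1 & E2 & K).
      rewrite (dummy_eq IO (u, 0, 0) w) by (auto using IO_dummy).
      unfold px at 2 in E1; unfold py at 2 in E2; cbn [fst snd] in E1, E2.
      destruct K as [(k & psi & Hk & Hp & ->)|[(k & psi & Hk & Hp & ->)|(p & Hp & ->)]].
      - exfalso; unfold hat1, py in E2; cbn [fst snd] in E2; assert (q := Del_pos k psi Hk); lra.
      - destruct (hat2_O k psi Hk Hp) as (_ & _ & _ & _ & _ & ->).
        unfold hat2, px, py in E1, E2; cbn [fst snd] in E1, E2.
        assert (q := ellq_lower k psi Hk ltac:(lra)); rewrite E2 in q.
        assert (hp : PI / 2 <= psi).
        { destruct (Rle_or_lt (PI / 2) psi) as [A|A]; auto.
          assert (Q := cos_gt_0 psi ltac:(lra) A); lra. }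
        assert (p1 := PI2_1).
        assert (D2 := Del_sq' k psi Hk); rewrite E2 in D2.
        assert (D0 := Del_pos k psi Hk).
        assert (E1' : Del k psi = u * k) by (rewrite <- E1; field; lra).
        assert (hk : 1 / 2 <= k).
        { rewrite E1' in D2; assert (u ^ 2 <= 1) by nra.
          assert (u ^ 2 * k ^ 2 <= 1 * k ^ 2) by (apply Rmult_le_compat_r; [nra|lra]).
          nra. }
        apply Rmult_le_reg_r with k; [lra|]; unfold Rdiv at 2; rewrite Rmult_assoc, Rinv_l by lra.
        nra.
      - exfalso; unfold hat3, py in E2; cbn [fst snd] in E2.
        assert (c := Rinv_0_lt_compat _ (cosh_pos p)); lra. }
    set (I := IO (u, 0, 0)) in *.
    replace (2 * _ / _) with (- (2 * (u * I) / (u * u))) by (field; lra).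
    apply Ropp_le_contravar, div; try lra; nra.
  - apply (key (s * C) C); [nra|lra|intros; lra|intros u Hu HO HI].
    change (sg (u - C, C, 0)) with s; set (I := IO (u - C, C, 0)) in *.
    replace (2 * _ / _) with (- (2 * (s * C + (C - u) * I) / (u * (2 * C - u))))
      by (field; lra).
    apply Ropp_le_contravar, div; try lra.
    assert (0 <= (C - u) * I) by (apply Rmult_le_pos; lra).
    assert (0 < s * C) by nra; nra.
Qed.

Lemma yO_surj C y : -1 < C < 1 -> y < 0 -> exists b, OM (b, C, 0) /\ yO (b, C, 0) = y.
Proof.
  intros HC Hy; destruct (yO_low C y HC) as (b1 & H1 & L1).
  destruct (yO_small C (- y) HC ltac:(lra)) as (b0 & Hb0).
  assert (N0 := Rmax_l b0 (b1 + 1)); assert (N1 := Rmax_r b0 (b1 + 1)).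
  destruct (Hb0 _ N0) as [_ A]; apply Rabs_def2 in A.
  assert (K : forall s, b1 <= s -> OM (s, C, 0)).
  { intros s Hs; destruct H1 as [S H1]; split; [exact S|].
    unfold px, py in *; cbn [fst snd] in *; lra. }
  destruct (ivt_value (fun s => yO (s, C, 0)) b1 (Rmax b0 (b1 + 1)) y) as (b & Hb & E).
  - lra.
  - intros x Hx; eapply derive_continuity_pt, yO_line, K; lra.
  - lra.
  - exists b; split; [apply K; lra|exact E].
Qed.

(** The momentum [b] of the arc with second momentum [py v] whose end lies at the
    height [px v]: the inverse of [yO] in its first variable. *)
Definition b_at_height (v : R3) : R :=
  epsilon (inhabits 0) (fun b => OM (b, py v, 0) /\ yO (b, py v, 0) = px v).
Definition VY (v : R3) : Prop := px v < 0 /\ strip v.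

Lemma b_at_height_spec y C z : VY (y, C, z) ->
  OM (b_at_height (y, C, z), C, 0) /\ yO (b_at_height (y, C, z), C, 0) = y.
Proof.
  intros [H1 H2]; unfold b_at_height at 1 2; apply epsilon_spec.
  apply yO_surj; [exact H2|exact H1].
Qed.

Lemma yO_inj b b' C : OM (b, C, 0) -> OM (b', C, 0) -> yO (b, C, 0) = yO (b', C, 0) -> b = b'.
Proof.
  intros H H' E; destruct (Rtotal_order b b') as [L|[L|L]]; auto; exfalso.
  - assert (A := yO_increasing b b' C 0 H L); lra.
  - assert (A := yO_increasing b' b C 0 H' L); lra.
Qed.

Lemma b_at_height_unique b C z : OM (b, C, 0) -> b_at_height (yO (b, C, 0), C, z) = b.
Proof.
  intros H; destruct (b_at_height_spec (yO (b, C, 0)) C z) as [B1 B2].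
  - split; [apply (yO_neg _ H)|apply (proj1 H)].
  - now apply (yO_inj _ _ C).
Qed.

Lemma cinf_b_at_height : open VY /\ cinf VY b_at_height.
Proof.
  apply (cinf_param_inverse OM VY yO b_at_height).
  - apply open_OM.
  - intros x x' t y z [S H] _ Ht; split; [exact S|].
    unfold px, py in *; cbn [fst snd] in *; lra.
  - apply cinf_yO.
  - intros; now apply Jac_pos.
  - intros x y z H; split; [now apply yO_neg|apply (proj1 H)].
  - intros t y z H; destruct (b_at_height_spec t y z H) as [B1 B2]; split; [exact B1|].
    now rewrite (yO_dummy _ _ z 0).
Qed.

(** ** The abscissa at a given height *)

(** In the coordinates [(C, y)], instead of [(b, C)], the abscissa of the end point
    is to be inverted in its first variable. *)
Definition x_at_height (v : R3) : R := xO (b_at_height (py v, px v, 0), px v, 0).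
Definition UX (v : R3) : Prop := (-1 < px v /\ px v < 1) /\ py v < 0.

Lemma open_UX : open UX.
Proof.
  apply (open_gt py (fun _ => 0) (fun v => -1 < px v /\ px v < 1)).
  - apply (open_gt px (fun _ => 1) (fun v => -1 < px v)).
    + apply (open_lt_cinf (fun _ => -1) px); [apply cinf_const|apply cinf_px].
    + intros; apply continuous_px.
    + intros; apply continuous_const.
  - intros; apply continuous_py.
  - intros; apply continuous_const.
Qed.

Lemma UX_VY C y z : UX (C, y, z) -> VY (y, C, 0).
Proof. intros [H1 H2]; split; [exact H2|exact H1]. Qed.

Lemma cinf_x_at_height : cinf UX x_at_height.
Proof.
  destruct cinf_b_at_height as [OV CB].
  apply (cinf_comp UX OM xO (fun v => b_at_height (py v, px v, 0)) px (fun _ => 0)).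
  - apply open_OM.
  - intros [[C y] z] H; apply (b_at_height_spec y C 0), (UX_VY C y z H).
  - apply cinf_xO.
  - apply (cinf_comp UX VY b_at_height py px (fun _ => 0)); auto.
    + intros [[C y] z] H; exact (UX_VY C y z H).
    + apply cinf_py.
    + apply cinf_px.
    + apply cinf_const.
  - apply cinf_px.
  - apply cinf_const.
Qed.

(** The derivative in [C] at constant height is the Jacobian divided by the
    derivative of the height in [b]. *)
Lemma x_at_height_derive_pos v : UX v -> 0 < D1 x_at_height v.
Proof.
  destruct v as [[C y] z]; intros H; assert (HV := UX_VY C y z H).
  destruct cinf_b_at_height as [OV CB]; destruct (b_at_height_spec y C 0 HV) as [B1 B2].
  set (B := b_at_height (y, C, 0)) in *.
  destruct (cinf_partials VY b_at_height OV CB) as (Pb & _).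
  destruct (Pb y C 0 HV) as (_ & Db & _); set (db := D2 b_at_height (y, C, 0)) in *.
  destruct (Jac_pos _ B1) as [J1 J2].
  assert (Did : is_derive (fun s : R => s) C 1) by apply (@is_derive_id R_AbsRing).
  (* the height is constant along the curve [b_at_height (y, _)] *)
  assert (Ey : D1 yO (B, C, 0) * db + D2 yO (B, C, 0) * 1 = 0).
  { assert (Dy := chain_cinf OM yO (fun s => b_at_height (y, s, 0)) (fun s => s) 0 C db 1
      open_OM cinf_yO B1 Db Did); cbv beta in Dy; fold B in Dy.
    rewrite <- (is_derive_unique _ _ _ Dy); apply is_derive_unique.
    apply derive_ext_loc with (fun _ => y).
    - destruct (open_lines VY y C 0 OV HV) as (_ & l & _); revert l; apply filter_imp.
      intros s Hs; symmetry; apply (b_at_height_spec y s 0 Hs).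
    - apply (@is_derive_const R_AbsRing R_NormedModule). }
  assert (Dx := chain_cinf OM xO (fun s => b_at_height (y, s, 0)) (fun s => s) 0 C db 1
      open_OM cinf_xO B1 Db Did); cbv beta in Dx; fold B in Dx.
  assert (E : D1 x_at_height (C, y, z) = D1 xO (B, C, 0) * db + D2 xO (B, C, 0) * 1)
    by exact (is_derive_unique _ _ _ Dx).
  rewrite E; unfold Jac in J2.
  apply Rmult_lt_reg_r with (D1 yO (B, C, 0)); auto; rewrite Rmult_0_l.
  replace ((D1 xO (B, C, 0) * db + D2 xO (B, C, 0) * 1) * D1 yO (B, C, 0)) with
    (D2 xO (B, C, 0) * D1 yO (B, C, 0) + D1 xO (B, C, 0) * (D1 yO (B, C, 0) * db)) by ring.
  replace (D1 yO (B, C, 0) * db) with (- D2 yO (B, C, 0)) by lra; lra.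
Qed.

Lemma x_at_height_line C y z : UX (C, y, z) ->
  is_derive (fun s => x_at_height (s, y, z)) C (D1 x_at_height (C, y, z)).
Proof.
  intros H; destruct (cinf_partials UX x_at_height open_UX cinf_x_at_height) as (P & _).
  destruct (P C y z H) as (P1 & _); exact P1.
Qed.

Lemma x_at_height_increasing C C' y z : UX (C, y, z) -> C < C' < 1 ->
  x_at_height (C, y, z) < x_at_height (C', y, z).
Proof.
  intros H L.
  assert (K : forall s, C <= s <= C' -> UX (s, y, z)).
  { intros s Hs; unfold UX, px, py in *; cbn [fst snd] in *; lra. }
  apply (pos_of_derive (fun s => x_at_height (s, y, z)) (fun s => D1 x_at_height (s, y, z))); [| |lra].
  - intros s Hs; apply x_at_height_line, K, Hs.
  - intros s Hs; apply x_at_height_derive_pos, K, Hs.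
Qed.

(** ** The boundary curves as limits of symmetric arcs *)

Lemma x3_k y : y < 0 -> exists k, 0 < k < 1 /\ y = - (4 * k * ellE k / (1 - k ^ 2)) /\
  x3 y = 4 * ellE k / (1 - k ^ 2).
Proof.
  intros Hy; destruct (x3_spec y Hy) as (n & Hn & E1 & ->).
  destruct (n_of_k n Hn) as (Hk & En & _); exists (sqrt (n / (1 + n))).
  set (k := sqrt (n / (1 + n))) in *; split; [exact Hk|].
  destruct (k_of_n k Hk) as (_ & E2 & E3); rewrite En in E2, E3.
  rewrite ellE_Et, En by auto; rewrite E2 in E1; rewrite E3.
  assert (h : 0 < 1 - k ^ 2) by nra; assert (hs := sqrt_lt_R0 _ h).
  assert (e := pow2_sqrt (1 - k ^ 2) (Rlt_le _ _ h)).
  set (kap := sqrt (1 - k ^ 2)) in *.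
  split; [replace y with (- - y) by ring; rewrite E1|]; rewrite <- e; field; lra.
Qed.

Lemma x2_k y : y < 0 -> exists k, 0 < k < 1 /\ y = - (4 * ella k / (1 - k ^ 2)) /\
  x2 y = 4 * k * ella k / (1 - k ^ 2).
Proof.
  intros Hy; destruct (x2_spec y Hy) as (n & Hn & E1 & ->).
  destruct (n_of_k n Hn) as (Hk & En & _); exists (sqrt (n / (1 + n))).
  set (k := sqrt (n / (1 + n))) in *; split; [exact Hk|].
  destruct (k_of_n k Hk) as (_ & E2 & E3); rewrite En in E2, E3.
  rewrite ella_At, En by auto; rewrite E3 in E1; rewrite E2.
  assert (h : 0 < 1 - k ^ 2) by nra; assert (hs := sqrt_lt_R0 _ h).
  assert (e := pow2_sqrt (1 - k ^ 2) (Rlt_le _ _ h)).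
  set (kap := sqrt (1 - k ^ 2)) in *.
  split; [replace y with (- - y) by ring; rewrite E1|]; rewrite <- e; field; lra.
Qed.

Lemma n_increasing k k' : 0 < k < k' -> k' < 1 -> k ^ 2 / (1 - k ^ 2) < k' ^ 2 / (1 - k' ^ 2).
Proof.
  intros H H'; assert (k ^ 2 < k' ^ 2) by nra; assert (k' ^ 2 < 1) by nra.
  unfold Rdiv; apply Rmult_le_0_lt_compat; [nra| |auto|].
  - apply Rlt_le, Rinv_0_lt_compat; lra.
  - apply Rinv_lt_contravar; [apply Rmult_lt_0_compat|]; lra.
Qed.

Lemma curve3_increasing k k' : 0 < k < k' -> k' < 1 ->
  4 * k * ellE k / (1 - k ^ 2) < 4 * k' * ellE k' / (1 - k' ^ 2).
Proof.
  intros H H'; assert (L := n_increasing k k' H H').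
  assert (G : forall k, 0 < k < 1 -> 4 * k * ellE k / (1 - k ^ 2) =
    4 * (sqrt (k ^ 2 / (1 - k ^ 2)) * Et (k ^ 2 / (1 - k ^ 2)))).
  { intros j Hj; destruct (k_of_n j Hj) as (_ & -> & _); rewrite ellE_Et by auto.
    assert (h : 0 < 1 - j ^ 2) by nra; assert (hs := sqrt_lt_R0 _ h).
    assert (e := pow2_sqrt (1 - j ^ 2) (Rlt_le _ _ h)).
    set (kap := sqrt (1 - j ^ 2)) in *; set (n := j ^ 2 / (1 - j ^ 2)) in *; clearbody n.
    rewrite <- e; field; lra. }
  rewrite !G by lra; destruct (k_of_n k ltac:(lra)) as (Hn & _).
  set (n := k ^ 2 / (1 - k ^ 2)) in *; set (n' := k' ^ 2 / (1 - k' ^ 2)) in *.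
  apply Rmult_lt_compat_l; [lra|]; apply Rmult_le_0_lt_compat.
  - apply sqrt_pos.
  - apply Rlt_le, Et_pos; lra.
  - apply sqrt_lt_1; lra.
  - apply Et_increasing; lra.
Qed.

Lemma curve2_increasing k k' : 0 < k < k' -> k' < 1 ->
  4 * ella k / (1 - k ^ 2) < 4 * ella k' / (1 - k' ^ 2).
Proof.
  intros H H'; assert (L := n_increasing k k' H H').
  assert (G : forall k, 0 < k < 1 -> 4 * ella k / (1 - k ^ 2) =
    4 * (sqrt (1 + k ^ 2 / (1 - k ^ 2)) * At (k ^ 2 / (1 - k ^ 2)))).
  { intros j Hj; destruct (k_of_n j Hj) as (_ & _ & ->); rewrite ella_At by auto.
    assert (h : 0 < 1 - j ^ 2) by nra; assert (hs := sqrt_lt_R0 _ h).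
    assert (e := pow2_sqrt (1 - j ^ 2) (Rlt_le _ _ h)).
    set (kap := sqrt (1 - j ^ 2)) in *; set (n := j ^ 2 / (1 - j ^ 2)) in *; clearbody n.
    rewrite <- e; field; lra. }
  rewrite !G by lra; destruct (k_of_n k ltac:(lra)) as (Hn & _).
  set (n := k ^ 2 / (1 - k ^ 2)) in *; set (n' := k' ^ 2 / (1 - k' ^ 2)) in *.
  apply Rmult_lt_compat_l; [lra|]; apply Rmult_le_0_lt_compat.
  - apply sqrt_pos.
  - apply Rlt_le, At_pos; lra.
  - apply sqrt_lt_1; lra.
  - apply At_increasing; lra.
Qed.

(** A level of a function decreasing in the modulus on the line [psi = PI]
    persists for the amplitudes slightly below [PI], at a nearby modulus. *)
Lemma level_persists (F : R3 -> R) k0 d : cinf UK F -> 0 < k0 < 1 -> 0 < d ->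
  (forall k k', 0 < k < k' -> k' < 1 -> F (k', PI, 0) < F (k, PI, 0)) ->
  exists k psi, 0 < k < 1 /\ 0 < psi < PI /\ box d (k0, PI, 0) (k, psi, 0) /\
    F (k, psi, 0) = F (k0, PI, 0).
Proof.
  intros HF Hk Hd Hdec; assert (p := PI_RGT_0).
  set (e := Rmin d (Rmin k0 (1 - k0)) / 2).
  assert (He : 0 < e /\ e < d /\ e < k0 /\ e < 1 - k0).
  { unfold e; assert (h1 := Rmin_l d (Rmin k0 (1 - k0))); assert (h2 := Rmin_r d (Rmin k0 (1 - k0))).
    assert (h3 := Rmin_l k0 (1 - k0)); assert (h4 := Rmin_r k0 (1 - k0)).
    assert (0 < Rmin d (Rmin k0 (1 - k0))) by (repeat apply Rmin_glb_lt; lra); lra. }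
  clearbody e.
  assert (A := Hdec (k0 - e) k0 ltac:(lra) ltac:(lra)).
  assert (B := Hdec k0 (k0 + e) ltac:(lra) ltac:(lra)).
  assert (cF : forall k t z : R, 0 < k < 1 -> continuous F (k, t, z)).
  { intros k t z H; apply (cinf_continuous UK F HF); exact H. }
  destruct (proj1 (cont_box F _) (cF (k0 - e) PI 0 ltac:(lra))
    (F (k0 - e, PI, 0) - F (k0, PI, 0)) ltac:(lra)) as (d1 & Hd1 & W1).
  destruct (proj1 (cont_box F _) (cF (k0 + e) PI 0 ltac:(lra))
    (F (k0, PI, 0) - F (k0 + e, PI, 0)) ltac:(lra)) as (d2 & Hd2 & W2).
  set (f := Rmin (Rmin d PI) (Rmin d1 d2) / 2).
  assert (Hf : 0 < f /\ f < d /\ f < PI /\ f < d1 /\ f < d2).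
  { unfold f; assert (h1 := Rmin_l (Rmin d PI) (Rmin d1 d2));
    assert (h2 := Rmin_r (Rmin d PI) (Rmin d1 d2)).
    assert (h3 := Rmin_l d PI); assert (h4 := Rmin_r d PI).
    assert (h5 := Rmin_l d1 d2); assert (h6 := Rmin_r d1 d2).
    assert (0 < Rmin (Rmin d PI) (Rmin d1 d2)) by (repeat apply Rmin_glb_lt; lra); lra. }
  clearbody f.
  assert (bx : forall k r, 0 < r -> f < r -> box r (k, PI, 0) (k, PI - f, 0)).
  { intros k r Hr Hfr; unfold box, px, py, pz; cbn [fst snd]; rewrite !Rminus_diag, !Rabs_R0.
    split; [|split; auto]; auto; rewrite Rabs_left; lra. }
  assert (V1 := Rabs_def2 _ _ (W1 _ (bx (k0 - e) d1 ltac:(lra) ltac:(lra)))).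
  assert (V2 := Rabs_def2 _ _ (W2 _ (bx (k0 + e) d2 ltac:(lra) ltac:(lra)))).
  destruct (cinf_partials UK F open_UK HF) as (P & _).
  destruct (ivt_value (fun k => - F (k, PI - f, 0)) (k0 - e) (k0 + e) (- F (k0, PI, 0)))
    as (k & K & E).
  - lra.
  - intros x Hx; apply continuity_pt_opp.
    apply (derive_continuity_pt (fun k => F (k, PI - f, 0)) x (D1 F (x, PI - f, 0))).
    destruct (P x (PI - f) 0) as (P1 & _); [unfold UK, px; cbn [fst snd]; lra|exact P1].
  - destruct V1, V2; split; [lra|]. lra.
  - exists k, (PI - f); split; [lra|split; [lra|split; [|lra]]].
    unfold box, px, py, pz; cbn [fst snd]; rewrite Rminus_diag, Rabs_R0.
    split; [|split; auto]; apply Rabs_def1; lra.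
Qed.

Lemma approach (X Y Z : R3 -> R) k0 e : cinf UK X -> cinf UK Y -> cinf UK Z ->
  0 < k0 < 1 -> 0 < e ->
  (forall k k', 0 < k < k' -> k' < 1 -> Y (k', PI, 0) < Y (k, PI, 0)) ->
  exists k psi, 0 < k < 1 /\ 0 < psi < PI /\ Y (k, psi, 0) = Y (k0, PI, 0) /\
    Rabs (X (k, psi, 0) - X (k0, PI, 0)) < e /\ Rabs (Z (k, psi, 0) - Z (k0, PI, 0)) < e.
Proof.
  intros HX HY HZ Hk He Hdec.
  destruct (proj1 (cont_box X _) (cinf_continuous UK X HX (k0, PI, 0) Hk) e He)
    as (d1 & Hd1 & W1).
  destruct (proj1 (cont_box Z _) (cinf_continuous UK Z HZ (k0, PI, 0) Hk) e He)
    as (d2 & Hd2 & W2).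
  destruct (level_persists Y k0 (Rmin d1 d2) HY Hk (Rmin_glb_lt _ _ _ Hd1 Hd2) Hdec)
    as (k & psi & Hk' & Hp & (B1 & B2 & B3) & E).
  assert (h1 := Rmin_l d1 d2); assert (h2 := Rmin_r d1 d2).
  exists k, psi; split; [auto|split; [auto|split; [auto|split]]].
  - apply W1; split; [|split]; lra.
  - apply W2; split; [|split]; lra.
Qed.

Lemma ellEi_PI k : 0 < k < 1 -> ellEi PI k = 2 * ellE k.
Proof.
  intros Hk; assert (h := ellEi_period k 0 Hk); rewrite Rplus_0_l, ellEi_0 in h; lra.
Qed.

Lemma Del_PI k : 0 < k < 1 -> Del k PI = 1.
Proof. intros Hk; apply Del_eq_1; [auto|apply sin_PI]. Qed.

Lemma cinf_modulus : cinf UK (fun v => 1 - px v ^ 2).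
Proof. apply cinf_minus; [apply cinf_const|apply cinf_sq, cinf_px]. Qed.

Lemma modulus_neq v : UK v -> 1 - px v ^ 2 <> 0.
Proof. intros [H1 H2]; nra. Qed.

Lemma x_at_height_of_arc b C y : OM (b, C, 0) -> yO (b, C, 0) = y ->
  UX (C, y, 0) /\ x_at_height (C, y, 0) = xO (b, C, 0).
Proof.
  intros H E; split; [split; [apply (proj1 H)|]|].
  - change (y < 0); rewrite <- E; now apply yO_neg.
  - unfold x_at_height, px, py; cbn [fst snd]; rewrite <- E, b_at_height_unique; auto.
Qed.

(** As [C] tends to 1 at a fixed height, the amplitude tends to [PI] and the arc
    approaches a full period of an oscillation started at the angle 0: its end
    point lies on the curve [x = x3 y]. In the coordinates [(k, psi)] all functions
    are smooth at [psi = PI], so that the limit is a mere evaluation. *)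
Lemma x_at_height_limit_right y e : y < 0 -> 0 < e ->
  exists C, UX (C, y, 0) /\ 1 - e < C /\ Rabs (x_at_height (C, y, 0) - x3 y) < e.
Proof.
  intros Hy He; destruct (x3_k y Hy) as (k0 & Hk0 & Ey & ->).
  set (Y := fun v => 2 * (px v * cos (py v) * EE v - px v * sin (py v) * Dl v) / (1 - px v ^ 2)).
  set (X := fun v => 2 * (Dl v * EE v - px v * cos (py v) * (px v * sin (py v))) / (1 - px v ^ 2)).
  assert (cc : cinf UK (fun v => px v * cos (py v)))
    by (apply cinf_mult; [apply cinf_px|apply cinf_cos, cinf_py]).
  assert (cs : cinf UK (fun v => px v * sin (py v)))
    by (apply cinf_mult; [apply cinf_px|apply cinf_sin, cinf_py]).
  assert (cY : cinf UK Y).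
  { apply cinf_div; [apply modulus_neq| |apply cinf_modulus].
    apply cinf_mult; [apply cinf_const|apply cinf_minus; apply cinf_mult; auto];
      [apply cinf_EE|apply cinf_Dl]. }
  assert (cX : cinf UK X).
  { apply cinf_div; [apply modulus_neq| |apply cinf_modulus].
    apply cinf_mult; [apply cinf_const|apply cinf_minus; apply cinf_mult; auto];
      [apply cinf_Dl|apply cinf_EE]. }
  assert (vY : forall k, 0 < k < 1 -> Y (k, PI, 0) = - (4 * k * ellE k / (1 - k ^ 2))).
  { intros k Hk; unfold Y, EE, px, py; cbn [fst snd]; rewrite ellEi_PI, sin_PI, cos_PI by auto.
    field; nra. }
  assert (vX : X (k0, PI, 0) = 4 * ellE k0 / (1 - k0 ^ 2)).
  { unfold X, EE, Dl, px, py; cbn [fst snd]; rewrite ellEi_PI, Del_PI, sin_PI by auto.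
    field; nra. }
  destruct (approach X Y Dl k0 e cX cY cinf_Dl Hk0 He) as (k & psi & Hk & Hp & E1 & E2 & E3).
  { intros k k' H H'; rewrite !vY by lra; apply Ropp_lt_contravar, curve3_increasing; auto. }
  rewrite vX in E2; rewrite vY, <- Ey in E1 by auto.
  unfold Dl, px, py in E3; cbn [fst snd] in E3; rewrite Del_PI in E3 by auto.
  destruct (hat1_O k psi Hk Hp) as (HO & Ed & Es & _ & _ & EI).
  destruct (xyO_formula _ HO) as [Fx Fy]; [rewrite Ed; nra|].
  rewrite Ed, Es, EI in Fx, Fy.
  destruct (x_at_height_of_arc (k * cos psi) (Del k psi) y HO) as [U Ec].
  { fold (hat1 k psi); rewrite Fy, <- E1; reflexivity. }
  exists (Del k psi); split; [exact U|split; [apply Rabs_def2 in E3; lra|]].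
  rewrite Ec; fold (hat1 k psi); rewrite Fx; exact E2.
Qed.

(** As [C] tends to -1, the arc approaches a full period of a rotation started at
    the angle [- 2 PI], whose end point lies on the curve [x = x2 y]. *)
Lemma x_at_height_limit_left y e : y < 0 -> 0 < e ->
  exists C, UX (C, y, 0) /\ C < -1 + e /\ Rabs (x_at_height (C, y, 0) - x2 y) < e.
Proof.
  intros Hy He; destruct (x2_k y Hy) as (k0 & Hk0 & Ey & ->).
  set (q := fun v => EE v - (1 - px v ^ 2) * FF v).
  set (Y := fun v => -2 * (Dl v * q v - px v ^ 2 * (sin (py v) * cos (py v))) / (1 - px v ^ 2)).
  set (X := fun v => -2 * (px v * (cos (py v) * q v - Dl v * sin (py v))) / (1 - px v ^ 2)).
  assert (cc : cinf UK (fun v => cos (py v))) by apply cinf_cos, cinf_py.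
  assert (cs : cinf UK (fun v => sin (py v))) by apply cinf_sin, cinf_py.
  assert (cq : cinf UK q).
  { apply cinf_minus; [apply cinf_EE|apply cinf_mult; [apply cinf_modulus|apply cinf_FF]]. }
  assert (cY : cinf UK Y).
  { apply cinf_div; [apply modulus_neq| |apply cinf_modulus].
    apply cinf_mult; [apply cinf_const|apply cinf_minus; apply cinf_mult; auto].
    - apply cinf_Dl.
    - apply cinf_sq, cinf_px.
    - now apply cinf_mult. }
  assert (cX : cinf UK X).
  { apply cinf_div; [apply modulus_neq| |apply cinf_modulus].
    apply cinf_mult; [apply cinf_const|apply cinf_mult; [apply cinf_px|]].
    apply cinf_minus; apply cinf_mult; auto; apply cinf_Dl. }
  assert (vq : forall k, 0 < k < 1 -> q (k, PI, 0) = 2 * ella k).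
  { intros k Hk; unfold q, EE, FF, px, py, ella; cbn [fst snd].
    rewrite ellEi_PI, ellF_PI by auto; ring. }
  assert (vY : forall k, 0 < k < 1 -> Y (k, PI, 0) = - (4 * ella k / (1 - k ^ 2))).
  { intros k Hk; unfold Y; rewrite vq by auto; unfold Dl, px, py; cbn [fst snd].
    rewrite Del_PI, sin_PI by auto; field; nra. }
  assert (vX : X (k0, PI, 0) = 4 * k0 * ella k0 / (1 - k0 ^ 2)).
  { unfold X; rewrite vq by auto; unfold Dl, px, py; cbn [fst snd].
    rewrite sin_PI, cos_PI; field; nra. }
  destruct (approach X Y (fun v => cos (py v)) k0 e cX cY cc Hk0 He)
    as (k & psi & Hk & Hp & E1 & E2 & E3).
  { intros k k' H H'; rewrite !vY by lra; apply Ropp_lt_contravar, curve2_increasing; auto. }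
  rewrite vX in E2; rewrite vY, <- Ey in E1 by auto.
  unfold py in E3; cbn [fst snd] in E3; rewrite cos_PI in E3.
  destruct (hat2_O k psi Hk Hp) as (HO & Ed & Es & _ & _ & EI).
  assert (Hd : 1 - (/ k) ^ 2 <> 0).
  { assert (1 < / k) by (rewrite <- Rinv_1; apply Rinv_lt_contravar; lra); nra. }
  destruct (xyO_formula _ HO) as [Fx Fy]; [now rewrite Ed|].
  rewrite Ed, Es, EI in Fx, Fy.
  assert (nk1 : 1 - k ^ 2 <> 0) by nra.
  assert (nk2 : k ^ 2 - 1 <> 0) by nra.
  destruct (x_at_height_of_arc (Del k psi / k) (cos psi) y HO) as [U Ec].
  { fold (hat2 k psi); rewrite Fy, <- E1.
    unfold hat2, px, py, Y, q, EE, FF, Dl, ellq, px, py; cbn [fst snd]; field.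
    split; [auto|split; [nra|lra]]. }
  exists (cos psi); split; [exact U|split; [apply Rabs_def2 in E3; lra|]].
  rewrite Ec; fold (hat2 k psi).
  replace (xO (hat2 k psi)) with (X (k, psi, 0)); [exact E2|rewrite Fx].
  unfold hat2, px, py, X, q, EE, FF, Dl, ellq, px, py; cbn [fst snd]; field.
  split; [lra|split; [nra|lra]].
Qed.

(** Monotonicity turns the limits into strict bounds. *)
Lemma x_at_height_range C y : UX (C, y, 0) -> x2 y < x_at_height (C, y, 0) < x3 y.
Proof.
  intros H; assert (Hy : y < 0) by apply H.
  assert (HC : -1 < C < 1) by (destruct H as [HC _]; exact HC).
  assert (K : forall C', -1 < C' < 1 -> UX (C', y, 0)) by (intros C' HC'; split; auto).
  split.
  - assert (A := x_at_height_increasing ((C - 1) / 2) C y 0 (K ((C - 1) / 2) ltac:(lra)) ltac:(lra)).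
    set (g := x_at_height (C, y, 0) - x_at_height ((C - 1) / 2, y, 0)) in *.
    assert (Hg : 0 < g) by (unfold g; lra).
    assert (r1 := Rmin_l g ((C + 1) / 2)); assert (r2 := Rmin_r g ((C + 1) / 2)).
    destruct (x_at_height_limit_left y (Rmin g ((C + 1) / 2)) Hy) as (C' & U & L & B).
    { apply Rmin_glb_lt; lra. }
    assert (D := x_at_height_increasing C' ((C - 1) / 2) y 0 U ltac:(lra)).
    apply Rabs_def2 in B; unfold g in *; lra.
  - assert (A := x_at_height_increasing C ((C + 1) / 2) y 0 H ltac:(lra)).
    set (g := x_at_height ((C + 1) / 2, y, 0) - x_at_height (C, y, 0)) in *.
    assert (Hg : 0 < g) by (unfold g; lra).
    assert (r1 := Rmin_l g ((1 - C) / 2)); assert (r2 := Rmin_r g ((1 - C) / 2)).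
    destruct (x_at_height_limit_right y (Rmin g ((1 - C) / 2)) Hy) as (C' & U & L & B).
    { apply Rmin_glb_lt; lra. }
    assert (D := x_at_height_increasing ((C + 1) / 2) C' y 0 (K ((C + 1) / 2) ltac:(lra))
      ltac:(destruct U as [[U1 U2] _]; unfold px in *; cbn [fst snd] in *; lra)).
    apply Rabs_def2 in B; unfold g in *; lra.
Qed.

Lemma x_at_height_surj x y : y < 0 -> x2 y < x < x3 y -> exists C, UX (C, y, 0) /\ x_at_height (C, y, 0) = x.
Proof.
  intros Hy Hx.
  destruct (x_at_height_limit_left y (x - x2 y) Hy ltac:(lra)) as (Ca & Ua & _ & Ba).
  destruct (x_at_height_limit_right y (x3 y - x) Hy ltac:(lra)) as (Cb & Ub & _ & Bb).
  apply Rabs_def2 in Ba; apply Rabs_def2 in Bb.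
  assert (L : Ca < Cb).
  { destruct (Rtotal_order Ca Cb) as [L|[L|L]]; auto; exfalso; [subst; lra|].
    assert (A := x_at_height_increasing Cb Ca y 0 Ub ltac:(split; [exact L|apply Ua])); lra. }
  assert (K : forall s, Ca <= s <= Cb -> UX (s, y, 0)).
  { intros s Hs; unfold UX, px, py in *; cbn [fst snd] in *; lra. }
  destruct (ivt_value (fun s => x_at_height (s, y, 0)) Ca Cb x L) as (C & HC & E).
  - intros s Hs; eapply derive_continuity_pt, x_at_height_line, K, Hs.
  - lra.
  - exists C; split; [apply K; lra|exact E].
Qed.

Definition V35 (v : R3) : Prop := py v < 0 /\ x2 (py v) < px v < x3 (py v).

(** The momenta of the arc that ends at the point [(x, y)]. *)
Definition Cend (v : R3) : R :=
  epsilon (inhabits 0) (fun C => UX (C, py v, 0) /\ x_at_height (C, py v, 0) = px v).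
Definition bend (v : R3) : R := b_at_height (py v, Cend v, 0).

Lemma Cend_spec x y z : V35 (x, y, z) ->
  UX (Cend (x, y, z), y, 0) /\ x_at_height (Cend (x, y, z), y, 0) = x.
Proof.
  intros [H1 H2]; unfold Cend at 1 2; apply epsilon_spec.
  apply x_at_height_surj; [exact H1|exact H2].
Qed.

Lemma Cend_unique C y z : UX (C, y, 0) -> Cend (x_at_height (C, y, 0), y, z) = C.
Proof.
  intros H; destruct (Cend_spec (x_at_height (C, y, 0)) y z) as [U E].
  { split; [apply H|]; now apply x_at_height_range. }
  set (C' := Cend (x_at_height (C, y, 0), y, z)) in *.
  destruct (Rtotal_order C C') as [L|[L|L]]; auto; exfalso.
  - assert (A := x_at_height_increasing C C' y 0 H ltac:(split; [exact L|apply U])); lra.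
  - assert (A := x_at_height_increasing C' C y 0 U ltac:(split; [exact L|apply H])); lra.
Qed.

Lemma cinf_Cend : open V35 /\ cinf V35 Cend.
Proof.
  apply (cinf_param_inverse UX V35 x_at_height Cend).
  - apply open_UX.
  - intros x x' t y z [S H] [S' H'] Ht; split; [|exact H].
    unfold px, py in *; cbn [fst snd] in *; lra.
  - apply cinf_x_at_height.
  - apply x_at_height_derive_pos.
  - intros x y z H; split; [apply H|]; exact (x_at_height_range x y H).
  - intros t y z H; destruct (Cend_spec t y z H) as [U E]; split; [exact U|exact E].
Qed.

Lemma end_spec x y z : V35 (x, y, z) ->
  OM (bend (x, y, z), Cend (x, y, z), 0) /\
  xO (bend (x, y, z), Cend (x, y, z), 0) = x /\ yO (bend (x, y, z), Cend (x, y, z), 0) = y.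
Proof.
  intros H; destruct (Cend_spec x y z H) as [U E].
  destruct (b_at_height_spec y (Cend (x, y, z)) 0 (UX_VY _ _ _ U)) as [B1 B2].
  split; [exact B1|split; [exact E|exact B2]].
Qed.

Lemma end_unique b C z : OM (b, C, 0) ->
  Cend (xO (b, C, 0), yO (b, C, 0), z) = C /\ bend (xO (b, C, 0), yO (b, C, 0), z) = b.
Proof.
  intros H; destruct (x_at_height_of_arc b C _ H eq_refl) as [U E].
  assert (EC : Cend (xO (b, C, 0), yO (b, C, 0), z) = C) by (rewrite <- E; now apply Cend_unique).
  split; [exact EC|]; unfold bend; rewrite EC; now apply b_at_height_unique.
Qed.

Lemma diffeo_35 : diffeomorphism N35 M35 Exp.
Proof.
  destruct cinf_Cend as [OV CC]; destruct cinf_b_at_height as [OB CB].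
  assert (cb : cinf V35 bend).
  { apply (cinf_comp V35 VY b_at_height py Cend (fun _ => 0)); auto.
    - intros [[x y] z] H; exact (UX_VY _ _ _ (proj1 (Cend_spec x y z H))).
    - apply cinf_py.
    - apply cinf_const. }
  assert (BV : forall q, M35 q <-> pz q = 0 /\ V35 q).
  { intros q; unfold M35; rewrite in_plane_pz; reflexivity. }
  apply (diffeo_base N35 M35 (fun C b => OM (b, C, 0)) (fun C b => 2 * rO (b, C, 0))
    (fun C b => xO (b, C, 0)) (fun C b => yO (b, C, 0)) Cend bend).
  - apply N35_iff.
  - intros C b [[H1 H2] _]; unfold py in *; cbn [fst snd] in *; lra.
  - intros C b H; apply (reach_Exp _ _ _ _ (reach_OM _ H)).
  - intros C b H; split; [|now apply end_unique].
    apply BV; split; [reflexivity|].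
    destruct (x_at_height_of_arc b C _ H eq_refl) as [U <-].
    split; [apply U|]; now apply x_at_height_range.
  - intros [[x y] z] Hq; apply BV in Hq; destruct Hq as [Hz Hq].
    destruct (end_spec x y z Hq) as (H & -> & ->); split; [exact H|].
    unfold pz in Hz; cbn [fst snd] in Hz; now rewrite Hz.
  - intros C b H; exists (fun v => OM (py v, px v, 0)),
      (fun v => xO (py v, px v, 0)), (fun v => yO (py v, px v, 0)).
    assert (sw : forall f, cinf OM f ->
      cinf (fun v => OM (py v, px v, 0)) (fun v => f (py v, px v, 0))).
    { intros f Hf; apply (cinf_comp _ OM f py px (fun _ => 0)); auto;
        [apply open_OM|apply cinf_py|apply cinf_px|apply cinf_const]. }
    split; [|split; [|split; [|split]]].
    + apply (open_gt (fun v => - px v) py (fun v => -1 < px v /\ px v < 1)).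
      * apply (open_gt px (fun _ => 1) (fun v => -1 < px v)).
        -- apply (open_lt_cinf (fun _ => -1) px); [apply cinf_const|apply cinf_px].
        -- intros; apply continuous_px.
        -- intros; apply continuous_const.
      * intros v _; apply (cinf_continuous (fun _ => True)); auto; apply cinf_opp, cinf_px.
      * intros; apply continuous_py.
    + exact H.
    + apply sw, cinf_xO.
    + apply sw, cinf_yO.
    + intros; split; reflexivity.
  - intros q Hq; apply BV in Hq; destruct Hq as [_ Hq].
    exists V35, (fun v => - (2 * acos (Cend v))), (fun v => 2 * bend v),
      (fun v => 2 * rO (bend v, Cend v, 0)).
    split; [auto|split; [auto|split; [|split; [|split]]]].
    + apply cinf_opp, cinf_mult; [apply cinf_const|apply cinf_acos; auto].
      intros [[x y] z] H; destruct (Cend_spec x y z H) as [[U _] _]; exact U.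
    + apply cinf_mult; [apply cinf_const|exact cb].
    + apply cinf_mult; [apply cinf_const|].
      apply (cinf_comp V35 OM rO bend Cend (fun _ => 0)); auto.
      * apply open_OM.
      * intros [[x y] z] H; apply (end_spec x y z H).
      * apply cinf_rO.
      * apply cinf_const.
    + intros w _ _; split; [|split]; reflexivity.
Qed.

(** * The forty sets *)

Lemma ang_affine s g c k : s = 1 \/ s = -1 -> ang (s * gam (ang g, c) + k) = ang (s * g + k).
Proof.
  intros [-> | ->]; destruct (gam_ang g c) as [n ->].
  - rewrite <- (ang_eq (1 * g + k) n); f_equal; ring.
  - rewrite <- (ang_eq (-1 * g + k) (- n)); f_equal; rewrite opp_IZR; ring.
Qed.

(** Four of the reflections act on the final state of an arc, and are affine in the
    covering only if that state depends affinely on the initial one. On the base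
    sets it is [(sf * gamma, c)]: the initial state itself for a full period, its
    mirror image for a symmetric arc. *)
Lemma diffeo_reflected (A : N -> Prop) (B : R3 -> Prop) (sf : R) (j : nat) :
  sf = 1 \/ sf = -1 ->
  (forall l t, A (l, t) -> exists q, reach l t q (ang (sf * gam l), mom l) /\ pz q = 0) ->
  (1 <= j <= 7)%nat -> diffeomorphism A B Exp ->
  diffeomorphism (image (epsN j) A) (image (epsM j) B) Exp.
Proof.
  intros Hsf HA Hj HD.
  assert (ss : sf * sf = 1) by (destruct Hsf; subst; ring).
  assert (HE : forall nu, A nu -> Exp (epsN j nu) = epsM j (Exp nu)).
  { intros [l t] H; destruct (HA l t H) as (q & (g & c & x & y & z & G & -> & _) & Hz).
    apply (Exp_reflect _ _ _ _ _ _ _ _ Hj G Hz). }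
  assert (HL : forall g c t, A ((ang g, c), t) ->
    flow (ang g, c) t = (ang (sf * g), c)).
  { intros g c t H; destruct (HA _ _ H) as (q & Hr & _).
    rewrite (proj2 (reach_Exp _ _ _ _ Hr)); cbn [mom snd]; f_equal.
    rewrite <- (Rplus_0_r (sf * gam _)), ang_affine by auto; f_equal; ring. }
  assert (red : forall s1 s2 k r1 r2, s1 = 1 \/ s1 = -1 -> s2 * s2 = 1 -> r1 * r1 = 1 ->
     r2 * r2 = 1 -> (forall x y z, epsM j (x, y, z) = (r1 * x, r2 * y, z)) ->
     (forall g c t, A ((ang g, c), t) ->
        epsN j ((ang g, c), t) = ((ang (s1 * g + k), s2 * c), t)) ->
     diffeomorphism (image (epsN j) A) (image (epsM j) B) Exp).
  { intros s1 s2 k r1 r2 H1 H2 H3 H4 HM HN.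
    apply (diffeo_reflect A B (epsN j) (epsM j) s1 s2 k r1 r2); auto.
    - destruct H1; subst; ring.
    - intros [[x y] z]; rewrite HM; unfold diag_affine, px, py, pz; cbn [fst snd].
      f_equal; [f_equal|]; ring.
    - intros [[g c] t] H; cbn [cov] in *; rewrite HN by exact H.
      unfold diag_affine, px, py, pz; cbn [cov fst snd].
      f_equal; [f_equal|]; ring. }
  assert (J : j = 1%nat \/ j = 2%nat \/ j = 3%nat \/ j = 4%nat \/ j = 5%nat \/
    j = 6%nat \/ j = 7%nat) by lia.
  assert (same : forall h c, ang (gam (ang h, c)) = ang h) by (intros; apply ang_rep).
  assert (opsh : forall h c k, ang (- gam (ang h, c) + k) = ang (- h + k)).
  { intros h c k; replace (- h) with (-1 * h) by ring; rewrite <- (ang_affine (-1) h c k) by auto.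
    f_equal; ring. }
  assert (Hsf' : - sf = 1 \/ - sf = -1) by (destruct Hsf; subst; [right|left]; ring).
  assert (p1 : 1 = 1 \/ 1 = -1) by auto; assert (m1 : -1 = 1 \/ -1 = -1) by auto.
  assert (pair : forall (a a' : circle) (c c' t : R), a = a' -> c = c' ->
    ((a, c), t) = ((a', c'), t)) by (intros; congruence).
  assert (tri : forall x y z x' y' : R, x = x' -> y = y' -> (x, y, z) = (x', y', z))
    by (intros; congruence).
  assert (sq : - sf * - sf = 1) by (rewrite <- ss; ring).
  destruct J as [J|[J|[J|[J|[J|[J|J]]]]]]; subst j; clear HE Hj.
  - apply (red sf (-1) 0 1 (-1)); auto; try ring; intros; [apply tri; ring|].
    cbn [epsN]; rewrite HL by auto; apply pair; [|cbn [mom snd]; ring].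
    rewrite same; f_equal; ring.
  - apply (red (- sf) 1 0 1 1); auto; try ring; intros; [apply tri; ring|].
    cbn [epsN]; rewrite HL by auto; apply pair; [|cbn [mom snd]; ring].
    rewrite ang_neg; f_equal; ring.
  - apply (red (-1) (-1) 0 1 (-1)); auto; try ring; intros; [apply tri; ring|].
    apply pair; [|cbn [mom snd]; ring].
    rewrite ang_neg; f_equal; ring.
  - apply (red 1 1 (2 * PI) (-1) 1); auto; try ring; intros; [apply tri; ring|].
    apply pair; [|cbn [mom snd]; ring].
    rewrite ang_shift; f_equal; ring.
  - apply (red sf (-1) (2 * PI) (-1) (-1)); auto; try ring; intros; [apply tri; ring|].
    cbn [epsN]; rewrite HL by auto; apply pair; [|cbn [mom snd]; ring].
    rewrite ang_shift; f_equal; ring.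
  - apply (red (- sf) 1 (2 * PI) (-1) 1); auto; try ring; intros; [apply tri; ring|].
    cbn [epsN]; rewrite HL by auto; apply pair; [|cbn [mom snd]; ring].
    rewrite opsh; f_equal; ring.
  - apply (red (-1) (-1) (2 * PI) (-1) (-1)); auto; try ring; intros; [apply tri; ring|].
    apply pair; [|cbn [mom snd]; ring].
    rewrite opsh; f_equal; ring.
Qed.

Lemma diffeo_periodic (A : N -> Prop) (B : R3 -> Prop) (j : nat) :
  (forall l t, A (l, t) -> exists q, reach l t q l /\ pz q = 0) ->
  diffeomorphism A B Exp -> (1 <= j <= 7)%nat ->
  diffeomorphism (image (epsN j) A) (image (epsM j) B) Exp.
Proof.
  intros HA HD Hj; apply (diffeo_reflected A B 1); auto.
  intros l t H; destruct (HA l t H) as (q & Hr & Hz); exists q; split; auto.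
  replace (ang (1 * gam l), mom l) with l; auto.
  destruct l as [a c]; cbn [mom snd]; f_equal; rewrite Rmult_1_l; symmetry; apply ang_rep.
Qed.

Lemma periodic1 (A : N -> Prop) (D : R -> R -> Prop) :
  (forall l t, A (l, t) <-> exists C b, D C b /\ l = state_of C b /\ t = T1 C b) ->
  (forall C b, D C b -> region1 C b) ->
  forall l t, A (l, t) -> exists q, reach l t q l /\ pz q = 0.
Proof.
  intros HA HD l t H; apply HA in H; destruct H as (C & b & H & -> & ->).
  eexists; split; [apply reach_T1; auto|reflexivity].
Qed.

Lemma periodic2 (A : N -> Prop) (D : R -> R -> Prop) :
  (forall l t, A (l, t) <-> exists C b, D C b /\ l = state_of C b /\ t = T2 C b) ->
  (forall C b, D C b -> region2 C b) ->
  forall l t, A (l, t) -> exists q, reach l t q l /\ pz q = 0.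
Proof.
  intros HA HD l t H; apply HA in H; destruct H as (C & b & H & -> & ->).
  eexists; split; [apply reach_T2; auto|reflexivity].
Qed.

Lemma periodic4 (A : N -> Prop) : (forall nu, A nu -> C4_0 (fst nu)) ->
  forall l t, A (l, t) -> exists q, reach l t q l /\ pz q = 0.
Proof.
  intros HA l t H; apply HA in H; cbn [fst] in H; rewrite H.
  eexists; split; [apply reach_C4|reflexivity].
Qed.

Lemma reflected_35 l t : N35 (l, t) ->
  exists q, reach l t q (ang (-1 * gam l), mom l) /\ pz q = 0.
Proof.
  intros H; apply N35_iff in H; destruct H as (C & b & HO & -> & ->).
  exists (xO (b, C, 0), yO (b, C, 0), 0); split; [|reflexivity].
  replace (ang (-1 * gam (state_of C b)), mom (state_of C b)) with (end_state C b).
  - apply (reach_OM _ HO).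
  - unfold end_state, state_of; cbn [mom snd]; f_equal.
    replace (-1 * gam _) with (- gam (ang (- (2 * acos C)), 2 * b)) by ring.
    rewrite ang_neg; f_equal; ring.
Qed.

Theorem theorem4p1 (i : nat) (Hi : (1 <= i <= 40)%nat) :
  diffeomorphism (N' i) (M' i) Exp.
Proof.
  assert (Q1 := periodic1 _ _ N1_iff dom1_region).
  assert (Q17 := periodic1 _ _ N17_iff dom17_region).
  assert (Q21 := periodic1 _ _ N21_iff dom21_region).
  assert (Q9 := periodic2 _ _ N9_iff dom9_region).
  assert (Q25 := periodic2 _ _ N25_iff dom25_region).
  assert (Q29 := periodic2 _ _ N29_iff dom29_region).
  assert (Q33 := periodic4 N33 (fun nu H => proj1 H)).
  assert (Q39 := periodic4 N39 (fun nu H => proj1 H)).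
  assert (m1 : -1 = 1 \/ -1 = -1) by auto.
  assert (D1 := diffeo_1); assert (D9 := diffeo_9); assert (D17 := diffeo_17).
  assert (D21 := diffeo_21); assert (D25 := diffeo_25); assert (D29 := diffeo_29).
  assert (D33 := diffeo_33); assert (D35 := diffeo_35); assert (D39 := diffeo_39).
  do 41 (try destruct i as [|i]);
    try (exfalso; clear - Hi; lia); unfold N', M'; cbn [forty]; try assumption;
    solve [apply diffeo_periodic; [assumption|assumption|clear; lia]
          |apply (diffeo_reflected N35 M35 (-1) _ m1 reflected_35); [clear; lia|assumption]].
Qed.
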